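(* Let $\nu>-1$, $\delta>0$ and $1<p\le\infty$. Then there is a constant $C$ such that $$\|\mathcal{B}^\delta f\|_{L^p((0,1),d\mu_\nu)}\le C\|f\|_{L^p((0,1),d\mu_\nu)}\quad\text{for all } f\in L^p((0,1),d\mu_\nu)$$ if and only if either ($-1<\nu\le-1/2$ or $\delta>\nu+1/2$) and $1<p\le\infty$, or ($\delta\le\nu+1/2$ and $\nu>-1/2$) and $p_0<p<p_1$, where $p_0=\frac{4(\nu+1)}{2\nu+3+2\delta}$ and $p_1=\frac{4(\nu+1)}{2\nu+1-2\delta}$.
   Context: Let $J_\nu$ be the Bessel function of order $\nu>-1$, $0<s_1<s_2<\dots$ its successive positive zeros, $d\mu_\nu(x)=x^{2\nu+1}dx$ on $(0,1)$, $\psi_j(x)=\frac{\sqrt2}{|J_{\nu+1}(s_j)|}x^{-\nu}J_\nu(s_jx)$, $a_j(f)=\int_0^1 f\psi_j\,d\mu_\nu$. For $\delta>0$, $R>0$, $\mathcal{B}_R^\delta(f,x)=\sum_{j\ge1}(1-s_j^2/R^2)_+^\delta a_j(f)\psi_j(x)$ with $(1-s^2)_+=\max\{1-s^2,0\}$, and the maximal operator is $\mathcal{B}^\delta f(x)=\sup_{R>0}|\mathcal{B}_R^\delta(f,x)|$. *)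

(* Defs.v *)
From HB Require Import structures.
From mathcomp Require Import all_boot all_order all_algebra.
From mathcomp Require Import all_classical all_reals all_analysis.
Set Implicit Arguments. Unset Strict Implicit. Unset Printing Implicit Defensive.
Import Order.TTheory GRing.Theory Num.Theory.
Import numFieldNormedType.Exports.
Local Open Scope classical_set_scope.
Local Open Scope ring_scope.

Section Defs.
Variable R : realType.

Definition Gamma (a : R) : R :=
  Rintegral lebesgue_measure `]0%R, +oo[ (fun t => t `^ (a - 1) * expR (- t)).

Definition besselJ (nu x : R) : R :=
  limn (series (fun k : nat =>
    (-1) ^+ k / ((k`!)%:R * Gamma (k%:R + nu + 1)) * (x / 2) `^ (2 * k%:R + nu))).

(* s is the increasing enumeration (indexed from 0) of the positive zeros of J_nu:
   s 0 = s_1 < s 1 = s_2 < ... *)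
Definition bessel_zeros (nu : R) (s : nat -> R) : Prop :=
  (forall j, 0 < s j) /\ (forall j, besselJ nu (s j) = 0) /\
  (forall i j, (i < j)%N -> s i < s j) /\
  (forall x, 0 < x -> besselJ nu x = 0 -> exists j, s j = x).

Definition psi (nu : R) (s : nat -> R) (j : nat) (x : R) : R :=
  Num.sqrt 2 / `|besselJ (nu + 1) (s j)| * x `^ (- nu) * besselJ nu (s j * x).

Definition fb_coef (nu : R) (s : nat -> R) (f : R -> R) (j : nat) : R :=
  Rintegral lebesgue_measure `]0%R, 1%R[
    (fun x => f x * psi nu s j x * x `^ (2 * nu + 1)).

Definition BR (nu delta : R) (s : nat -> R) (f : R -> R) (Rr x : R) : R :=
  limn (series (fun j : nat =>
    Num.max 0 (1 - s j ^+ 2 / Rr ^+ 2) `^ delta * fb_coef nu s f j * psi nu s j x)).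

Definition Bmax (nu delta : R) (s : nat -> R) (f : R -> R) (x : R) : \bar R :=
  ereal_sup [set (`|BR nu delta s f Rr x|)%:E | Rr in `]0%R, +oo[].

Definition mu_nu (nu : R) (A : set R) : \bar R :=
  (\int[lebesgue_measure]_(x in A `&` `]0%R, 1%R[) (x `^ (2 * nu + 1))%:E)%E.

Definition Lpnorm (nu : R) (p : \bar R) (g : R -> \bar R) : \bar R :=
  match p with
  | r%:E => ((\int[lebesgue_measure]_(x in `]0%R, 1%R[)
                ((`|g x| `^ r) * (x `^ (2 * nu + 1))%:E)) `^ r^-1)%E
  | +oo%E => ereal_inf [set y : \bar R | mu_nu nu [set x | (y < `|g x|)%E] = 0%E]
  | -oo%E => 0%E
  end.

Definition p0 (nu delta : R) : R := 4 * (nu + 1) / (2 * nu + 3 + 2 * delta).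

Definition p1 (nu delta : R) : \bar R :=
  if 2 * nu + 1 - 2 * delta == 0 then +oo%E
  else (4 * (nu + 1) / (2 * nu + 1 - 2 * delta))%:E.

End Defs.

(* Main.v *)
Require Import Defs.
From HB Require Import structures.
From mathcomp Require Import all_boot all_order all_algebra.
From mathcomp Require Import all_classical all_reals all_analysis.
From mathcomp Require Import measurable_realfun.
From mathcomp Require Import ring lra zify.
Set Implicit Arguments. Unset Strict Implicit. Unset Printing Implicit Defensive.
Import Order.TTheory GRing.Theory Num.Theory.
Import numFieldNormedType.Exports.
Local Open Scope classical_set_scope.
Local Open Scope ring_scope.

(* Sufficiency rests on a kernel bound: up to constants, sum_j (1 - s_j^2/T^2)_+^delta psi_j(x) psi_j(y)
   is at most T (1 + T|x-y|)^(-1-delta) ((x + 1/T) (y + 1/T))^(-nu-1/2). It is proved without Bessel asymptotics: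
   at scale 1/(T|x-y|) the symbol is approximated by a superposition of the functions cos(t s/T) with |t| so small
   that finite propagation speed for u_tt = u'' + (2 nu + 1)/x u' makes the corresponding kernel vanish at (x, y),
   and the error is summed over the separated zeros. Near the diagonal the bound is dominated by the
   Hardy-Littlewood maximal function, elsewhere by homogeneous kernels of Hardy type; the exponents p_0 and p_1
   are those allowed by Schur's test.
   Necessity: applied to an approximate Dirac mass at 0 and rescaled by T, the means converge, by Sonine's
   integral, to a combination of J_m(Y)/Y^m with m >= nu + delta + 1, whose leading term is not in
   L^q(Y^(2 nu + 1) dY) for q <= p_0, so Fatou's lemma excludes p <= p_0. Self-adjointness excludes p >= p_1. *)

(** The s_j are known only as an enumeration of zeros, so their size, their separation and the
    completeness of the psi_j all have to be proved. The first two come from the energy w^2 + w'^2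
    of w = x^(nu + 1/2) phi_nu, which stays between positive constants away from 0. Completeness
    comes from Picone's identity: it gives a Poincare inequality with sharp constant s_N^2 for
    functions vanishing at the zeros of phi_nu(s_N x), and interpolation by the first N
    eigenfunctions trades these zeros for orthogonality. A wave kernel is not a convergent series.
    Finite speed is therefore stated for pairs of smooth bumps, and exponential type by the action
    on finite cosine sums; bumps shrink to points only in the finite Riesz sum. For p = oo the
    supremum over T cannot be taken inside the integral, because a logarithm appears; there the
    kernel is integrated for fixed T. In the necessity part the mass at 0 has the symbol (1 - s^2/(4
    T^2))^N. For s <= T this is a polynomial in 1 - s^2/T^2, so Sonine's integral evaluates the
    limit exactly. *)

Section Combinators.
Variable R : realType.
Implicit Types (f g : R -> R) (x k : R).

(* Rules d_ for [is_derive _ 1] and c_ for [continuous], on expanded functions so that they chain by [apply]. *)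
Lemma dE f x (a b : R) : is_derive x 1 f a -> a = b -> is_derive x 1 f b.
Proof. by move=> h <-. Qed.

Lemma dcst k x : is_derive x 1 (fun _ : R => k) 0.
Proof. exact: is_derive_cst. Qed.

Lemma did x : is_derive x 1 (fun y : R => y) 1.
Proof. exact: is_derive_id. Qed.

Lemma dD f g x (a b : R) : is_derive x 1 f a -> is_derive x 1 g b ->
  is_derive x 1 (fun y : R => f y + g y) (a + b).
Proof. by move=> h1 h2; exact: is_deriveD. Qed.

Lemma dB f g x (a b : R) : is_derive x 1 f a -> is_derive x 1 g b ->
  is_derive x 1 (fun y : R => f y - g y) (a - b).
Proof. by move=> h1 h2; exact: is_deriveB. Qed.

Lemma dN f x (a : R) : is_derive x 1 f a -> is_derive x 1 (fun y : R => - f y) (- a).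
Proof. by move=> h1; exact: is_deriveN. Qed.

Lemma dM f g x (a b : R) : is_derive x 1 f a -> is_derive x 1 g b ->
  is_derive x 1 (fun y : R => f y * g y) (a * g x + f x * b).
Proof.
move=> h1 h2; have h := @is_deriveM _ _ f g x 1 a b h1 h2.
by apply: dE h _; rewrite /GRing.scale/= addrC mulrC.
Qed.

Lemma dZ k f x (a : R) : is_derive x 1 f a -> is_derive x 1 (fun y : R => k * f y) (k * a).
Proof. by move=> h1; apply: dE (dM (dcst k x) h1) _; rewrite mul0r add0r. Qed.

Lemma dcomp f g x (a b : R) : is_derive x 1 g b -> is_derive (g x) 1 f a ->
  is_derive x 1 (fun y : R => f (g y)) (a * b).
Proof.
move=> h1 h2; have h := @is_derive1_comp R f g x a b h2 h1.
by apply: dE h _; rewrite mulrC.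
Qed.

Lemma dX f n x (a : R) : is_derive x 1 f a ->
  is_derive x 1 (fun y : R => f y ^+ n) (n%:R * f x ^+ n.-1 * a).
Proof.
case: n => [|n] h1.
  by rewrite !mul0r; apply: dE (dcst 1 x) _.
have h := @is_deriveX _ _ f n.+1 x 1 a h1.
rewrite (_ : (fun y => _) = f ^+ n.+1); first by apply: dE h _.
by apply/funext => y; rewrite fctE; elim: n.+1 => // m IH; rewrite !exprS IH.
Qed.

Lemma dV f x (a : R) : f x != 0 -> is_derive x 1 f a ->
  is_derive x 1 (fun y : R => (f y)^-1) (- a / f x ^+ 2).
Proof.
move=> f0 h1; have h := @is_deriveV R f x a 1 f0 h1.
by apply: dE h _; rewrite /GRing.scale/= !mulNr mulrC.
Qed.

Lemma dsum n (F : 'I_n -> R -> R) (a : 'I_n -> R) x :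
  (forall i, is_derive x 1 (F i) (a i)) ->
  is_derive x 1 (fun y : R => \sum_(i < n) F i y) (\sum_(i < n) a i).
Proof.
move=> h; have := @is_derive_sum _ _ _ n F x 1 a h.
by rewrite (_ : (fun y => _) = \sum_(i < n) F i)//; apply/funext => y; rewrite fct_sumE.
Qed.

Lemma dpowR r x : 0 < x -> is_derive x 1 (fun y : R => y `^ r) (r * x `^ (r - 1)).
Proof. by move=> x0; exact: is_derive1_powR. Qed.

Lemma ccst k : continuous (fun _ : R => k).
Proof. by move=> x; exact: cvg_cst. Qed.

Lemma cid : continuous (fun y : R => y).
Proof. by move=> x. Qed.

Lemma cD f g : continuous f -> continuous g -> continuous (fun y : R => f y + g y).
Proof. by move=> h1 h2 x; apply: cvgD; [exact: h1|exact: h2]. Qed.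

Lemma cN f : continuous f -> continuous (fun y : R => - f y).
Proof. by move=> h1 x; apply: cvgN; exact: h1. Qed.

Lemma cB f g : continuous f -> continuous g -> continuous (fun y : R => f y - g y).
Proof. by move=> h1 h2 x; apply: cvgB; [exact: h1|exact: h2]. Qed.

Lemma cM f g : continuous f -> continuous g -> continuous (fun y : R => f y * g y).
Proof. by move=> h1 h2 x; apply: cvgM; [exact: h1|exact: h2]. Qed.

Lemma cX f n : continuous f -> continuous (fun y : R => f y ^+ n).
Proof.
move=> h1; elim: n => [|n IHn].
  by rewrite (_ : (fun _ => _) = (fun=> 1))//; exact: ccst.
by under eq_fun do rewrite exprS; exact: cM.
Qed.

Lemma ccomp f g : continuous f -> continuous g -> continuous (fun y : R => f (g y)).
Proof. by move=> h1 h2 x; apply: continuous_comp; [exact: h2|exact: h1]. Qed.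

Lemma csum n (F : 'I_n -> R -> R) : (forall i, continuous (F i)) ->
  continuous (fun y : R => \sum_(i < n) F i y).
Proof. elim: n F => [|n IHn] F h.
  by rewrite (_ : (fun _ => _) = fun=> 0)//; [exact: ccst|apply/funext => y; rewrite big_ord0].
by under eq_fun do rewrite big_ord_recr/=; apply: cD => //; exact: IHn. Qed.

Lemma is_derive_continuous f f' :
  (forall x, is_derive x 1 f (f' x)) -> continuous f.
Proof.
move=> df x; apply/differentiable_continuous/derivable1_diffP.
by have [] := df x.
Qed.

End Combinators.

(** * Fundamental theorem of calculus on open intervals; integrals against powers of x *)

Section Calculus.
Variable R : realType.
Notation mu := (@lebesgue_measure R).
Implicit Types (f F g : R -> R) (a b x : R).

(** The denominators start at 3 so that no interval is empty. Integrands that are singular at the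
    end points are reached through these compact intervals. *)
Lemma exhaust_oo a b : a < b ->
  (`]a, b[%classic : set R) =
  \bigcup_n `[a + (b - a) / n.+3%:R, b - (b - a) / n.+3%:R]%classic.
Proof.
move=> ab; have ba : 0 < b - a by rewrite subr_gt0.
apply/seteqP; split => [x /=|x [n _] /=]; rewrite !in_itv/=; last first.
  have h : 0 < (b - a) / n.+3%:R by rewrite divr_gt0.
  by move: h; set e := _ / _ => h /andP[h1 h2]; apply/andP; split; lra.
case/andP=> ax xb.
have m0 : 0 < Num.min (x - a) (b - x) by rewrite lt_min !subr_gt0 ax.
have mb : 0 < Num.min (x - a) (b - x) / (b - a) by rewrite divr_gt0.
have [n hn] := ltr_add_invr mb.
exists n => //=; rewrite in_itv/=.
have : (b - a) / n.+3%:R < Num.min (x - a) (b - x).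
  move: hn; rewrite add0r ltr_pdivlMr// mulrC; apply: le_lt_trans.
  by rewrite ler_pM2l// lef_pV2 ?posrE// ler_nat ltnW.
by rewrite lt_min; set e := _ / _ => /andP[h1 h2]; apply/andP; split; lra.
Qed.

Lemma cvg_shrink a b : (a + (b - a) / n.+3%:R : R) @[n --> \oo] --> a.
Proof.
rewrite -[X in _ --> X]addr0; apply: cvgD; first exact: cvg_cst.
rewrite -[X in _ --> X](mulr0 (b - a)); apply: cvgMr.
have := @cvg_harmonic R; rewrite -(cvg_shiftn 2%N) /=.
by under eq_fun do rewrite /= addn2.
Qed.

Lemma continuous_in_within f a b : {in `]a, b[, continuous f} ->
  forall c d, a < c -> d < b -> {within `[c, d], continuous f}.
Proof.
move=> cf c d ac db; apply: continuous_in_subspaceT => x.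
rewrite inE/= in_itv/= => /andP[cx xd]; apply: cf.
by rewrite in_itv/= (lt_le_trans ac cx) (le_lt_trans xd db).
Qed.

Lemma FTC_cc f F a b : a <= b ->
  (forall x, a <= x <= b -> is_derive x 1 F (f x)) ->
  {within `[a, b], continuous f} ->
  (\int[mu]_(x in `[a, b]) (f x)%:E = (F b - F a)%:E)%E.
Proof.
rewrite le_eqVlt => /predU1P[->|ab] dF cf.
  by rewrite set_itv1 integral_set1 subrr.
have cF x : a <= x <= b -> {for x, continuous F}.
  move=> xab; apply/differentiable_continuous/derivable1_diffP.
  by have [] := dF _ xab.
rewrite (@continuous_FTC2 _ f F)// ?EFinB//.
- split.
  + by move=> x; rewrite in_itv/= => /andP[/ltW ax /ltW xb]; have [] := dF x; rewrite ?ax ?xb.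
  + by apply: cvg_at_right_filter; apply: cF; rewrite lexx ltW.
  + by apply: cvg_at_left_filter; apply: cF; rewrite lexx ltW.
- move=> x; rewrite in_itv/= => /andP[/ltW ax /ltW xb].
  by rewrite derive1E; have [|_ ->] := dF x; first by rewrite ax xb.
Qed.

Section FTC_oo.
Variables (f F : R -> R) (a b : R).
Hypotheses (ab : a < b) (dF : forall x, a < x < b -> is_derive x 1 F (f x)).
Hypotheses (cf : {in `]a, b[, continuous f}).
Hypotheses (Fa : F x @[x --> a^'+] --> F a) (Fb : F x @[x --> b^'-] --> F b).

Let I n : set R := `[a + (b - a) / n.+3%:R, b - (b - a) / n.+3%:R]%classic.

Let I_lt n : (a < a + (b - a) / n.+3%:R) /\ (b - (b - a) / n.+3%:R < b) /\
   (a + (b - a) / n.+3%:R <= b - (b - a) / n.+3%:R).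
Proof.
have ba : 0 < b - a by rewrite subr_gt0.
have h : 0 < (b - a) / n.+3%:R by rewrite divr_gt0.
have : (b - a) / n.+3%:R <= (b - a) / 2.
  by rewrite ler_pM2l// lef_pV2 ?posrE// ler_nat.
move: h; set e := _ / n.+3%:R => h h'.
by split; first lra; split; lra.
Qed.

Let int_I n : (\int[mu]_(x in I n) (f x)%:E =
  (F (b - (b - a) / n.+3%:R) - F (a + (b - a) / n.+3%:R))%:E)%E.
Proof.
have [h1 [h2 h3]] := I_lt n.
apply: FTC_cc => //; last exact: (continuous_in_within cf h1 h2).
by move=> x /andP[ax xb]; apply: dF; rewrite (lt_le_trans h1 ax) (le_lt_trans xb h2).
Qed.

Let cvgI : ((F (b - (b - a) / n.+3%:R) - F (a + (b - a) / n.+3%:R))%:E)%E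
   @[n --> \oo] --> ((F b - F a)%:E)%E.
Proof.
apply: cvg_EFin; first by near=> n.
apply: cvgB.
- move/cvg_at_leftP : Fb; apply; split; first by move=> n; have [_ []] := I_lt n.
  have := @cvg_shrink b a; apply: cvg_trans; apply: near_eq_cvg; near=> n.
  by rewrite -[b - a]opprB mulNr opprK.
- by move/cvg_at_rightP : Fa; apply; split; [move=> n; have [] := I_lt n|exact: cvg_shrink].
Unshelve. all: by end_near. Qed.

Lemma measurable_oo_continuous : measurable_fun `]a, b[ f.
Proof.
apply: open_continuous_measurable_fun; first exact: interval_open.
by move=> x /[1!inE] xab; exact: cf.
Qed.

(** Positivity makes the integrals over [I n] monotone in n, so finiteness of the integral is a
    conclusion; [FTC_oo] treats signed integrands by dominated convergence. *)
Lemma ge0_FTC_oo : (forall x, a < x < b -> 0 <= f x) ->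
  (\int[mu]_(x in `]a, b[) (f x)%:E = (F b - F a)%:E)%E.
Proof.
move=> f0.
have mono : nondecreasing_seq I.
  move=> m n mn; apply/subsetPset => x; rewrite /I /= !in_itv/= => /andP[h1 h2].
  have : (b - a) / n.+3%:R <= (b - a) / m.+3%:R.
    by rewrite ler_pM2l ?subr_gt0// lef_pV2 ?posrE// ler_nat !ltnS.
  by move: h1 h2; set e := _ / n.+3%:R; set e' := _ / m.+3%:R => h1 h2 h; apply/andP; split; lra.
have sub n : I n `<=` `]a, b[%classic.
  by rewrite (exhaust_oo ab) => x hx; exists n.
rewrite (exhaust_oo ab).
have h3 : (\int[mu]_(x in I i) (EFin \o f) x @[i --> \oo] -->
    \int[mu]_(x in \bigcup_i I i) (EFin \o f) x)%E.
  apply: ge0_nondecreasing_set_cvg_integral => //.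
  - by move=> i; exact: measurable_itv.
  - move=> i; apply/measurable_EFinP; apply: measurable_funS measurable_oo_continuous => //.
  - by move=> i x /sub/=; rewrite in_itv/= lee_fin => /f0.
have h4 := cvg_lim _ h3; rewrite -(h4 _)//; apply/cvg_lim => //.
by under eq_fun do rewrite int_I.
Qed.

Lemma FTC_oo : mu.-integrable `]a, b[ (EFin \o f) ->
  (\int[mu]_(x in `]a, b[) f x = F b - F a)%R.
Proof.
move=> intf.
have sub n : I n `<=` `]a, b[%classic.
  by rewrite (exhaust_oo ab) => x hx; exists n.
have [|||||_ _] := @dominated_convergence _ _ R mu `]a, b[%classic (measurable_itv _)
   (fun n => (EFin \o f) \_ (I n)) (EFin \o f) (abse \o (EFin \o f)).
- move=> n; apply/(measurable_restrict _ (measurable_itv _) (measurable_itv _)).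
  rewrite setIidr; last exact: (sub n).
  apply/measurable_EFinP; apply: measurable_funS measurable_oo_continuous => //.
  exact: (sub n).
- by apply/measurable_EFinP; exact: measurable_oo_continuous.
- apply/aeW => x; rewrite (exhaust_oo ab) => -[n _ Inx].
  apply: cvg_near_cst; near=> m; rewrite patchE mem_set//.
  have : I n `<=` I m.
    move=> y; rewrite /I /= !in_itv/= => /andP[h1 h2].
    have : (b - a) / m.+3%:R <= (b - a) / n.+3%:R.
      rewrite ler_pM2l ?subr_gt0// lef_pV2 ?posrE// ler_nat !ltnS.
      by near: m; exact: nbhs_infty_ge.
    by move: h1 h2; set e := _ / n.+3%:R; set e' := _ / m.+3%:R => h1 h2 h; apply/andP; split; lra.
  by apply.
- exact: integrable_abse.
- apply/aeW => x n _ /=; rewrite patchE; case: ifPn => //= _.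
  by rewrite lee_fin normr0.
move=> H; rewrite /Rintegral.
have -> : (\int[mu]_(x in `]a, b[) (f x)%:E = (F b - F a)%:E)%E; last by [].
have h4 := cvg_lim _ H; rewrite -(h4 _)//; apply/cvg_lim => //.
have E n : (\int[mu]_(x in `]a, b[) ((EFin \o f) \_ (I n)) x = \int[mu]_(x in I n) (f x)%:E)%E.
  by rewrite -integral_mkcondr; congr integral; exact/setIidPr.
by under eq_fun do rewrite E int_I.
Unshelve. all: by end_near. Qed.

End FTC_oo.

Lemma continuous_bounded_itv f a b : continuous f ->
  exists C, 0 < C /\ forall x, a <= x <= b -> `|f x| <= C.
Proof.
move=> cf; have [ab|ba] := leP a b; last first.
  by exists 1; split => // x /andP[ax xb]; move: (le_trans ax xb); rewrite leNgt ba.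
have cg : {within `[a, b], continuous (fun x => `|f x|)}.
  apply: continuous_subspaceT => x; apply: (continuous_comp (cf x)).
  exact: norm_continuous.
have [c _ hc] := EVT_max ab cg; exists (`|f c| + 1); split.
  by rewrite ltr_pwDr.
by move=> x xab; apply: (le_trans (hc x _)); rewrite ?in_itv//= lerDl.
Qed.

Lemma continuous_measurable_itv f (i : interval R) : continuous f ->
  measurable_fun [set` i] f.
Proof.
by move=> cf; apply: measurable_funTS; apply: continuous_measurable_fun.
Qed.

Lemma continuous_powR_pos (r x : R) : 0 < x -> {for x, continuous (fun y : R => y `^ r)}.
Proof.
move=> x0; apply/differentiable_continuous/derivable1_diffP.
by have [] := @is_derive1_powR R r x x0.
Qed.

Lemma measurable_powR01 (r : R) : measurable_fun (`]0, 1[ : set R) (fun x : R => x `^ r).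
Proof. exact: measurable_funTS. Qed.

Lemma powR_cvg_right0 (q : R) : 0 < q -> (x : R) `^ q @[x --> 0^'+] --> 0 `^ q.
Proof. by move=> q0; rewrite powR0 ?gt_eqF//; exact: powR_cvg0. Qed.

Lemma integral_powR01 (q : R) : 0 < q ->
  (\int[mu]_(x in `]0%R, 1%R[) (x `^ (q - 1))%:E = (q^-1)%:E)%E.
Proof.
move=> q0.
apply: (etrans (@ge0_FTC_oo (fun x => x `^ (q - 1)) (fun x => q^-1 * x `^ q) 0 1 _ _ _ _ _ _)) => //.
- move=> x /andP[x0 _]; apply: dE (dZ q^-1 (dpowR q x0)) _.
  by rewrite mulrA mulVf ?gt_eqF// mul1r.
- by move=> x; rewrite in_itv/= => /andP[x0 _]; exact: continuous_powR_pos.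
- by apply: cvgMr; exact: powR_cvg_right0.
- by apply: cvgMr; apply: cvg_at_left_filter; exact: continuous_powR_pos.
- by move=> x _; exact: powR_ge0.
- by rewrite powR1 powR0 ?gt_eqF// mulr0 subr0 mulr1.
Qed.

Lemma integrable_powR01 (q : R) : 0 < q ->
  mu.-integrable (`]0, 1[ : set R) (EFin \o (fun x : R => x `^ (q - 1))).
Proof.
move=> q0; apply/integrableP; split.
  by apply/measurable_EFinP; exact: measurable_powR01.
under eq_integral do rewrite /= ger0_norm ?powR_ge0//.
by rewrite integral_powR01// ltry.
Qed.

Lemma integrable_bounded_weight (q : R) f : 0 < q -> measurable_fun (`]0, 1[ : set R) f ->
  (exists C, forall x, 0 < x < 1 -> `|f x| <= C) ->
  mu.-integrable (`]0, 1[ : set R) (EFin \o (fun x : R => f x * x `^ (q - 1))).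
Proof.
move=> q0 mf [C hC].
apply: (@le_integrable _ _ _ mu _ _ _ (fun x => (C * x `^ (q - 1))%:E)) => //.
- by apply/measurable_EFinP; apply: measurable_funM => //; exact: measurable_powR01.
- move=> x /=; rewrite in_itv/= => /hC h.
  rewrite lee_fin normrM [leRHS]normrM ler_pM// (le_trans h)// ler_norm//.
- rewrite (_ : (fun _ => _) = (fun x => C%:E * (x `^ (q - 1))%:E)%E)//.
  by apply: integrableZl => //; exact: integrable_powR01.
Qed.

Lemma integrable_continuous_weight (q : R) f : 0 < q -> continuous f ->
  mu.-integrable (`]0, 1[ : set R) (EFin \o (fun x : R => f x * x `^ (q - 1))).
Proof.
move=> q0 cf; apply: integrable_bounded_weight => //; first exact: continuous_measurable_itv.
have [C [_ hC]] := continuous_bounded_itv 0 1 cf.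
by exists C => x /andP[/ltW x0 /ltW x1]; apply: hC; rewrite x0.
Qed.

(* The boundary term at 0 of an integration by parts against x^(q-1) dx vanishes because q > 0. *)
Lemma divergence01 (q : R) (H H' : R -> R) : 0 < q ->
  (forall x, is_derive x 1 H (H' x)) -> continuous (fun x => x * H' x) ->
  \int[mu]_(x in `]0, 1[) ((q * H x + x * H' x) * x `^ (q - 1)) = H 1.
Proof.
move=> q0 dH cxH'.
have cH := is_derive_continuous dH.
have cG : continuous (fun x => q * H x + x * H' x).
  by move=> x; apply: cvgD; [apply: cvgMr; exact: cH|exact: cxH'].
apply: (etrans (@FTC_oo _ (fun x => x `^ q * H x) 0 1 _ _ _ _ _ _)) => //.
- move=> x /andP[x0 _].
  apply: dE (dM (dpowR q x0) (dH x)) _.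
  by rewrite -(mulr_powRB1 (ltW x0) q0); ring.
- move=> x; rewrite in_itv/= => /andP[x0 _].
  by apply: cvgM; [exact: cG|exact: continuous_powR_pos].
- by apply: cvgM; [exact: powR_cvg_right0|apply: cvg_at_right_filter; exact: cH].
- by apply: cvg_at_left_filter; apply: cvgM; [exact: continuous_powR_pos|exact: cH].
- exact: integrable_continuous_weight.
- by rewrite powR1 powR0 ?gt_eqF// mul0r subr0 mul1r.
Qed.

End Calculus.

Section RealIntegrable.
Variable R : realType.
Notation mu := (@lebesgue_measure R).
Variables (D : set R) (mD : measurable D).
Implicit Types (f g : R -> R).

Lemma integrableRZ k f : mu.-integrable D (EFin \o f) ->
  mu.-integrable D (EFin \o (fun x => k * f x)).
Proof.
move=> h; rewrite (_ : EFin \o _ = (fun x => k%:E * (EFin \o f) x)%E)//.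
exact: integrableZl.
Qed.

Lemma integrableRD f g : mu.-integrable D (EFin \o f) -> mu.-integrable D (EFin \o g) ->
  mu.-integrable D (EFin \o (fun x => f x + g x)).
Proof.
move=> h1 h2; rewrite (_ : EFin \o _ = ((EFin \o f) \+ (EFin \o g))%E)//.
exact: integrableD.
Qed.

Lemma integrableRN f : mu.-integrable D (EFin \o f) ->
  mu.-integrable D (EFin \o (fun x => - f x)).
Proof.
move=> h; rewrite (_ : EFin \o _ = (-%E \o (EFin \o f))%E)//.
exact: integrableN.
Qed.

Lemma integrableRB f g : mu.-integrable D (EFin \o f) -> mu.-integrable D (EFin \o g) ->
  mu.-integrable D (EFin \o (fun x => f x - g x)).
Proof. by move=> h1 h2; apply: integrableRD => //; exact: integrableRN. Qed.

Lemma integrableRsum n (F : 'I_n -> R -> R) :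
  (forall i, mu.-integrable D (EFin \o F i)) ->
  mu.-integrable D (EFin \o (fun x => \sum_(i < n) F i x)).
Proof.
move=> h; elim: n F h => [|n IHn] F h.
  apply: (@eq_integrable _ _ _ mu D mD (cst 0%E)); last exact: integrable0.
  by move=> x _ /=; rewrite big_ord0.
have := integrableRD (IHn (fun i => F (widen_ord (leqnSn n) i)) (fun i => h _)) (h ord_max).
by apply: eq_integrable => // x _ /=; rewrite big_ord_recr.
Qed.

Lemma Rintegral_sum n (F : 'I_n -> R -> R) :
  (forall i, mu.-integrable D (EFin \o F i)) ->
  \int[mu]_(x in D) (\sum_(i < n) F i x) = \sum_(i < n) \int[mu]_(x in D) F i x.
Proof.
move=> h; elim: n F h => [|n IHn] F h.
  rewrite big_ord0; under eq_Rintegral do rewrite big_ord0.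
  by rewrite /Rintegral integral0.
rewrite big_ord_recr/= -IHn// -RintegralD//; last first.
  exact: (integrableRsum (fun i => h (widen_ord (leqnSn n) i))).
by apply: eq_Rintegral => x _; rewrite big_ord_recr.
Qed.

End RealIntegrable.

(** * The Bessel function *)

Section NormalizedBessel.
Variable R : realType.
Implicit Types (nu x z : R).

Definition poch (a : R) k := \prod_(i < k) (a + i%:R).

Definition bcoef nu (k : nat) : R := (- 4^-1) ^+ k / (k`!%:R * poch (nu + 1) k).

Definition bseries nu z : R := limn (pseries (bcoef nu) z).

(* phi nu x = Gamma(nu+1) (x/2)^(-nu) J_nu(x), so that phi nu 0 = 1. *)
Definition phi nu x : R := bseries nu (x ^+ 2).

Lemma poch_gt0 a k : 0 < a -> 0 < poch a k.
Proof. by move=> a0; apply: prodr_gt0 => i _; rewrite ltr_pwDl. Qed.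

Lemma pochS a k : poch a k.+1 = a * poch (a + 1) k.
Proof.
rewrite /poch big_ord_recl/= addr0; congr (_ * _).
by apply: eq_bigr => i _; rewrite /bump/= add1n -natr1; ring.
Qed.

Lemma pochSr a k : poch a k.+1 = poch a k * (a + k%:R).
Proof. by rewrite /poch big_ord_recr. Qed.

Lemma poch_ge a k : 0 < a -> Num.min 1 a <= poch a k.
Proof.
move=> a0; case: k => [|k]; first by rewrite /poch big_ord0 ge_min lexx.
rewrite pochS ge_min; apply/orP; right; rewrite ler_peMr ?(ltW a0)//.
apply: (big_ind (fun x => 1 <= x)) => // [x y x1 y1|i _]; first by rewrite mulr_ege1.
by rewrite -addrA addrCA lerDl addr_ge0// ltW.
Qed.

(** All factors of [poch] after the first are at least 1, so up to a constant the series is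
    dominated by the exponential series, for every z. *)
Lemma norm_bcoef_le nu k z : -1 < nu ->
  `|bcoef nu k * z ^+ k| <= (Num.min 1 (nu + 1))^-1 * exp_coeff `|z| k.
Proof.
move=> nu1; have a0 : 0 < nu + 1 by rewrite -ltrBlDr sub0r.
have m0 : 0 < Num.min 1 (nu + 1) by rewrite lt_min ltr01.
rewrite /bcoef /exp_coeff/= normrM normrX !normrM normrX normfV normrM.
rewrite normrN (ger0_norm (_ : 0 <= 4^-1))// (gtr0_norm (poch_gt0 _ a0)) normr_nat.
rewrite invfM.
set p := (poch _ _)^-1; set f := (k`!%:R)^-1.
have -> : 4^-1 ^+ k * (f * p) * `|z| ^+ k = p * (4^-1 ^+ k * (`|z| ^+ k * f)) by ring.
apply: ler_pM.
- by rewrite invr_ge0 ltW// poch_gt0.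
- by rewrite !mulr_ge0// ?exprn_ge0// invr_ge0.
- by rewrite lef_pV2 ?posrE ?poch_gt0// poch_ge.
- rewrite ler_piMl// ?mulr_ge0// ?exprn_ge0//; first by rewrite invr_ge0.
  by rewrite exprn_ile1//; lra.
Qed.

Lemma is_cvg_bseries nu z : -1 < nu -> cvgn (pseries (bcoef nu) z).
Proof.
move=> nu1; apply: normed_cvg.
apply: (@series_le_cvg _ _ (fun k => (Num.min 1 (nu + 1))^-1 * exp_coeff `|z| k)).
- by move=> k /=.
- move=> k /=; apply: mulr_ge0; first by rewrite invr_ge0 le_min ler01/=; lra.
  by rewrite exp_coeff_ge0.
- by move=> k; exact: norm_bcoef_le.
- rewrite (_ : series _ = (fun n => (Num.min 1 (nu + 1))^-1 * series (exp_coeff `|z|) n)).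
    by apply: is_cvgMr; exact: is_cvg_series_exp_coeff.
  by apply/funext => n; rewrite /series/= mulr_sumr.
Qed.

Lemma bcoef_diffs nu : -1 < nu ->
  pseries_diffs (bcoef nu) = (fun k => - (4 * (nu + 1))^-1 * bcoef (nu + 1) k).
Proof.
move=> nu1; apply/funext => k; rewrite /pseries_diffs /bcoef pochS factS natrM exprS.
have := poch_gt0 k (_ : 0 < nu + 1 + 1); have k0 : 0 < k`!%:R :> R by rewrite ltr0n fact_gt0.
set p := poch _ _ => hp; have p0 : 0 < p by apply: hp; lra.
by field; rewrite !gt_eqF// ?ltr0n//; lra.
Qed.

Lemma pseriesZ c (a : nat -> R) z : pseries (fun k => c * a k) z = (fun n => c * pseries a z n).
Proof.
by apply/funext => n; rewrite /pseries /series/= mulr_sumr; apply: eq_bigr => i _; rewrite mulrA.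
Qed.

Lemma is_derive_bseries nu z : -1 < nu ->
  is_derive z 1 (bseries nu) (- (4 * (nu + 1))^-1 * bseries (nu + 1) z).
Proof.
move=> nu1.
have h a c x : -1 < a -> cvgn (pseries (fun k => c * bcoef a k) x).
  by move=> a1; rewrite pseriesZ; apply: is_cvgMr; exact: is_cvg_bseries.
have -> : - (4 * (nu + 1))^-1 * bseries (nu + 1) z = limn (pseries (pseries_diffs (bcoef nu)) z).
  rewrite bcoef_diffs// pseriesZ; apply/esym/cvg_lim => //; apply: cvgMr.
  by apply: is_cvg_bseries; lra.
apply: (@pseries_snd_diffs _ _ (`|z| + 1)).
- exact: is_cvg_bseries.
- by rewrite bcoef_diffs//; apply: h; lra.
- rewrite bcoef_diffs//.
  have -> : pseries_diffs (fun k => - (4 * (nu + 1))^-1 * bcoef (nu + 1) k) =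
     (fun k => - (4 * (nu + 1))^-1 * pseries_diffs (bcoef (nu + 1)) k).
    by apply/funext => k; rewrite /pseries_diffs; ring.
  rewrite pseriesZ; apply: is_cvgMr; rewrite bcoef_diffs; last by lra.
  by apply: h; lra.
- by rewrite ltr_normr; apply/orP; left; rewrite ltrDl.
Qed.

(** The contiguous relation between three consecutive orders. Combined with the derivative formula
    it amounts to Bessel's equation, which is how the differential equation enters below. *)
Lemma bseries_contiguous nu z : -1 < nu ->
  bseries nu z = bseries (nu + 1) z -
    z / (4 * (nu + 1) * (nu + 2)) * bseries (nu + 2) z.
Proof.
move=> nu1; apply/cvg_lim => //.
(* The identity already holds for partial sums, with one term fewer in the last series because of
   its factor z; this explains the shift in the limit. *)
have E n : pseries (bcoef nu) z n.+1 = pseries (bcoef (nu + 1)) z n.+1 -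
    z / (4 * (nu + 1) * (nu + 2)) * pseries (bcoef (nu + 2)) z n.
  elim: n => [|n IHn].
    by rewrite /pseries /series/= !big_nat1 big_geq// mulr0 subr0 /bcoef /poch !big_ord0.
  rewrite /pseries /series/= in IHn *; rewrite big_nat_recr//= IHn.
  rewrite [X in _ = X - _]big_nat_recr//= [X in _ = _ - _ * X]big_nat_recr//=.
  suff -> : bcoef nu n.+1 * z ^+ n.+1 = bcoef (nu + 1) n.+1 * z ^+ n.+1 -
     z / (4 * (nu + 1) * (nu + 2)) * (bcoef (nu + 2) n * z ^+ n) by ring.
  have n0 : 0 <= n%:R :> R by [].
  rewrite /bcoef (pochS (nu + 1)) factS natrM !exprS.
  have e : poch (nu + 2 + 1) n = poch (nu + 1 + 1) n * (nu + 2 + n%:R) / (nu + 2).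
    have -> : nu + 2 + n%:R = nu + 1 + 1 + n%:R by lra.
    rewrite -pochSr pochS (_ : nu + 1 + 1 + 1 = nu + 2 + 1); last lra.
    by rewrite (_ : nu + 1 + 1 = nu + 2); [rewrite mulrAC mulfV ?mul1r// gt_eqF//|]; lra.
  rewrite e pochSr; have : 0 < poch (nu + 1 + 1) n by apply: poch_gt0; lra.
  set p := poch _ _ => p0.
  have k0 : 0 < n`!%:R :> R by rewrite ltr0n fact_gt0.
  have -> : (n.+1)%:R = n%:R + 1 :> R by rewrite natr1.
  by field; rewrite !gt_eqF//; lra.
rewrite -(cvg_shiftS (pseries (bcoef nu) z)).
apply: cvg_trans; first by apply: near_eq_cvg; near=> n; rewrite /= E.
apply: cvgB.
  rewrite (cvg_shiftS (pseries (bcoef (nu + 1)) z)); apply: is_cvg_bseries; lra.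
by apply: cvgMr; apply: is_cvg_bseries; lra.
Unshelve. all: by end_near. Qed.

Lemma phi0 nu : -1 < nu -> phi nu 0 = 1.
Proof.
move=> nu1; rewrite /phi expr0n/=; apply/cvg_lim => //.
rewrite -(cvg_shiftS (pseries (bcoef nu) 0)); apply: cvg_near_cst; near=> n.
rewrite /pseries /series/= big_nat_recl//= big1 => [|i _]; last by rewrite exprS mul0r mulr0.
by rewrite /bcoef /poch big_ord0 !expr0 fact0 !mulr1 divr1 addr0.
Unshelve. all: by end_near. Qed.

Lemma dphi nu x : -1 < nu ->
  is_derive x 1 (phi nu) (- (x / (2 * (nu + 1))) * phi (nu + 1) x).
Proof.
move=> nu1; apply: dE (dcomp (dX 2 (did x)) (is_derive_bseries (x ^+ 2) nu1)) _.
by rewrite /phi/=; field; lra.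
Qed.

Lemma phi_contiguous nu x : -1 < nu ->
  phi nu x = phi (nu + 1) x - x ^+ 2 / (4 * (nu + 1) * (nu + 2)) * phi (nu + 2) x.
Proof. by move=> nu1; exact: bseries_contiguous. Qed.

Lemma continuous_phi nu : -1 < nu -> continuous (phi nu).
Proof. by move=> nu1; apply: is_derive_continuous => x; exact: dphi. Qed.

End NormalizedBessel.

(** * The Gamma function: positivity and functional equation *)

Section GammaFunction.
Variable R : realType.
Notation mu := (@lebesgue_measure R).
Implicit Types (a t : R).

Let gint a t := t `^ (a - 1) * expR (- t).

Lemma powR_le_expR a : exists C, 0 < C /\ forall t, 1 <= t -> t `^ a <= C * expR (t / 2).
Proof.
(* ln t <= |ln K| + t/K, and K > 2 |a| makes |a| t/K at most t/2. *)
pose K := 2 * `|a| + 1; have K0 : 0 < K by rewrite ltr_wpDl// mulr_ge0.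
exists (expR (`|a| * `|ln K|)); split; first exact: expR_gt0.
move=> t t1; have t0 : 0 < t by apply: lt_le_trans t1.
rewrite /powR gt_eqF// -expRD ler_expR.
have lt0 : 0 <= ln t by rewrite ln_ge0.
apply: (@le_trans _ _ (`|a| * ln t)); first by rewrite ler_wpM2r// ler_norm.
have h : ln t <= `|ln K| + t / K.
  have /(_ t K) h1 := @ln_div R.
  rewrite -[t in leLHS](divfK (lt0r_neq0 K0)) lnM ?posrE ?divr_gt0// addrC.
  apply: lerD; first exact: ler_norm.
  by apply: ltW; apply: ln_sublinear; rewrite divr_gt0.
apply: (le_trans (ler_wpM2l (normr_ge0 a) h)).
rewrite mulrDr lerD2l mulrCA ler_pM2l// ler_pdivrMr// /K.
by have := normr_ge0 a; lra.
Qed.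

Lemma integral_expR_half : (\int[mu]_(x in `[1%R, +oo[) (expR (- (x / 2)))%:E < +oo)%E.
Proof.
rewrite (@ge0_continuous_FTC2y _ _ (fun x => - 2 * expR (- (x / 2))) 1 0) ?ltry//.
- by apply: continuous_subspaceT => x; apply: continuous_comp; [|exact: continuous_expR];
    apply: cvgN; apply: cvgMl.
- rewrite -[X in _ --> X](mulr0 (-2)); apply: cvgMr.
  apply: (@cvg_comp _ _ _ (fun x : R => x / 2) (fun y : R => expR (- y)) _ _ _ _ (@cvgr_expR R)).
  exact: gt0_cvgMly.
- apply: cvg_at_right_filter; apply: cvgMr; apply: continuous_comp; last exact: continuous_expR.
  by apply: cvgN; apply: cvgMl.
- move=> x _; rewrite derive1E.
  have [_ ->] : is_derive (x : R) 1 (fun x : R => - 2 * expR (- (x / 2))) (expR (- (x / 2))) => //.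
  apply: dE (dZ (-2) (dcomp (dN (dM (did x) (dcst 2^-1 x))) (is_derive_expR _))) _.
  by field.
Qed.

Lemma measurable_gint a (D : set R) : measurable_fun D (gint a).
Proof.
apply: measurable_funM; first exact: measurable_funTS.
apply: measurable_funTS; apply: continuous_measurable_fun => x.
by apply: continuous_comp; [exact: cvgN|exact: continuous_expR].
Qed.

Lemma gint_ge0 a t : 0 <= gint a t.
Proof. by rewrite mulr_ge0// ?powR_ge0// expR_ge0. Qed.

Lemma integrable_gint a : 0 < a -> mu.-integrable `]0, +oo[ (EFin \o gint a).
Proof.
move=> a0.
have -> : `]0, +oo[%classic = `]0, 1[%classic `|` `[1, +oo[%classic :> set R.
  by rewrite -itv_bndbnd_setU// bnd_simp.
apply/integrableP; split; first by apply/measurable_EFinP; exact: measurable_gint.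
under eq_integral do rewrite /= ger0_norm ?gint_ge0//.
rewrite ge0_integral_setU//=.
- apply: lte_add_pinfty.
  + apply: (@le_lt_trans _ _ (\int[mu]_(x in `]0%R, 1%R[) (x `^ (a - 1))%:E)%E).
      apply: ge0_le_integral => //.
      * by move=> x _; rewrite lee_fin gint_ge0.
      * by apply/measurable_EFinP; exact: measurable_gint.
      * by apply/measurable_EFinP; apply: measurable_funTS; exact: measurable_powR.
      * move=> x /=; rewrite in_itv/= => /andP[x0 _].
        by rewrite lee_fin ler_piMr ?powR_ge0// -expR0 ler_expR oppr_le0 ltW.
    by rewrite integral_powR01// ltry.
  + have [C [C0 hC]] := powR_le_expR (a - 1).
    apply: (@le_lt_trans _ _ (\int[mu]_(x in `[1%R, +oo[) (C%:E * (expR (- (x / 2)))%:E))%E).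
      apply: ge0_le_integral => //.
      * by move=> x _; rewrite lee_fin gint_ge0.
      * by apply/measurable_EFinP; exact: measurable_gint.
      * apply/measurable_EFinP; apply: measurable_funM => //; apply: measurable_funTS.
        apply: continuous_measurable_fun => x; apply: continuous_comp; last exact: continuous_expR.
        by apply: cvgN; apply: cvgMl.
      * move=> x /=; rewrite in_itv/= andbT => x1.
        rewrite -EFinM lee_fin /gint.
        have -> : expR (- (x / 2)) = expR (x / 2) * expR (- x).
          by rewrite -expRD; congr expR; lra.
        by rewrite mulrA ler_wpM2r ?expR_ge0// hC.
    rewrite ge0_integralZl//=.
    * rewrite lte_mul_pinfty//; first by rewrite lee_fin ltW.
      exact: integral_expR_half.
    * apply/measurable_EFinP; apply: measurable_funTS.
      apply: continuous_measurable_fun => x; apply: continuous_comp; last exact: continuous_expR.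
      by apply: cvgN; apply: cvgMl.
    * by rewrite lee_fin ltW.
- by apply/measurable_EFinP; exact: measurable_gint.
- by move=> x _; rewrite lee_fin gint_ge0.
- apply/disj_setPS => x [/=]; rewrite !in_itv/= andbT => /andP[_ x1] x2.
  by move: x1; rewrite ltNge x2.
Qed.

Lemma Gamma_gt0 a : 0 < a -> 0 < Gamma a.
Proof.
move=> a0; have [h1 h2] := integrableP _ _ _ (integrable_gint a0).
rewrite /Gamma /Rintegral fine_gt0//; apply/andP; split; last first.
  apply: le_lt_trans h2; apply: ge0_le_integral => //.
  - by move=> x _; rewrite lee_fin gint_ge0.
  - by apply: measurableT_comp.
  - by move=> x _; rewrite lee_fin ler_norm.
pose c := (Num.min 1 (2 `^ (a - 1))) * expR (- 2).
have c0 : 0 < c by rewrite mulr_gt0 ?expR_gt0// lt_min ltr01 powR_gt0.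
apply: (@lt_le_trans _ _ (\int[mu]_(x in `[1%R, 2%R]) c%:E)%E).
  rewrite integral_cst//= lebesgue_measure_itv/= lte_fin ltr1n -EFinB -EFinM lte_fin mulr_gt0// subr_gt0 ltr1n.
  apply: (@le_trans _ _ (\int[mu]_(x in `[1%R, 2%R]) (gint a x)%:E)%E).
  apply: ge0_le_integral => //.
  - by move=> x _; rewrite lee_fin ltW.
  - by apply/measurable_EFinP; exact: measurable_gint.
  - move=> x /=; rewrite in_itv/= => /andP[x1 x2]; rewrite lee_fin.
    have x0 : 0 < x by apply: lt_le_trans x1.
    apply: ler_pM.
    + by rewrite le_min ler01 powR_ge0.
    + exact: expR_ge0.
    + rewrite ge_min; have [a1|a1] := leP 1 a.
        apply/orP; left; rewrite -[leLHS](powRr0 x); apply: ler_powR => //; lra.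
      apply/orP; right; rewrite /powR !gt_eqF// ler_expR ler_wnM2l//; first by lra.
      by rewrite ler_ln ?posrE.
    + by rewrite ler_expR lerN2.
apply: ge0_subset_integral => //.
- by move=> x _; rewrite lee_fin gint_ge0.
- by move=> x /=; rewrite !in_itv/= => /andP[x1 _]; rewrite andbT (lt_le_trans _ x1).
Qed.

Lemma Gamma_rec a : 0 < a -> Gamma (a + 1) = a * Gamma a.
Proof.
move=> a0.
pose I n : set R := `]0, n.+1%:R[%classic.
have cupI : \bigcup_n I n = `]0, +oo[%classic.
  apply/seteqP; split => x; first by move=> [n _]; rewrite /I/= !in_itv/= => /andP[->].
  rewrite /= in_itv/= andbT => x0; exists (Num.truncn x) => //.
  by rewrite /I/= in_itv/= x0 truncnS_gt.
have Icvg b : 0 < b -> (\int[mu]_(x in I n) (gint b x)%:E @[n --> \oo] --> (Gamma b)%:E)%E.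
  move=> b0; rewrite /Gamma /Rintegral fineK; last first.
    exact: (integrable_fin_num _ (integrable_gint b0)).
  rewrite -cupI; apply: ge0_nondecreasing_set_cvg_integral => //.
  - move=> m n mn; apply/subsetPset => x; rewrite /I/= !in_itv/= => /andP[-> h]/=.
    by apply: (lt_le_trans h); rewrite ler_nat.
  - by move=> n; exact: measurable_itv.
  - by move=> n; apply/measurable_EFinP; exact: measurable_gint.
  - by move=> n x _; rewrite lee_fin gint_ge0.
have Iint b n : 0 < b -> mu.-integrable (I n) (EFin \o gint b).
  move=> b0; apply: integrableS (integrable_gint b0) => //; first exact: measurable_itv.
  by move=> x; rewrite /I/= !in_itv/= andbT => /andP[].
have rcvg b : 0 < b -> \int[mu]_(x in I n) gint b x @[n --> \oo] --> Gamma b.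
  by move=> b0; apply: fine_cvg; exact: Icvg.
have a10 : 0 < a + 1 by rewrite addr_gt0.
have key n : a * \int[mu]_(x in I n) gint a x - \int[mu]_(x in I n) gint (a + 1) x =
    n.+1%:R `^ a * expR (- n.+1%:R).
  rewrite -RintegralZl//; [|exact: measurable_itv|exact: Iint].
  rewrite -RintegralB//=; [|exact: measurable_itv| |exact: Iint]; last first.
    exact: (integrableRZ (measurable_itv _) a (Iint a n a0)).
  have iD : mu.-integrable (I n) (EFin \o (fun x => a * gint a x - gint (a + 1) x)).
    apply: integrableRB => //; [exact: measurable_itv| |exact: Iint].
    exact: (integrableRZ (measurable_itv _) a (Iint a n a0)).
  have E x : 0 < x -> a * gint a x - gint (a + 1) x =
      a * x `^ (a - 1) * expR (- x) + x `^ a * (expR (- x) * -1).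
    by move=> x0; rewrite /gint addrK; ring.
  apply: (etrans (@FTC_oo _ (fun x => a * gint a x - gint (a + 1) x)
     (fun x => x `^ a * expR (- x)) 0 n.+1%:R _ _ _ _ _ _)) => //.
  - move=> x /andP[x0 _]; apply: dE (dM (dpowR a x0) (dcomp (dN (did x)) (is_derive_expR _))) _.
    by rewrite E.
  - move=> x; rewrite in_itv/= => /andP[x0 _].
    have ce : {for x, continuous (fun y : R => expR (- y))}.
      by apply: continuous_comp; [exact: cvgN|exact: continuous_expR].
    by apply: cvgB; [apply: cvgMr|]; apply: cvgM => //; exact: continuous_powR_pos.
  - have ce : {for 0, continuous (fun y : R => expR (- y))}.
      by apply: continuous_comp; [exact: cvgN|exact: continuous_expR].
    by apply: cvgM; [exact: powR_cvg_right0|exact: cvg_at_right_filter].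
  - have ce : {for n.+1%:R, continuous (fun y : R => expR (- y))}.
      by apply: continuous_comp; [exact: cvgN|exact: continuous_expR].
    by apply: cvg_at_left_filter; apply: cvgM => //; exact: continuous_powR_pos.
  - by rewrite powR0 ?gt_eqF// mul0r subr0.
have lim0 : (n.+1%:R : R) `^ a * expR (- n.+1%:R) @[n --> \oo] --> (0 : R).
  have [C [C0 hC]] := powR_le_expR (a + 1).
  have : (C * n.+1%:R^-1 : R) @[n --> \oo] --> (0 : R).
    rewrite -[X in _ --> X](mulr0 C); apply: cvgMr; exact: cvg_harmonic.
  apply: (squeeze_cvgr (f := fun=> 0)); last exact: cvg_cst.
  apply: nearW => n; rewrite mulr_ge0 ?powR_ge0 ?expR_ge0//=.
  have n1 : 1 <= n.+1%:R :> R by rewrite ler1n.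
  have n0 : 0 < n.+1%:R :> R by [].
  have e : n.+1%:R `^ a * n.+1%:R = n.+1%:R `^ (a + 1) :> R.
    by rewrite mulrC -(mulr_powRB1 (ltW n0) a10) addrK.
  rewrite ler_pdivlMr// mulrAC e.
  apply: (le_trans (ler_wpM2r (expR_ge0 _) (hC _ n1))).
  move: n0 n1; set N := n.+1%:R => n0 n1.
  rewrite -mulrA -expRD ler_piMr ?(ltW C0)//.
  by rewrite -[leRHS]expR0 ler_expR subr_le0 ler_pdivrMr// ler_peMr ?(ltW n0)// ler1n.
have h1 : a * \int[mu]_(x in I n) gint a x - \int[mu]_(x in I n) gint (a + 1) x @[n --> \oo]
   --> a * Gamma a - Gamma (a + 1).
  by apply: cvgB; [apply: cvgMr|]; exact: rcvg.
apply/eqP; rewrite eq_sym -subr_eq0; apply/eqP.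
apply: (cvg_unique _ h1); first exact: norm_hausdorff.
by apply: cvg_trans lim0; apply: near_eq_cvg; near=> n; rewrite key.
Unshelve. all: by end_near. Qed.

End GammaFunction.

(** * Consequences of the mean value theorem; comparison of powers *)

Section Monotonicity.
Variable R : realType.
Implicit Types (F f : R -> R) (a b x : R).

Lemma MVT_le F f a b : a <= b -> (forall x, a <= x <= b -> is_derive x 1 F (f x)) ->
  exists2 c, a <= c <= b & F b - F a = f c * (b - a).
Proof.
move=> ab dF.
have cF : {within `[a, b], continuous F}.
  apply: derivable_within_continuous => x; rewrite in_itv/= => /dF[].
  by move=> + _.
have dF' x : x \in `]a, b[ -> is_derive x 1 F (f x).
  by rewrite in_itv/= => /andP[/ltW ax /ltW xb]; apply: dF; rewrite ax.
by have [c] := MVT_segment ab dF' cF; rewrite in_itv/=; exists c.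
Qed.

Lemma derive_ge0_le F f a b : a <= b -> (forall x, a <= x <= b -> is_derive x 1 F (f x)) ->
  (forall x, a <= x <= b -> 0 <= f x) -> F a <= F b.
Proof.
move=> ab dF f0; have [c cab e] := MVT_le ab dF.
by rewrite -subr_ge0 e mulr_ge0 ?f0// subr_ge0.
Qed.

Lemma derive_le0_ge F f a b : a <= b -> (forall x, a <= x <= b -> is_derive x 1 F (f x)) ->
  (forall x, a <= x <= b -> f x <= 0) -> F b <= F a.
Proof.
move=> ab dF f0; have [c cab e] := MVT_le ab dF.
by rewrite -subr_le0 e mulr_le0_ge0 ?f0// subr_ge0.
Qed.

Lemma powR_ratio (K t u c : R) : 1 <= K -> 0 < t -> 0 < u -> t <= K * u -> u <= K * t ->
  t `^ c <= K `^ `|c| * u `^ c.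
Proof.
move=> K1 t0 u0 tu ut; have K0 : 0 < K by apply: lt_le_trans K1.
have [c0|c0] := leP 0 c.
  by rewrite ger0_norm// -powRM ?(ltW K0) ?(ltW u0)//; apply: ge0_ler_powR; rewrite ?nnegrE ?mulr_ge0// ltW.
rewrite ltr0_norm//.
have -> : t `^ c = (t `^ (- c))^-1 by rewrite -powRN opprK.
have -> : u `^ c = (u `^ (- c))^-1 by rewrite -powRN opprK.
rewrite -[leRHS]invf_div lef_pV2 ?posrE ?powR_gt0 ?divr_gt0 ?powR_gt0//.
rewrite ler_pdivrMr ?powR_gt0// mulrC -powRM ?(ltW K0) ?(ltW t0)//.
by apply: ge0_ler_powR; rewrite ?nnegrE ?mulr_ge0 ?oppr_ge0// ltW.
Qed.

Lemma powR_pred (t r : R) : 0 < t -> t `^ (r - 1) = t `^ r / t.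
Proof.
move=> t0; have h : (r == 1) ==> (t != 0) by rewrite (gt_eqF t0)/= implybT.
by rewrite powRB// powRr1// ltW.
Qed.

End Monotonicity.

(** * Energy of Bessel's equation: size of phi, its zeros and their separation *)

Section Energy.
Variables (R : realType) (nu : R).
Hypothesis nu1 : -1 < nu.
Let b : R := nu + 1 / 2.
Implicit Types t u : R.

Definition Dphi (t : R) : R := - (t / (2 * (nu + 1))) * phi (nu + 1) t.

(* amp solves w'' + (1 - (nu^2 - 1/4) / t^2) w = 0. *)
Definition amp (t : R) : R := t `^ (nu + 1 / 2) * phi nu t.

Definition damp (t : R) : R :=
  t `^ (nu + 1 / 2) * (Dphi t + (nu + 1 / 2) / t * phi nu t).

Definition energy (t : R) : R := damp t ^+ 2 + amp t ^+ 2.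

Let kap : R := `|b ^+ 2 - b|.

Lemma dDphi t : t != 0 -> is_derive t 1 Dphi (- phi nu t - (2 * nu + 1) / t * Dphi t).
Proof.
have hnu := nu1; move=> t0; have nu2 : -1 < nu + 1 by lra.
apply: dE (dM (dN (dM (did t) (dcst (2 * (nu + 1))^-1 t))) (dphi t nu2)) _.
rewrite (phi_contiguous t nu1) /Dphi -addrA (_ : 1 + 1 = 2)//.
by field; rewrite t0 !gt_eqF//; lra.
Qed.


Lemma is_derive_amp t : 0 < t -> is_derive t 1 amp (damp t).
Proof.
have hnu := nu1; move=> t0; apply: dE (dM (dpowR (nu + 1 / 2) t0) (dphi t nu1)) _.
by rewrite /damp /Dphi powR_pred//; field; rewrite !gt_eqF//; lra.
Qed.

Lemma is_derive_damp t : 0 < t ->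
  is_derive t 1 damp (- amp t + (b ^+ 2 - b) / t ^+ 2 * amp t).
Proof.
move=> t0; have tn0 : t != 0 by rewrite gt_eqF.
apply: dE (dM (dpowR (nu + 1 / 2) t0) (dD (dDphi tn0)
  (dM (dM (dcst (nu + 1 / 2) t) (dV tn0 (did t))) (dphi t nu1)))) _.
rewrite -/(Dphi t) /amp /b powR_pred//.
by field.
Qed.

Lemma is_derive_energy t : 0 < t ->
  is_derive t 1 energy (2 * ((b ^+ 2 - b) / t ^+ 2) * (damp t * amp t)).
Proof.
move=> t0; apply: dE (dD (dX 2 (is_derive_damp t0)) (dX 2 (is_derive_amp t0))) _.
by rewrite /=; ring.
Qed.

Lemma energy_ge0 t : 0 <= energy t.
Proof. by rewrite addr_ge0// sqr_ge0. Qed.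

Let abs_dE t : 0 < t ->
  `|2 * ((b ^+ 2 - b) / t ^+ 2) * (damp t * amp t)| <= kap / t ^+ 2 * energy t.
Proof.
move=> t0; have -> : 2 * ((b ^+ 2 - b) / t ^+ 2) * (damp t * amp t) =
  (b ^+ 2 - b) / t ^+ 2 * (2 * (damp t * amp t)) by ring.
rewrite normrM normrM normfV (ger0_norm (sqr_ge0 t)) -/kap ler_wpM2l//.
  by rewrite mulr_ge0 ?normr_ge0// invr_ge0 sqr_ge0.
rewrite /energy ler_norml; have := sqr_ge0 (damp t + amp t); rewrite sqrrD => h1.
have := sqr_ge0 (damp t - amp t); rewrite sqrrB => h2.
by apply/andP; split; lra.
Qed.

Lemma energy_exp_mono (a t : R) : 0 < a -> a <= t ->
  energy t * expR (kap / t) <= energy a * expR (kap / a) /\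
  energy a * expR (- (kap / a)) <= energy t * expR (- (kap / t)).
Proof.
move=> a0 at_; have pos x : a <= x <= t -> 0 < x.
  by move=> /andP[ax _]; apply: lt_le_trans ax.
have dk (x : R) : 0 < x -> is_derive x 1 (fun y : R => kap / y) (- (kap / x ^+ 2)).
  move=> x0; have xn0 : x != 0 by rewrite gt_eqF.
  by apply: dE (dZ kap (dV xn0 (did x))) _; field.
split.
- apply: (@derive_le0_ge _ (fun x => energy x * expR (kap / x)) (fun x => (2 * ((b ^+ 2 - b) / x ^+ 2) * (damp x * amp x)) * expR (kap / x) + energy x * (expR (kap / x) * (- (kap / x ^+ 2)))) _ _ at_).
    move=> x /pos x0; exact: dM (is_derive_energy x0) (dcomp (dk x x0) (is_derive_expR _)).
  move=> x /pos x0; have := abs_dE x0; rewrite ler_norml => /andP[_ h].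
  rewrite (_ : _ + _ = (2 * ((b ^+ 2 - b) / x ^+ 2) * (damp x * amp x) -
    kap / x ^+ 2 * energy x) * expR (kap / x)); last by ring.
  by rewrite mulr_le0_ge0 ?expR_ge0// subr_le0.
- apply: (@derive_ge0_le _ (fun x => energy x * expR (- (kap / x))) (fun x => (2 * ((b ^+ 2 - b) / x ^+ 2) * (damp x * amp x)) * expR (- (kap / x)) + energy x * (expR (- (kap / x)) * (- - (kap / x ^+ 2)))) _ _ at_).
    move=> x /pos x0; exact: dM (is_derive_energy x0) (dcomp (dN (dk x x0)) (is_derive_expR _)).
  move=> x /pos x0; have := abs_dE x0; rewrite ler_norml => /andP[h _].
  rewrite (_ : _ + _ = (2 * ((b ^+ 2 - b) / x ^+ 2) * (damp x * amp x) +
    kap / x ^+ 2 * energy x) * expR (- (kap / x))); last by ring.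
  by rewrite mulr_ge0 ?expR_ge0//; lra.
Qed.

Lemma phi_near0 : exists2 t0 : R, 0 < t0 & forall t, 0 <= t <= t0 -> 2^-1 < phi nu t.
Proof.
have := continuous_phi nu1 (x := 0) => /cvgrPdist_lt /(_ 2^-1).
rewrite phi0// => /(_ ltac:(by []))/nbhs_ballP[e /= e0 he].
exists (e / 2); first by rewrite divr_gt0.
move=> t /andP[t0 te]; have := he t; rewrite /ball/= sub0r normrN ger0_norm//.
have te' : t < e by lra.
by move=> /(_ te'); rewrite ltr_norml => /andP[_]; lra.
Qed.

(** The start t0 is chosen where phi > 1/2, hence amp and the energy do not vanish there;
    [energy_exp_mono] propagates both bounds to infinity. This replaces the asymptotic formulas for
    Bessel functions. *)
Lemma energy_bounds : exists t0 m M, [/\ 0 < t0, 0 < m, 0 < M,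
  forall t, 0 <= t <= t0 -> 2^-1 < phi nu t &
  forall t, t0 <= t -> m <= energy t <= M].
Proof.
have [t0 t00 ht0] := phi_near0.
have E0 : 0 < energy t0.
  rewrite /energy ltr_wpDl ?sqr_ge0// exprn_even_gt0//= mulf_neq0//.
    by rewrite gt_eqF// powR_gt0.
  by rewrite gt_eqF// (lt_trans _ (ht0 t0 _))// ?lexx ?ltW.
exists t0, (energy t0 * expR (- (kap / t0))), (energy t0 * expR (kap / t0)).
split => //; try by rewrite mulr_gt0// expR_gt0.
move=> t tt0; have t_gt0 : 0 < t by apply: lt_le_trans tt0.
have k0 : 0 <= kap / t by rewrite divr_ge0 ?normr_ge0// ltW.
have [h1 h2] := energy_exp_mono t00 tt0; apply/andP; split.
  by apply: (le_trans h2); rewrite ler_piMr ?energy_ge0// -expR0 ler_expR oppr_le0.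
apply: le_trans h1; rewrite ler_peMr ?energy_ge0// -expR0 ler_expR//.
Qed.

(** E exp(-kap/t) increases and is bounded. Freezing it below t0 with [Num.max t0] gives a function
    that is monotone on the whole line. The limit is later the limit of the normalising
    constants. *)
Lemma energy_cvg : exists2 Einf : R, 0 < Einf & energy t @[t --> +oo] --> Einf.
Proof.
have [t0 [m [M [t00 m0 M0 _ hE]]]] := energy_bounds.
pose G (x : R) := energy (Num.max t0 x) * expR (- (kap / Num.max t0 x)).
have maxp x : 0 < Num.max t0 x by rewrite lt_max t00.
have Gnd : {homo G : x y / x <= y}.
  move=> x y xy; have h : Num.max t0 x <= Num.max t0 y.
    by rewrite ge_max le_max lexx/= le_max xy orbT.
  by have [] := energy_exp_mono (maxp x) h.
have kx x : 0 <= kap / Num.max t0 x by rewrite divr_ge0 ?normr_ge0// ltW.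
have GM x : G x <= M.
  have /hE/andP[_ h] : t0 <= Num.max t0 x by rewrite le_max lexx.
  by apply: le_trans h; rewrite ler_piMr ?energy_ge0// -expR0 ler_expR oppr_le0.
have Gcvg : G x @[x --> +oo] --> sup (range G).
  apply: nondecreasing_cvgr => //.
  by exists M => _ [x _ <-].
have kcvg : expR (kap / x) @[x --> +oo] --> (1 : R).
  rewrite -expR0; apply: (@cvg_comp _ _ _ (fun x : R => kap / x) expR); last exact: continuous_expR.
  have h : kap / x @[x --> +oo] --> kap * (0 : R).
    apply: cvgMr; apply: (gtr0_cvgV0 _).2; last exact: cvg_id.
    exact: nbhs_pinfty_gt.
  by move: h; rewrite mulr0.
have cvgE : energy t @[t --> +oo] --> sup (range G).
  rewrite -[X in _ --> X]mulr1.
  apply: cvg_trans (cvgM Gcvg kcvg); apply: near_eq_cvg; near=> t.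
  have tt0 : Num.max t0 t = t.
    by apply: max_r; near: t; exact: (nbhs_pinfty_ge (num_real _)).
  by rewrite /= /G tt0 -mulrA -expRD addNr expR0 mulr1.
exists (sup (range G)) => //.
apply: (@lt_le_trans _ _ m) => //; apply: (cvgr_to_ge cvgE); near=> t.
have t0t : t0 <= t by near: t; exact: (nbhs_pinfty_ge (num_real _)).
by have /andP[] := hE t t0t.
Unshelve. all: by end_near. Qed.

(** The factor 1 + t merges boundedness near 0 with the behaviour t^(-b) at infinity; for nu < -1/2
    the bound allows growth. *)
Lemma phi_bound : exists2 C : R, 0 < C &
  forall t, 0 <= t -> `|phi nu t| <= C * (1 + t) `^ (- (nu + 1 / 2)).
Proof.
have [t0 [m [M [t00 m0 M0 _ hE]]]] := energy_bounds.
have [A [A0 hA]] := continuous_bounded_itv 0 t0 (continuous_phi nu1).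
pose K := 1 + t0 + t0^-1.
have K1 : 1 <= K by rewrite /K -addrA lerDl addr_ge0 ?invr_ge0// ltW.
have K0 : 0 < K by apply: lt_le_trans K1.
pose KK := K `^ `|- (nu + 1 / 2)|.
exists ((A + Num.sqrt M) * KK).
  by rewrite mulr_gt0 ?powR_gt0// ltr_pwDl// sqrtr_ge0.
move=> t t_ge0; have [tt0|/ltW tt0] := leP t t0.
  apply: (le_trans (hA t _)); first by rewrite t_ge0.
  rewrite -mulrA -[leLHS]mulr1; apply: ler_pM => //; first exact: ltW.
    by rewrite lerDl sqrtr_ge0.
  have t1 : 0 < 1 + t by lra.
  have := @powR_ratio _ K 1 (1 + t) (- (nu + 1 / 2)) K1 ltr01 t1.
  rewrite powR1; apply.
  - by rewrite -(mulr1 1) ler_pM//; lra.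
  - by rewrite mulr1 /K -addrA lerD2l (le_trans tt0)// lerDl invr_ge0 ltW.
have t_gt0 : 0 < t by apply: lt_le_trans tt0.
have wM : `|amp t| <= Num.sqrt M.
  rewrite -sqrtr_sqr ler_wsqrtr//; have /andP[_] := hE _ tt0.
  by apply: le_trans; rewrite lerDr sqr_ge0.
have -> : phi nu t = t `^ (- (nu + 1 / 2)) * amp t.
  by rewrite /amp mulrA powRN mulVf ?mul1r// gt_eqF// powR_gt0.
rewrite normrM ger0_norm ?powR_ge0// mulrC -mulrA.
apply: ler_pM; rewrite ?powR_ge0//.
  by apply: (le_trans wM); rewrite lerDr ltW.
apply: powR_ratio => //; first by lra.
- by rewrite -(mul1r t) ler_pM//; lra.
- rewrite /K !mulrDl mul1r; have : 1 <= t0^-1 * t by rewrite mulrC ler_pdivlMr// mul1r.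
  by have h2 : 0 <= t0 * t; [rewrite mulr_ge0// ltW|move=> h1; lra].
Qed.

(** At a zero of phi the energy is w'^2 = t^(2 nu + 1) phi'^2, so the energy bounds become bounds on
    phi'. For the separation: w' vanishes somewhere between two zeros, starts with modulus at least
    sqrt m, and |w''| <= K, so it needs a length sqrt m / K to reach 0. *)
Lemma phi_zeros : exists t0 m M h, [/\ 0 < t0, 0 < m, 0 < M & 0 < h] /\
  (forall t, 0 < t -> phi nu t = 0 ->
    t0 <= t /\ m <= t `^ (2 * nu + 1) * Dphi t ^+ 2 <= M) /\
  (forall t u, 0 < t -> t < u -> phi nu t = 0 -> phi nu u = 0 -> h <= u - t).
Proof.
have [t0 [m [M [t00 m0 M0 hphi hE]]]] := energy_bounds.
pose K := (1 + kap / t0 ^+ 2) * Num.sqrt M.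
have K0 : 0 < K.
  by rewrite mulr_gt0 ?sqrtr_gt0// ltr_pwDl// divr_ge0 ?normr_ge0 ?sqr_ge0.
have zt t : 0 < t -> phi nu t = 0 -> t0 <= t.
  move=> tp zt; rewrite leNgt; apply/negP => tt0.
  have := hphi t; rewrite zt (ltW tp) (ltW tt0) => /(_ isT).
  by rewrite ltNge invr_ge0 ler0n.
have zE t : 0 < t -> phi nu t = 0 -> energy t = t `^ (2 * nu + 1) * Dphi t ^+ 2.
  move=> tp zt'; rewrite /energy /damp /amp zt' !mulr0 addr0 expr0n/= addr0.
  rewrite exprMn -(powR_mulrn 2 (powR_ge0 t (nu + 1 / 2))) -powRrM.
  by congr (_ `^ _ * _); lra.
exists t0, m, M, (Num.sqrt m / K); split; [|split].
- by split => //; rewrite divr_gt0// sqrtr_gt0.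
- by move=> t tp tz; rewrite zt//; split => //; rewrite -zE//; apply: hE; exact: zt.
- move=> t u tp tu tz uz; have tt0 := zt _ tp tz.
  have pos x : t <= x -> 0 < x by apply: lt_le_trans.
  have [c /andP[tc cu] e] : exists2 c, t <= c <= u & amp u - amp t = damp c * (u - t).
    apply: (MVT_le (ltW tu)) => x /andP[tx _]; apply: is_derive_amp; exact: pos.
  move: e; rewrite /amp tz uz !mulr0 subrr => /esym/eqP.
  rewrite mulf_eq0 subr_eq0 (gt_eqF tu) orbF => /eqP c0.
  have [d /andP[td dc] e] : exists2 d, t <= d <= c & damp c - damp t =
      (- amp d + (b ^+ 2 - b) / d ^+ 2 * amp d) * (c - t).
    apply: (MVT_le tc) => x /andP[tx _]; apply: is_derive_damp; exact: pos.
  have d0 : 0 < d by exact: pos.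
  have t0d : t0 <= d by apply: le_trans td.
  have ad : `|amp d| <= Num.sqrt M.
    rewrite -sqrtr_sqr ler_wsqrtr//; have /andP[_] := hE _ t0d.
    by apply: le_trans; rewrite lerDr sqr_ge0.
  have hd : `|damp t| <= K * (c - t).
    rewrite -normrN -sub0r -c0 e normrM (ger0_norm (_ : 0 <= c - t)) ?subr_ge0//.
    rewrite ler_wpM2r ?subr_ge0//.
    rewrite -mulN1r -mulrDl normrM; apply: ler_pM => //.
    apply: (le_trans (ler_normD _ _)); rewrite normrN1 lerD2l normrM normfV -/kap.
    rewrite (ger0_norm (sqr_ge0 d)) ler_wpM2l ?normr_ge0// lef_pV2 ?posrE ?exprn_gt0//.
    by rewrite lerXn2r ?nnegrE// ltW.
  rewrite ler_pdivrMr// mulrC.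
  apply: (@le_trans _ _ (K * (c - t))); last first.
    by rewrite ler_pM2l//; lra.
  apply: le_trans hd; rewrite -sqrtr_sqr ler_wsqrtr//.
  have /andP[h _] := hE _ tt0; move: h.
  by rewrite /energy {1}/amp tz mulr0 expr0n/= addr0.
Qed.

End Energy.

(** * Translation between J_nu and its normalised form *)

Section BesselLink.
Variable R : realType.
Implicit Types (nu x : R) (s : nat -> R).

Lemma Gamma_poch nu k : -1 < nu ->
  Gamma (k%:R + nu + 1) = poch (nu + 1) k * Gamma (nu + 1).
Proof.
move=> nu1; elim: k => [|k IHk]; first by rewrite add0r /poch big_ord0 mul1r.
have k0 : 0 <= k%:R :> R by [].
have -> : k.+1%:R + nu + 1 = (k%:R + nu + 1) + 1 :> R by rewrite -natr1; ring.
rewrite (@Gamma_rec _ (k%:R + nu + 1)); last by rewrite -addrA ltr_wpDl//; clear -nu1; lra.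
by rewrite IHk pochSr; ring.
Qed.

Lemma besselJE nu x : -1 < nu -> 0 < x ->
  besselJ nu x = (x / 2) `^ nu / Gamma (nu + 1) * phi nu x.
Proof.
move=> nu1 x0; apply/cvg_lim => //.
have G0 : 0 < Gamma (nu + 1) by apply: Gamma_gt0; lra.
have x20 : 0 < x / 2 by rewrite divr_gt0.
rewrite (_ : series _ = (fun n => (x / 2) `^ nu / Gamma (nu + 1) * pseries (bcoef nu) (x ^+ 2) n)).
  by apply: cvgMr; exact: is_cvg_bseries.
rewrite -pseriesZ; apply/funext => n; rewrite /pseries /series/=; apply: eq_bigr => k _.
rewrite Gamma_poch// /bcoef.
have p0 : 0 < poch (nu + 1) k by apply: poch_gt0; lra.
have k0 : 0 < k`!%:R :> R by rewrite ltr0n fact_gt0.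
have -> : (x / 2) `^ (2 * k%:R + nu) = (x / 2) `^ nu * 4^-1 ^+ k * (x ^+ 2) ^+ k.
  rewrite addrC powRD ?(gt_eqF x20)/= ?implybT// -mulrA; congr (_ * _).
  rewrite powRrM powR_mulrn ?powR_ge0// -exprMn; congr (_ ^+ _).
  by rewrite (powR_mulrn 2 (ltW x20)); field.
have -> : (- 4^-1) ^+ k = (-1) ^+ k * 4^-1 ^+ k :> R by rewrite -exprMn mulN1r.
by field; rewrite !gt_eqF.
Qed.

Lemma besselJ_eq0 nu x : -1 < nu -> 0 < x -> besselJ nu x = 0 -> phi nu x = 0.
Proof.
move=> nu1 x0; rewrite besselJE// => /eqP; rewrite mulf_eq0 => /orP[|/eqP//].
have G0 : 0 < Gamma (nu + 1) by apply: Gamma_gt0; lra.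
by rewrite gt_eqF// divr_gt0// powR_gt0// divr_gt0.
Qed.

(** What the constant of [psi] becomes in terms of phi: powers of s_j and Gamma factors cancel,
    because phi' is a multiple of x phi_(nu+1). At a zero t it normalises phi(t x), see
    [ip_esc_eq]. *)
Definition ncoef nu (t : R) : R := Num.sqrt 2 / `|Dphi nu t|.

Lemma psiE nu s j x : -1 < nu -> (forall j, 0 < s j) -> 0 < x ->
  psi nu s j x = ncoef nu (s j) * phi nu (s j * x).
Proof.
move=> nu1 s0 x0; have sj := s0 j; have nu2 : -1 < nu + 1 by lra.
rewrite /psi (besselJE nu2 sj) (besselJE nu1 (mulr_gt0 sj x0)).
have G0 : 0 < Gamma (nu + 1) by apply: Gamma_gt0; lra.
have G1 : Gamma (nu + 1 + 1) = (nu + 1) * Gamma (nu + 1) by apply: Gamma_rec; lra.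
rewrite G1 /ncoef /Dphi.
have -> : (s j / 2) `^ (nu + 1) = (s j / 2) `^ nu * (s j / 2).
  rewrite powRD ?powRr1 ?divr_ge0 ?ltW//.
  by rewrite (gt_eqF (divr_gt0 sj _))//= implybT.
have -> : (s j * x / 2) `^ nu = (s j / 2) `^ nu * x `^ nu.
  by rewrite mulrAC (powRM _ (divr_ge0 (ltW sj) (ler0n R 2)) (ltW x0)).
rewrite powRN !normrM normrN !normrM !normfV !normrM.
have p0 : 0 < (s j / 2) `^ nu by rewrite powR_gt0// divr_gt0.
have x1 : 0 < x `^ nu by rewrite powR_gt0.
have nu10 : 0 < nu + 1 by clear -nu1; lra.
rewrite !(gtr0_norm p0, gtr0_norm G0, gtr0_norm nu10, gtr0_norm sj, ger0_norm (ler0n _ _)).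
have [->|f0] := eqVneq (`|phi (nu + 1) (s j)|) 0; first by rewrite !(mulr0, invr0, mul0r).
by field; rewrite f0 !gt_eqF.
Qed.

End BesselLink.

(** * Fourier-Bessel expansions *)

Section Radial.
Variables (R : realType) (nu : R).
Hypothesis nu1 : -1 < nu.
Notation mu := (@lebesgue_measure R).
Notation q := (2 * nu + 2).
Implicit Types (f g h e d : R -> R) (x t : R).

Let q0 : 0 < q. Proof. by move: nu1 => h; lra. Qed.

Definition wgt (x : R) : R := x `^ (2 * nu + 1).

Lemma wgtE x : wgt x = x `^ (q - 1).
Proof. by rewrite /wgt; congr (_ `^ _); lra. Qed.

Lemma wgt_ge0 x : 0 <= wgt x. Proof. exact: powR_ge0. Qed.

Lemma wgt_gt0 x : 0 < x -> 0 < wgt x. Proof. exact: powR_gt0. Qed.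

Lemma measurable_wgt (D : set R) : measurable_fun D wgt.
Proof. by apply: measurable_funTS; exact: measurable_powR. Qed.

Lemma integrable_wgt_continuous f : continuous f ->
  mu.-integrable (`]0, 1[ : set R) (EFin \o (fun x => f x * wgt x)).
Proof.
move=> cf; have := integrable_continuous_weight q0 cf.
by apply: eq_integrable => // x _; rewrite /= wgtE.
Qed.

Lemma integrable_wgt_bounded f : measurable_fun (`]0, 1[ : set R) f ->
  (exists C, forall x, 0 < x < 1 -> `|f x| <= C) ->
  mu.-integrable (`]0, 1[ : set R) (EFin \o (fun x => f x * wgt x)).
Proof.
move=> mf hf; have := integrable_bounded_weight q0 mf hf.
by apply: eq_integrable => // x _; rewrite /= wgtE.
Qed.

Definition wint f : R := \int[mu]_(x in `]0, 1[) (f x * wgt x).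

Lemma wintD f g : continuous f -> continuous g ->
  wint (fun x => f x + g x) = wint f + wint g.
Proof.
move=> cf cg; rewrite /wint -RintegralD//; try exact: integrable_wgt_continuous.
by apply: eq_Rintegral => x _; rewrite mulrDl.
Qed.

Lemma wintZ k f : continuous f -> wint (fun x => k * f x) = k * wint f.
Proof.
move=> cf; rewrite /wint -RintegralZl//; try exact: integrable_wgt_continuous.
by apply: eq_Rintegral => x _; rewrite mulrA.
Qed.

Lemma wintN f : continuous f -> wint (fun x => - f x) = - wint f.
Proof.
move=> cf; rewrite -mulN1r -wintZ//; congr wint.
by apply/funext => x; rewrite mulN1r.
Qed.

Lemma wintB f g : continuous f -> continuous g ->
  wint (fun x => f x - g x) = wint f - wint g.
Proof. by move=> cf cg; rewrite wintD ?wintN//; exact: cN. Qed.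

Lemma wint_sum n (F : 'I_n -> R -> R) : (forall i, continuous (F i)) ->
  wint (fun x => \sum_(i < n) F i x) = \sum_(i < n) wint (F i).
Proof.
move=> cF; rewrite /wint -Rintegral_sum//; last by move=> i; exact: integrable_wgt_continuous.
by apply: eq_Rintegral => x _; rewrite mulr_suml.
Qed.

Lemma eq_wint f g : (forall x, 0 < x < 1 -> f x = g x) -> wint f = wint g.
Proof.
by move=> fg; apply: eq_Rintegral => x; rewrite inE/= in_itv/= => x01; rewrite fg.
Qed.

Lemma le_wint f g : continuous f -> continuous g ->
  (forall x, 0 < x < 1 -> f x <= g x) -> wint f <= wint g.
Proof.
move=> cf cg fg; apply: le_Rintegral => //; try exact: integrable_wgt_continuous.
by move=> x /=; rewrite in_itv/= => x01; rewrite ler_wpM2r ?wgt_ge0// fg.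
Qed.

Lemma wint_ge0 f : (forall x, 0 < x < 1 -> 0 <= f x) -> 0 <= wint f.
Proof.
move=> f0; apply: Rintegral_ge0 => x /=; rewrite in_itv/= => x01.
by rewrite mulr_ge0 ?f0 ?wgt_ge0.
Qed.

Lemma norm_wint_le f g : continuous f -> continuous g ->
  (forall x, 0 < x < 1 -> `|f x| <= g x) -> `|wint f| <= wint g.
Proof.
move=> cf cg fg; rewrite ler_norml -wintN//; apply/andP; split; apply: le_wint => //.
- exact: cN.
- by move=> x /fg; rewrite ler_norml => /andP[].
- by move=> x /fg; rewrite ler_norml => /andP[].
Qed.

Definition ip f g : R := wint (fun x => f x * g x).

Lemma ipC f g : ip f g = ip g f.
Proof. by rewrite /ip; congr wint; apply/funext => x; rewrite mulrC. Qed.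

Lemma ip_ge0 f : 0 <= ip f f.
Proof. by apply: wint_ge0 => x _; rewrite -expr2 sqr_ge0. Qed.

Lemma ipDl f g h : continuous f -> continuous g -> continuous h ->
  ip (fun x => f x + g x) h = ip f h + ip g h.
Proof.
move=> cf cg ch; rewrite /ip -wintD; try exact: cM.
by congr wint; apply/funext => x; rewrite mulrDl.
Qed.

Lemma ipZl k f g : continuous f -> continuous g ->
  ip (fun x => k * f x) g = k * ip f g.
Proof.
move=> cf cg; rewrite /ip -wintZ; try exact: cM.
by congr wint; apply/funext => x; rewrite mulrA.
Qed.

Lemma ipBl f g h : continuous f -> continuous g -> continuous h ->
  ip (fun x => f x - g x) h = ip f h - ip g h.
Proof.
move=> cf cg ch; rewrite /ip -wintB; try exact: cM.
by congr wint; apply/funext => x; rewrite mulrBl.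
Qed.

Lemma ip_suml n (F : 'I_n -> R -> R) g : (forall i, continuous (F i)) -> continuous g ->
  ip (fun x => \sum_(i < n) F i x) g = \sum_(i < n) ip (F i) g.
Proof.
move=> cF cg; rewrite /ip -wint_sum; last by move=> i; exact: cM.
by congr wint; apply/funext => x; rewrite mulr_suml.
Qed.

Lemma ip_CS f g : continuous f -> continuous g -> ip f g ^+ 2 <= ip f f * ip g g.
Proof.
move=> cf cg.
have key t : 0 <= ip g g * t ^+ 2 - 2 * ip f g * t + ip f f.
  have := ip_ge0 (fun x => f x - t * g x).
  have ctg : continuous (fun x => t * g x) by apply: cM => //; exact: ccst.
  rewrite ipBl//; last exact: cB.
  rewrite (ipC f) (ipC (fun x => t * g x)) !ipBl// ipZl// (ipC f) !ipZl// (ipC g (fun x => t * g x)) ipZl//.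
  by rewrite (ipC g f) => h; apply: le_trans h _; rewrite le_eqVlt; apply/orP; left; apply/eqP; ring.
have [g0|g0] := eqVneq (ip g g) 0.
  (* When g has norm 0 the polynomial in t is affine, and at this t it takes the value -1 unless
     [ip f g] vanishes. *)
  have h1 := key ((ip f f + 1) / (2 * ip f g)).
  have [->|fg0] := eqVneq (ip f g) 0; first by rewrite expr0n/= mulr_ge0// ip_ge0.
  move: h1; rewrite g0 mul0r add0r.
  rewrite (_ : 2 * ip f g * ((ip f f + 1) / (2 * ip f g)) = ip f f + 1); last by field.
  by move=> h; exfalso; lra.
have gp : 0 < ip g g by rewrite lt_def g0 ip_ge0.
have := key (ip f g / ip g g).
rewrite (_ : _ + ip f f = (ip f f * ip g g - ip f g ^+ 2) / ip g g); last by field.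
by rewrite pmulr_lge0 ?invr_gt0// subr_ge0.
Qed.

(* f is even, e = f'/x, and h = - f'' - (2 nu + 1)/x f' is the image of f under the Bessel operator. *)
Definition radial f e h : Prop :=
  [/\ forall x, is_derive x 1 f (x * e x),
      exists e', (forall x, is_derive x 1 e (e' x)) /\ (forall x, x * e' x = - h x - q * e x) &
      continuous h].

Lemma radial_continuous f e h : radial f e h -> continuous f /\ continuous e /\ continuous h.
Proof.
move=> [df [e' [de _]] ch]; split; first exact: is_derive_continuous df.
by split => //; exact: is_derive_continuous de.
Qed.

(** Green's formula: [divergence01] applied to [e * g], whose boundary value at 1 contains the
    factor [g 1]. Working with e = f'/x avoids every division by x at the origin. *)
Lemma radial_green f e h g d k : radial f e h -> radial g d k -> g 1 = 0 ->
  ip h g = wint (fun x => x ^+ 2 * e x * d x).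
Proof.
move=> rf rg g1; have [cf [ce ch]] := radial_continuous rf.
have [cg [cd ck]] := radial_continuous rg.
have [df [e' [de he]] _] := rf; have [dg _ _] := rg.
have dH x : is_derive x 1 (fun y => e y * g y) (e' x * g x + e x * (x * d x)) := dM (de x) (dg x).
have cxH : continuous (fun x => x * (e' x * g x + e x * (x * d x))).
  rewrite (_ : (fun x => _) = (fun x => (- h x - q * e x) * g x + x ^+ 2 * e x * d x)).
    apply: cD; apply: cM => //; last by apply: cM => //; apply: cX; exact: cid.
    by apply: cB; [exact: cN|apply: cM => //; exact: ccst].
  by apply/funext => x; rewrite -he; ring.
have := divergence01 q0 dH cxH; rewrite g1 mulr0.
rewrite (_ : \int[mu]_(x in _) _ = wint (fun x => x ^+ 2 * e x * d x - h x * g x)).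
  rewrite wintB; [|by apply: cM => //; apply: cM => //; apply: cX; exact: cid|exact: cM].
  by move/eqP; rewrite subr_eq0 => /eqP ->.
apply: eq_Rintegral => x _; rewrite wgtE; congr (_ * _).
rewrite (_ : x * _ = (x * e' x) * g x + x ^+ 2 * e x * d x); last by ring.
by rewrite he; ring.
Qed.

Lemma radialD f e h g d k : radial f e h -> radial g d k ->
  radial (fun x => f x + g x) (fun x => e x + d x) (fun x => h x + k x).
Proof.
move=> [df [e' [de he]] ch] [dg [d' [dd hd]] ck]; split.
- by move=> x; apply: dE (dD (df x) (dg x)) _; rewrite mulrDr.
- exists (fun x => e' x + d' x); split; first by move=> x; exact: dD.
  by move=> x; rewrite mulrDr he hd; ring.
- exact: cD.
Qed.

Lemma radialZ c f e h : radial f e h ->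
  radial (fun x => c * f x) (fun x => c * e x) (fun x => c * h x).
Proof.
move=> [df [e' [de he]] ch]; split.
- by move=> x; apply: dE (dZ c (df x)) _; rewrite mulrCA.
- exists (fun x => c * e' x); split; first by move=> x; exact: dZ.
  by move=> x; rewrite mulrCA he; ring.
- by apply: cM => //; exact: ccst.
Qed.

Lemma radialB f e h g d k : radial f e h -> radial g d k ->
  radial (fun x => f x - g x) (fun x => e x - d x) (fun x => h x - k x).
Proof.
move=> rf rg; have := radialD rf (radialZ (-1) rg).
by congr radial; apply/funext => x; rewrite mulN1r.
Qed.

Lemma radial0 : radial (fun=> 0) (fun=> 0) (fun=> 0).
Proof.
split; last exact: ccst.
- by move=> x; rewrite mulr0; exact: dcst.
- exists (fun=> 0); split; first by move=> x; exact: dcst.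
  by move=> x; rewrite !mulr0 subr0 oppr0.
Qed.

Lemma radial_sum n (F E H : 'I_n -> R -> R) : (forall i, radial (F i) (E i) (H i)) ->
  radial (fun x => \sum_(i < n) F i x) (fun x => \sum_(i < n) E i x) (fun x => \sum_(i < n) H i x).
Proof.
elim: n F E H => [|n IHn] F E H r.
  by have := radial0; congr radial; apply/funext => x; rewrite big_ord0.
have := radialD (IHn _ _ _ (fun i => r (widen_ord (leqnSn n) i))) (r ord_max).
by congr radial; apply/funext => x; rewrite big_ord_recr.
Qed.

Definition esc (t x : R) : R := phi nu (t * x).
Definition esc' (t x : R) : R := - (t ^+ 2 / q) * phi (nu + 1) (t * x).

Lemma radial_esc t : radial (esc t) (esc' t) (fun x => t ^+ 2 * esc t x).
Proof.
have hnu := nu1; have nu2 : -1 < nu + 1 by lra.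
have dt x : is_derive x 1 (fun y => t * y) t by apply: dE (dZ t (did x)) _; rewrite mulr1.
split.
- move=> x; apply: dE (dcomp (dt x) (dphi (t * x) nu1)) _; rewrite /esc'.
  by field; rewrite !gt_eqF//; lra.
- exists (fun x => - (t ^+ 2 / q) * (- (t * x / (2 * (nu + 1 + 1))) * phi (nu + 1 + 1) (t * x) * t)).
  split; first by move=> x; apply: dZ; exact: dcomp (dt x) (dphi (t * x) nu2).
  move=> x; rewrite /esc /esc' (phi_contiguous (t * x) nu1).
  rewrite (_ : nu + 1 + 1 = nu + 2); last by lra.
  by field; rewrite !gt_eqF//; lra.
- apply: cM; first exact: ccst.
  apply: (@ccomp _ (phi nu) (fun x => t * x)); first exact: continuous_phi.
  by apply: cM; [exact: ccst|exact: cid].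
Qed.

Lemma ip_esc_neq t u : t ^+ 2 != u ^+ 2 -> phi nu t = 0 -> phi nu u = 0 ->
  ip (esc t) (esc u) = 0.
Proof.
move=> tu zt zu; have rt := radial_esc t; have ru := radial_esc u.
have [ct _] := radial_continuous rt; have [cu _] := radial_continuous ru.
have e1 := radial_green rt ru; have e2 := radial_green ru rt.
rewrite /esc !mulr1 in e1 e2; have := e1 zu; have := e2 zt.
rewrite !ipZl// => h2 h1.
have : t ^+ 2 * ip (esc t) (esc u) = u ^+ 2 * ip (esc t) (esc u).
  rewrite [in RHS]ipC [LHS]h1 [RHS]h2; congr wint; apply/funext => x; ring.
move/eqP; rewrite -subr_eq0 -mulrBl mulf_eq0 subr_eq0 (negbTE tu)/=.
by move/eqP.
Qed.

Lemma ip_esc_eq t : 0 < t -> phi nu t = 0 -> ip (esc t) (esc t) = Dphi nu t ^+ 2 / 2.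
Proof.
move=> t0 zt; have tn0 : t != 0 by rewrite gt_eqF.
have [cf [ce ch]] := radial_continuous (radial_esc t).
have [df [e' [de he]] _] := radial_esc t.
pose f := esc t; pose e := esc' t.
(* Lommel's integral: this quadratic form in f and f'/x is chosen so that q H + x H' = f^2, and
   [divergence01] then evaluates the norm by the value at 1, where f vanishes. *)
pose H x := 2^-1 * ((x * e x) ^+ 2 / t ^+ 2 + f x ^+ 2) + nu / t ^+ 2 * (f x * e x).
pose H' x := 2^-1 * ((2%:R * (x * e x) ^+ 1 * (1 * e x + x * e' x)) * (t ^+ 2)^-1 + 2%:R * f x ^+ 1 * (x * e x)) +
   nu / t ^+ 2 * ((x * e x) * e x + f x * e' x).
have dH x : is_derive x 1 H (H' x).
  apply: dD.
    apply: dZ; apply: dD; last exact: (dX 2 (df x)).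
    apply: dE (dM (dX 2 (dM (did x) (de x))) (dcst _ x)) _.
    by rewrite /= mulr0 addr0.
  by apply: dZ; exact: dM (df x) (de x).
have key x : q * H x + x * H' x = f x ^+ 2.
  have -> : x * H' x = (x * e x) / t ^+ 2 * (x * e x + x * (x * e' x)) + x ^+ 2 * f x * e x +
     nu / t ^+ 2 * ((x * e x) ^+ 2 + f x * (x * e' x)).
    by rewrite /H'; field.
  rewrite he /H -/f -/e -/(f x).
  by field.
have cx : continuous (fun x => x * H' x).
  rewrite (_ : (fun x => _) = (fun x => f x ^+ 2 - q * H x)); last first.
    by apply/funext => x; rewrite -key addrC addKr.
  apply: cB; first by apply: cX.
  by apply: cM; [exact: ccst|exact: is_derive_continuous dH].
have := divergence01 q0 dH cx.
rewrite (_ : \int[mu]_(x in _) _ = ip f f); last first.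
  by apply: eq_Rintegral => x _; rewrite key wgtE expr2.
move=> ->; rewrite /H /f /e /esc /esc' /Dphi !mulr1 !mul1r zt.
by move: nu1 => hnu; field; rewrite tn0 !gt_eqF//; lra.
Qed.

End Radial.

(** * The orthonormal eigenfunctions and the separation of the frequencies *)

Section Zeros.
Variables (R : realType) (nu : R) (s : nat -> R).
Hypothesis nu1 : -1 < nu.
Hypothesis hs : bessel_zeros nu s.
Notation b := (nu + 1 / 2).
Implicit Types (x t : R) (i j N : nat).

Lemma s_gt0 j : 0 < s j. Proof. by have [] := hs. Qed.

Lemma phi_s j : phi nu (s j) = 0.
Proof. by apply: besselJ_eq0 => //; [exact: s_gt0|have [_ []] := hs]. Qed.

Lemma s_lt i j : (i < j)%N -> s i < s j.
Proof. by have [_ [_ [+ _]]] := hs; apply. Qed.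

Lemma s_le i j : (i <= j)%N -> s i <= s j.
Proof. by rewrite leq_eqVlt => /predU1P[->//|/s_lt/ltW]. Qed.

Lemma s_exhaust x : 0 < x -> phi nu x = 0 -> exists j, s j = x.
Proof.
move=> x0 zx; have [_ [_ [_ h]]] := hs; apply: h => //.
by rewrite besselJE// zx mulr0.
Qed.

(** Agrees with [psi] for x > 0 but has no factor x^(-nu), so it is continuous on the whole line and
    has a value at 0. *)
Definition ev j x : R := ncoef nu (s j) * esc nu (s j) x.
Definition ev' j x : R := ncoef nu (s j) * esc' nu (s j) x.

Lemma evE j x : ev j x = ncoef nu (s j) * phi nu (s j * x). Proof. by []. Qed.

Lemma radial_ev j : radial nu (ev j) (ev' j) (fun x => s j ^+ 2 * ev j x).
Proof.
have := radialZ (ncoef nu (s j)) (radial_esc nu1 (s j)).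
by congr radial; apply/funext => x; rewrite /ev mulrCA.
Qed.

Lemma continuous_ev j : continuous (ev j).
Proof. by have [] := radial_continuous (radial_ev j). Qed.

Lemma ev_1 j : ev j 1 = 0.
Proof. by rewrite /ev /esc mulr1 phi_s mulr0. Qed.

Lemma psi_ev j x : 0 < x -> psi nu s j x = ev j x.
Proof. by move=> x0; rewrite psiE//; exact: s_gt0. Qed.

Lemma Dphi_s_neq0 j : Dphi nu (s j) != 0.
Proof.
have [t0 [m [M [h [[t00 m0 _ _] [hz _]]]]]] := phi_zeros nu1.
have [_ /andP[hm _]] := hz _ (s_gt0 j) (phi_s j).
apply/eqP => h0; move: hm; rewrite h0 expr0n/= mulr0 leNgt.
by rewrite m0.
Qed.

Lemma ncoef_gt0 j : 0 < ncoef nu (s j).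
Proof. by rewrite divr_gt0 ?sqrtr_gt0// normr_gt0 Dphi_s_neq0. Qed.

Lemma ip_ev i j : ip nu (ev i) (ev j) = (i == j)%:R.
Proof.
have c t : continuous (esc nu t) by have [] := radial_continuous (radial_esc nu1 t).
rewrite /ev ipZl//; last by apply: cM => //; exact: ccst.
rewrite ipC ipZl//.
have [<-|ij] := eqVneq i j.
  rewrite ip_esc_eq ?phi_s ?s_gt0// /ncoef.
  have D0 := Dphi_s_neq0 i.
  have e : `|Dphi nu (s i)| ^+ 2 = Dphi nu (s i) ^+ 2 by rewrite real_normK// num_real.
  rewrite -e mulrCA mulrA -expr2 exprMn exprVn sqr_sqrtr//.
  have n0 : `|Dphi nu (s i)| != 0 by rewrite normr_eq0.
  by rewrite (_ : true%:R = 1)//; field.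
rewrite ip_esc_neq ?phi_s// ?mulr0//.
rewrite eqf_sqr negb_or; apply/andP; split.
  by apply/eqP => e; move: ij; rewrite neq_ltn => /orP[] /s_lt; rewrite e ltxx.
by rewrite gt_eqF// (lt_trans _ (s_gt0 _))// oppr_lt0 s_gt0.
Qed.

Lemma ncoef_bounds : exists2 C : R, 0 < C &
  forall j, ncoef nu (s j) <= C * s j `^ b /\ s j `^ b <= C * ncoef nu (s j).
Proof.
have [t0 [m [M [h [[t00 m0 M0 _] [hz _]]]]]] := phi_zeros nu1.
exists (Num.sqrt 2 / Num.sqrt m + Num.sqrt M / Num.sqrt 2).
  by rewrite addr_gt0// divr_gt0// sqrtr_gt0.
move=> j; have [_ /andP[h1 h2]] := hz _ (s_gt0 j) (phi_s j).
have s2 : 0 < Num.sqrt 2 :> R by rewrite sqrtr_gt0.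
have sm : 0 < Num.sqrt m by rewrite sqrtr_gt0.
have sM : 0 < Num.sqrt M by rewrite sqrtr_gt0.
have D0 : 0 < `|Dphi nu (s j)| by rewrite normr_gt0 Dphi_s_neq0.
have p0 : 0 < s j `^ b by rewrite powR_gt0// s_gt0.
have e : s j `^ (2 * nu + 1) * Dphi nu (s j) ^+ 2 = (s j `^ b * `|Dphi nu (s j)|) ^+ 2.
  rewrite [in RHS]exprMn real_normK ?num_real// -(powR_mulrn 2 (powR_ge0 _ _)) -powRrM.
  by congr (_ `^ _ * _); lra.
have y0 : 0 <= s j `^ b * `|Dphi nu (s j)| by rewrite mulr_ge0// ltW.
have k1 : Num.sqrt m <= s j `^ b * `|Dphi nu (s j)|.
  by rewrite -(ger0_norm y0) -sqrtr_sqr -e ler_wsqrtr.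
have k2 : s j `^ b * `|Dphi nu (s j)| <= Num.sqrt M.
  by rewrite -(ger0_norm y0) -sqrtr_sqr -e ler_wsqrtr.
have P : 0 <= Num.sqrt 2 / Num.sqrt m * s j `^ b by rewrite !mulr_ge0 ?invr_ge0 ?ltW.
split.
  rewrite mulrDl; apply: (@le_trans _ _ (Num.sqrt 2 / Num.sqrt m * s j `^ b)).
    rewrite /ncoef -mulrA ler_pM2l// mulrC ler_pdivlMr// mulrC ler_pdivrMr//.
  by rewrite lerDl !mulr_ge0 ?invr_ge0// ltW.
rewrite mulrDl; apply: (@le_trans _ _ (Num.sqrt M / Num.sqrt 2 * ncoef nu (s j))).
  rewrite /ncoef (_ : _ * _ = Num.sqrt M / `|Dphi nu (s j)|); last by field; rewrite !gt_eqF.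
  by rewrite ler_pdivlMr.
by rewrite lerDr !mulr_ge0 ?invr_ge0// ltW// ?ncoef_gt0.
Qed.

(** The normalisation has size s_j^b and phi(s_j x) is O((1 + s_j x)^(-b)); the two combine because
    x + 1/s_j = (1 + s_j x)/s_j. *)
Lemma ev_bound : exists2 C : R, 0 < C &
  forall j x, 0 <= x -> `|ev j x| <= C * (x + (s j)^-1) `^ (- b).
Proof.
have [C C0 hC] := ncoef_bounds; have [D D0 hD] := phi_bound nu1.
exists (C * D); first by rewrite mulr_gt0.
move=> j x x0; have sj := s_gt0 j; have [h1 _] := hC j.
rewrite /ev /esc normrM (gtr0_norm (ncoef_gt0 j)).
have sx0 : 0 <= s j * x by rewrite mulr_ge0// ltW.
apply: (@le_trans _ _ (C * s j `^ b * (D * (1 + s j * x) `^ (- b)))).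
  by apply: ler_pM => //; [exact/ltW/ncoef_gt0|exact: hD].
have -> : x + (s j)^-1 = (1 + s j * x) * (s j)^-1 by field; rewrite gt_eqF.
rewrite powRM; [|by rewrite addr_ge0|by rewrite invr_ge0 ltW].
have -> : (s j)^-1 `^ (- b) = s j `^ b.
  by rewrite -(powR_inv1 (ltW sj)) -powRrM mulN1r opprK.
by rewrite le_eqVlt; apply/orP; left; apply/eqP; ring.
Qed.

Lemma s_sep : exists2 h : R, 0 < h &
  (forall j, h * j.+1%:R <= s j) /\ forall i j, (i <= j)%N -> h * (j - i)%N%:R <= s j - s i.
Proof.
have [t0 [m [M [h [[t00 _ _ h0] [hz hsep]]]]]] := phi_zeros nu1.
have st j : h <= s j.+1 - s j.
  by apply: hsep; rewrite ?s_gt0 ?phi_s// s_lt.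
have h1 i j : (i <= j)%N -> h * (j - i)%N%:R <= s j - s i.
  move=> /subnKC <-; rewrite addKn; elim: (j - i)%N => [|k IHk].
    by rewrite mulr0 addn0 subrr.
  by rewrite addnS -natr1 mulrDr mulr1; have := st (i + k)%N; lra.
have m0 : 0 < Num.min h t0 by rewrite lt_min h0.
exists (Num.min h t0) => //; split.
- move=> j; have := h1 0%N j isT; rewrite subn0 => h2.
  have [h3 _] := hz _ (s_gt0 0) (phi_s 0).
  have : Num.min h t0 * j%:R <= h * j%:R by rewrite ler_wpM2r// ge_min lexx.
  have : Num.min h t0 <= t0 by rewrite ge_min lexx orbT.
  by rewrite -natr1 mulrDr mulr1; lra.
- move=> i j ij; apply: le_trans (h1 i j ij); rewrite ler_wpM2r// ge_min lexx//.
Qed.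

End Zeros.

Section Shrink.
Variable R : realType.
Notation mu := (@lebesgue_measure R).

(** Prepared for Picone's identity, where the derivative f is singular at the end points: only its
    majorant P has to be integrable, and F enters through one-sided limits instead of values. *)
Lemma FTC_oo_ge (P F f : R -> R) (a b A B : R) : a < b ->
  (forall x, a < x < b -> is_derive x 1 F (f x)) ->
  {in `]a, b[, continuous f} -> {in `]a, b[, continuous P} ->
  (forall x, a < x < b -> f x <= P x) ->
  F x @[x --> a^'+] --> A -> F x @[x --> b^'-] --> B ->
  mu.-integrable `]a, b[ (EFin \o P) ->
  B - A <= \int[mu]_(x in `]a, b[) P x.
Proof.
move=> ab dF cf cP fP FA FB iP.
pose I n : set R := `[a + (b - a) / n.+3%:R, b - (b - a) / n.+3%:R]%classic.
have ba : 0 < b - a by rewrite subr_gt0.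
have I_lt n : [/\ a < a + (b - a) / n.+3%:R, b - (b - a) / n.+3%:R < b &
    a + (b - a) / n.+3%:R <= b - (b - a) / n.+3%:R].
  have h : 0 < (b - a) / n.+3%:R by rewrite divr_gt0.
  have : (b - a) / n.+3%:R <= (b - a) / 2.
    by rewrite ler_pM2l// lef_pV2 ?posrE// ler_nat.
  by move: h; set e := _ / n.+3%:R => h h'; split; lra.
have sub n : I n `<=` `]a, b[%classic.
  by rewrite (exhaust_oo ab) => x hx; exists n.
have mP : measurable_fun `]a, b[ P by exact: measurable_oo_continuous.
have [|||||_ _] := @dominated_convergence _ _ R mu `]a, b[%classic (measurable_itv _)
   (fun n => (EFin \o P) \_ (I n)) (EFin \o P) (abse \o (EFin \o P)).
- move=> n; apply/(measurable_restrict _ (measurable_itv _) (measurable_itv _)).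
  rewrite setIidr; last exact: (sub n).
  apply/measurable_EFinP; apply: measurable_funS mP => //.
  exact: (sub n).
- by apply/measurable_EFinP.
- apply/aeW => x; rewrite (exhaust_oo ab) => -[n _ Inx].
  apply: cvg_near_cst; near=> m; rewrite patchE mem_set//.
  have : I n `<=` I m.
    move=> y; rewrite /I /= !in_itv/= => /andP[h1 h2].
    have : (b - a) / m.+3%:R <= (b - a) / n.+3%:R.
      rewrite ler_pM2l ?subr_gt0// lef_pV2 ?posrE// ler_nat !ltnS.
      by near: m; exact: nbhs_infty_ge.
    by move: h1 h2; set e := _ / n.+3%:R; set e' := _ / m.+3%:R => h1 h2 h; apply/andP; split; lra.
  by apply.
- exact: integrable_abse.
- apply/aeW => x n _ /=; rewrite patchE; case: ifPn => //= _.
  by rewrite lee_fin normr0.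
move=> H.
have iPn n : mu.-integrable (I n) (EFin \o P).
  by apply: integrableS iP => //; (exact: measurable_itv || exact: (sub n)).
have C1 : \int[mu]_(x in I n) P x @[n --> \oo] --> \int[mu]_(x in `]a, b[) P x.
  apply: fine_cvg; rewrite fineK; last exact: (integrable_fin_num _ iP).
  apply: cvg_trans H; apply: near_eq_cvg; near=> n.
  by rewrite /= -integral_mkcondr; congr integral; apply/setIidPr; exact: (sub n).
have C2 : F (b - (b - a) / n.+3%:R) - F (a + (b - a) / n.+3%:R) @[n --> \oo] --> B - A.
  apply: cvgB.
  - move/cvg_at_leftP : FB; apply; split; first by move=> n; have [] := I_lt n.
    have := @cvg_shrink _ b a; apply: cvg_trans; apply: near_eq_cvg; near=> n.
    by rewrite -[b - a]opprB mulNr opprK.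
  - by move/cvg_at_rightP : FA; apply; split; [move=> n; have [] := I_lt n|exact: cvg_shrink].
apply: ler_cvg_to C2 C1 _; near=> n.
have [h1 h2 h3] := I_lt n.
have fi x : x \in I n -> a < x < b by rewrite inE => /sub; rewrite /= in_itv.
have e : (\int[mu]_(x in I n) (f x)%:E = (F (b - (b - a) / n.+3%:R) - F (a + (b - a) / n.+3%:R))%:E)%E.
  apply: FTC_cc => //; last exact: (continuous_in_within cf h1 h2).
  by move=> x /andP[ax xb]; apply: dF; rewrite (lt_le_trans h1 ax) (le_lt_trans xb h2).
rewrite -[leLHS]/(fine _%:E) -e.
apply: le_Rintegral => //; first exact: measurable_itv.
- apply: continuous_compact_integrable; first exact: segment_compact.
  exact: (continuous_in_within cf h1 h2).
- by move=> x xI; apply: fP; apply: fi; rewrite inE.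
Unshelve. all: by end_near. Qed.

End Shrink.

(** * Picone's identity on the nodal intervals of an eigenfunction *)

Section Picone.
Variables (R : realType) (nu : R) (s : nat -> R).
Hypothesis nu1 : -1 < nu.
Hypothesis hs : bessel_zeros nu s.
Notation mu := (@lebesgue_measure R).
Notation q := (2 * nu + 2).
Notation W := (wgt nu).
Implicit Types (x t : R) (f g h e d k : R -> R).

Let q0 : 0 < q. Proof. by move: nu1 => h; lra. Qed.

Let Psi N := esc nu (s N).
Let eps N := esc' nu (s N).

(** Caratheodory's form of the derivative extracts x - a from numerator and denominator. The point a
    itself is excluded because there the quotient is 0 by the convention for division. *)
Lemma ratio_cvg g (f : R -> R) (a g' f' : R) : g a = 0 -> f a = 0 -> f' != 0 ->
  is_derive a 1 g g' -> is_derive a 1 f f' ->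
  exists2 r : R -> R, {for a, continuous r} & \forall x \near a, x != a -> g x / f x = r x.
Proof.
move=> ga fa f'0 /is_derive1_caratheodory[g1 [hg cg _]] /is_derive1_caratheodory[f1 [hf cf f1a]].
exists (fun x => g1 x / f1 x).
  by apply: cvgM; [exact: cg|apply: cvgV => //; rewrite f1a].
have f1n : \forall x \near a, f1 x != 0 by apply: cvgr_neq0 cf _; rewrite f1a.
near=> x => xa.
have -> : g x = g1 x * (x - a) by rewrite -hg ga subr0.
have -> : f x = f1 x * (x - a) by rewrite -hf fa subr0.
have fx0 : f1 x != 0 by near: x.
by field; rewrite fx0 subr_eq0 xa.
Unshelve. all: by end_near. Qed.

(** The boundary term x^(2 nu + 1) g^2 Psi'/Psi of Picone's identity, with Psi' = x eps. *)
Let F N g x := x `^ q * (eps N x * g x * (g x / Psi N x)).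

Lemma Psi_simple N a : 0 < a -> Psi N a = 0 -> a * eps N a != 0.
Proof.
move=> a0 za; have [t0 [m [M [h [[t00 m0 _ _] [hz _]]]]]] := phi_zeros nu1.
have sa : 0 < s N * a by rewrite mulr_gt0// (s_gt0 hs).
have [_ /andP[hm _]] := hz _ sa za.
have sN := s_gt0 hs N; move: nu1 => hnu.
have e : a * eps N a = s N * Dphi nu (s N * a).
  by rewrite /eps /esc' /Dphi; field; rewrite !gt_eqF//; lra.
rewrite e mulf_neq0 ?(gt_eqF sN)//; apply/eqP => h0.
by move: hm; rewrite h0 expr0n/= mulr0 leNgt m0.
Qed.

Lemma F_cvg0 N g d k a : radial nu g d k -> 0 < a -> Psi N a = 0 -> g a = 0 ->
  F N g x @[x --> a^'] --> 0.
Proof.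
move=> [dg _ _] a0 za ga; have [dP [e' [de _]] _] := radial_esc nu1 (s N).
have [r cr hr] := ratio_cvg ga za (Psi_simple a0 za) (dg a) (dP a).
have cg : {for a, continuous g} by exact: is_derive_continuous dg a.
have ce : {for a, continuous (eps N)} by exact: is_derive_continuous de a.
have : x `^ q * (eps N x * g x * r x) @[x --> a] --> a `^ q * (eps N a * g a * r a).
  by apply: cvgM; [exact: continuous_powR_pos|apply: cvgM => //; exact: cvgM].
rewrite ga mulr0 mul0r mulr0 => h.
have h' : x `^ q * (eps N x * g x * r x) @[x --> a^'] --> 0.
  by apply: cvg_trans h; apply: cvg_app; exact: cvg_within.
apply: cvg_trans h'; apply: near_eq_cvg.
rewrite /dnbhs; apply: filterS hr => x hx xa.
by rewrite /F hx.
Qed.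

Lemma F_cvg0_right0 N g d k : radial nu g d k -> F N g x @[x --> 0^'+] --> 0.
Proof.
move=> [dg _ _]; have [dP [e' [de _]] _] := radial_esc nu1 (s N).
have P0 : Psi N 0 = 1 by rewrite /Psi /esc mulr0 phi0.
have : eps N x * g x * (g x / Psi N x) @[x --> 0^'+] --> eps N 0 * g 0 * (g 0 / Psi N 0).
  apply: cvg_at_right_filter; apply: cvgM.
    by apply: cvgM; [exact: (is_derive_continuous de)|exact: (is_derive_continuous dg)].
  apply: cvgM; first exact: (is_derive_continuous dg).
  by apply: cvgV; [rewrite P0 oner_eq0|exact: (is_derive_continuous dP)].
move=> h; have H : x `^ q * (eps N x * g x * (g x / Psi N x)) @[x --> 0^'+] -->
    0 * (eps N 0 * g 0 * (g 0 / Psi N 0)) by apply: cvgM; [exact: powR_cvg0|exact: h].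
by move: H; rewrite mul0r.
Qed.

(** The integrand minus the derivative of [F] is a weighted square, so the integral dominates the
    increment of [F], and [F] tends to 0 at both ends. *)
Lemma picone_itv N g d k a c : radial nu g d k -> 0 <= a -> a < c -> c <= 1 ->
  (forall x, a < x < c -> Psi N x != 0) ->
  F N g x @[x --> a^'+] --> 0 -> F N g x @[x --> c^'-] --> 0 ->
  0 <= \int[mu]_(x in `]a, c[) ((x ^+ 2 * d x ^+ 2 - s N ^+ 2 * g x ^+ 2) * W x).
Proof.
move=> rg a0 ac c1 hP Fa Fc.
have [cg [cd ck]] := radial_continuous rg; have [dg _ _] := rg.
have rP := radial_esc nu1 (s N); have [cP [ceps _]] := radial_continuous rP.
have [dP [e' [de he]] _] := rP.
have cpt (u : R -> R) x : continuous u -> {for x, continuous u} by exact.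
pose G x := W x * (- s N ^+ 2 * g x ^+ 2 + 2 * x ^+ 2 * g x * d x * (eps N x / Psi N x)
   - x ^+ 2 * (g x * (eps N x / Psi N x)) ^+ 2).
rewrite -[leLHS](subrr (0 : R)).
apply: (@FTC_oo_ge _ _ (F N g) G a c) => //.
- move=> x /[dup] /andP[ax xc] axc; have x0 : 0 < x by apply: le_lt_trans ax.
  have Px := hP x axc.
  apply: dE (dM (dpowR q x0) (dM (dM (de x) (dg x)) (dM (dg x) (dV Px (dP x))))) _.
  rewrite /G wgtE -/(Psi N x) -/(eps N x).
  rewrite -(mulr_powRB1 (ltW x0) q0).
  have := he x; rewrite -/(Psi N x) -/(eps N x) => he'.
  have -> : q * x `^ (q - 1) * (eps N x * g x * (g x / Psi N x)) +
    x * x `^ (q - 1) * ((e' x * g x + eps N x * (x * d x)) * (g x / Psi N x) +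
     eps N x * g x * (x * d x / Psi N x + g x * (- (x * eps N x) / Psi N x ^+ 2))) =
    x `^ (q - 1) * (q * (eps N x * g x * (g x / Psi N x)) +
     ((x * e' x) * g x + x ^+ 2 * eps N x * d x) * (g x / Psi N x) +
     x ^+ 2 * eps N x * g x * (d x / Psi N x + g x * (- eps N x / Psi N x ^+ 2))) by ring.
  rewrite he'; field.
  exact: Px.
- move=> x; rewrite in_itv/= => /[dup] /andP[ax xc] axc.
  have x0 : 0 < x by apply: le_lt_trans ax.
  have cep : {for x, continuous (fun y => eps N y / Psi N y)}.
    by apply: cvgM; [exact: ceps|apply: cvgV; [exact: hP|exact: cP]].
  have c2 : {for x, continuous (fun y : R => y ^+ 2)} by apply: cX; exact: cid.
  have c1' : continuous (fun y => - s N ^+ 2 * g y ^+ 2).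
    by apply: cM; [exact: ccst|exact: cX].
  have c3 : continuous (fun y : R => 2 * y ^+ 2 * g y * d y).
    by apply: cM => //; apply: cM => //; apply: cM; [exact: ccst|apply: cX; exact: cid].
  apply: cvgM; first exact: continuous_powR_pos.
  apply: cvgB; first apply: cvgD.
  + exact: c1'.
  + by apply: cvgM; [exact: c3|exact: cep].
  + apply: cvgM => //; rewrite /continuous_at.
    under eq_fun do rewrite expr2; rewrite expr2.
    by apply: cvgM; apply: cvgM => //; exact: cg.
- move=> x; rewrite in_itv/= => /andP[ax xc]; have x0 : 0 < x by apply: le_lt_trans ax.
  apply: cvgM; last exact: continuous_powR_pos.
  have : continuous (fun x => x ^+ 2 * d x ^+ 2 - s N ^+ 2 * g x ^+ 2).
    apply: cB; apply: cM; try exact: cX; try exact: ccst.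
    by apply: cX; exact: cid.
  exact.
- move=> x /[dup] /andP[ax xc] axc; have x0 : 0 < x by apply: le_lt_trans ax.
  rewrite /G mulrC ler_wpM2r ?wgt_ge0//.
  (* This is (g' - g Psi'/Psi)^2, the defect in Picone's identity. *)
  have := sqr_ge0 (x * d x - x * (g x * (eps N x / Psi N x))).
  rewrite sqrrB !exprMn -subr_ge0 => h; apply: (le_trans h).
  by rewrite le_eqVlt; apply/orP; left; apply/eqP; ring.
- apply: integrableS (integrable_wgt_continuous nu1 _) => //; try exact: measurable_itv.
    by move=> x /=; rewrite !in_itv/= => /andP[ax xc]; rewrite (le_lt_trans a0 ax) (lt_le_trans xc c1).
  apply: cB; apply: cM; try exact: cX; try exact: ccst.
  by apply: cX; exact: cid.
Qed.

(** Indices are shifted by one: index 0 is the end point 0, where [F] vanishes thanks to x^q and not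
    to a zero of Psi, and index N + 1 is the point 1. *)
Definition znode N i : R := if i is i'.+1 then s i' / s N else 0.

Lemma znode_lt N i : (i <= N)%N -> znode N i < znode N i.+1.
Proof.
have sN := s_gt0 hs N; case: i => [|i] iN /=; first by rewrite divr_gt0// (s_gt0 hs).
by rewrite ltr_pM2r ?invr_gt0// (s_lt hs).
Qed.

Lemma znode_last N : znode N N.+1 = 1.
Proof. by rewrite /= divff// gt_eqF// (s_gt0 hs). Qed.

Lemma znode_le1 N i : (i <= N.+1)%N -> 0 <= znode N i <= 1.
Proof.
have sN := s_gt0 hs N; case: i => [|i]/=; first by rewrite lexx ler01.
rewrite ltnS => iN; apply/andP; split; first by rewrite divr_ge0// ltW// (s_gt0 hs).
by rewrite ler_pdivrMr// mul1r (s_le hs).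
Qed.

Lemma Psi_neq0 N i x : (i <= N)%N -> znode N i < x < znode N i.+1 -> Psi N x != 0.
Proof.
move=> iN /andP[ix xi]; have sN := s_gt0 hs N.
have x0 : 0 < x by apply: le_lt_trans ix; have /andP[] := @znode_le1 N i (leqW iN).
apply/eqP => zx; have [j sj] := s_exhaust nu1 hs (mulr_gt0 sN x0) zx.
have xj : x = s j / s N by rewrite sj mulrAC divff ?mul1r// gt_eqF.
move: xi; rewrite xj /= ltr_pM2r ?invr_gt0// => ji.
have {}ji : (j < i)%N.
  by rewrite ltnNge; apply/negP => /(s_le hs); rewrite leNgt ji.
move: ix; rewrite xj; case: i ji {iN} => // i; rewrite ltnS => ji /=.
by rewrite ltr_pM2r ?invr_gt0// ltNge (s_le hs ji).
Qed.

(** A Poincare inequality with the constant s_N^2. It is paid for by zeros of g at all zeros of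
    Psi_N in ]0, 1], which cancel the singularities of Psi'/Psi; the nodal intervals are then added
    up. *)
Lemma picone N g d k : radial nu g d k -> g 1 = 0 ->
  (forall i, (i < N)%N -> g (s i / s N) = 0) ->
  s N ^+ 2 * ip nu g g <= wint nu (fun x => x ^+ 2 * d x ^+ 2).
Proof.
move=> rg g1 gz; have [cg [cd ck]] := radial_continuous rg.
have sN := s_gt0 hs N.
pose P x := (x ^+ 2 * d x ^+ 2 - s N ^+ 2 * g x ^+ 2) * W x.
have cP : continuous (fun x => x ^+ 2 * d x ^+ 2 - s N ^+ 2 * g x ^+ 2).
  apply: cB; apply: cM; try exact: cX; try exact: ccst.
  by apply: cX; exact: cid.
have iP := integrable_wgt_continuous nu1 cP.
have gzn i : (i <= N)%N -> g (znode N i.+1) = 0 /\ Psi N (znode N i.+1) = 0.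
  move=> iN; split.
    move: iN; rewrite leq_eqVlt => /predU1P[->|iN]; first by rewrite znode_last.
    exact: gz.
  rewrite /Psi /esc /= mulrCA divff ?mulr1 ?gt_eqF//; exact: (phi_s nu1 hs).
have zpos i : (i <= N)%N -> 0 < znode N i.+1.
  by move=> iN; apply: le_lt_trans (znode_lt iN); have /andP[] := @znode_le1 N i (leqW iN).
have step i : (i <= N)%N -> 0 <= \int[mu]_(x in `]znode N i, znode N i.+1[) P x.
  move=> iN; have /andP[a0 _] := @znode_le1 N i (leqW iN).
  have /andP[_ c1] := @znode_le1 N i.+1 iN.
  apply: (@picone_itv N g d k) => //; first exact: znode_lt.
  - by move=> x; apply: Psi_neq0.
  - case: i iN a0 c1 => [|i] iN a0 c1; first exact: F_cvg0_right0 rg.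
    have [gi Pi] := gzn i (ltnW iN).
    exact: cvg_dnbhs_at_right (F_cvg0 rg (zpos i (ltnW iN)) Pi gi).
  - have [gi Pi] := gzn i iN.
    exact: cvg_dnbhs_at_left (F_cvg0 rg (zpos i iN) Pi gi).
have tot i : (i <= N.+1)%N -> 0 <= \int[mu]_(x in `]0, znode N i[) P x.
  elim: i => [|i IHi] iN; first by rewrite /= set_itvoo0 ?Rintegral_set0.
  have /andP[a0 a1] := @znode_le1 N i (leqW iN).
  have /andP[c0 c1] := @znode_le1 N i.+1 iN.
  have lt := @znode_lt N i iN.
  have iPc : mu.-integrable `]0, znode N i.+1[ (EFin \o P).
    apply: integrableS iP => //; try exact: measurable_itv.
    by move=> x /=; rewrite !in_itv/= => /andP[-> xc]/=; rewrite (lt_le_trans xc c1).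
  have := @Rintegral_itvB R P (BRight 0) (BLeft (znode N i.+1)) (znode N i) iPc.
  rewrite bnd_simp a0 bnd_simp lt => /(_ isT isT) /eqP; rewrite subr_eq => /eqP ->.
  apply: addr_ge0; first exact: step.
  rewrite -Rintegral_itv_bndo_bndc; first exact: IHi (ltnW iN).
  apply: integrableS iPc => //; try exact: measurable_itv.
  by move=> x /=; rewrite !in_itv/= => /andP[-> xc]/=; rewrite (lt_trans xc lt).
have := tot N.+1 (leqnn _); rewrite znode_last.
rewrite (_ : \int[mu]_(x in _) P x = wint nu (fun x => x ^+ 2 * d x ^+ 2 - s N ^+ 2 * g x ^+ 2))//.
have c2 : continuous (fun x : R => x ^+ 2 * d x ^+ 2).
  by apply: cM; apply: cX => //; exact: cid.
have cg2 : continuous (fun x => g x ^+ 2) by exact: cX.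
rewrite wintB//; last by apply: cM => //; exact: ccst.
by rewrite wintZ// subr_ge0.
Qed.

End Picone.

(** * From nodal conditions to orthogonality; completeness of the eigenfunctions *)

Section Poincare.
Variables (R : realType) (nu : R) (s : nat -> R).
Hypothesis nu1 : -1 < nu.
Hypothesis hs : bessel_zeros nu s.
Notation ev := (ev nu s).
Notation ev' := (ev' nu s).
Notation ip := (ip nu).
Implicit Types (x t : R) (f g h e d k : R -> R).

Definition lcomb N (al : 'I_N -> R) x : R := \sum_(j < N) al j * ev j x.
Definition lcomb' N (al : 'I_N -> R) x : R := \sum_(j < N) al j * ev' j x.

Lemma lcombE N (al : 'I_N -> R) x : lcomb al x = \sum_(j < N) al j * ev j x. Proof. by []. Qed.

Lemma radial_lcomb N (al : 'I_N -> R) :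
  radial nu (lcomb al) (lcomb' al) (lcomb (fun j => s j ^+ 2 * al j)).
Proof.
have := radial_sum (fun j : 'I_N => radialZ (al j) (radial_ev s nu1 j)).
congr radial; apply/funext => x; apply: eq_bigr => j _.
by rewrite mulrCA mulrA.
Qed.

Lemma continuous_lcomb N (al : 'I_N -> R) : continuous (lcomb al).
Proof. by have [] := radial_continuous (radial_lcomb al). Qed.

Lemma lcomb1 N (al : 'I_N -> R) : lcomb al 1 = 0.
Proof. by rewrite /lcomb big1// => j _; rewrite ev_1 ?mulr0. Qed.

Lemma ip_lcombl N (al : 'I_N -> R) g : continuous g ->
  ip (lcomb al) g = \sum_(j < N) al j * ip (ev j) g.
Proof.
move=> cg; rewrite /lcomb ip_suml//; last first.
  by move=> j; apply: cM; [exact: ccst|exact: (@continuous_ev R nu s nu1)].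
by apply: eq_bigr => j _; rewrite ipZl//; exact: (@continuous_ev R nu s nu1).
Qed.

Lemma ip_lcomb2 N (al be : 'I_N -> R) :
  ip (lcomb al) (lcomb be) = \sum_(j < N) al j * be j.
Proof.
rewrite ip_lcombl; last exact: continuous_lcomb.
apply: eq_bigr => i _; congr (_ * _).
rewrite ipC ip_lcombl; last exact: (@continuous_ev R nu s nu1).
rewrite (bigD1 i)//= ip_ev// eqxx mulr1 big1 ?addr0// => j ji.
by rewrite ip_ev// (negbTE (_ : (j : nat) != i)) ?mulr0.
Qed.


(** The evaluation matrix is injective: a combination vanishing at all nodes satisfies, by [picone],
    s_N^2 sum al_j^2 <= sum s_j^2 al_j^2, and s_j < s_N for j < N forces every al_j to be 0. *)
Lemma interp_nodes N (v : 'I_N -> R) : exists al : 'I_N -> R,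
  forall i : 'I_N, lcomb al (s i / s N) = v i.
Proof.
pose A : 'M[R]_N := \matrix_(j < N, i < N) ev j (s i / s N).
have sN := s_gt0 hs N.
have inj (u : 'rV[R]_N) : u *m A = 0 -> u = 0.
  move=> uA; pose al j := u 0 j.
  have z (i : nat) : (i < N)%N -> lcomb al (s i / s N) = 0.
    move=> iN; have := congr1 (fun M : 'rV[R]_N => M 0 (Ordinal iN)) uA.
    rewrite !mxE => h; rewrite -[RHS]h; apply: eq_bigr => j _.
    by rewrite mxE.
  have := picone nu1 hs (radial_lcomb al) (lcomb1 al) z.
  have := radial_green nu1 (radial_lcomb al) (radial_lcomb al) (lcomb1 al).
  rewrite ip_lcomb2 => e.
  have -> : wint nu (fun x => x ^+ 2 * lcomb' al x ^+ 2) =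
      wint nu (fun x => x ^+ 2 * lcomb' al x * lcomb' al x).
    by congr wint; apply/funext => x; rewrite expr2 mulrA.
  rewrite -e ip_lcomb2 mulr_sumr -subr_le0 -sumrB => h.
  have pos (j : 'I_N) : 0 <= s N ^+ 2 * (al j * al j) - s j ^+ 2 * al j * al j.
    rewrite -mulrA -mulrBl mulr_ge0// -?expr2 ?sqr_ge0// subr_ge0.
    by rewrite lerXn2r ?nnegrE ?(ltW (s_gt0 hs _))// (s_le hs)// ltnW.
  have h0 : \sum_(j < N) (s N ^+ 2 * (al j * al j) - s j ^+ 2 * al j * al j) = 0.
    by apply/eqP; rewrite eq_le h sumr_ge0.
  apply/rowP => j; rewrite mxE.
  have := psumr_eq0P (fun i _ => pos i) h0.
  move=> /(_ j isT).
  rewrite -mulrA -mulrBl => /eqP; rewrite mulf_eq0 -expr2 sqrf_eq0 => /orP[|/eqP//].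
  rewrite subr_eq0 eqf_sqr => /orP[/eqP e1|/eqP e1].
    by have := s_lt hs (ltn_ord j); rewrite e1 ltxx.
  by move: sN; rewrite e1 oppr_gt0 ltNge ltW// (s_gt0 hs).
have uA : A \in unitmx by rewrite -row_free_unit; exact: inj_row_free.
exists (fun j => ((\row_i v i) *m invmx A) 0 j) => i.
have : (\row_i v i) *m invmx A *m A = \row_i v i by rewrite mulmxKV.
move=> /(congr1 (fun M : 'rV[R]_N => M 0 i)); rewrite [RHS]mxE mxE => h.
rewrite -[RHS]h; apply: eq_bigr => j _.
by congr (_ * _); rewrite /A mxE.
Qed.

(** A combination p of the first N eigenfunctions is added so that f + p vanishes at the nodes of
    [picone]. Since f is orthogonal to p and to its image, the inequality for f + p splits into that
    for f and one for p, and the latter goes the other way because s_j <= s_N; subtracting it leaves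
    f alone. *)
Lemma poincare N f e k : radial nu f e k -> f 1 = 0 ->
  (forall j, (j < N)%N -> ip f (ev j) = 0) -> s N ^+ 2 * ip f f <= ip k f.
Proof.
move=> rf f1 fo; have [cf [ce ck]] := radial_continuous rf.
have sN := s_gt0 hs N.
have [al hal] := interp_nodes (fun i : 'I_N => - f (s i / s N)).
have rp := radial_lcomb al.
have cp := (@continuous_lcomb N al).
have rg := radialD rf rp.
have g1 : f 1 + lcomb al 1 = 0 by rewrite f1 lcomb1 addr0.
have gz i : (i < N)%N -> f (s i / s N) + lcomb al (s i / s N) = 0.
  by move=> iN; rewrite (hal (Ordinal iN)) subrr.
have := picone nu1 hs rg g1 gz.
have -> : wint nu (fun x => x ^+ 2 * (e x + lcomb' al x) ^+ 2) =
    wint nu (fun x => x ^+ 2 * (e x + lcomb' al x) * (e x + lcomb' al x)).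
  by congr wint; apply/funext => x; rewrite expr2 mulrA.
rewrite -(radial_green nu1 rg rg g1).
pose kp := lcomb (fun j => s j ^+ 2 * al j).
have ckp : continuous kp by exact: continuous_lcomb.
have fp (be : 'I_N -> R) : ip (lcomb be) f = 0.
  rewrite ip_lcombl// big1// => j _.
  by rewrite ipC fo ?mulr0.
have kfp : ip k (lcomb al) = 0.
  rewrite (radial_green nu1 rf rp (lcomb1 al)).
  rewrite (_ : wint nu _ = wint nu (fun x => x ^+ 2 * lcomb' al x * e x)); last first.
    by congr wint; apply/funext => x; rewrite mulrAC.
  by rewrite -(radial_green nu1 rp rf f1) fp.
have cfp : continuous (fun x => f x + lcomb al x) by exact: cD.
rewrite !ipDl// (ipC nu f) (ipC nu (lcomb al)) (ipC nu k) (ipC nu kp) !ipDl//.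
rewrite (ipC nu f (lcomb al)) fp addr0 add0r.
rewrite (ipC nu (lcomb al) k) kfp addr0 (ipC nu f k) (ipC nu f kp) fp add0r.
rewrite (ipC nu (lcomb al) kp) ip_lcomb2 /kp ip_lcomb2 mulrDr.
have : \sum_(j < N) s j ^+ 2 * al j * al j <= s N ^+ 2 * \sum_(j < N) al j * al j.
  rewrite mulr_sumr; apply: ler_sum => j _; rewrite -mulrA ler_wpM2r// -?expr2 ?sqr_ge0//.
  by rewrite lerXn2r ?nnegrE ?(ltW (s_gt0 hs _))// (s_le hs)// ltnW.
by lra.
Qed.

Definition fcoef f j : R := ip f (ev j).
Definition proj f N : R -> R := lcomb (fun j : 'I_N => fcoef f j).

Lemma ip_proj f N g : continuous g ->
  ip (proj f N) g = \sum_(j < N) fcoef f j * fcoef g j.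
Proof.
move=> cg; rewrite /proj ip_lcombl//; apply: eq_bigr => j _.
by rewrite /fcoef (ipC nu g).
Qed.

Lemma ip_sub_proj f N : continuous f ->
  ip (fun x => f x - proj f N x) (fun x => f x - proj f N x) =
  ip f f - \sum_(j < N) fcoef f j ^+ 2.
Proof.
move=> cf; have cp : continuous (proj f N) by exact: continuous_lcomb.
have cfp : continuous (fun x => f x - proj f N x) by exact: cB.
have e1 : ip f (proj f N) = \sum_(j < N) fcoef f j * fcoef f j by rewrite ipC ip_proj.
have e2 : ip (proj f N) (proj f N) = \sum_(j < N) fcoef f j * fcoef f j by rewrite /proj ip_lcomb2.
have e3 : \sum_(j < N) fcoef f j ^+ 2 = \sum_(j < N) fcoef f j * fcoef f j.
  by apply: eq_bigr => j _; rewrite expr2.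
rewrite ipBl// (ipC nu f) (ipC nu (proj f N)) !ipBl// (ipC nu (proj f N) f) e1 e2 e3.
by ring.
Qed.

Lemma fcoef_image f e k j : radial nu f e k -> f 1 = 0 ->
  fcoef k j = s j ^+ 2 * fcoef f j.
Proof.
move=> rf f1; have rj := radial_ev s nu1 j.
have [cf [ce ck]] := radial_continuous rf.
have cj := @continuous_ev R nu s nu1 j.
rewrite /fcoef (radial_green nu1 rf rj (@ev_1 R nu s nu1 hs j)).
rewrite (_ : wint nu _ = wint nu (fun x => x ^+ 2 * ev' j x * e x)); last first.
  by congr wint; apply/funext => x; rewrite mulrAC.
by rewrite -(radial_green nu1 rj rf f1) ipZl// ipC.
Qed.

Lemma radial_sub_proj f e k N : radial nu f e k -> f 1 = 0 ->
  radial nu (fun x => f x - proj f N x) (fun x => e x - lcomb' (fun j : 'I_N => fcoef f j) x)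
    (fun x => k x - proj k N x).
Proof.
move=> rf f1; have := radialB rf (radial_lcomb (fun j : 'I_N => fcoef f j)).
congr radial; apply/funext => x; congr (_ - _); rewrite /proj /lcomb.
by apply: eq_bigr => j _; rewrite (fcoef_image j rf f1).
Qed.

(** Completeness in quantitative form, since s_N tends to infinity: the remainder is orthogonal to
    the first N eigenfunctions. On the right the nonnegative sum of s_i^2 times the squared
    coefficients has been dropped. *)
Lemma proj_error f e k N : radial nu f e k -> f 1 = 0 ->
  s N ^+ 2 * ip (fun x => f x - proj f N x) (fun x => f x - proj f N x) <= ip k f.
Proof.
move=> rf f1; have [cf [ce ck]] := radial_continuous rf.
have cp g : continuous (proj g N) by exact: continuous_lcomb.
have r := radial_sub_proj N rf f1.
have z : f 1 - proj f N 1 = 0 by rewrite f1 /proj lcomb1 subr0.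
have := poincare r z; move=> /(_ N) h; apply: le_trans.
  apply: h => j jN; have cj := @continuous_ev R nu s nu1 j.
  rewrite ipBl// /proj ip_lcombl//.
  rewrite (bigD1 (Ordinal jN))//= ip_ev// eqxx mulr1 big1 ?addr0; last first.
    by move=> i /eqP ij; rewrite ip_ev//; case: eqP => [e0|]; rewrite ?mulr0//; case: ij; exact: val_inj.
  by rewrite /fcoef subrr.
have cfp : continuous (fun x => f x - proj f N x) by exact: cB.
pose S := \sum_(i < N) fcoef f i * fcoef k i.
have e1 : ip k (proj f N) = S by rewrite ipC ip_proj.
have e2 : ip (proj k N) f = S by rewrite ip_proj//; apply: eq_bigr => i _; rewrite mulrC.
have e3 : ip (proj k N) (proj f N) = S.
  by rewrite /proj ip_lcomb2; apply: eq_bigr => i _; rewrite mulrC.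
rewrite ipBl// (ipC nu k) (ipC nu (proj k N)) !ipBl// (ipC nu f k) (ipC nu f (proj k N)).
rewrite (ipC nu (proj f N) k) (ipC nu (proj f N) (proj k N)) e1 e2 e3.
rewrite opprB addrA subrK.
rewrite lerBlDr lerDl; apply: sumr_ge0 => i _.
by rewrite (fcoef_image i rf f1) mulrCA mulr_ge0 ?sqr_ge0// -expr2 sqr_ge0.
Qed.

End Poincare.

(** * Finite propagation speed *)

Section Bumps.
Variables (R : realType) (nu : R).
Hypothesis nu1 : -1 < nu.
Notation mu := (@lebesgue_measure R).
Implicit Types (x y z : R).

Lemma sqr_le_le x y : 0 < y -> x ^+ 2 <= y ^+ 2 -> x <= y.
Proof.
move=> y0; rewrite leNgt => xy; rewrite leNgt; apply: contra xy => yx.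
by rewrite ltr_pXn2r// nnegrE ltW// (lt_trans y0 yx).
Qed.

(** A remainder of order h^2 treats both sides of the kink of [Num.max 0] in one inequality. *)
Lemma is_derive_quadratic (F : R -> R) x (a C : R) :
  (forall h, `|F (x + h) - F x - h * a| <= C * h ^+ 2) -> is_derive x 1 F a.
Proof.
move=> hF.
have cv : h^-1 *: (F (h *: (1 : R) + x) - F x) @[h --> (0:R)^'] --> a.
  apply/cvgrPdist_le => /= ep ep0.
  have C1 : 0 < `|C| + 1 by rewrite ltr_wpDl.
  near=> h; have h0 : h != 0 by near: h; exact: nbhs_dnbhs_neq.
  have hs : `|h| <= ep / (`|C| + 1).
    near: h; apply: dnbhs0_le; exact: divr_gt0.
  rewrite /GRing.scale/= mulr1 (addrC h).
  rewrite (_ : a - _ = - h^-1 * (F (x + h) - F x - h * a)); last by field.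
  rewrite normrM normrN normfV ler_pdivrMl ?normr_gt0//.
  apply: (le_trans (hF h)).
  rewrite -(real_normK (num_real h)) expr2 mulrA mulrC ler_wpM2l//.
  apply: (@le_trans _ _ ((`|C| + 1) * `|h|)).
    by rewrite ler_wpM2r// (le_trans (ler_norm _))// lerDl.
  by rewrite mulrC -ler_pdivlMr.
by apply: DeriveDef; [apply/cvg_ex; exists a|exact: cvg_lim cv].
Unshelve. all: by end_near. Qed.

Lemma dpos2 x : is_derive x 1 (fun z => Num.max 0 z ^+ 2) (2 * Num.max 0 x).
Proof.
apply: (@is_derive_quadratic _ _ _ 1) => h; rewrite mul1r.
have [xh|xh] := leP 0 (x + h); have [x0|x0] := leP 0 x; rewrite ler_norml; apply/andP; split; nra.
Qed.

Lemma dpos3 x : is_derive x 1 (fun z => Num.max 0 z ^+ 3) (3 * Num.max 0 x ^+ 2).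
Proof.
rewrite (_ : (fun z => _) = (fun z => z * Num.max 0 z ^+ 2)); last first.
  by apply/funext => z; case: (leP 0 z) => z0; rewrite ?expr0n ?mulr0// exprS.
apply: dE (dM (did x) (dpos2 x)) _.
by case: (leP 0 x) => x0; ring.
Qed.

Lemma continuous_pos : continuous (fun z : R => Num.max 0 z).
Proof. by move=> x; apply: continuous_max; [exact: cvg_cst|exact: cvg_id]. Qed.

Section Bump.
Variables a c : R.
Let p z := (z - a) * (c - z).
(** The cube makes the truncated polynomial twice continuously differentiable, and dependence on x^2
    alone makes f'/x differentiable, as [radial] asks. *)
Definition cbump x : R := Num.max 0 ((x ^+ 2 - a) * (c - x ^+ 2)) ^+ 3.

Let dp x : is_derive x 1 (fun y => (y ^+ 2 - a) * (c - y ^+ 2)) (2 * x * (a + c - 2 * x ^+ 2)).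
Proof.
have d2 := dX 2 (did x).
by apply: dE (dM (dB d2 (dcst a x)) (dB (dcst c x) d2)) _; rewrite /=; ring.
Qed.

Lemma radial_cbump : exists e h, radial nu cbump e h.
Proof.
pose m x := Num.max 0 ((x ^+ 2 - a) * (c - x ^+ 2)).
pose e x := 6 * (m x ^+ 2 * (a + c - 2 * x ^+ 2)).
pose e' x := 6 * ((2 * m x * (2 * x * (a + c - 2 * x ^+ 2))) * (a + c - 2 * x ^+ 2) + m x ^+ 2 * (- (4 * x))).
have de x : is_derive x 1 e (e' x).
  apply: dZ; apply: dE (dM (dcomp (dp x) (dpos2 _)) (dB (dcst (a + c) x) (dZ 2 (dX 2 (did x))))) _.
  by rewrite /= /m; ring.
have cm : continuous m.
  by apply: (ccomp continuous_pos); exact: is_derive_continuous dp.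
have ce := is_derive_continuous de.
exists e, (fun x => - (x * e' x + (2 * nu + 2) * e x)); split.
- move=> x; apply: dE (dcomp (dp x) (dpos3 _)) _; rewrite /e /m; ring.
- by exists e'; split => // x; ring.
- apply: cN; apply: cD; last by apply: cM => //; exact: ccst.
  have c2 : continuous (fun x => a + c - 2 * x ^+ 2).
    by apply: cB; [exact: ccst|apply: cM; [exact: ccst|apply: cX; exact: cid]].
  have cx k : continuous (fun x : R => k * x) by apply: cM; [exact: ccst|exact: cid].
  apply: cM; first exact: cid.
  apply: cM; first exact: ccst.
  apply: cD; last by apply: cM; [exact: cX|apply: cN; exact: cx].
  apply: cM => //; apply: cM; first by apply: cM => //; exact: ccst.
  by apply: cM.
Qed.

Lemma cbump_ge0 x : 0 <= cbump x.
Proof. by rewrite exprn_ge0// le_max lexx. Qed.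
End Bump.

Lemma wint0 : wint nu (fun=> 0) = 0.
Proof. by rewrite /wint /Rintegral; under eq_integral do rewrite mul0r; rewrite integral0. Qed.

Lemma wint_gt0 (f : R -> R) x0 : continuous f -> (forall x, 0 <= f x) -> 0 < x0 < 1 -> 0 < f x0 ->
  0 < wint nu f.
Proof.
move=> cf f0 /andP[x00 x01] fx0.
have cg : {for x0, continuous (fun x => f x * wgt nu x)}.
  by apply: cvgM; [exact: cf|exact: continuous_powR_pos].
have g0 : 0 < f x0 * wgt nu x0 by rewrite mulr_gt0// wgt_gt0.
pose v := f x0 * wgt nu x0.
have : \forall x \near x0, v / 2 < f x * wgt nu x.
  by apply: (cvgr_gt _ cg); rewrite ltr_pdivrMr// ltr_pMr// ltr1n.
move=> /nbhs_ballP[r /= r0 hr].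
pose r' := Num.min (r / 2) (Num.min (x0 / 2) ((1 - x0) / 2)).
have rr : [/\ 0 < r', r' < r, r' < x0 & r' < 1 - x0].
  rewrite /r' !lt_min !gt_min !divr_gt0 ?subr_gt0//=.
  have -> : r / 2 < r by lra.
  have -> : x0 / 2 < x0 by lra.
  have -> : (1 - x0) / 2 < 1 - x0 by lra.
  by rewrite ?orbT.
have [r'0 r'r r'x r'1] := rr.
have ig := integrable_wgt_continuous nu1 cf.
rewrite /wint /Rintegral fine_gt0//; apply/andP; split; last first.
  have : (\int[mu]_(x in `]0%R, 1%R[) (f x * wgt nu x)%:E)%E \is a fin_num.
    by apply: integrable_fin_num; [exact: measurable_itv|exact: ig].
  by rewrite fin_numE => /andP[_]; rewrite lt_neqAle leey andbT.
have c0 : (0 < \int[mu]_(x in `[(x0 - r')%R, (x0 + r')%R]) (v / 2)%:E)%E.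
  rewrite integral_cst//= lebesgue_measure_itv/= ifT; last by rewrite lte_fin; lra.
  by rewrite -EFinB -EFinM lte_fin mulr_gt0// ?divr_gt0//; lra.
have sub : `[x0 - r', x0 + r']%classic `<=` (`]0, 1[%classic : set R).
  by move=> x /=; rewrite !in_itv/= => /andP[h1 h2]; apply/andP; split; lra.
apply: (lt_le_trans c0).
apply: (@le_trans _ _ (\int[mu]_(x in `[(x0 - r')%R, (x0 + r')%R]) (f x * wgt nu x)%:E)%E).
  apply: ge0_le_integral => //.
  - by move=> x _; rewrite lee_fin divr_ge0// ltW.
  - apply/measurable_EFinP; apply: (measurable_funS _ sub) => //.
    apply: measurable_funM; last exact: measurable_wgt.
    exact: continuous_measurable_itv.
  - move=> x /=; rewrite in_itv/= => /andP[h1 h2]; rewrite lee_fin ltW//; apply: hr.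
    by rewrite /ball/= ltr_norml; apply/andP; split; lra.
apply: ge0_subset_integral => //.
- by apply/measurable_EFinP; apply: measurable_funM; [exact: continuous_measurable_itv|exact: measurable_wgt].
- by move=> x _; rewrite lee_fin mulr_ge0 ?wgt_ge0.
Qed.

Lemma bump_at x0 r : 0 < x0 < 1 -> 0 < r -> exists f e h : R -> R, [/\ radial nu f e h, f 1 = 0,
  forall x, 0 <= f x, forall x, 0 <= x -> r <= `|x - x0| -> f x = 0 & wint nu f = 1].
Proof.
move=> /andP[x00 x01] r0.
pose r' := Num.min r (Num.min (x0 / 2) ((1 - x0) / 2)).
have [r'0 r'r r'x r'1] : [/\ 0 < r', r' <= r, r' < x0 & r' < 1 - x0].
  rewrite /r' !lt_min !gt_min !ge_min lexx r0 !divr_gt0 ?subr_gt0//=.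
  have -> : x0 / 2 < x0 by lra.
  have -> : (1 - x0) / 2 < 1 - x0 by lra.
  by rewrite ?orbT.
(* For x >= 0 the product (x^2 - a)(c - x^2) is positive exactly between x0 - r' and x0 + r'; here
   r' < x0 and x0 + r' < 1 matter. *)
pose a := (x0 - r') ^+ 2; pose c := (x0 + r') ^+ 2.
have [e [h rf]] := radial_cbump a c.
have [cf _] := radial_continuous rf.
have z x : 0 <= x -> r' <= `|x - x0| -> cbump a c x = 0.
  move=> x0' hx; rewrite /cbump.
  suff -> : Num.max 0 ((x ^+ 2 - a) * (c - x ^+ 2)) = 0 by rewrite expr0n.
  apply/max_idPl.
  have -> : (x ^+ 2 - a) * (c - x ^+ 2) = - (((x - x0) ^+ 2 - r' ^+ 2) * ((x + x0) ^+ 2 - r' ^+ 2)).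
    by rewrite /a /c; ring.
  rewrite oppr_le0 mulr_ge0//.
    by rewrite -(real_normK (num_real (x - x0))) subr_ge0 lerXn2r// ?nnegrE// ltW.
  by rewrite subr_ge0 lerXn2r ?nnegrE ?ltW// ?addr_ge0//; lra.
have w0 : 0 < wint nu (cbump a c).
  apply: (@wint_gt0 _ x0) => //; first by move=> x; exact: cbump_ge0.
    by rewrite x00.
  rewrite /cbump exprn_gt0// lt_max; apply/orP; right.
  by rewrite /a /c; apply: mulr_gt0; nra.
exists (fun x => (wint nu (cbump a c))^-1 * cbump a c x), (fun x => (wint nu (cbump a c))^-1 * e x),
  (fun x => (wint nu (cbump a c))^-1 * h x); split.
- exact: radialZ.
- by rewrite z ?mulr0//; rewrite ger0_norm; lra.
- by move=> x; apply: mulr_ge0; [rewrite invr_ge0 ltW|exact: cbump_ge0].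
- by move=> x x0' hx; rewrite z ?mulr0//; exact: le_trans hx.
- by rewrite wintZ// mulVf// gt_eqF.
Qed.

End Bumps.

(** * Weighted energy of the truncated wave and unit speed of propagation *)

Section Propagation.
Variables (R : realType) (nu : R) (s : nat -> R).
Hypothesis nu1 : -1 < nu.
Hypothesis hs : bessel_zeros nu s.
Notation ev := (ev nu s).
Notation ev' := (ev' nu s).
Notation ip := (ip nu).
Notation wint := (wint nu).
Notation fcoef := (fcoef nu s).
Notation proj := (proj nu s).
Implicit Types (x t k : R) (f g h e d : R -> R).

Lemma wint_bilinear N (F : 'I_N -> R -> R) w (a c : 'I_N -> R) :
  (forall i, continuous (F i)) -> continuous w ->
  wint (fun x => (\sum_i a i * F i x) * (\sum_j c j * F j x) * w x) =
  \sum_i \sum_j a i * c j * wint (fun x => F i x * F j x * w x).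
Proof.
move=> cF cw.
have cij i j : continuous (fun x => F i x * F j x * w x) by apply: cM => //; exact: cM.
have cj i : continuous (fun x => \sum_j a i * c j * (F i x * F j x * w x)).
  by apply: csum => j; apply: cM => //; exact: ccst.
transitivity (wint (fun x => \sum_i \sum_j a i * c j * (F i x * F j x * w x))).
  apply: eq_wint => x _; rewrite mulr_suml mulr_suml; apply: eq_bigr => i _.
  rewrite mulr_sumr mulr_suml; apply: eq_bigr => j _; ring.
rewrite wint_sum//; apply: eq_bigr => i _; rewrite wint_sum//; last first.
  by move=> j; apply: cM => //; exact: ccst.
by apply: eq_bigr => j _; rewrite wintZ.
Qed.

(** Time occurs only in finitely many coefficients, so the derivative is taken of a finite double
    sum and not under an integral sign. *)
Lemma is_derive_wint_square N (F : 'I_N -> R -> R) w (c : 'I_N -> R -> R) (c' : 'I_N -> R) t :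
  (forall i, continuous (F i)) -> continuous w ->
  (forall i, is_derive t 1 (c i) (c' i)) ->
  is_derive t 1 (fun t => wint (fun x => (\sum_i c i t * F i x) * (\sum_i c i t * F i x) * w x))
    (2 * wint (fun x => (\sum_i c i t * F i x) * (\sum_i c' i * F i x) * w x)).
Proof.
move=> cF cw dc.
rewrite (_ : (fun t => _) = (fun t => \sum_i \sum_j c i t * c j t * wint (fun x => F i x * F j x * w x))); last first.
  by apply/funext => u; rewrite wint_bilinear.
apply: dE (dsum (fun i => dsum (fun j => dM (dM (dc i) (dc j))
  (dcst (wint (fun x => F i x * F j x * w x)) t)))) _.
rewrite wint_bilinear//= mulr_natl mulr2n.
rewrite [X in _ = X + _]exchange_big/= -big_split/=; apply: eq_bigr => i _.
rewrite -big_split/=; apply: eq_bigr => j _.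
rewrite (_ : wint (fun x => F j x * F i x * w x) = wint (fun x => F i x * F j x * w x)); first by ring.
by congr wint; apply/funext => x; rewrite (mulrC (F j x)).
Qed.

Lemma weighted_green k f e h g d h' : radial nu f e h -> radial nu g d h' -> g 1 = 0 ->
  wint (fun x => - h x * g x * expR (k * x)) + wint (fun x => x * e x * (x * d x) * expR (k * x)) =
  - k * wint (fun x => x * e x * g x * expR (k * x)).
Proof.
move=> rf rg g1; have [cf [ce ch]] := radial_continuous rf.
have [cg [cd _]] := radial_continuous rg.
have [df [e' [de he]] _] := rf; have [dg _ _] := rg.
have q0 : 0 < 2 * nu + 2 by move: nu1 => hnu; lra.
have dw x : is_derive x 1 (fun x => expR (k * x)) (k * expR (k * x)).
  apply: dE (dcomp (dZ k (did x)) (is_derive_expR (k * x))) _.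
  by rewrite mulr1 mulrC.
have cw := is_derive_continuous dw.
have dH x := dM (dM (de x) (dg x)) (dw x).
have cI : continuous (fun x : R => x) by exact: cid.
have c1 : continuous (fun x => - h x * g x * expR (k * x)).
  by apply: cM => //; apply: cM => //; exact: cN.
have c2 : continuous (fun x => x * e x * (x * d x) * expR (k * x)).
  by apply: cM => //; apply: cM; apply: cM.
have c3 : continuous (fun x => k * (x * e x * g x * expR (k * x))).
  by apply: cM; [exact: ccst|apply: cM => //; apply: cM => //; exact: cM].
have E x : (2 * nu + 2) * (e x * g x * expR (k * x)) + x * ((e' x * g x + e x * (x * d x)) * expR (k * x) + e x * g x * (k * expR (k * x))) =
    - h x * g x * expR (k * x) + x * e x * (x * d x) * expR (k * x) + k * (x * e x * g x * expR (k * x)).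
  rewrite (_ : x * (_ + _) = ((x * e' x) * g x + e x * x * (x * d x)) * expR (k * x) + x * e x * g x * (k * expR (k * x))); last by ring.
  by rewrite he; ring.
have := divergence01 q0 dH; rewrite g1 mulr0 mul0r => D.
have c4 : continuous (fun x => x * ((e' x * g x + e x * (x * d x)) * expR (k * x) + e x * g x * (k * expR (k * x)))).
  rewrite (_ : (fun x => _) = (fun x => - h x * g x * expR (k * x) + x * e x * (x * d x) * expR (k * x) +
      k * (x * e x * g x * expR (k * x)) - (2 * nu + 2) * (e x * g x * expR (k * x)))); last first.
    by apply/funext => x; rewrite -E addrAC subrr add0r.
  apply: cB; first by apply: cD => //; apply: cD.
  by apply: cM; [exact: ccst|apply: cM => //; exact: cM].
have := D c4.
rewrite (_ : \int[_]_(x in _) _ = wint (fun x => - h x * g x * expR (k * x) + x * e x * (x * d x) * expR (k * x) + k * (x * e x * g x * expR (k * x)))); last first.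
  by apply: eq_Rintegral => x _; rewrite wgtE E.
rewrite wintD//; last exact: cD.
rewrite wintD// wintZ//; last by apply: cM => //; apply: cM => //; exact: cM.
lra.
Qed.

(** Coefficients of the wave that starts from the displacement f with velocity 0; [wave_c] holds
    those of its velocity. *)
Definition wave_d (f : R -> R) t (j : nat) : R := cos (t * s j) * fcoef f j.
Definition wave_c (f : R -> R) t (j : nat) : R := - (s j * sin (t * s j)) * fcoef f j.

Definition wenergy k f N t : R :=
  wint (fun x => (\sum_(j < N) wave_c f t j * ev j x) * (\sum_(j < N) wave_c f t j * ev j x) * expR (k * x)) +
  wint (fun x => (\sum_(j < N) wave_d f t j * (x * ev' j x)) * (\sum_(j < N) wave_d f t j * (x * ev' j x)) * expR (k * x)).

Let cev j : continuous (ev j). Proof. exact: (@continuous_ev R nu s nu1). Qed.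
Let cev' j : continuous (ev' j).
Proof. by have [_ []] := radial_continuous (radial_ev s nu1 j). Qed.
Let cxev' j : continuous (fun x => x * ev' j x).
Proof. by apply: cM; [exact: cid|exact: cev']. Qed.
Let cexp k : continuous (fun x : R => expR (k * x)).
Proof.
apply: (@ccomp _ expR); first exact: continuous_expR.
by apply: cM; [exact: ccst|exact: cid].
Qed.

Lemma dwave_d f t j : is_derive t 1 (fun t => wave_d f t j) (wave_c f t j).
Proof.
apply: dE (dM (dcomp (dM (did t) (dcst (s j) t)) (is_derive_cos _)) (dcst (fcoef f j) t)) _.
by rewrite /wave_c; ring.
Qed.

Lemma dwave_c f t j : is_derive t 1 (fun t => wave_c f t j) (- (s j ^+ 2 * wave_d f t j)).
Proof.
apply: dE (dM (dN (dZ (s j) (dcomp (dM (did t) (dcst (s j) t)) (is_derive_sin _)))) (dcst (fcoef f j) t)) _.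
by rewrite /wave_d; ring.
Qed.

(** The weight exp(k x) leaves in the derivative of the energy only the flux -2 k times the integral
    of u_t u_x exp(k x). Since 2 u_t u_x <= u_t^2 + u_x^2, the growth rate is at most -k; that this
    rate equals the weight's exponent is the unit speed. *)
Lemma wenergy_exp_mono k f N t : k < 0 -> 0 <= t ->
  wenergy k f N t <= expR (- k * t) * wenergy k f N 0.
Proof.
move=> k0 t0.
pose V t := lcomb nu s (fun j : 'I_N => wave_c f t j).
pose eV t := lcomb' nu s (fun j : 'I_N => wave_c f t j).
pose eU t := lcomb' nu s (fun j : 'I_N => wave_d f t j).
have cV u : continuous (V u) by exact: continuous_lcomb.
have ceU u : continuous (fun x => x * eU u x).
  apply: cM; first exact: cid.
  by have [_ []] := radial_continuous (radial_lcomb s nu1 (fun j : 'I_N => wave_d f u j)).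
have xe (al : 'I_N -> R) x : \sum_(j < N) al j * (x * ev' j x) = x * lcomb' nu s al x.
  by rewrite /lcomb' mulr_sumr; apply: eq_bigr => j _; rewrite mulrCA.
pose X u := wint (fun x => x * eU u x * V u x * expR (k * x)).
have dE' u : is_derive u (1 : R) (wenergy k f N) (2 * (- k * X u)).
  have d1 := is_derive_wint_square (F := fun i : 'I_N => ev i) (w := fun x => expR (k * x))
    (fun i : 'I_N => @cev i) (@cexp k) (fun i : 'I_N => dwave_c f u i).
  have d2 := is_derive_wint_square (F := fun (i : 'I_N) x => x * ev' i x) (w := fun x => expR (k * x))
    (fun i : 'I_N => @cxev' i) (@cexp k) (fun i : 'I_N => dwave_d f u i).
  apply: dE (dD d1 d2) _; rewrite -mulrDr; congr (_ * _).
  have := weighted_green k (radial_lcomb s nu1 (fun j : 'I_N => wave_d f u j))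
    (radial_lcomb s nu1 (fun j : 'I_N => wave_c f u j)) (lcomb1 nu1 hs _).
  rewrite /X => <-; congr (_ + _); congr wint; apply/funext => x; congr (_ * _).
    rewrite mulrC; congr (_ * _).
    by rewrite /lcomb -sumrN; apply: eq_bigr => j _; rewrite mulNr.
  by rewrite !xe.
have dec : expR (k * t) * wenergy k f N t <= expR (k * 0) * wenergy k f N 0.
  have dG u : is_derive u (1 : R) (fun u => expR (k * u) * wenergy k f N u)
     (k * expR (k * u) * wenergy k f N u + expR (k * u) * (2 * (- k * X u))).
    have dw : is_derive u (1 : R) (fun x => expR (k * x)) (k * expR (k * u)).
      apply: dE (dcomp (dZ k (did u)) (is_derive_expR (k * u))) _.
      by rewrite mulr1 mulrC.
    exact: dM dw (dE' u).
  apply: (derive_le0_ge t0 (fun x _ => dG x)) => u _.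
  rewrite (_ : _ + _ = expR (k * u) * (k * (wenergy k f N u - 2 * X u))); last by ring.
  rewrite pmulr_rle0 ?expR_gt0// nmulr_rle0//.
  rewrite /wenergy subr_ge0 /X -wintZ//; last by apply: cM => //; exact: cM.
  have cVV : continuous (fun x => V u x * V u x * expR (k * x)) by apply: cM => //; exact: cM.
  have cUU : continuous (fun x => x * eU u x * (x * eU u x) * expR (k * x)) by apply: cM => //; exact: cM.
  rewrite (_ : wint (fun x => _ * _ * _) + _ =
    wint (fun x => V u x * V u x * expR (k * x) + x * eU u x * (x * eU u x) * expR (k * x))); last first.
    rewrite wintD//; congr (_ + _); congr wint; apply/funext => x.
    by rewrite !xe.
  apply: le_wint => //.
  - by apply: cM; [exact: ccst|apply: cM => //; exact: cM].
  - exact: cD.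
  move=> x _; rewrite -mulrDl mulrA ler_pM2r ?expR_gt0// -subr_ge0.
  by rewrite (_ : _ - _ = (V u x - x * eU u x) ^+ 2) ?sqr_ge0//; ring.
move: dec; rewrite mulr0 expR0 mul1r => dec.
by rewrite mulNr expRN ler_pdivlMl ?expR_gt0.
Qed.

Lemma s_cvg_pinfty (A : R) : exists N0, forall N, (N0 <= N)%N -> A <= s N.
Proof.
have [h h0 [hj _]] := s_sep nu1 hs.
have [n hn] := ltr_add_invr (ltr01 : (0 : R) < 1).
pose N0 := Num.truncn (`|A| / h).
exists N0 => N NN; apply: le_trans (hj N).
have : `|A| / h < N0.+1%:R by rewrite truncnS_gt.
rewrite ltr_pdivrMr// mulrC => /ltW hA.
apply: le_trans (ler_norm A) (le_trans hA _).
by rewrite ler_pM2l// ler_nat.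
Qed.

(** The second quantity is, by Green's formula, the Dirichlet energy of the remainder, which
    measures how far the truncated wave is from starting at f. It follows from the first kind of
    estimate by Cauchy-Schwarz. *)
Lemma proj_cvg f e (k : R -> R) eps : radial nu f e k -> f 1 = 0 -> 0 < eps ->
  exists N0, forall N, (N0 <= N)%N ->
  ip (fun x => f x - proj f N x) (fun x => f x - proj f N x) <= eps /\
  ip (fun x => k x - proj k N x) (fun x => f x - proj f N x) <= eps.
Proof.
move=> rf f1 e0; have [cf [ce ck]] := radial_continuous rf.
pose B : R := (`|ip k f| + 1) * (ip k k + 1).
have [N0 hN0] := s_cvg_pinfty (1 + B / eps + B / eps ^+ 2).
have k0 := ip_ge0 nu k.
have B1 : 1 <= B.
  by rewrite /B -[leLHS]mulr1; apply: ler_pM => //; rewrite lerDr.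
have B0 : 0 < B by apply: lt_le_trans B1.
have be : 0 <= B / eps by rewrite divr_ge0// ltW.
have be2 : 0 <= B / eps ^+ 2 by rewrite divr_ge0 ?sqr_ge0// ltW.
exists N0 => N /hN0 hN.
have sN : 0 < s N by exact: s_gt0 hs _.
have s1 : 1 <= s N by lra.
have s2 : s N <= s N ^+ 2 by rewrite expr2 -[leLHS]mul1r ler_pM2r.
have sb1 : B / eps <= s N ^+ 2 by apply: le_trans s2; lra.
have sb2 : B / eps ^+ 2 <= s N ^+ 2 by apply: le_trans s2; lra.
have cp g : continuous (proj g N) by exact: continuous_lcomb.
have cfp : continuous (fun x => f x - proj f N x) by exact: cB.
have ckp : continuous (fun x => k x - proj k N x) by exact: cB.
set D := ip (fun x => f x - proj f N x) (fun x => f x - proj f N x).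
have D0 : 0 <= D by exact: ip_ge0.
have pe : s N ^+ 2 * D <= `|ip k f|.
  exact: le_trans (proj_error nu1 hs N rf f1) (ler_norm _).
have kB : `|ip k f| <= B.
  rewrite /B (le_trans (_ : _ <= `|ip k f| + 1)) ?lerDl// ler_peMr ?lerDr//.
have ekB : ip k k * `|ip k f| <= B.
  by rewrite /B mulrC ler_pM// lerDl.
split.
  have : (B / eps) * D <= B.
    apply: le_trans (le_trans pe kB); exact: ler_wpM2r.
  by rewrite mulrAC ler_pdivrMr// ler_pM2l.
have CS := ip_CS nu1 ckp cfp.
have kp : ip (fun x => k x - proj k N x) (fun x => k x - proj k N x) <= ip k k.
  rewrite (ip_sub_proj nu1 hs)// lerBlDr lerDl.
  by apply: sumr_ge0 => i _; exact: sqr_ge0.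
set Q := ip (fun x => k x - proj k N x) (fun x => f x - proj f N x) in CS *.
have Q2 : Q ^+ 2 <= ip k k * D.
  by apply: (le_trans CS); rewrite ler_wpM2r.
have : (B / eps ^+ 2) * Q ^+ 2 <= B.
  apply: (@le_trans _ _ ((s N ^+ 2) * (ip k k * D))).
    apply: ler_pM; [exact: be2|exact: sqr_ge0|exact: sb2|exact: Q2].
  by rewrite mulrCA; apply: le_trans ekB; rewrite ler_wpM2l.
rewrite mulrAC ler_pdivrMr ?exprn_gt0// ler_pM2l// => h.
exact: sqr_le_le e0 h.
Qed.

Lemma parseval_pair f e (k : R -> R) g eps : radial nu f e k -> f 1 = 0 -> continuous g -> 0 < eps ->
  exists N0, forall N, (N0 <= N)%N -> `|ip f g - \sum_(j < N) fcoef f j * fcoef g j| <= eps.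
Proof.
move=> rf f1 cg e0; have [cf _] := radial_continuous rf.
have g0 := ip_ge0 nu g.
have G0 : 0 < ip g g + 1 by rewrite ltr_wpDl.
have ep : 0 < eps ^+ 2 / (ip g g + 1) by rewrite divr_gt0 ?exprn_gt0.
have [N0 hN0] := proj_cvg rf f1 ep.
exists N0 => N /hN0[h _].
have cp : continuous (proj f N) by exact: continuous_lcomb.
have cfp : continuous (fun x => f x - proj f N x) by exact: cB.
have CS := ip_CS nu1 cfp cg.
move: CS; rewrite {1}ipBl// ip_proj//; set X := ip f g - _ => CS.
have : X ^+ 2 <= eps ^+ 2.
  apply: (le_trans CS); apply: (@le_trans _ _ (eps ^+ 2 / (ip g g + 1) * (ip g g + 1))).
    by apply: ler_pM => //; [exact: ip_ge0|rewrite lerDl].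
  by rewrite mulfVK ?gt_eqF.
rewrite -(real_normK (num_real X)) ler_pXn2r ?nnegrE//; exact: ltW.
Qed.

(* Weighting the energy by [expR (- K x)] and letting K grow kills the interaction of two bumps
   whose distance exceeds the elapsed time, because waves travel at unit speed. *)
Lemma wave_velocity_cvg0 f e (k : R -> R) g (al be T eps : R) : radial nu f e k -> f 1 = 0 -> continuous g ->
  0 <= al -> 0 <= T -> al + T < be ->
  (forall x, 0 < x < be -> f x = 0) -> (forall x, 0 < x -> al <= x -> g x = 0) -> 0 < eps ->
  exists N0, forall N, (N0 <= N)%N -> forall t, 0 <= t <= T ->
    `|\sum_(j < N) s j * sin (t * s j) * (fcoef f j * fcoef g j)| <= eps.
Proof.
move=> rf f1 cg al0 T0 ab fz gz eps0; have [cf [ce ck]] := radial_continuous rf.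
have [df _ _] := rf.
have cI : continuous (fun x : R => x) by exact: cid.
have ez x : 0 < x < be -> x * e x = 0.
  move=> /andP[x0 xb]; have d1 := df x.
  have : is_derive x (1 : R) f 0.
    apply: (near_eq_is_derive (f := fun=> 0) _ (dcst 0 x)).
    near=> y; rewrite fz//; apply/andP; split; near: y; [exact: lt_nbhsr|exact: lt_nbhsl].
  by move=> d2; have [_ <-] := d1; have [_ ->] := d2.
pose Q := wint (fun x => x * e x * (x * e x)).
pose G := ip g g.
have cxe : continuous (fun x => x * e x) by exact: cM.
have Q0 : 0 <= Q by apply: wint_ge0 => x _; rewrite -expr2 sqr_ge0.
have G0 : 0 <= G by exact: ip_ge0.
pose ep2 := eps ^+ 2 / 2.
have ep20 : 0 < ep2 by rewrite divr_gt0 ?exprn_gt0.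
(* Large enough that exp(-K (be - al - T)) brings 2 Q G below ep2, by exp y >= 1 + y. *)
pose K := (2 * Q * G / ep2 + 1) / (be - (al + T)).
have d0 : 0 < be - (al + T) by rewrite subr_gt0.
have K0 : 0 < K by rewrite divr_gt0// ltr_wpDl// !mulr_ge0// invr_ge0 ltW.
have Kbig : 2 * Q * G * expR (- (K * (be - (al + T)))) <= ep2.
  rewrite expRN ler_pdivrMr ?expR_gt0//.
  apply: le_trans (_ : ep2 * (1 + K * (be - (al + T))) <= _); last by rewrite ler_pM2l// expR_ge1Dx.
  rewrite /K divfK ?gt_eqF// mulrDr mulrDr mulrCA divff ?gt_eqF// !mulr1.
  by lra.
(* The truncation error is not localised and meets the full weight exp(K (T + al)); it is made small
   after K has been fixed. *)
pose eta := ep2 / (2 * (G + 1) * expR (K * (T + al))).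
have eta0 : 0 < eta by rewrite divr_gt0// !mulr_gt0 ?expR_gt0// ltr_wpDl.
have [N0 hN0] := proj_cvg rf f1 eta0.
exists N0 => N /hN0[_ QN] t /andP[t0 tT].
pose w x := expR (- K * x).
have cw : continuous w by exact: cexp.
pose V := lcomb nu s (fun j : 'I_N => wave_c f t j).
have cV : continuous V by exact: continuous_lcomb.
rewrite (_ : \sum_(j < N) _ = - ip V g); last first.
  rewrite ip_lcombl// -sumrN; apply: eq_bigr => j _.
  by rewrite /wave_c (ipC nu _ g) /fcoef; ring.
rewrite normrN -(@ler_pXn2r _ 2) ?nnegrE ?(ltW eps0)// real_normK ?num_real//.
have ch c : continuous (fun x : R => expR (c * x)) by exact: cexp.
(* The weight is split as exp(-K x/2) on the velocity and exp(K x/2) on g; the second factor is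
   harmless since g lives on x < al. *)
have CS : ip V g ^+ 2 <= wint (fun x => V x * V x * w x) * wint (fun x => g x * g x * expR (K * x)).
  have c1 : continuous (fun x => V x * expR (- K / 2 * x)) by apply: cM => //; exact: ch.
  have c2 : continuous (fun x => g x * expR (K / 2 * x)) by apply: cM => //; exact: ch.
  have := ip_CS nu1 c1 c2.
  rewrite (_ : ip _ (fun x => g x * expR (K / 2 * x)) = ip V g); last first.
    congr wint; apply/funext => x; rewrite mulrACA -expRD.
    by rewrite (_ : _ + _ = 0) ?expR0 ?mulr1//; lra.
  rewrite (_ : ip (fun x => V x * _) _ = wint (fun x => V x * V x * w x)); last first.
    by congr wint; apply/funext => x; rewrite mulrACA -expRD; congr (_ * expR _); lra.
  rewrite (_ : ip (fun x => g x * _) _ = wint (fun x => g x * g x * expR (K * x)))//.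
  by congr wint; apply/funext => x; rewrite mulrACA -expRD; congr (_ * expR _); lra.
have B1 : wint (fun x => g x * g x * expR (K * x)) <= expR (K * al) * G.
  rewrite /G /ip -wintZ; [|exact: nu1|exact: cM]; apply: le_wint => //.
  - by apply: cM; [exact: cM|exact: ch].
  - by apply: cM; [exact: ccst|exact: cM].
  move=> x /andP[x0 x1]; rewrite mulrC; have [ax|xa] := leP al x.
    by rewrite gz// !mulr0.
  by rewrite ler_wpM2r -?expr2 ?sqr_ge0// ler_expR ler_pM2l// ltW.
have E0 : 0 <= wenergy (- K) f N 0.
  by apply: addr_ge0; apply: wint_ge0 => x _; rewrite mulr_ge0 ?expR_ge0// -expr2 sqr_ge0.
have B2 : wint (fun x => V x * V x * w x) <= expR (K * T) * wenergy (- K) f N 0.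
  apply: (@le_trans _ _ (wenergy (- K) f N t)).
    rewrite /wenergy lerDl; apply: wint_ge0 => x _.
    by rewrite mulr_ge0 ?expR_ge0// -expr2 sqr_ge0.
  apply: (le_trans (wenergy_exp_mono _ _ _ _)) => //; first by rewrite oppr_lt0.
  rewrite opprK; apply: ler_wpM2r; first exact: E0.
  by rewrite ler_expR ler_pM2l.
(* The initial energy is that of f, which lives on x >= be and carries exp(-K be), plus that of the
   remainder f - proj f. *)
have B3 : wenergy (- K) f N 0 <= 2 * expR (- K * be) * Q + 2 * eta.
  have [cF [cE _]] := radial_continuous (radial_sub_proj nu1 hs N rf f1).
  pose D x := e x - lcomb' nu s (fun j : 'I_N => fcoef f j) x.
  have cxD : continuous (fun x => x * D x) by exact: cM.
  have QN' : wint (fun x => x * D x * (x * D x)) <= eta.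
    apply: le_trans QN.
    have z : f 1 - proj f N 1 = 0 by rewrite f1 [proj f N 1](lcomb1 nu1 hs) subr0.
    rewrite (radial_green nu1 (radial_sub_proj nu1 hs N rf f1) (radial_sub_proj nu1 hs N rf f1) z).
    by rewrite le_eqVlt; apply/orP; left; apply/eqP; congr wint; apply/funext => x; rewrite /D; ring.
  rewrite /wenergy [X in X + _](_ : _ = 0) ?add0r; last first.
    rewrite (_ : (fun x => _) = fun=> 0); last first.
      apply/funext => x; rewrite big1 ?mul0r// => j _.
      by rewrite /wave_c mul0r sin0 mulr0 oppr0 !mul0r.
    exact: wint0.
  rewrite (_ : wint _ = wint (fun x => (x * e x - x * D x) * (x * e x - x * D x) * w x)); last first.
    congr wint; apply/funext => x; congr (_ * _).
    suff -> : \sum_(j < N) wave_d f 0 j * (x * ev' j x) = x * e x - x * D x by [].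
    rewrite -mulrBr /D opprB addrC subrK /lcomb' mulr_sumr; apply: eq_bigr => j _.
    by rewrite /wave_d mul0r cos0 mul1r mulrCA.
  apply: (@le_trans _ _ (wint (fun x => 2 * expR (- K * be) * (x * e x * (x * e x)) + 2 * (x * D x * (x * D x))))); last first.
    rewrite wintD//; [|apply: cM; [exact: ccst|exact: cM]|apply: cM; [exact: ccst|exact: cM]].
    rewrite !wintZ//; try exact: cM.
    by rewrite lerD2l ler_pM2l.
  apply: le_wint => //.
  - by apply: cM => //; apply: cM; exact: cB.
  - by apply: cD; apply: cM; [exact: ccst|exact: cM|exact: ccst|exact: cM].
  move=> x /andP[x0 x1].
  have w1 : w x <= 1 by rewrite /w -[leRHS]expR0 ler_expR mulNr oppr_le0 mulr_ge0// ltW.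
  have w0 : 0 < w x by exact: expR_gt0.
  have [xb|bx] := ltP x be.
    rewrite ez ?x0// mulr0 mulr0 !add0r; set X := x * D x.
    have : 0 <= X * X by rewrite -expr2 sqr_ge0.
    by rewrite mulrNN => X0; clear -X0 w1; nra.
  have wb : w x <= expR (- K * be) by rewrite /w ler_expR !mulNr lerN2 ler_pM2l.
  set X := x * D x; set Y := x * e x.
  apply: (@le_trans _ _ ((2 * (Y * Y) + 2 * (X * X)) * w x)).
    rewrite ler_pM2r// -subr_ge0 (_ : _ - _ = (X + Y) ^+ 2) ?sqr_ge0//; ring.
  rewrite mulrDl; apply: lerD.
    by rewrite mulrAC; apply: ler_wpM2r; [rewrite -expr2 sqr_ge0|rewrite ler_pM2l].
  by rewrite -[leRHS]mulr1 ler_wpM2l// mulr_ge0// -expr2 sqr_ge0.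
apply: (le_trans CS).
apply: (@le_trans _ _ (expR (K * T) * (2 * expR (- K * be) * Q + 2 * eta) * (expR (K * al) * G))).
  apply: ler_pM => //.
  - by apply: wint_ge0 => x _; rewrite mulr_ge0 ?expR_ge0// -expr2 sqr_ge0.
  - by apply: wint_ge0 => x _; rewrite mulr_ge0 ?expR_ge0// -expr2 sqr_ge0.
  - by apply: (le_trans B2); rewrite ler_pM2l ?expR_gt0.
have -> : expR (K * T) * (2 * expR (- K * be) * Q + 2 * eta) * (expR (K * al) * G) =
    2 * Q * G * (expR (K * T) * expR (- K * be) * expR (K * al)) +
    2 * eta * G * (expR (K * T) * expR (K * al)) by ring.
rewrite -!expRD (_ : K * T + - K * be + K * al = - (K * (be - (al + T)))); last by ring.
rewrite -mulrDr.
have : 2 * eta * G * expR (K * (T + al)) <= ep2.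
  rewrite /eta; set X := expR _; have X0 : 0 < X by exact: expR_gt0.
  have -> : 2 * (ep2 / (2 * (G + 1) * X)) * G * X = ep2 * (G / (G + 1)).
    have G1 : G + 1 != 0 by rewrite gt_eqF// ltr_wpDl.
    by field; rewrite G1 gt_eqF.
  by rewrite -[leRHS]mulr1 ler_pM2l// ler_pdivrMr ?ltr_wpDl// mul1r lerDl.
by rewrite /ep2 in Kbig *; clear -Kbig; lra.
Unshelve. all: by end_near. Qed.

(** At t = 0 the sum is close to (f, g) = 0 by Parseval, and its t-derivative is, up to sign, the
    sum bounded in [wave_velocity_cvg0]. The detour through the velocity is needed because the
    energy controls derivatives of the wave. The partial sums become small for large N, uniformly in
    t. *)
Lemma finite_speed f e (k : R -> R) g (al be T eps : R) : radial nu f e k -> f 1 = 0 -> continuous g ->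
  0 <= al -> 0 <= T -> al + T < be ->
  (forall x, 0 < x < be -> f x = 0) -> (forall x, 0 < x -> al <= x -> g x = 0) -> 0 < eps ->
  exists N0, forall N, (N0 <= N)%N -> forall t, `|t| <= T ->
    `|\sum_(j < N) cos (t * s j) * (fcoef f j * fcoef g j)| <= eps.
Proof.
move=> rf f1 cg al0 T0 ab fz gz eps0.
have fg0 : ip f g = 0.
  rewrite (_ : ip f g = wint (fun=> 0)); last first.
    apply: eq_wint => x /andP[x0 _]; have [xa|ax] := ltP x be; first by rewrite fz ?mul0r// x0.
    by rewrite gz ?mulr0//; lra.
  exact: wint0.
have ep1 : 0 < eps / (2 * (T + 1)) by rewrite divr_gt0// mulr_gt0// ltr_wpDl.
have ep2 : 0 < eps / 2 by rewrite divr_gt0.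
have [N1 h1] := wave_velocity_cvg0 rf f1 cg al0 T0 ab fz gz ep1.
have [N2 h2] := parseval_pair rf f1 cg ep2.
exists (maxn N1 N2) => N; rewrite geq_max => /andP[/h1{}h1 /h2{}h2].
suff main t : 0 <= t <= T -> `|\sum_(j < N) cos (t * s j) * (fcoef f j * fcoef g j)| <= eps.
  move=> t tT; have [t0|t0] := leP 0 t; first by apply: main; rewrite t0 -(ger0_norm t0).
  have := main (- t); rewrite oppr_ge0 (ltW t0) -(ltr0_norm t0) => /(_ tT).
  rewrite ltr0_norm//.
  by under eq_bigr do rewrite mulNr cosN.
move=> /andP[t0 tT].
pose C u := \sum_(j < N) cos (u * s j) * (fcoef f j * fcoef g j).
have dC u : is_derive u (1 : R) C (- \sum_(j < N) s j * sin (u * s j) * (fcoef f j * fcoef g j)).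
  apply: dE (dsum (fun j : 'I_N => dM (dcomp (dM (did u) (dcst (s j) u)) (is_derive_cos _))
    (dcst (fcoef f j * fcoef g j) u))) _.
  by rewrite -sumrN; apply: eq_bigr => j _; ring.
have [c /andP[c0 ct]] := MVT_le t0 (fun x _ => dC x).
rewrite subr0 => e1.
have b1 : `|C t - C 0| <= eps / 2.
  rewrite e1 normrM normrN (ger0_norm t0).
  apply: (@le_trans _ _ (eps / (2 * (T + 1)) * (T + 1))).
    apply: ler_pM => //; last by lra.
    by apply: h1; rewrite c0 (le_trans ct).
  by rewrite le_eqVlt; apply/orP; left; apply/eqP; field; rewrite gt_eqF// ltr_wpDl.
have b2 : `|C 0| <= eps / 2.
  move: h2; rewrite fg0 sub0r normrN /C.
  by under [X in _ -> `|X| <= _]eq_bigr do rewrite mul0r cos0 mul1r.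
have -> : \sum_(j < N) cos (t * s j) * (fcoef f j * fcoef g j) = (C t - C 0) + C 0 by rewrite subrK.
by apply: (le_trans (ler_normD _ _)); lra.
Qed.

End Propagation.

(** * Approximation of the Riesz symbol *)

Section ExponentialType.
Variable R : realType.
Implicit Types (G : R -> R) (L t x : R).

(* [etype L G]: G is a superposition of the functions cos (t x) with |t| <= L, expressed by duality. *)
Definition etype L G : Prop := exists2 C, 0 <= C &
  forall n (sg c : 'I_n -> R) eps,
    (forall t, `|t| <= L -> `|\sum_(i < n) cos (t * sg i) * c i| <= eps) ->
    `|\sum_(i < n) G (sg i) * c i| <= C * eps.

Definition sinc x : R := if x == 0 then 1 else sin x / x.

Lemma etype1 L : 0 <= L -> etype L (fun=> 1).
Proof.
move=> L0; exists 1 => // n sg c eps h; rewrite mul1r.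
apply: le_trans (h 0 _); rewrite ?normr0//.
by rewrite le_eqVlt; apply/orP; left; apply/eqP; congr `|_|; apply: eq_bigr => i _; rewrite mul0r cos0.
Qed.

Lemma etypeW L L' G : L <= L' -> etype L G -> etype L' G.
Proof.
move=> LL [C C0 h]; exists C => // n sg c eps hc; apply: h => t tL.
by apply: hc; exact: le_trans LL.
Qed.

Lemma etypeZ k L G : etype L G -> etype L (fun x => k * G x).
Proof.
move=> [C C0 h]; exists (`|k| * C); first by rewrite mulr_ge0.
move=> n sg c eps hc; rewrite (_ : \sum_(i < n) _ = k * \sum_(i < n) G (sg i) * c i).
  by rewrite normrM -mulrA ler_wpM2l// h.
by rewrite mulr_sumr; apply: eq_bigr => i _; rewrite mulrA.
Qed.

Lemma etypeD L G H : etype L G -> etype L H -> etype L (fun x => G x + H x).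
Proof.
move=> [C C0 h] [D D0 k]; exists (C + D); first by rewrite addr_ge0.
move=> n sg c eps hc; rewrite (_ : \sum_(i < n) _ = \sum_(i < n) G (sg i) * c i + \sum_(i < n) H (sg i) * c i).
  by rewrite mulrDl (le_trans (ler_normD _ _))// lerD// ?h ?k.
by rewrite -big_split/=; apply: eq_bigr => i _; rewrite mulrDl.
Qed.

Lemma etype_sum L m (G : 'I_m -> R -> R) : 0 <= L -> (forall i, etype L (G i)) ->
  etype L (fun x => \sum_(i < m) G i x).
Proof.
move=> L0; elim: m G => [|m IHm] G h.
  have := etypeZ 0 (etype1 L0); congr etype; apply/funext => x.
  by rewrite big_ord0 mul0r.
have := etypeD (IHm _ (fun i => h (widen_ord (leqnSn m) i))) (h ord_max).
by congr etype; apply/funext => x; rewrite big_ord_recr.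
Qed.

Lemma etype_scale a L G : 0 <= a -> etype L G -> etype (a * L) (fun x => G (a * x)).
Proof.
move=> a0 [C C0 h]; exists C => // n sg c eps hc.
apply: (h n (fun i => a * sg i)) => t tL.
have := hc (t * a); rewrite normrM (ger0_norm a0) mulrC ler_wpM2l// => /(_ isT).
by under eq_bigr do rewrite -mulrA.
Qed.

(** sinc x is the mean of cos(u x) over 0 <= u <= 1. For the finite sum at hand the mean value
    theorem supplies one u = e that realises the mean, and cos a cos b as a half sum shifts t by at
    most 1, whence the type L + 1. *)
Lemma etype_sinc L G : etype L G -> etype (L + 1) (fun x => G x * sinc x).
Proof.
move=> [C C0 h]; exists C => // n sg c eps hc.
(* The primitive in u of cos(u x) is sin(u x)/x, and u when x = 0. *)
pose F (u : R) := \sum_(i < n) (if sg i == 0 then u else sin (u * sg i) / sg i) * (G (sg i) * c i).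
pose f (u : R) := \sum_(i < n) cos (u * sg i) * (G (sg i) * c i).
have dF u : is_derive u (1 : R) F (f u).
  apply: dsum => i; have [->|i0] := eqVneq (sg i) 0.
    by apply: dE (dM (did u) (dcst (G 0 * c i) u)) _; rewrite !mulr0 cos0 addr0.
  apply: dE (dM (dM (dcomp (dM (did u) (dcst (sg i) u)) (is_derive_sin _)) (dcst (sg i)^-1 u))
    (dcst (G (sg i) * c i) u)) _.
  by field.
have [e /andP[e0 e1] eq] := MVT_le ler01 (fun x _ => dF x).
have F0 : F 0 = 0.
  rewrite /F big1// => i _; case: eqP => // _; rewrite ?mul0r// sin0 !mul0r//.
have F1 : F 1 = \sum_(i < n) G (sg i) * sinc (sg i) * c i.
  apply: eq_bigr => i _; rewrite /sinc mul1r; case: eqP => _; ring.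
rewrite -F1; move: eq; rewrite F0 subr0 subr0 mulr1 => ->.
rewrite /f (_ : \sum_(i < n) _ = \sum_(i < n) G (sg i) * (cos (e * sg i) * c i)); last first.
  by apply: eq_bigr => i _; ring.
apply: h => t tL.
rewrite (_ : \sum_(i < n) _ = 2^-1 * (\sum_(i < n) cos ((t + e) * sg i) * c i +
   \sum_(i < n) cos ((t - e) * sg i) * c i)); last first.
  rewrite -big_split/= mulr_sumr; apply: eq_bigr => i _.
  by rewrite mulrDl mulrBl cosD cosB; field.
have b u : `|u| <= 1 -> `|\sum_(i < n) cos ((t + u) * sg i) * c i| <= eps.
  by move=> u1; apply: hc; apply: le_trans (ler_normD _ _) _; rewrite lerD.
have b1 := b e; have b2 := b (- e).
rewrite normrM ger0_norm//.
have e1' : `|e| <= 1 by rewrite ger0_norm.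
rewrite normrN in b2.
have := ler_normD (\sum_(i < n) cos ((t + e) * sg i) * c i) (\sum_(i < n) cos ((t - e) * sg i) * c i).
move: (b1 e1') (b2 e1'); set X := `|_|; set Y := `|_|; set Z := `|_|.
by lra.
Qed.

Lemma etype_sincX n : etype n%:R (fun x => sinc x ^+ n).
Proof.
elim: n => [|n IHn]; first by have := etype1 (lexx 0); congr etype; apply/funext => x; rewrite expr0.
have := etype_sinc IHn; rewrite natr1; congr etype; apply/funext => x.
by rewrite exprSr.
Qed.

Lemma sinc0 : sinc 0 = 1. Proof. by rewrite /sinc eqxx. Qed.

Lemma mul_sinc x : x * sinc x = sin x.
Proof. by rewrite /sinc; case: eqP => [->|/eqP x0]; [rewrite sin0 mul0r|rewrite mulrCA mulfV// mulr1]. Qed.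

Lemma sincN x : sinc (- x) = sinc x.
Proof. by rewrite /sinc oppr_eq0 sinN invrN mulrNN. Qed.

Lemma norm_sinc_le x : (1 + `|x|) * `|sinc x| <= 2.
Proof.
have h1 : `|x| * `|sinc x| <= 1 by rewrite -normrM mul_sinc sin_max.
suff : `|sinc x| <= 1 by lra.
wlog x0 : x h1 / 0 <= x.
  move=> H; have [/H|/ltW xn] := leP 0 x; first exact.
  by have := H (- x); rewrite sincN normrN oppr_ge0; apply.
move: x0; rewrite le_eqVlt => /predU1P[<-|x0]; first by rewrite sinc0 normr1.
have [c _] := MVT_le (ltW x0) (fun y _ => is_derive_sin y).
rewrite sin0 !subr0 => e; have : x * `|sinc x| <= x * 1.
  rewrite -{1}(gtr0_norm x0) -normrM mul_sinc e normrM (gtr0_norm x0) mulrC ler_pM2l//.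
  exact: cos_max.
by rewrite ler_pM2l.
Qed.

Lemma continuous_sinc : continuous sinc.
Proof.
move=> x; have [->|x0] := eqVneq x 0; last first.
  have : (fun y => sin y / y) y @[y --> x] --> sin x / x.
    by apply: cvgM; [exact: continuous_sin|exact: cvgV].
  rewrite /continuous_at /sinc (negbTE x0); apply: cvg_trans; apply: near_eq_cvg.
  by near=> y; rewrite ifF//; apply/negbTE; near: y; exact: (cvgr_neq0 _ (@cvg_id _ _)).
rewrite /continuous_at sinc0.
apply/cvgrPdist_le => /= eps e0.
have [dsin esin] : is_derive (0 : R) 1 sin (cos 0) by exact: is_derive_sin.
move: dsin => /cvg_ex[/= l hl].
have := cvg_lim (@norm_hausdorff _ _) hl.
rewrite -/(derive sin 0 1) esin cos0 => l1; rewrite -l1 in hl.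
move/cvgrPdist_le : hl => /(_ _ e0) /nbhs_ballP[r /= r0 hr].
apply/nbhs_ballP; exists r => //= y yr.
have [->|y0] := eqVneq y 0; first by rewrite sinc0 subrr normr0 ltW.
have := hr y yr y0.
by rewrite /GRing.scale/= mulr1 addr0 sin0 subr0 /sinc (negbTE y0) mulrC.
Unshelve. all: by end_near. Qed.

End ExponentialType.

(** * Iterated finite differences *)

Section Differences.
Variable R : realType.
Implicit Types (f g : R -> R) (x y u : R).

Fixpoint fdiff f r x u : R := if r is r'.+1 then fdiff f r' x u - fdiff f r' (x + u) u else f x.

(** The coefficient c 0 = 1 belongs to the untranslated value: it is what lets [approximant_of]
    recover the symbol itself from an averaged r-th difference. *)
Lemma fdiff_expand r : exists c : nat -> R, [/\ c 0%N = 1, forall i, (r < i)%N -> c i = 0 &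
  forall f x u, fdiff f r x u = \sum_(i < r.+1) c i * f (x + i%:R * u)].
Proof.
elim: r => [|r [c [c0 cr cf]]].
  exists (fun i => (i == 0%N)%:R); split => //; first by case.
  by move=> f x u; rewrite big_ord_recl big_ord0 /= mul0r !addr0 mul1r.
exists (fun i => c i - (if i is j.+1 then c j else 0)); split.
- by rewrite subr0.
- by case=> // i ri; rewrite !cr ?subrr// ltnW.
move=> f x u /=; rewrite !cf.
under [RHS]eq_bigr do rewrite mulrBl.
rewrite sumrB; congr (_ - _).
  by rewrite [RHS]big_ord_recr/= cr// mul0r addr0.
rewrite [RHS]big_ord_recl/= mul0r add0r; apply: eq_bigr => i _.
by rewrite /bump/= add1n -natr1 mulrDl mul1r addrA [x + u + _]addrAC.
Qed.

Lemma fdiff_eq f g r x u : (forall i, (i <= r)%N -> f (x + i%:R * u) = g (x + i%:R * u)) ->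
  fdiff f r x u = fdiff g r x u.
Proof.
have [c [_ _ cf]] := fdiff_expand r; move=> h; rewrite !cf; apply: eq_bigr => i _.
by rewrite h// -ltnS.
Qed.

Lemma fdiff_le f r x u B : (forall i, (i <= r)%N -> `|f (x + i%:R * u)| <= B) ->
  `|fdiff f r x u| <= 2 ^+ r * B.
Proof.
elim: r x => [|r IHr] x h /=; first by have := h 0%N isT; rewrite mul0r addr0 mul1r.
apply: le_trans (ler_normB _ _) _; rewrite exprS -mulrA mulr_natl mulr2n lerD//.
  by apply: IHr => i ir; apply: h; exact: leqW.
apply: IHr => i ir; have := h i.+1 ir.
by rewrite -natr1 mulrDl mul1r addrA [x + _ + u]addrAC.
Qed.

Lemma is_derive_fdiff f f' r x u :
  (forall i, (i <= r)%N -> is_derive (x + i%:R * u) 1 f (f' (x + i%:R * u))) ->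
  is_derive x 1 (fun y => fdiff f r y u) (fdiff f' r x u).
Proof.
elim: r x => [|r IHr] x h; first by have := h 0%N isT; rewrite mul0r addr0.
apply: dB; first by apply: IHr => i ir; apply: h; exact: leqW.
apply: dE (dcomp (f := fun y => fdiff f r y u) (dD (did x) (dcst u x)) (IHr _ _)) _ => [i ir|].
  have := h i.+1 ir.
  by rewrite -natr1 mulrDl mul1r addrA [x + _ + u]addrAC.
by rewrite addr0 mulr1.
Qed.

Lemma MVT_between f f' x u B :
  (forall y, Num.min x (x + u) <= y <= Num.max x (x + u) -> is_derive y 1 f (f' y) /\ `|f' y| <= B) ->
  `|f x - f (x + u)| <= `|u| * B.
Proof.
move=> h; have [u0|u0] := leP 0 u.
  have xu : x <= x + u by rewrite lerDl.
  rewrite (min_idPl xu) (max_idPr xu) in h.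
  have [c cu e] := MVT_le xu (fun y hy => (h y hy).1).
  rewrite distrC e normrM mulrC [x + u]addrC addrK ler_wpM2l//.
  by have [] := h c cu.
have xu : x + u <= x by rewrite gerDl ltW.
rewrite (min_idPr xu) (max_idPl xu) in h.
have [c cu e] := MVT_le xu (fun y hy => (h y hy).1).
rewrite e normrM mulrC opprD addrA subrr sub0r normrN ler_wpM2l//.
by have [] := h c cu.
Qed.

(** [F] lists successive derivatives; each difference is traded for a factor |u| and one derivative.
    All nodes lie between the two end points that are assumed to be in [a, b]. *)
Lemma fdiff_smooth (F : nat -> R -> R) r k x u a b B :
  (forall i y, (i < k + r)%N -> a <= y <= b -> is_derive y (1 : R) (F i) (F i.+1 y)) ->
  (forall y, a <= y <= b -> `|F (k + r)%N y| <= B) ->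
  a <= x <= b -> a <= x + r%:R * u <= b -> `|fdiff (F k) r x u| <= `|u| ^+ r * B.
Proof.
elim: r k x => [|r IHr] k x dF hB /andP[ax xb].
  by move=> _ /=; rewrite mul1r; have := hB x; rewrite addn0 ax; apply.
rewrite -natr1 mulrDl mul1r => /andP[au ub].
rewrite /= exprS -mulrA; apply: (@MVT_between (fun y => fdiff (F k) r y u) (fdiff (F k.+1) r ^~ u)).
move=> y; rewrite ge_min le_max => yxu.
have r0 : 0 <= r%:R :> R by [].
have yab i : (i <= r)%N -> a <= y + i%:R * u <= b.
  move=> ir; have ir' : i%:R <= r%:R :> R by rewrite ler_nat.
  have i0 : 0 <= i%:R :> R by [].
  have [u0|u0] := leP 0 u.
    have iu : 0 <= i%:R * u by rewrite mulr_ge0.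
    have iru : i%:R * u <= r%:R * u by rewrite ler_wpM2r.
    by move: yxu => /andP[/orP[h1|h1] /orP[h2|h2]]; clear -u0 h1 h2 iu iru ax xb au ub; apply/andP; split; lra.
  have iu : i%:R * u <= 0 by rewrite mulr_ge0_le0// ltW.
  have iru : r%:R * u <= i%:R * u by rewrite ler_wnM2r// ltW.
  by move: yxu => /andP[/orP[h1|h1] /orP[h2|h2]]; clear -u0 h1 h2 iu iru ax xb au ub; apply/andP; split; lra.
split.
  apply: is_derive_fdiff => i ir; apply: dF; last exact: yab.
  by rewrite -[X in (X < _)%N]addn0 ltn_add2l.
apply: IHr => //.
- by move=> i z ik; apply: dF; move: ik; rewrite addSnnS.
- by move=> z; rewrite addSnnS; exact: hB.
- by have := yab 0%N isT; rewrite mul0r addr0.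
- exact: yab.
Qed.

End Differences.

(** * The Riesz symbol and its finite differences *)

Section Symbol.
Variables (R : realType) (de : R).
Hypothesis de0 : 0 < de.
Implicit Types (x y u : R).

Definition msym x : R := Num.max 0 (1 - x ^+ 2) `^ de.

Lemma msym_ge0 x : 0 <= msym x. Proof. exact: powR_ge0. Qed.

Lemma msymN x : msym (- x) = msym x. Proof. by rewrite /msym sqrrN. Qed.

Lemma msym_out x : 1 <= `|x| -> msym x = 0.
Proof.
move=> x1; rewrite /msym (max_idPl _) ?powR0 ?gt_eqF// subr_le0.
by rewrite -(real_normK (num_real x)) exprn_ege1.
Qed.

Lemma msym_in x : `|x| <= 1 -> msym x = (1 - x ^+ 2) `^ de.
Proof.
move=> x1; rewrite /msym (max_idPr _)// subr_ge0.
by rewrite -(real_normK (num_real x)) exprn_ile1.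
Qed.

Lemma msym_le1 x : msym x <= 1.
Proof.
have [x1|/ltW x1] := leP 1 `|x|; first by rewrite msym_out.
have e1 : (1 : R) `^ de = 1 by rewrite powR1.
rewrite msym_in// -[leRHS]e1; apply: ge0_ler_powR; rewrite ?nnegrE ?(ltW de0)//.
  by rewrite subr_ge0 -(real_normK (num_real x)) exprn_ile1.
by rewrite gerBl sqr_ge0.
Qed.

Lemma msym_le x : msym x <= (2 * `|1 - `|x| |) `^ de.
Proof.
have [x1|x1] := leP 1 `|x|; first by rewrite msym_out// powR_ge0.
rewrite msym_in ?(ltW x1)//; apply: ge0_ler_powR; rewrite ?nnegrE ?(ltW de0)//.
  by rewrite subr_ge0 -(real_normK (num_real x)) exprn_ile1// ltW.
rewrite -(real_normK (num_real x)) (@ger0_norm _ (1 - `|x|)) ?subr_ge0 ?(ltW x1)//.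
by have := normr_ge0 x; nra.
Qed.

Lemma continuous_pospowR : continuous (fun y : R => Num.max 0 y `^ de).
Proof.
move=> x; have [x0|x0] := ltP 0 x.
  have : (fun y : R => y `^ de) y @[y --> x] --> Num.max 0 x `^ de.
    by rewrite (max_idPr (ltW x0)); exact: continuous_powR_pos.
  apply: cvg_trans; apply: near_eq_cvg; near=> y.
  by rewrite (max_idPr _)// ltW//; near: y; exact: lt_nbhsr.
rewrite /continuous_at (max_idPl x0) powR0 ?gt_eqF//.
apply/cvgrPdist_lt => /= eps e0.
have e1 : 0 < eps `^ de^-1 by rewrite powR_gt0.
near=> y; rewrite sub0r normrN ger0_norm ?powR_ge0//.
have -> : eps = (eps `^ de^-1) `^ de by rewrite -powRrM mulVf ?gt_eqF// powRr1 ?ltW.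
apply: gt0_ltr_powR; rewrite ?nnegrE ?le_max ?lexx ?(ltW e1)//.
by rewrite gt_max e1/=; near: y; apply: lt_nbhsl; exact: le_lt_trans e1.
Unshelve. all: by end_near. Qed.

Lemma continuous_msym : continuous msym.
Proof.
apply: (ccomp continuous_pospowR); apply: cB; first exact: ccst.
by apply: cX; exact: cid.
Qed.

(** The polynomial factor left in the k-th derivative of (1 - x^2)^de on |x| < 1 when (1 - x^2)^(de
    - k) is split off. *)
Fixpoint mpoly k : {poly R} := if k is k'.+1 then
  (mpoly k')^`() * (1 - 'X ^+ 2) - (2 * (de - k'%:R)) *: ('X * mpoly k') else 1.

Definition mder k x : R := (mpoly k).[x] * (1 - x ^+ 2) `^ (de - k%:R).

Lemma mder0 x : mder 0 x = (1 - x ^+ 2) `^ de.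
Proof. by rewrite /mder subr0 (_ : mpoly 0 = 1%:P)// hornerC mul1r. Qed.

Lemma is_derive_mder k x : `|x| < 1 -> is_derive x 1 (mder k) (mder k.+1 x).
Proof.
move=> x1; have x2 : 0 < 1 - x ^+ 2.
  by rewrite subr_gt0 -(real_normK (num_real x)) exprn_ilt1.
have d1 : is_derive x (1 : R) (fun y => (1 - y ^+ 2) `^ (de - k%:R))
    (((de - k%:R) * (1 - x ^+ 2) `^ (de - k%:R - 1)) * (0 - 2%:R * x ^+ 1 * 1)).
  exact: dcomp (dB (dcst 1 x) (dX 2 (did x))) (dpowR (de - k%:R) x2).
apply: dE (dM (is_derive_poly (mpoly k) x) d1) _.
have e : de - k.+1%:R = de - k%:R - 1 by rewrite -natr1 opprD addrA.
have h1 : (1 - 'X ^+ 2 : {poly R}).[x] = 1 - x ^+ 2 by rewrite !hornerE.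
rewrite /mder e (powR_pred _ x2) [mpoly k.+1]/= hornerD hornerN hornerM h1 hornerZ hornerM hornerX.
by field; rewrite gt_eqF.
Qed.

Lemma mder_bound k : exists2 C, 0 < C & forall d x : R, 0 < d -> de <= k%:R -> d <= 1 - `|x| ->
  `|mder k x| <= C * d `^ (de - k%:R).
Proof.
have ch : continuous (horner (mpoly k)) by exact: continuous_horner.
have [C [C0 hC]] := continuous_bounded_itv (-1) 1 ch.
exists C => // d x d0 dk dx; rewrite /mder normrM (ger0_norm (powR_ge0 _ _)).
have x1 : `|x| <= 1 by lra.
apply: ler_pM; [exact: normr_ge0|exact: powR_ge0|by apply: hC; rewrite -ler_norml|].
have d2 : d <= 1 - x ^+ 2.
  rewrite -(real_normK (num_real x)); apply: (le_trans dx); rewrite lerD2l lerN2.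
  by rewrite expr2 ler_piMr.
have d3 : 0 < 1 - x ^+ 2 by exact: lt_le_trans d2.
rewrite -[de - k%:R]opprB !powRN lef_pV2 ?posrE ?powR_gt0//.
by apply: ge0_ler_powR; rewrite ?nnegrE ?(ltW d0) ?(ltW d3)// subr_ge0.
Qed.

(* Far from |x| = 1, at scale |u|, use r derivatives; otherwise use the Hoelder-type bound [msym_le]. *)
Lemma fdiff_msym r : (0 < r)%N -> de <= r%:R -> exists2 C, 0 < C &
  forall A x w : R, 1 <= A -> `|fdiff msym r x (w / A)| <=
    C * A `^ (- de) * (1 + A * `|1 - `|x| |) `^ (de - r%:R) * (1 + `|w|) ^+ r.
Proof.
move=> r0 der; have [K K0 hK] := mder_bound r.
pose D := r%:R : R; have D1 : 1 <= D by rewrite ler1n.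
pose C1 := 2 ^+ r * ((6 * D) `^ de * (3 * D) `^ (D - de)).
pose C2 := 2 ^+ r * (8 `^ de * 2 `^ (D - de)).
pose C3 := K * (2^-1 `^ (de - D)) * 2 `^ (D - de).
have C10 : 0 < C1 by rewrite !mulr_gt0 ?powR_gt0 ?exprn_gt0//; lra.
have C20 : 0 < C2 by rewrite !mulr_gt0 ?powR_gt0 ?exprn_gt0//; lra.
have C30 : 0 < C3 by rewrite !mulr_gt0 ?powR_gt0 ?exprn_gt0//; lra.
exists (C1 + C2 + C3); first by rewrite !addr_gt0.
move=> A x w A1; set d := `|1 - _|; have d0 : 0 <= d by exact: normr_ge0.
have A0 : 0 < A by exact: lt_le_trans A1.
have Dd : 0 <= D - de by rewrite subr_ge0.
have w0 : 0 <= `|w| by exact: normr_ge0.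
have D0 : 0 <= D by lra.
have Dw0 : 0 <= D * `|w| / A by rewrite divr_ge0 ?(ltW A0)// mulr_ge0.
have Ad0 : 0 <= A * d by rewrite mulr_ge0// ltW.
set X := A `^ (- de) * (1 + A * d) `^ (de - D) * (1 + `|w|) ^+ r.
have X0 : 0 <= X by rewrite !mulr_ge0 ?powR_ge0// exprn_ge0// addr_ge0.
(* Three regimes, d being the distance of |x| to 1: the step may reach the singular points, A d <= 2
   r |w|; x is within 1/A of them; or all nodes keep the distance d/2 from them and derivatives can
   be used. *)
suff : [\/ `|fdiff msym r x (w / A)| <= C1 * X, `|fdiff msym r x (w / A)| <= C2 * X |
            `|fdiff msym r x (w / A)| <= C3 * X].
  have := mulr_ge0 (ltW C10) X0; have := mulr_ge0 (ltW C20) X0; have := mulr_ge0 (ltW C30) X0.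
  have -> : (C1 + C2 + C3) * A `^ (- de) * (1 + A * d) `^ (de - r%:R) * (1 + `|w|) ^+ r = C1 * X + C2 * X + C3 * X.
    by rewrite /X -/D; ring.
  by clear; move=> ? ? ? [] ?; lra.
have crude i : (i <= r)%N -> msym (x + i%:R * (w / A)) <= (2 * (d + D * `|w| / A)) `^ de.
  move=> ir; apply: (le_trans (msym_le _)); apply: ge0_ler_powR; rewrite ?nnegrE ?(ltW de0) ?mulr_ge0//.
    exact: addr_ge0.
  rewrite ler_pM2l//.
  have : `| (1 - `|x + i%:R * (w / A)|) - (1 - `|x|) | <= `|i%:R * (w / A)|.
    rewrite opprB addrC addrA subrK distrC.
    by apply: le_trans (ler_dist_dist _ _) _; rewrite addrAC subrr add0r.
  rewrite normrM normrM normfV (gtr0_norm A0) normr_nat => h.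
  have h2 : i%:R * (`|w| / A) <= D * `|w| / A.
    by rewrite mulrA ler_pM2r ?invr_gt0// ler_wpM2r// ler_nat.
  have := ler_normD (1 - `|x|) ((1 - `|x + i%:R * (w / A)|) - (1 - `|x|)).
  by rewrite [_ + (_ - _)]addrC subrK -/d; lra.
have AdeE : A `^ (- de) = (A^-1) `^ de by rewrite -(powR_inv1 (ltW A0)) -powRrM mulN1r.
have far : A * d <= 2 * D * `|w| -> `|fdiff msym r x (w / A)| <= C1 * X.
  move=> hd; apply: (le_trans (fdiff_le (B := (6 * D * ((1 + `|w|) / A)) `^ de) _)).
    move=> i ir; rewrite ger0_norm ?msym_ge0//; apply: (le_trans (crude i ir)).
    apply: ge0_ler_powR; rewrite ?nnegrE ?(ltW de0)//.
    - by rewrite mulr_ge0// addr_ge0.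
    - by rewrite !mulr_ge0 ?invr_ge0 ?(ltW A0)// addr_ge0.
    have -> : 2 * (d + D * `|w| / A) = (2 * (A * d) + 2 * D * `|w|) / A by field; rewrite gt_eqF.
    by rewrite [leRHS]mulrA ler_pM2r ?invr_gt0//; nra.
  rewrite powRM; [|lra|by rewrite divr_ge0 ?ltW//; lra].
  rewrite (@powRM _ (1 + `|w|) A^-1); [|lra|by rewrite invr_ge0 ltW].
  rewrite -AdeE /C1 /X.
  set P := (6 * D) `^ de; set Q := A `^ (- de).
  have P0 : 0 <= P by exact: powR_ge0.
  have Q0 : 0 <= Q by exact: powR_ge0.
  have key : (1 + `|w|) `^ de <= (3 * D) `^ (D - de) * ((1 + A * d) `^ (de - D) * (1 + `|w|) ^+ r).
    have w1 : 0 < 1 + `|w| by rewrite ltr_pwDl.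
    have Ad1 : 0 < 1 + A * d by rewrite ltr_pwDl.
    have e2 : (1 + `|w|) `^ D = (1 + `|w|) `^ (D - de) * (1 + `|w|) `^ de.
      by rewrite -powRD ?(gt_eqF w1) ?implybT// subrK.
    rewrite -powR_mulrn ?(ltW w1)// -/D e2 !mulrA ler_peMl ?powR_ge0//.
    rewrite -[de - D]opprB powRN mulrAC ler_pdivlMr ?powR_gt0// mul1r -powRM; [|clear -D1 w0 Ad0; lra|clear -D1 w0 Ad0; lra].
    have Dw : 0 <= D * `|w| by rewrite mulr_ge0.
    by apply: ge0_ler_powR; rewrite ?nnegrE//; clear -hd Dw D1 Ad0 w0; lra.
  rewrite (_ : 2 ^+ r * (P * ((1 + `|w|) `^ de * Q)) = (2 ^+ r * P * Q) * (1 + `|w|) `^ de); last by ring.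
  rewrite [leRHS](_ : _ = (2 ^+ r * P * Q) * ((3 * D) `^ (D - de) * ((1 + A * d) `^ (de - D) * (1 + `|w|) ^+ r))); last by ring.
  by rewrite ler_wpM2l// !mulr_ge0// exprn_ge0.
have [hf|hf] := leP (A * d) (2 * D * `|w|); first by constructor 1; exact: far.
have w1 : 1 <= (1 + `|w|) ^+ r by rewrite exprn_ege1// lerDl.
have dw : D * `|w| / A <= d / 2.
  by rewrite ler_pdivrMr//; lra.
have [Ad|Ad] := leP (A * d) 1.
  constructor 2; apply: (le_trans (fdiff_le (B := (8 * A^-1) `^ de) _)).
    move=> i ir; rewrite ger0_norm ?msym_ge0//; apply: (le_trans (crude i ir)).
    apply: ge0_ler_powR; rewrite ?nnegrE ?(ltW de0)//.
    - by rewrite mulr_ge0// addr_ge0.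
    - by rewrite mulr_ge0// invr_ge0 ltW.
    have : d <= A^-1 by rewrite -[leRHS]mul1r ler_pdivlMr// mulrC.
    have : 0 < A^-1 by rewrite invr_gt0.
    by clear -dw; lra.
  rewrite powRM ?invr_ge0 ?(ltW A0)// -AdeE /C2 /X.
  have key : 1 <= 2 `^ (D - de) * ((1 + A * d) `^ (de - D) * (1 + `|w|) ^+ r).
    rewrite mulrA -[leLHS]mul1r; apply: ler_pM => //.
    have Ad1 : 0 < 1 + A * d by rewrite ltr_pwDl.
    rewrite -[de - D]opprB powRN ler_pdivlMr ?powR_gt0// mul1r.
    by apply: ge0_ler_powR; rewrite ?nnegrE//; clear -Ad Ad0 Dd; lra.
  rewrite [leLHS](_ : _ = 2 ^+ r * 8 `^ de * A `^ (- de) * 1); last by ring.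
  rewrite [leRHS](_ : _ = 2 ^+ r * 8 `^ de * A `^ (- de) * (2 `^ (D - de) * ((1 + A * d) `^ (de - D) * (1 + `|w|) ^+ r))); last by ring.
  by rewrite ler_wpM2l// !mulr_ge0 ?powR_ge0// exprn_ge0.
have dp : 0 < d.
  by rewrite lt_def d0 andbT; apply/eqP => e0; move: Ad; rewrite e0 mulr0 ltNge ler01.
have near i : (i <= r)%N -> `|i%:R * (w / A)| <= d / 2.
  move=> ir; apply: le_trans dw; rewrite normrM normrM normfV (gtr0_norm A0) normr_nat mulrA.
  by rewrite ler_pM2r ?invr_gt0// ler_wpM2r// ler_nat.
constructor 3; have [x1|x1] := leP 1 `|x|.
  have z i : (i <= r)%N -> msym (x + i%:R * (w / A)) = 0.
    move=> ir; apply: msym_out; have := near i ir.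
    rewrite /d (@ler0_norm _ (1 - `|x|)) ?subr_le0// opprB => h.
    have := lerB_normD x (i%:R * (w / A)); have := normr_ge0 x; clear -h x1; lra.
  rewrite (fdiff_eq (g := fun=> 0)); last by move=> i ir; rewrite z.
  have := fdiff_le (f := fun=> 0) (x := x) (u := w / A) (r := r) (B := 0).
  rewrite mulr0 => h; apply: le_trans (h _) _; first by move=> i _; rewrite normr0.
  by rewrite mulr_ge0// ltW.
have dE' : d = 1 - `|x| by rewrite /d ger0_norm// subr_ge0 ltW.
have inn i : (i <= r)%N -> `|x + i%:R * (w / A)| <= 1 - d / 2.
  by move=> ir; have := near i ir; have := ler_normD x (i%:R * (w / A)); clear -dE'; lra.
have d2 : 0 < d / 2 by rewrite divr_gt0.
rewrite (fdiff_eq (g := mder 0)); last first.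
  by move=> i ir; rewrite mder0 msym_in//; have := inn i ir; clear -dp; lra.
have hx : - (1 - d / 2) <= x <= 1 - d / 2 by rewrite -ler_norml; have := inn 0%N isT; rewrite mul0r addr0.
have hxr : - (1 - d / 2) <= x + r%:R * (w / A) <= 1 - d / 2 by rewrite -ler_norml; exact: inn.
apply: (le_trans (@fdiff_smooth R mder r 0 x (w / A) (- (1 - d / 2)) (1 - d / 2)
  (K * (d / 2) `^ (de - D)) _ _ hx hxr)).
- move=> i y _; rewrite -ler_norml => hy; apply: is_derive_mder; clear -hy dp; lra.
- move=> y; rewrite -ler_norml => hy; rewrite add0n; apply: hK => //; clear -hy dp; lra.
rewrite /C3 /X powRM ?invr_ge0// ?(ltW dp)//.
have Ar : `|w / A| ^+ r = `|w| ^+ r * A `^ (- D).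
  have AR : A ^- r = A `^ (- D) by rewrite powRN powR_mulrn// ltW.
  by rewrite normrM normfV (gtr0_norm A0) exprMn exprVn AR.
have Adp : 0 < A * d by rewrite mulr_gt0.
have e1 : A `^ (- D) * d `^ (de - D) = A `^ (- de) * (A * d) `^ (de - D).
  rewrite powRM ?(ltW A0)// mulrA -powRD ?(gt_eqF A0) ?implybT//.
  by congr (_ `^ _ * _); ring.
have k1 : (A * d) `^ (de - D) <= 2 `^ (D - de) * (1 + A * d) `^ (de - D).
  rewrite -[de - D]opprB !powRN ler_pdivlMr; last by rewrite powR_gt0//; clear -Adp; lra.
  rewrite ler_pdivrMl ?powR_gt0// mulrC -powRM; [|clear -Adp; lra|clear -Adp; lra].
  rewrite [d * A]mulrC.
  by apply: ge0_ler_powR; [exact: Dd|rewrite nnegrE addr_ge0|rewrite nnegrE mulr_ge0|clear -Ad; lra].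
have k2 : `|w| ^+ r <= (1 + `|w|) ^+ r by rewrite lerXn2r ?nnegrE ?addr_ge0// lerDr.
rewrite Ar.
rewrite [leLHS](_ : _ = K * 2^-1 `^ (de - D) * (`|w| ^+ r * (A `^ (- D) * d `^ (de - D)))); last by ring.
rewrite e1.
rewrite [leRHS](_ : _ = K * 2^-1 `^ (de - D) * ((1 + `|w|) ^+ r * (A `^ (- de) * (2 `^ (D - de) * (1 + A * d) `^ (de - D))))); last by ring.
rewrite ler_wpM2l ?mulr_ge0 ?powR_ge0 ?(ltW K0)//; apply: ler_pM; [exact: exprn_ge0|by rewrite mulr_ge0 ?powR_ge0|exact: k2|].
by rewrite ler_wpM2l ?powR_ge0.
Qed.

End Symbol.

(** * Convolution with kernels of exponential type *)

Section Convolution.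
Variables (R : realType).
Notation mu := (@lebesgue_measure R).
Implicit Types (m ka : R -> R) (a x w : R).

Lemma integrable_oneDsqrV : mu.-integrable setT (EFin \o (fun x : R => (oneDsqr x)^-1)).
Proof.
apply/integrableP; split.
  by apply/measurable_EFinP; apply: continuous_measurable_fun; exact: continuous_oneDsqrV.
under eq_integral do rewrite /= ger0_norm ?invr_ge0 ?(le_trans ler01 (oneDsqr_ge1 _))//.
rewrite ge0_symfun_integralT.
- by rewrite -set_itvcy integral0y_oneDsqr -EFinM ltry.
- by move=> x; rewrite invr_ge0 (le_trans ler01 (oneDsqr_ge1 _)).
- exact: continuous_oneDsqrV.
- by move=> x; rewrite /= /oneDsqr sqrrN.
Qed.

Lemma integral_shift_scale (G : R -> R) a x : 0 < a -> continuous G -> (forall w, 0 <= G w) ->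
  (\int[mu]_w (G w)%:E = \int[mu]_v (G (a * (v - x)) * a)%:E)%E.
Proof.
move=> a0 cG G0; pose F v : R := a * (v - x).
have dF v : is_derive v (1 : R) F a.
  by apply: dE (dZ a (dB (did v) (dcst x v))) _; rewrite subr0 mulr1.
have F' : F^`()%classic = fun=> a.
  by apply/funext => v; rewrite derive1E; have [_ ->] := dF v.
rewrite (@increasing_ge0_integration_by_substitutionT _ F G)//.
- by apply: eq_integral => v _; rewrite F'.
- by move=> u v uv; rewrite /F ltr_pM2l// ltrD2r.
- by rewrite F'; exact: ccst.
- by rewrite F'; apply/cvg_ex; exists a; exact: cvg_cst.
- by rewrite F'; apply/cvg_ex; exists a; exact: cvg_cst.
- apply/cvgrNyPle => A; near=> v.
  rewrite /F -ler_pdivlMl// lerBlDr; near: v.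
  exact: (nbhs_ninfty_le (num_real _)).
- apply/cvgryPge => A; near=> v.
  rewrite /F -ler_pdivrMl// lerBrDr; near: v.
  exact: (nbhs_pinfty_ge (num_real _)).
Unshelve. all: by end_near. Qed.

(** Up to the total mass of [ka], an average of m around x at scale 1/a. *)
Definition cint m ka a x : R := \int[mu]_(w in setT) (m (x + w / a) * ka w).

Section Fixed.
Variables (m ka : R -> R) (B : R).
Hypotheses (cm : continuous m) (m0 : forall x, 0 <= m x) (im : mu.-integrable setT (EFin \o m)).
Hypotheses (ck : continuous ka) (k0 : forall x, 0 <= ka x) (kB : forall x, ka x <= B).

Let icint a x : mu.-integrable setT (EFin \o (fun v => m v * ka (a * (v - x)))).
Proof.
apply: (@le_integrable _ _ _ mu setT measurableT _ (EFin \o (fun v => B * m v))).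
- apply/measurable_EFinP; apply: continuous_measurable_fun; apply: cM => //.
  by apply: (ccomp ck); apply: cM; [exact: ccst|apply: cB; [exact: cid|exact: ccst]].
- move=> v _ /=; rewrite lee_fin !ger0_norm ?mulr_ge0//; last exact: le_trans (kB 0).
  by rewrite mulrC ler_wpM2r.
- exact: integrableRZ.
Qed.

Lemma cintE a x : 0 < a -> cint m ka a x = a * \int[mu]_(v in setT) (m v * ka (a * (v - x))).
Proof.
move=> a0; rewrite -RintegralZl; [|exact: measurableT|exact: icint].
rewrite /cint /Rintegral; congr fine.
rewrite (integral_shift_scale x a0).
- apply: eq_integral => v _; congr EFin.
  have -> : x + a * (v - x) / a = v by rewrite mulrAC divff ?gt_eqF// mul1r addrC subrK.
  by rewrite mulrC.
- apply: cM => //; apply: (ccomp cm); apply: cD; first exact: ccst.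
  by apply: cM; [exact: cid|exact: ccst].
- by move=> w; exact: mulr_ge0.
Qed.

(** After the change of variables x sits in the kernel, and for each v the kernel is tested on the
    2n points v - x_i and v + x_i. Symmetrising in x makes the sines cancel: cos(t(v - x)) + cos(t(v
    + x)) = 2 cos(t v) cos(t x), so the test reduces to the given cosine sum. *)
Lemma etype_cint a L : 0 < a -> etype L ka -> etype (a * L) (fun x => cint m ka a x + cint m ka a (- x)).
Proof.
move=> a0 /(etype_scale (ltW a0))[C C0 h].
exists (a * (C * 2 * \int[mu]_(v in setT) m v)).
  by rewrite !mulr_ge0 ?(ltW a0)// Rintegral_ge0.
move=> n sg c eps hc.
pose Phi v := \sum_(i < n) (ka (a * (v - sg i)) + ka (a * (v + sg i))) * c i.
have hPhi v : `|Phi v| <= C * (2 * eps).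
  pose sg' (i : 'I_(n + n)) := match fintype.split i with inl j => v - sg j | inr j => v + sg j end.
  pose c' (i : 'I_(n + n)) := match fintype.split i with inl j => c j | inr j => c j end.
  have sl (j : 'I_n) : fintype.split (lshift n j) = inl j by exact: (unsplitK (inl j)).
  have sr (j : 'I_n) : fintype.split (rshift n j) = inr j by exact: (unsplitK (inr j)).
  have E (G : R -> R) : \sum_(i < n + n) G (sg' i) * c' i =
      \sum_(i < n) (G (v - sg i) + G (v + sg i)) * c i.
    rewrite big_split_ord/= -big_split/=; apply: eq_bigr => i _.
    by rewrite /sg' /c' sl sr mulrDl.
  rewrite /Phi -(E (fun x => ka (a * x))); apply: h => t tL.
  rewrite (E (fun x => cos (t * x))).
  rewrite (_ : \sum_(i < n) _ = 2 * cos (t * v) * \sum_(i < n) cos (t * sg i) * c i).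
    rewrite normrM normrM ger0_norm// -mulrA ler_pM2l//.
    by rewrite -[leRHS]mul1r; apply: ler_pM => //; [exact: cos_max|exact: hc].
  by rewrite mulr_sumr; apply: eq_bigr => i _; rewrite (mulrBr t) (mulrDr t) cosB cosD; ring.
have iP : mu.-integrable setT (EFin \o (fun v => m v * Phi v)).
  have S : mu.-integrable setT (EFin \o (fun v => \sum_(i < n)
      c i * (m v * ka (a * (v - sg i)) + m v * ka (a * (v - (- sg i)))))).
    by apply: integrableRsum => // i; apply: integrableRZ => //; apply: integrableRD => //; exact: icint.
  have := S; apply: eq_integrable => // v _ /=; congr EFin; rewrite mulr_sumr; apply: eq_bigr => i _.
  by rewrite opprK; ring.
rewrite (_ : \sum_(i < n) _ = a * \int[mu]_(v in setT) (m v * Phi v)); last first.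
  rewrite (_ : \int[mu]_(v in setT) _ = \sum_(i < n) c i * (\int[mu]_(v in setT) (m v * ka (a * (v - sg i))) +
      \int[mu]_(v in setT) (m v * ka (a * (v - (- sg i)))))).
    rewrite mulr_sumr; apply: eq_bigr => i _; rewrite !cintE//; ring.
  transitivity (\sum_(i < n) \int[mu]_(v in setT)
      (c i * (m v * ka (a * (v - sg i)) + m v * ka (a * (v - (- sg i)))))).
    rewrite -(Rintegral_sum measurableT); last first.
      by move=> i; apply: integrableRZ => //; apply: integrableRD => //; exact: icint.
    apply: eq_Rintegral => v _; rewrite mulr_sumr; apply: eq_bigr => i _.
    by rewrite opprK; ring.
  apply: eq_bigr => i _; rewrite RintegralZl; [|exact: measurableT|by apply: integrableRD => //; exact: icint].
  by congr (_ * _); rewrite RintegralD//; exact: icint.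
rewrite normrM (gtr0_norm a0) -!mulrA ler_pM2l//.
apply: (le_trans (le_normr_Rintegral _ iP)) => //.
apply: (@le_trans _ _ (\int[mu]_(v in setT) (C * (2 * eps) * m v))).
  apply: le_Rintegral => //.
  - have := integrable_norm iP; by [].
  - exact: integrableRZ.
  by move=> v _; rewrite normrM (ger0_norm (m0 v)) mulrC ler_wpM2r.
by rewrite RintegralZl// le_eqVlt; apply/orP; left; apply/eqP; ring.
Qed.

End Fixed.

End Convolution.

(** * Jackson approximation of the symbol by functions of exponential type *)

Section Approximant.
Variables (R : realType) (de : R).
Hypothesis de0 : 0 < de.
Notation mu := (@lebesgue_measure R).
Implicit Types (a x w : R).
Notation msym := (msym de).

Lemma integrable_msym : mu.-integrable setT (EFin \o msym).
Proof.
apply: (@le_integrable _ _ _ mu setT measurableT _ (EFin \o (fun x : R => 2 * (oneDsqr x)^-1))).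
- by apply/measurable_EFinP; apply: continuous_measurable_fun; exact: continuous_msym.
- move=> x _ /=; rewrite lee_fin ger0_norm ?msym_ge0// ger0_norm; last first.
    by rewrite mulr_ge0// invr_ge0 (le_trans ler01 (oneDsqr_ge1 _)).
  have d0 : 0 < oneDsqr x by exact: lt_le_trans ltr01 (oneDsqr_ge1 _).
  have [x1|x1] := leP 1 `|x|.
    by rewrite msym_out// mulr_ge0// invr_ge0 ltW.
  apply: (le_trans (msym_le1 _ _)) => //.
  rewrite ler_pdivlMr// mul1r /oneDsqr.
  have : x ^+ 2 <= 1 by rewrite -(real_normK (num_real x)) exprn_ile1// ltW.
  lra.
- by apply: integrableRZ => //; exact: integrable_oneDsqrV.
Qed.

(** A Jackson kernel: nonnegative since the exponent is even, of exponential type 2 M, and decaying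
    like |x|^(-2M). *)
Definition kap M x : R := sinc x ^+ (2 * M).

Lemma kap_ge0 M x : 0 <= kap M x.
Proof. by rewrite /kap exprM exprn_ge0// sqr_ge0. Qed.

Lemma continuous_kap M : continuous (kap M).
Proof. by apply: cX; exact: continuous_sinc. Qed.

Lemma kap_le M x : (1 + `|x|) ^+ (2 * M) * kap M x <= 2 ^+ (2 * M).
Proof.
rewrite -[kap M x](ger0_norm (kap_ge0 _ _)) normrX -exprMn lerXn2r ?nnegrE ?mulr_ge0 ?addr_ge0//.
exact: norm_sinc_le.
Qed.

Lemma kap_bound M x : kap M x <= 2 ^+ (2 * M).
Proof.
apply: le_trans (kap_le M x); rewrite ler_peMl ?kap_ge0//.
by rewrite exprn_ege1// lerDl.
Qed.

Lemma integrable_kap M r : (r.+2 <= 2 * M)%N ->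
  mu.-integrable setT (EFin \o (fun w => (1 + `|w|) ^+ r * kap M w)).
Proof.
move=> rM.
apply: (@le_integrable _ _ _ mu setT measurableT _ (EFin \o (fun x : R => 2 ^+ (2 * M) * (oneDsqr x)^-1))).
- apply/measurable_EFinP; apply: continuous_measurable_fun; apply: cM; last exact: continuous_kap.
  by apply: cX; apply: cD; [exact: ccst|exact: norm_continuous].
- move=> x _ /=; rewrite lee_fin.
  have n1 : 1 <= 1 + `|x| by rewrite lerDl.
  have d0 : 0 < oneDsqr x by exact: lt_le_trans ltr01 (oneDsqr_ge1 _).
  have g1 : 0 <= (1 + `|x|) ^+ r * kap M x by rewrite mulr_ge0 ?kap_ge0// exprn_ge0// (le_trans ler01).
  have g2 : 0 <= 2 ^+ (2 * M) * (oneDsqr x)^-1 by rewrite mulr_ge0 ?exprn_ge0// invr_ge0 ltW.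
  rewrite (ger0_norm g1) (ger0_norm g2).
  rewrite ler_pdivlMr//; apply: le_trans (kap_le M x).
  rewrite mulrAC ler_wpM2r ?kap_ge0//.
  apply: (@le_trans _ _ ((1 + `|x|) ^+ r.+2)); last exact: ler_weXn2l.
  rewrite -addn2 exprD ler_wpM2l// ?exprn_ge0 ?(le_trans ler01 n1)//.
  rewrite /oneDsqr -(real_normK (num_real x)).
  have := normr_ge0 x; nra.
- by apply: integrableRZ => //; exact: integrable_oneDsqrV.
Qed.

Lemma integral_kap_gt0 M : (2 <= 2 * M)%N -> 0 < \int[mu]_(w in setT) kap M w.
Proof.
move=> M1; have ik : mu.-integrable setT (EFin \o kap M).
  have := integrable_kap M1; apply: eq_integrable => // x _.
  by rewrite /= expr0 mul1r.
have : \forall x \near (0 : R), 2^-1 < kap M x.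
  have := @continuous_kap M 0; rewrite /continuous_at {2}/kap sinc0 expr1n => h.
  by apply: (cvgr_gt _ h); rewrite invf_lt1// ltr1n.
move=> /nbhs_ballP[r /= r0 hr].
have fk : (\int[mu]_(w in setT) (kap M w)%:E)%E \is a fin_num.
  by apply: integrable_fin_num; [exact: measurableT|exact: ik].
rewrite /Rintegral fine_gt0//; apply/andP; split; last first.
  by move: fk; rewrite fin_numE => /andP[_]; rewrite lt_neqAle leey andbT.
have c0 : (0 < \int[mu]_(x in `[0%R, (r / 2)%R]) (2^-1)%:E)%E.
  rewrite integral_cst//= lebesgue_measure_itv/= ifT; last by rewrite lte_fin divr_gt0.
  by rewrite -EFinB -EFinM lte_fin subr0 mulr_gt0// ?divr_gt0.
apply: (lt_le_trans c0).
apply: (@le_trans _ _ (\int[mu]_(x in `[0%R, (r / 2)%R]) (kap M x)%:E)%E).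
  apply: ge0_le_integral => //.
  - by apply/measurable_EFinP; apply: continuous_measurable_itv; exact: continuous_kap.
  - move=> x /=; rewrite in_itv/= => /andP[h1 h2]; rewrite lee_fin ltW//; apply: hr.
    by rewrite /ball/= sub0r normrN ger0_norm//; lra.
apply: ge0_subset_integral => //.
- by apply/measurable_EFinP; apply: continuous_measurable_fun; exact: continuous_kap.
- by move=> x _; rewrite lee_fin kap_ge0.
Qed.

(** Averaging the r-th difference of the symbol against the kernel gives the symbol plus averages of
    its translates by i w/A with i >= 1. The latter, with opposite sign, are taken as F, so the
    error is the averaged r-th difference, bounded by [fdiff_msym]. *)
Lemma approximant_of (ka : R -> R) (B L : R) r : (0 < r)%N -> de <= r%:R -> 0 < L ->
  continuous ka -> (forall w, 0 <= ka w <= B) ->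
  mu.-integrable setT (EFin \o (fun w => (1 + `|w|) ^+ r * ka w)) ->
  0 < \int[mu]_(w in setT) ka w -> etype L ka ->
  exists2 C : R, 0 < C & forall A, 1 <= A -> exists2 F, etype (L * A) F &
    forall x, `|msym x - F x| <= C * A `^ (- de) * (1 + A * `|1 - `|x| |) `^ (de - r%:R).
Proof.
move=> r0 der L0 cK kB iw g0 tk; have [K K0 hK] := fdiff_msym de0 r0 der.
have k0 w : 0 <= ka w by have /andP[] := kB w.
have [c [c0 cr cf]] := fdiff_expand R r.
set ck := \int[mu]_(w in setT) ka w in g0.
have i0 : mu.-integrable setT (EFin \o ka).
  apply: (@le_integrable _ _ _ mu setT measurableT _ (EFin \o (fun w => (1 + `|w|) ^+ r * ka w))) => //.
    by apply/measurable_EFinP; exact: continuous_measurable_fun.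
  move=> w _ /=; rewrite lee_fin (ger0_norm (k0 w)) ger0_norm ?mulr_ge0 ?exprn_ge0 ?addr_ge0//.
  by rewrite ler_peMl// exprn_ege1// lerDl.
pose W := \int[mu]_(w in setT) ((1 + `|w|) ^+ r * ka w).
have W0 : 0 <= W.
  by apply: Rintegral_ge0 => w _; rewrite mulr_ge0// exprn_ge0// addr_ge0.
exists (K * (W + 1) / ck); first by rewrite divr_gt0// mulr_gt0// ltr_wpDl.
move=> A A1; have A0 : 0 < A by exact: lt_le_trans A1.
have cm := continuous_msym de0.
have im : forall a x, mu.-integrable setT (EFin \o (fun w => msym (x + w * a) * ka w)).
  move=> a x.
  apply: (@le_integrable _ _ _ mu setT measurableT _ (EFin \o (fun w => (1 + `|w|) ^+ r * ka w))) => //.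
    apply/measurable_EFinP; apply: continuous_measurable_fun; apply: cM => //.
    apply: (ccomp cm); apply: cD; first exact: ccst.
    by apply: cM; [exact: cid|exact: ccst].
  move=> w _ /=; rewrite lee_fin (ger0_norm (mulr_ge0 (msym_ge0 _ _) (k0 _))) [leRHS]ger0_norm ?mulr_ge0 ?k0 ?exprn_ge0 ?addr_ge0//.
  rewrite ler_wpM2r ?k0// (le_trans (msym_le1 _ _))// exprn_ege1// lerDl//.
pose I (i : nat) x := cint msym ka (A / i.+1%:R) x.
(* Symmetrised in x for [etype_cint]; this changes nothing in the error because the symbol is even.
   Translates by i.+1 w/A are averages at scale A/i.+1, hence of smaller type. *)
pose F x := - (2 * ck)^-1 * \sum_(i < r) c i.+1 * (I i x + I i (- x)).
exists F.
  rewrite mulrC; apply: etypeZ; apply: etype_sum => [|i].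
    by rewrite mulr_ge0 ?(ltW A0) ?(ltW L0).
  apply: etypeZ; have ai : 0 < A / i.+1%:R by rewrite divr_gt0.
  apply: (@etypeW _ (A / i.+1%:R * L)).
    by rewrite ler_pM2r// ler_pdivrMr// ler_peMr ?(ltW A0)// ler1n.
  apply: (etype_cint (B := B)) => //.
  - by move=> x; exact: msym_ge0.
  - exact: integrable_msym.
  - by move=> x; have /andP[] := kB x.
have JS (i : nat) x : \int[mu]_(w in setT) (msym (x + w * (i.+1%:R / A)) * ka w) = I i x.
  by apply: eq_Rintegral => w _; rewrite invf_div.
clearbody I.
pose E x := ck^-1 * \int[mu]_(w in setT) (fdiff msym r x (w / A) * ka w).
have EE x : E x = msym x + ck^-1 * \sum_(i < r) c i.+1 * I i x.
  rewrite /E.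
  have -> : \int[mu]_(w in setT) (fdiff msym r x (w / A) * ka w) =
      \sum_(i < r.+1) c i * \int[mu]_(w in setT) (msym (x + w * (i%:R / A)) * ka w).
    under [RHS]eq_bigr do rewrite -RintegralZl//.
    rewrite -(Rintegral_sum measurableT); last by move=> i; exact: integrableRZ.
    apply: eq_Rintegral => w _; rewrite cf mulr_suml; apply: eq_bigr => i _.
    by rewrite [X in _ = X]mulrA; congr (_ * msym (_ + _) * _); rewrite mulrCA.
  have J0 : \int[mu]_(w in setT) (msym (x + w * (0%:R / A)) * ka w) = msym x * ck.
    rewrite /ck -RintegralZl; [|exact: measurableT|exact: i0].
    by apply: eq_Rintegral => w _; rewrite mul0r mulr0 addr0.
  have gen (J : nat -> R) : \sum_(i < r.+1) c i * J i = J 0%N + \sum_(i < r) c i.+1 * J i.+1.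
    by rewrite big_ord_recl [c _]c0 mul1r.
  rewrite (gen (fun i => \int[mu]_(w in setT) (msym (x + w * (i%:R / A)) * ka w))) J0.
  have eJ : \sum_(i < r) c i.+1 * \int[mu]_(w in setT) (msym (x + w * (i.+1%:R / A)) * ka w) =
      \sum_(i < r) c i.+1 * I i x by apply: eq_bigr => i _; congr (_ * _); exact: JS.
  rewrite eJ.
  by rewrite mulrDr mulrCA mulVf ?mulr1// gt_eqF.
have bE x : `|E x| <= ck^-1 * (K * A `^ (- de) * (1 + A * `|1 - `|x| |) `^ (de - r%:R) * W).
  rewrite /E normrM normfV (gtr0_norm g0) ler_pM2l ?invr_gt0//.
  have iF : mu.-integrable setT (EFin \o (fun w => fdiff msym r x (w / A) * ka w)).
    have S : mu.-integrable setT (EFin \o (fun w => \sum_(i < r.+1)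
        c i * (msym (x + w * (i%:R / A)) * ka w))).
      by apply: integrableRsum => // i; exact: integrableRZ.
    have := S; apply: eq_integrable => // w _ /=; congr EFin; rewrite cf mulr_suml; apply: eq_bigr => i _.
    by rewrite mulrA; congr (_ * msym (_ + _) * _); rewrite mulrCA.
  apply: (le_trans (le_normr_Rintegral _ iF)) => //.
  rewrite /W -RintegralZl//; apply: le_Rintegral => //.
  - exact: (integrable_norm iF).
  - exact: integrableRZ.
  by move=> w _; rewrite normrM (ger0_norm (k0 _)) mulrA ler_wpM2r ?k0// hK.
move=> x; have -> : msym x - F x = 2^-1 * (E x + E (- x)).
  rewrite !EE msymN /F.
  rewrite (_ : \sum_(i < r) c i.+1 * (I i x + I i (- x)) = \sum_(i < r) c i.+1 * I i x + \sum_(i < r) c i.+1 * I i (- x)).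
    by field; rewrite gt_eqF.
  by rewrite -big_split/=; apply: eq_bigr => i _; rewrite mulrDr.
have b1 := bE x; have := bE (- x); rewrite normrN => b2.
rewrite normrM ger0_norm//.
have := ler_normD (E x) (E (- x)).
set X := A `^ (- de); set Y := (1 + _) `^ _ in b1 b2 *.
have X0 : 0 <= X by exact: powR_ge0.
have Y0 : 0 <= Y by exact: powR_ge0.
have : ck^-1 * (K * X * Y * W) <= K * (W + 1) / ck * X * Y.
  rewrite (_ : K * (W + 1) / ck * X * Y = ck^-1 * (K * X * Y * (W + 1))); last by ring.
  by rewrite ler_pM2l ?invr_gt0// ler_wpM2l ?lerDl// !mulr_ge0 ?(ltW K0).
by rewrite -/X in b1 b2; lra.
Qed.


Lemma approximant r : (0 < r)%N -> de <= r%:R -> exists C L : R, [/\ 0 < C, 0 < L &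
  forall A, 1 <= A -> exists2 F, etype (L * A) F &
    forall x, `|msym x - F x| <= C * A `^ (- de) * (1 + A * `|1 - `|x| |) `^ (de - r%:R)].
Proof.
(* The decay |w|^(-2M) has to beat the growth |w|^r of the difference bound by an integrable
   factor. *)
move=> r0 der; pose M := r.+1.
have rM : (r.+2 <= 2 * M)%N by rewrite /M mul2n -addnn addSn ltnS leq_addl.
have M1 : (2 <= 2 * M)%N by rewrite /M mul2n -addnn addSn addnS.
have L0 : 0 < (2 * M)%:R :> R by rewrite ltr0n.
have kb w : 0 <= kap M w <= 2 ^+ (2 * M) by rewrite kap_ge0; exact: kap_bound.
have [C C0 hC] := approximant_of r0 der L0 (@continuous_kap M) kb (integrable_kap rM)
  (integral_kap_gt0 M1) (etype_sincX _ (2 * M)).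
by exists C, (2 * M)%:R.
Qed.

End Approximant.

(** * Kernel bounds *)

Section ZeroSums.
Variable R : realType.
Implicit Types (u : nat -> R) (h a t : R).

Lemma cvg_ordsum n (v : 'I_n -> nat -> R) (l : 'I_n -> R) :
  (forall j, v j k @[k --> \oo] --> l j) -> \sum_(j < n) v j k @[k --> \oo] --> \sum_(j < n) l j.
Proof.
elim: n v l => [|n IHn] v l h.
  by rewrite big_ord0; under eq_fun do rewrite big_ord0; exact: cvg_cst.
rewrite big_ord_recr; under eq_fun do rewrite big_ord_recr.
by apply: cvgD; [apply: IHn => j; exact: h|exact: h].
Qed.

Lemma sum_inv_sqr_le a n : 0 < a -> \sum_(k < n) (1 + a * k%:R) ^- 2 <= 1 + a^-1.
Proof.
move=> a0; have pos (k : nat) : 0 < 1 + a * k%:R by rewrite ltr_pwDl// mulr_ge0// ltW.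
have -> : 1 + a^-1 = a^-1 + 1 by rewrite addrC.
(* Strengthened for the induction by the comparison 1/(X + a)^2 <= (1/a)(1/X - 1/(X + a)), which
   telescopes. *)
suff : \sum_(k < n) (1 + a * k%:R) ^- 2 <= a^-1 + 1 - (if n is n'.+1 then a^-1 * (1 + a * n'%:R)^-1 else 0).
  move=> /le_trans; apply; rewrite gerBl; case: n => // n.
  by rewrite mulr_ge0 ?invr_ge0 ?(ltW a0) ?(ltW (pos _)).
elim: n => [|n IHn]; first by rewrite big_ord0 subr0 addr_ge0// invr_ge0 ltW.
case: n IHn => [_|n IHn].
  by rewrite big_ord_recr big_ord0 /= mulr0 addr0 expr1n invr1 mulr1; lra.
rewrite big_ord_recr/=; apply: (le_trans (lerD IHn (lexx _))).
rewrite -[leLHS]addrA lerD2l.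
have p1 := pos n; have p2 := pos n.+1.
have e : 1 + a * n.+1%:R = 1 + a * n%:R + a by rewrite -natr1 mulrDr mulr1 addrA.
rewrite addrC lerBlDr e; set X := 1 + a * n%:R in p1 e *.
rewrite -subr_ge0.
have X1 : 0 < X + a by rewrite addr_gt0.
rewrite (_ : _ - _ = a / (X * (X + a) ^+ 2)); last by field; rewrite !gt_eqF.
by rewrite divr_ge0 ?mulr_ge0 ?exprn_ge0 ?ltW.
Qed.

(** The points left and right of t are each further away than an arithmetic progression of step h,
    so each side is a sum of the form [sum_inv_sqr_le]. *)
Lemma sum_separated u h a t n : 0 < h -> 0 < a ->
  (forall i j, (i <= j)%N -> h * (j - i)%N%:R <= u j - u i) ->
  \sum_(j < n) (1 + a * `|u j - t|) ^- 2 <= 2 * (1 + (a * h)^-1).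
Proof.
move=> h0 a0 sep.
have [j0 [jn lo hi]] : exists j0, [/\ (j0 <= n)%N, forall j, (j < j0)%N -> u j < t &
    forall j, (j0 <= j < n)%N -> t <= u j].
  elim: n => [|n [j0 [jn lo hi]]].
    by exists 0%N; split => // j; rewrite ltn0 andbF.
  have [tu|ut] := leP t (u n).
    exists j0; split => //; first exact: leqW.
    move=> j; rewrite ltnS (leq_eqVlt j n) => /andP[jj /orP[/eqP->//|jn']].
    by apply: hi; rewrite jj.
  exists n.+1; split => //; last by move=> j /andP[h1 h2]; move: (leq_trans h2 h1); rewrite ltnn.
  move=> j; rewrite ltnS => jn'; apply: le_lt_trans ut.
  by rewrite -subr_ge0 (le_trans _ (sep _ _ jn'))// mulr_ge0// ltW.
have ah : 0 < a * h by rewrite mulr_gt0.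
have term (j k : nat) : h * k%:R <= `|u j - t| -> (1 + a * `|u j - t|) ^- 2 <= (1 + a * h * k%:R) ^- 2.
  move=> hk; have p1 : 0 < 1 + a * h * k%:R by rewrite ltr_pwDl// mulr_ge0// ltW.
  have p2 : 1 + a * h * k%:R <= 1 + a * `|u j - t| by rewrite lerD2l -mulrA ler_pM2l.
  rewrite lef_pV2 ?posrE ?exprn_gt0//; last exact: lt_le_trans p2.
  by rewrite lerXn2r ?nnegrE ?(ltW p1)// (le_trans (ltW p1)).
rewrite -(subnKC jn) big_split_ord/= mulr_natl mulr2n; apply: lerD.
  rewrite (reindex_inj rev_ord_inj)/=; apply: le_trans (sum_inv_sqr_le j0 ah).
  apply: ler_sum => i _; apply: term.
  have lt1 : (j0 - i.+1 < j0)%N by have := ltn_ord i; lia.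
  have := lo _ lt1; have i0 : (i < j0)%N by [].
  have z : (0 < j0)%N by exact: leq_ltn_trans i0.
  have := sep (j0 - i.+1)%N j0.-1; rewrite -ltnS prednK// lt1 => /(_ isT).
  rewrite (_ : (j0.-1 - (j0 - i.+1))%N = i); last first.
    by move: i0 z; lia.
  have := lo j0.-1; rewrite prednK// leqnn => /(_ isT) h1 h2 h3.
  by rewrite ltr0_norm ?subr_lt0//; lra.
apply: le_trans (sum_inv_sqr_le (n - j0) ah); apply: ler_sum => i _; apply: term.
have hj : t <= u j0.
  apply: hi; rewrite leqnn/= -subn_gt0; exact: leq_ltn_trans (ltn_ord i).
have := sep j0 (j0 + i)%N (leq_addr _ _); rewrite addKn => h1.
have hi0 : 0 <= h * i%:R by rewrite mulr_ge0// ltW.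
by rewrite ger0_norm ?subr_ge0; lra.
Qed.

Lemma sum_powRN_le (th : R) n : 0 <= th -> th < 1 ->
  \sum_(j < n) j.+1%:R `^ (- th) <= (1 - th)^-1 * n%:R `^ (1 - th).
Proof.
move=> th0 th1; have q0 : 0 < 1 - th by rewrite subr_gt0.
elim: n => [|n IHn]; first by rewrite big_ord0 mulr_ge0 ?powR_ge0// invr_ge0 ltW.
rewrite big_ord_recr/=; apply: (le_trans (lerD IHn (lexx _))).
rewrite -lerBrDl -mulrBr ler_pdivlMl//.
case: n {IHn} => [|n].
  by rewrite !powR1 powR0 ?gt_eqF// subr0 mulr1 gerBl.
have n0 : 0 < n.+1%:R :> R by [].
have le : n.+1%:R <= n.+2%:R :> R by rewrite ler_nat.
have [c /andP[c1 c2] e] := MVT_le le (fun x hx => dpowR (1 - th) (lt_le_trans n0 (andP hx).1)).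
rewrite e -(natr1 n.+1) [_ + 1 - _]addrAC subrr add0r mulr1 ler_pM2l//.
rewrite (_ : 1 - th - 1 = - th); last by ring.
have c0 : 0 < c by exact: lt_le_trans c1.
rewrite !powRN lef_pV2 ?posrE ?powR_gt0//.
by rewrite natr1; apply: ge0_ler_powR; rewrite ?nnegrE// ltW.
Qed.

End ZeroSums.

(** * Pointwise bounds for the kernel of the Riesz means *)

Section Kernel.
Variables (R : realType) (nu : R) (s : nat -> R).
Hypothesis nu1 : -1 < nu.
Hypothesis hs : bessel_zeros nu s.
Notation ev := (ev nu s).
Notation fcoef := (fcoef nu s).
Notation b := (nu + 1 / 2).
Implicit Types (x y T : R) (f : R -> R).

(** For nu < -1/2 low frequencies are relatively large, with a loss (s_j/T)^(-th) in a product of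
    two weights. Here nu > -1 gives th < 1, which keeps the sum over s_j <= T of order T. *)
Let th : R := 2 * Num.max 0 (- b).
Let th0 : 0 <= th. Proof. by rewrite mulr_ge0// le_max lexx. Qed.
Let th1 : th < 1.
Proof. by move: nu1 => h; rewrite /th; case: (leP 0 (- b)) => ?; lra. Qed.

(* weight of the j-th eigenfunction relative to frequency T *)
Lemma weight_compare x T sj A : 0 <= x -> 0 < T -> 0 < sj -> 1 <= A ->
  (x + sj^-1) `^ (- b) <= (x + T^-1) `^ (- b) *
    ((1 + A * `|1 - sj / T|) `^ `|b| * (1 + (sj / T) `^ (- (th / 2)))).
Proof.
move=> x0 T0 s0 A1; set ta := sj / T; have t0 : 0 < ta by rewrite divr_gt0.
have si : 0 < sj^-1 by rewrite invr_gt0.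
have Ti : 0 < T^-1 by rewrite invr_gt0.
have p1 : 0 < x + sj^-1 by rewrite ltr_wpDl.
have p2 : 0 < x + T^-1 by rewrite ltr_wpDl.
have w1 : 1 <= 1 + A * `|1 - ta|.
  by rewrite lerDl mulr_ge0// (le_trans ler01).
have g0 : 0 <= ta `^ (- (th / 2)) by exact: powR_ge0.
have g1 : 1 <= 1 + ta `^ (- (th / 2)) by rewrite lerDl.
have wb : 1 <= (1 + A * `|1 - ta|) `^ `|b|.
  by rewrite -[leLHS](powRr0 (1 + A * `|1 - ta|)); apply: ler_powR.
have pp : 0 < (x + T^-1) `^ (- b) by rewrite powR_gt0.
have tle : ta <= 1 + A * `|1 - ta|.
  apply: (@le_trans _ _ (1 + 1 * `|1 - ta|)).
    by rewrite mul1r distrC; have := ler_norm (ta - 1); lra.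
  by rewrite lerD2l ler_wpM2r.
have simple : (x + sj^-1) `^ (- b) <= (x + T^-1) `^ (- b) ->
    (x + sj^-1) `^ (- b) <= (x + T^-1) `^ (- b) * ((1 + A * `|1 - ta|) `^ `|b| * (1 + ta `^ (- (th / 2)))).
  move=> h; apply: (le_trans h); rewrite ler_peMr ?(ltW pp)//.
  by rewrite -[leLHS]mul1r; apply: ler_pM.
have [b0|b0] := leP 0 b.
  rewrite -/(powR _ _) in simple *.
  have [ts|st] := leP sj T.
    apply: simple; rewrite !powRN lef_pV2 ?posrE ?powR_gt0//.
    by apply: ge0_ler_powR; rewrite ?nnegrE ?(ltW p1) ?(ltW p2)// lerD2l lef_pV2 ?posrE.
  apply: (@le_trans _ _ ((x + T^-1) `^ (- b) * ta `^ b)).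
    have -> : (x + T^-1) `^ (- b) * ta `^ b = ((x + T^-1) / ta) `^ (- b).
      rewrite powRM ?(ltW p2) ?invr_ge0 ?(ltW t0)//; congr (_ * _).
      by rewrite -(powR_inv1 (ltW t0)) -powRrM mulN1r opprK.
    rewrite !powRN lef_pV2 ?posrE ?powR_gt0// ?divr_gt0//.
    apply: ge0_ler_powR; rewrite ?nnegrE ?(ltW p1) ?(ltW (divr_gt0 p2 t0))//.
    rewrite mulrDl lerD//.
      by rewrite ler_pdivrMr// ler_peMr// /ta ler_pdivlMr// mul1r ltW.
    by rewrite /ta invf_div mulrA mulVf ?gt_eqF// mul1r.
  rewrite ler_pM2l//; apply: (@le_trans _ _ ((1 + A * `|1 - ta|) `^ `|b|)); last by rewrite ler_peMr ?powR_ge0.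
  by rewrite (ger0_norm b0); apply: ge0_ler_powR; rewrite ?nnegrE ?(ltW t0) ?(le_trans ler01 w1).
have bn : 0 <= - b by rewrite oppr_ge0 ltW.
have [ts|st] := leP T sj.
  apply: simple; apply: ge0_ler_powR; rewrite ?nnegrE ?(ltW p1) ?(ltW p2)//.
  by rewrite lerD2l lef_pV2 ?posrE.
have thE : th / 2 = - b by rewrite /th (max_idPr bn); field.
apply: (@le_trans _ _ ((x + T^-1) `^ (- b) * ta `^ (- (- b)))).
  have -> : (x + T^-1) `^ (- b) * ta `^ (- (- b)) = ((x + T^-1) / ta) `^ (- b).
    rewrite powRM ?(ltW p2) ?invr_ge0 ?(ltW t0)//; congr (_ * _).
    by rewrite -(powR_inv1 (ltW t0)) -powRrM mulN1r.
  apply: ge0_ler_powR; rewrite ?nnegrE ?(ltW p1) ?(ltW (divr_gt0 p2 t0))//.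
  rewrite mulrDl lerD//.
    by rewrite ler_pdivlMr// ler_piMr// /ta ler_pdivrMr// mul1r ltW.
  by rewrite /ta invf_div mulrA mulVf ?gt_eqF// mul1r.
rewrite ler_pM2l// -thE; apply: (@le_trans _ _ (1 * (1 + ta `^ (- (th / 2))))).
  by rewrite mul1r lerDr.
by rewrite ler_wpM2r// (le_trans ler01).
Qed.

(** The zeros within T/A of T number O(T/A), provided T/A is bounded below. Of the exponent N, the
    part 2 |b| pays for replacing s_j by T in the weights and 2 is left for summation. Zeros below
    T/2 are counted separately: there the decay gives 1/A and the loss (s_j/T)^(-th) is summable. *)
Lemma zero_sum (ka0 N : R) : 0 < ka0 -> 2 + 2 * `|b| <= N -> exists2 C : R, 0 < C &
  forall T A x y n, 0 < T -> 1 <= A -> ka0 <= T / A -> 0 <= x -> 0 <= y ->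
  \sum_(j < n) (1 + A * `|1 - s j / T|) `^ (- N) * ((x + (s j)^-1) `^ (- b) * (y + (s j)^-1) `^ (- b))
   <= C * (T / A) * ((x + T^-1) `^ (- b) * (y + T^-1) `^ (- b)).
Proof.
move=> k0 N2; have [h h0 [hj hsep]] := s_sep nu1 hs.
pose C1 := 16 * 2 * (ka0^-1 + h^-1).
pose C2 := 16 * (h `^ (- th) * ((1 - th)^-1 * h `^ (th - 1))).
have q0 : 0 < 1 - th by rewrite subr_gt0.
have C10 : 0 < C1 by rewrite !mulr_gt0// addr_gt0 ?invr_gt0.
have C20 : 0 < C2 by rewrite !mulr_gt0 ?powR_gt0 ?invr_gt0.
exists (C1 + C2); first by rewrite addr_gt0.
move=> T A x y n T0 A1 TA x0 y0.
have A0 : 0 < A by exact: lt_le_trans A1.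
have TA0 : 0 < T / A by rewrite divr_gt0.
pose w j := 1 + A * `|1 - s j / T|.
have w1 j : 1 <= w j by rewrite lerDl mulr_ge0// ltW.
have w0 j : 0 < w j by exact: lt_le_trans (w1 j).
set X := (x + T^-1) `^ (- b); set Y := (y + T^-1) `^ (- b).
have X0 : 0 <= X by exact: powR_ge0.
have Y0 : 0 <= Y by exact: powR_ge0.
pose ta j := s j / T.
have t0 j : 0 < ta j by rewrite divr_gt0// (s_gt0 hs).
have term j : w j `^ (- N) * ((x + (s j)^-1) `^ (- b) * (y + (s j)^-1) `^ (- b)) <=
    X * Y * (w j `^ (-2) * (1 + ta j `^ (- (th / 2))) ^+ 2).
  have h1 := weight_compare x0 T0 (s_gt0 hs j) A1.
  have h2 := weight_compare y0 T0 (s_gt0 hs j) A1.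
  rewrite -/X -/(w j) -/(ta j) in h1; rewrite -/Y -/(w j) -/(ta j) in h2.
  set g := 1 + _ in h1 h2 *.
  have g0 : 0 <= g by rewrite addr_ge0 ?powR_ge0.
  apply: (@le_trans _ _ (w j `^ (- N) * ((X * (w j `^ `|b| * g)) * (Y * (w j `^ `|b| * g))))).
    by rewrite ler_wpM2l ?powR_ge0//; apply: ler_pM => //; exact: powR_ge0.
  have -> : w j `^ (- N) * ((X * (w j `^ `|b| * g)) * (Y * (w j `^ `|b| * g))) =
      X * Y * ((w j `^ (- N) * (w j `^ `|b| * w j `^ `|b|)) * g ^+ 2) by ring.
  rewrite ler_wpM2l ?mulr_ge0// ler_wpM2r ?sqr_ge0//.
  rewrite -!powRD ?(gt_eqF (w0 j)) ?implybT//; apply: ler_powR => //; lra.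
apply: (@le_trans _ _ (\sum_(j < n) X * Y * (w j `^ (-2) * (1 + ta j `^ (- (th / 2))) ^+ 2))).
  by apply: ler_sum => j _; exact: term.
rewrite -mulr_sumr mulrC ler_wpM2r ?mulr_ge0//.
have w2 j : w j `^ (-2) = (1 + A / T * `|s j - T|) ^- 2.
  rewrite powRN; congr (_^-1); rewrite powR_mulrn ?(ltW (w0 j))//; congr (_ ^+ _).
  rewrite /w; have -> : 1 - s j / T = - ((s j - T) / T) by field; rewrite gt_eqF.
  by congr (1 + _); rewrite normrN normrM normfV (gtr0_norm T0) mulrCA mulrC.
pose small j := (s j <= T).
have term2 j : w j `^ (-2) * (1 + ta j `^ (- (th / 2))) ^+ 2 <=
    16 * (1 + A / T * `|s j - T|) ^- 2 + (if small j then 16 / A * ta j `^ (- th) else 0).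
  have tt : (ta j `^ (- (th / 2))) ^+ 2 = ta j `^ (- th).
    by rewrite -powR_mulrn ?powR_ge0// -powRrM; congr (_ `^ _); field.
  have sq : (1 + ta j `^ (- (th / 2))) ^+ 2 <= 2 + 2 * ta j `^ (- th).
    by rewrite -tt; set g := _ `^ _; rewrite -subr_ge0 (_ : _ - _ = (1 - g) ^+ 2) ?sqr_ge0//; ring.
  have W0 : 0 <= w j `^ (-2) by exact: powR_ge0.
  have [half|half] := leP (1 / 2) (ta j).
    have tb : ta j `^ (- th) <= 2.
      rewrite powRN -[leRHS]invrK lef_pV2 ?posrE ?powR_gt0// ?invr_gt0//.
      apply: (@le_trans _ _ (2^-1 `^ th)); last first.
        by apply: ge0_ler_powR; rewrite ?nnegrE ?(ltW (t0 j))// -[2^-1]mul1r.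
      rewrite -[leLHS](powRr1 (_ : 0 <= 2^-1))//.
      by apply: ger_powR; [rewrite invr_gt0 ltr0n invf_le1// ler1n|exact: ltW].
    have : w j `^ (-2) * (1 + ta j `^ (- (th / 2))) ^+ 2 <= w j `^ (-2) * 16.
      by rewrite ler_wpM2l//; apply: (le_trans sq); lra.
    rewrite w2 mulrC => h1; apply: (le_trans h1).
    rewrite mulrC lerDl; case: ifP => // _.
    by rewrite mulr_ge0 ?powR_ge0// divr_ge0 ?ltW.
  have sm : small j.
    rewrite /small; have : s j / T < 1 by apply: lt_trans half _; lra.
    by rewrite ltr_pdivrMr// mul1r => /ltW.
  rewrite sm; apply: (@le_trans _ _ (16 / A * ta j `^ (- th))); last first.
    by rewrite lerDr mulr_ge0// invr_ge0 exprn_ge0// addr_ge0// mulr_ge0// divr_ge0 ?ltW.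
  have tb : 1 <= ta j `^ (- th).
    rewrite powRN invf_ge1 ?powR_gt0//.
    rewrite -[leRHS](powRr0 (ta j)); apply: ger_powR; rewrite ?t0//=.
    by apply: le_trans (ltW half) _; lra.
  have wA : A / 2 <= w j.
    rewrite /w -/(ta j) ger0_norm; last by rewrite subr_ge0; apply: le_trans (ltW half) _; lra.
    have : A * (1 / 2) <= A * (1 - ta j) by rewrite ler_pM2l//; lra.
    lra.
  have wA2 : w j `^ (-2) <= 4 / A.
    rewrite powRN -[4 / A]invf_div lef_pV2 ?posrE ?powR_gt0// ?divr_gt0//.
    rewrite powR_mulrn ?(ltW (w0 j))//.
    have := w1 j; move: wA; set W := w j => wA W1.
    have : W <= W ^+ 2 by rewrite expr2 ler_peMr// (le_trans ler01).
    lra.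
  apply: (@le_trans _ _ (4 / A * (4 * ta j `^ (- th)))).
    apply: ler_pM => //; first by rewrite sqr_ge0.
    by apply: (le_trans sq); lra.
  by rewrite le_eqVlt; apply/orP; left; apply/eqP; field; rewrite gt_eqF.
apply: (@le_trans _ _ (\sum_(j < n) (16 * (1 + A / T * `|s j - T|) ^- 2 + (if small j then 16 / A * ta j `^ (- th) else 0)))).
  by apply: ler_sum => j _; exact: term2.
rewrite big_split/= [leRHS]mulrDl; apply: lerD.
  rewrite -mulr_sumr.
  have := @sum_separated R s h (A / T) T n h0 (divr_gt0 A0 T0) hsep.
  have e : (A / T * h)^-1 = T / A * h^-1 by field; rewrite !gt_eqF.
  have : 1 <= ka0^-1 * (T / A) by rewrite ler_pdivlMl// mulr1.
  rewrite e /C1; set S := \sum_(_ < _) _; set q := T / A; move=> u1 u2.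
  rewrite (_ : 16 * 2 * _ * q = 16 * (2 * (ka0^-1 * q + q * h^-1))); last by ring.
  by rewrite ler_pM2l//; apply: (le_trans u2); rewrite ler_pM2l// lerD2r.
pose J := Num.truncn (T / h).
have Jle : J%:R <= T / h by rewrite truncn_le// divr_ge0 ?ltW.
have smallJ j : small j -> (j < J)%N.
  move=> sj; have : h * j.+1%:R <= T by exact: le_trans (hj j) sj.
  rewrite mulrC -ler_pdivlMr// => hh.
  have : j.+1%:R < (J.+1)%:R :> R by apply: le_lt_trans hh _; exact: truncnS_gt.
  by rewrite ltr_nat ltnS.
have term3 j : (if small j then 16 / A * ta j `^ (- th) else 0) <=
    (if (j < J)%N then 16 / A * ((h / T) `^ (- th) * j.+1%:R `^ (- th)) else 0).
  case: ifPn => sj; last first.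
    by case: ifP => // _; rewrite mulr_ge0 ?divr_ge0 ?(ltW A0)// mulr_ge0 ?powR_ge0.
  rewrite smallJ// ler_wpM2l// ?divr_ge0 ?(ltW A0)//.
  rewrite -powRM ?divr_ge0 ?(ltW h0) ?(ltW T0)// !powRN lef_pV2 ?posrE ?powR_gt0//; last first.
    by rewrite mulr_gt0// divr_gt0.
  apply: ge0_ler_powR; rewrite ?nnegrE ?(ltW (t0 j))//.
    by rewrite mulr_ge0// divr_ge0 ?ltW.
  by rewrite /ta mulrAC ler_pM2r ?invr_gt0.
apply: (@le_trans _ _ (\sum_(j < n) (if (j < J)%N then 16 / A * ((h / T) `^ (- th) * j.+1%:R `^ (- th)) else 0))).
  by apply: ler_sum => j _; exact: term3.
have pos (j : nat) : 0 <= 16 / A * ((h / T) `^ (- th) * j.+1%:R `^ (- th)).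
  by rewrite mulr_ge0 ?divr_ge0 ?(ltW A0)// mulr_ge0 ?powR_ge0.
apply: (@le_trans _ _ (\sum_(j < J) 16 / A * ((h / T) `^ (- th) * j.+1%:R `^ (- th)))).
  rewrite -big_mkcond/=.
  rewrite (big_ord_widen_cond (maxn n J) (fun j => j < J)%N (fun j => 16 / A * ((h / T) `^ (- th) * j.+1%:R `^ (- th)))) ?leq_maxl//.
  rewrite (big_ord_widen (maxn n J) (fun j => 16 / A * ((h / T) `^ (- th) * j.+1%:R `^ (- th)))) ?leq_maxr//.
  rewrite [leLHS]big_mkcond [leRHS]big_mkcond/=; apply: ler_sum => j _.
  by case: (j < J)%N => //=; case: ifP.
rewrite -mulr_sumr -mulr_sumr.
apply: (@le_trans _ _ (16 / A * ((h / T) `^ (- th) * ((1 - th)^-1 * (T / h) `^ (1 - th))))).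
  rewrite ler_wpM2l ?divr_ge0 ?(ltW A0)// ler_wpM2l ?powR_ge0//.
  apply: (le_trans (sum_powRN_le _ th0 th1)); rewrite ler_wpM2l ?invr_ge0 ?(ltW q0)//.
  apply: ge0_ler_powR; rewrite ?nnegrE ?(ltW q0)//.
  by rewrite divr_ge0 ?ltW.
have -> : (h / T) `^ (- th) = h `^ (- th) * T `^ th.
  rewrite powRM ?(ltW h0) ?invr_ge0 ?(ltW T0)//; congr (_ * _).
  by rewrite -(powR_inv1 (ltW T0)) -powRrM mulN1r opprK.
have -> : (T / h) `^ (1 - th) = T `^ (1 - th) * h `^ (th - 1).
  rewrite powRM ?(ltW T0) ?invr_ge0 ?(ltW h0)//; congr (_ * _).
  by rewrite -(powR_inv1 (ltW h0)) -powRrM mulN1r opprB.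
rewrite /C2.
have eT : T `^ th * T `^ (1 - th) = T.
  by rewrite -powRD ?(gt_eqF T0) ?implybT// addrC subrK powRr1// ltW.
rewrite (_ : 16 / A * _ = 16 / A * (h `^ (- th) * ((1 - th)^-1 * h `^ (th - 1))) * (T `^ th * T `^ (1 - th))); last by ring.
by rewrite eT le_eqVlt; apply/orP; left; apply/eqP; ring.
Qed.

Definition is_bump y r f : Prop := exists e h, [/\ radial nu f e h, f 1 = 0,
  forall x, 0 <= f x, forall x, 0 <= x -> r <= `|x - y| -> f x = 0 & wint nu f = 1].

Lemma bump_average y r eps f g : is_bump y r f -> continuous g ->
  (forall x, 0 < x < 1 -> `|x - y| < r -> `|g x - g y| <= eps) -> `|ip nu f g - g y| <= eps.
Proof.
move=> [e [h [rf _ f0 fz fi]]] cg hg; have [cf _] := radial_continuous rf.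
have cgy : continuous (fun x => g x - g y) by apply: cB => //; exact: ccst.
have -> : ip nu f g - g y = wint nu (fun x => f x * (g x - g y)).
  rewrite (_ : (fun x => f x * _) = fun x => f x * g x - g y * f x); last first.
    by apply/funext => x; ring.
  rewrite wintB//; [|exact: cM|by apply: cM => //; exact: ccst].
  by rewrite wintZ// fi mulr1.
have -> : eps = wint nu (fun x => eps * f x) by rewrite wintZ// fi mulr1.
apply: norm_wint_le => //; [exact: cM|by apply: cM => //; exact: ccst|].
move=> x /andP[x0 x1]; rewrite normrM (ger0_norm (f0 x)) mulrC.
have [rx|xr] := leP r `|x - y|; first by rewrite fz ?mulr0// ltW.
by rewrite ler_wpM2r// hg// x0.
Qed.

Lemma bump_coef_le y r K f j : is_bump y r f ->
  (forall x, 0 < x < 1 -> `|x - y| < r -> `|ev j x| <= K) -> `|fcoef f j| <= K.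
Proof.
move=> [e [h [rf _ f0 fz fi]]] hK; have [cf _] := radial_continuous rf.
have ce := @continuous_ev R nu s nu1 j.
have -> : K = wint nu (fun x => K * f x) by rewrite wintZ// fi mulr1.
apply: norm_wint_le => //; [exact: cM|by apply: cM => //; exact: ccst|].
move=> x /andP[x0 x1]; rewrite normrM (ger0_norm (f0 x)) mulrC.
have [rx|xr] := leP r `|x - y|; first by rewrite fz ?mulr0// ltW.
by rewrite ler_wpM2r// hK// x0.
Qed.

Lemma bumps_exist y (r : nat -> R) : 0 < y < 1 -> (forall k, 0 < r k) ->
  exists f : nat -> R -> R, forall k, is_bump y (r k) (f k).
Proof.
move=> y01 r0; have /choice[f hf] : forall k, exists f, is_bump y (r k) f; last by exists f.
by move=> k; have [f [e [h [? ? ? ? ?]]]] := bump_at nu1 y01 (r0 k); exists f, e, h.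
Qed.

Lemma bump_coef_cvg y (r : nat -> R) (f : nat -> R -> R) j : r k @[k --> \oo] --> (0 : R) ->
  (forall k, is_bump y (r k) (f k)) -> fcoef (f k) j @[k --> \oo] --> ev j y.
Proof.
move=> r0 bf; have ce := @continuous_ev R nu s nu1 j.
apply/cvgrPdist_le => /= eps e0.
have /cvgrPdist_le/(_ _ e0)/nbhs_ballP[d /= d0 hd] := ce y.
near=> k; rewrite distrC; apply: bump_average (bf k) ce _ => x _ xy.
rewrite distrC; apply: hd; rewrite /ball/= distrC; apply: lt_le_trans xy _.
by near: k; apply: (cvgr_le _ r0).
Unshelve. all: by end_near. Qed.

(* A bound for averages over shrinking bumps is a bound for the kernel itself. *)
Lemma kernel_test n (c : nat -> R) x y r0 B : 0 < x < 1 -> 0 < y < 1 -> 0 < r0 ->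
  (forall r f g, 0 < r <= r0 -> is_bump y r f -> is_bump x r g ->
     `|\sum_(j < n) c j * (fcoef f j * fcoef g j)| <= B) ->
  `|\sum_(j < n) c j * (ev j x * ev j y)| <= B.
Proof.
move=> x01 y01 r00 h.
pose r (k : nat) := r0 / k.+1%:R.
have rk k : 0 < r k by rewrite divr_gt0.
have [f hf] := bumps_exist y01 rk; have [g hg] := bumps_exist x01 rk.
have rcv : r k @[k --> \oo] --> (0 : R).
  by rewrite -[X in _ --> X](mulr0 r0); apply: cvgMr; exact: cvg_harmonic.
have cv : \sum_(j < n) c j * (fcoef (f k) j * fcoef (g k) j) @[k --> \oo] -->
    \sum_(j < n) c j * (ev j x * ev j y).
  apply: cvg_ordsum => j; apply: cvgMr; rewrite (mulrC (ev j x)).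
  by apply: cvgM; exact: bump_coef_cvg rcv _.
have cvn : `|\sum_(j < n) c j * (fcoef (f k) j * fcoef (g k) j)| @[k --> \oo] -->
    `|\sum_(j < n) c j * (ev j x * ev j y)| by exact: cvg_norm cv.
apply: (cvgr_to_le cvn); near=> k.
apply: h (hf k) (hg k); rewrite rk/= /r ler_pdivrMr// ler_peMr ?(ltW r00)// ler1n//.
Unshelve. all: by end_near. Qed.

Section Bound.
Variable de : R.
Hypothesis de0 : 0 < de.
Notation msym := (msym de).

(** The symbol is replaced by its approximant of type L A with A of order T(y - x). The approximant
    contributes nothing by finite speed, and the error A^(-de), summed over O(T/A) zeros near T,
    gives T A^(-1-de). *)
Lemma kernel_far : exists C L : R, [/\ 0 < C, 0 < L & forall T x y n, 0 < T -> T <= s n ->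
  0 < x < 1 -> 0 < y < 1 -> x < y -> L <= T * (y - x) ->
  `|\sum_(j < n) msym (s j / T) * (ev j x * ev j y)| <=
    C * T * (T * (y - x)) `^ (-1 - de) * ((x + T^-1) `^ (- b) * (y + T^-1) `^ (- b))].
Proof.
pose N := 2 + 2 * `|b|.
have [r [r0 der rN]] : exists r : nat, [/\ (0 < r)%N, de <= r%:R & N <= r%:R - de].
  exists (Num.truncn (N + de)).+1; have h := truncnS_gt (N + de).
  have N0 : 0 <= N by rewrite addr_ge0// mulr_ge0.
  by split => //; lra.
have [C [L [C0 L0 hF]]] := approximant de0 r0 der.
have L40 : 0 < 4 * L by rewrite mulr_gt0.
have [D D0 hD] := zero_sum L40 rN.
have [E E0 hE] := ev_bound nu1 hs.
pose K := E * 2 `^ `|b|.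
have K0 : 0 < K by rewrite mulr_gt0 ?powR_gt0.
pose C' := K ^+ 2 * C * D * (4 * L) `^ (1 + de).
exists C', (4 * L); split; rewrite ?mulr_gt0 ?exprn_gt0 ?powR_gt0//.
move=> T x y n T0 Tn /andP[x0 x1] /andP[y0 y1] xy LT.
have yx : 0 < y - x by rewrite subr_gt0.
(* The times involved are |t|/T <= L A/T = (y - x)/4, less than the distance of the two bumps. *)
pose A := T * (y - x) / (4 * L).
have A1 : 1 <= A by rewrite ler_pdivlMr// mul1r.
have A0 : 0 < A by exact: lt_le_trans A1.
have TA : 4 * L <= T / A.
  have -> : T / A = 4 * L * (y - x)^-1 by rewrite /A; field; rewrite !gt_eqF.
  by rewrite ler_peMr ?(ltW L40)// invf_ge1//; lra.
have [F tF mF] := hF A A1.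
(* The first bound keeps the weights on the bumps comparable to those at the centres, the second
   keeps the bumps 3(y - x)/4 apart. *)
pose r1 := Num.min (x / 2) ((y - x) / 8).
have r10 : 0 < r1 by rewrite lt_min !divr_gt0.
have r1x : r1 <= x / 2 by rewrite ge_min lexx.
have r1y : r1 <= (y - x) / 8 by rewrite ge_min lexx orbT.
apply: (@kernel_test _ (fun j => msym (s j / T)) x y r1); rewrite ?x0 ?y0//.
move=> ro f g /andP[ro0 ror1] bf bg.
have wt z z' sj : 0 < z -> 0 < z' -> `|z' - z| < ro -> ro <= z / 2 -> 0 < sj ->
    (z' + sj^-1) `^ (- b) <= 2 `^ `|b| * (z + sj^-1) `^ (- b).
  move=> z0 z0' zz roz sj0; rewrite -(normrN b).
  have si : 0 < sj^-1 by rewrite invr_gt0.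
  by move: zz; rewrite ltr_norml => /andP[q1 q2]; apply: powR_ratio; rewrite ?ltr_wpDl ?(ltW z0) ?(ltW z0') ?ler1n//; clear -q1 q2 roz si z0 z0'; lra.
have coef z ro' k j : 0 < z < 1 -> is_bump z ro' k -> ro' <= z / 2 -> ro' <= ro ->
    `|fcoef k j| <= K * (z + (s j)^-1) `^ (- b).
  move=> /andP[z0 z1] bk roz roro; apply: bump_coef_le bk _ => x' /andP[x0' x1'] zz.
  apply: (le_trans (hE j x' (ltW x0'))); rewrite /K -mulrA ler_pM2l//.
  rewrite -(normrN b).
  have sj0 := s_gt0 hs j; have si : 0 < (s j)^-1 by rewrite invr_gt0.
  by move: zz; rewrite ltr_norml => /andP[q1 q2]; apply: powR_ratio; rewrite ?ltr_wpDl ?(ltW z0) ?(ltW x0') ?ler1n//; clear -q1 q2 roz roro si z0 x0'; lra.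
have cf j : `|fcoef f j| <= K * (y + (s j)^-1) `^ (- b).
  have roy : ro <= y / 2.
    by apply: (le_trans (le_trans ror1 r1x)); rewrite ler_pM2r ?invr_gt0// ltW.
  by apply: (coef y ro) => //; rewrite y0.
have cg j : `|fcoef g j| <= K * (x + (s j)^-1) `^ (- b).
  have rox : ro <= x / 2 by exact: le_trans ror1 r1x.
  by apply: (coef x ro) => //; rewrite x0.
pose a j := fcoef f j * fcoef g j.
have ab j : `|a j| <= K ^+ 2 * ((x + (s j)^-1) `^ (- b) * (y + (s j)^-1) `^ (- b)).
  rewrite /a normrM; apply: (le_trans (ler_pM _ _ (cf j) (cg j))) => //.
  by rewrite le_eqVlt; apply/orP; left; apply/eqP; ring.
apply/ler_addgt0Pr => eps e0.
have [Cf Cf0 hcf] := tF.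
have ep : 0 < eps / (Cf + 1) by rewrite divr_gt0// ltr_wpDl.
have [e [h [rf f1 f0 fz fi]]] := bf; have [e' [h' [rg g1 g0 gz gi]]] := bg.
have [cgg _] := radial_continuous rg.
have [|||||N0 hN0] := finite_speed nu1 hs (al := x + ro) (be := y - ro) (T := (y - x) / 4) rf f1 cgg _ _ _ _ _ ep.
- by rewrite addr_ge0 ?ltW.
- by rewrite divr_ge0// ltW.
- lra.
- move=> z /andP[z0 zy]; apply: fz; first exact: ltW.
  rewrite ltr0_norm; last by rewrite subr_lt0 (lt_le_trans zy)// gerBl ltW.
  by rewrite opprB lerBrDr addrC -lerBrDr ltW.
- move=> z z0 xz; apply: gz; first exact: ltW.
  rewrite ger0_norm; first by rewrite lerBrDl.
  by rewrite subr_ge0; apply: le_trans xz; rewrite lerDl ltW.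
(* Finite speed holds only for long sums, while the Riesz sum stops at n. It can be lengthened
   because the symbol vanishes at s_j/T for j >= n; the approximant does not. *)
pose M := maxn n N0.
have hM := hN0 M (leq_maxr _ _).
have hFM : `|\sum_(j < M) F (s j / T) * a j| <= eps.
  apply: (@le_trans _ _ (Cf * (eps / (Cf + 1)))); last first.
    by rewrite mulrCA ger_pMr// ler_pdivrMr ?mul1r ?lerDl// ltr_wpDl.
  apply: (hcf M (fun j => s j / T) a) => t tL.
  have := hM (t / T); rewrite normrM normfV (gtr0_norm T0) => H.
  under eq_bigr do rewrite mulrA mulrAC.
  apply: H; rewrite ler_pdivrMr//; apply: (le_trans tL).
  by rewrite /A le_eqVlt; apply/orP; left; apply/eqP; field; rewrite gt_eqF.
have -> : \sum_(j < n) msym (s j / T) * (fcoef f j * fcoef g j) = \sum_(j < M) msym (s j / T) * a j.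
  rewrite (big_ord_widen M (fun j => msym (s j / T) * (fcoef f j * fcoef g j))) ?leq_maxl//.
  rewrite big_mkcond/=; apply: eq_bigr => j _; case: ltnP => // nj.
  rewrite msym_out ?mul0r// ger0_norm ?divr_ge0 ?(ltW (s_gt0 hs j)) ?(ltW T0)//.
  by rewrite ler_pdivlMr// mul1r (le_trans Tn)// (s_le hs).
have -> : \sum_(j < M) msym (s j / T) * a j =
   \sum_(j < M) (msym (s j / T) - F (s j / T)) * a j + \sum_(j < M) F (s j / T) * a j.
  by rewrite -big_split/=; apply: eq_bigr => j _; rewrite mulrBl subrK.
apply: (le_trans (ler_normD _ _)); apply: lerD => //.
apply: (le_trans (ler_norm_sum _ _ _)).
apply: (@le_trans _ _ (K ^+ 2 * C * A `^ (- de) * \sum_(j < M) (1 + A * `|1 - s j / T|) `^ (- (r%:R - de)) *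
   ((x + (s j)^-1) `^ (- b) * (y + (s j)^-1) `^ (- b)))).
  rewrite mulr_sumr; apply: ler_sum => j _; rewrite normrM.
  have m1 := mF (s j / T).
  rewrite (ger0_norm (divr_ge0 (ltW (s_gt0 hs j)) (ltW T0))) in m1.
  apply: (le_trans (ler_pM _ _ m1 (ab j))) => //.
  by rewrite opprB le_eqVlt; apply/orP; left; apply/eqP; ring.
have hz := hD T A x y M T0 A1 TA (ltW x0) (ltW y0).
apply: (@le_trans _ _ (K ^+ 2 * C * A `^ (- de) * (D * (T / A) * ((x + T^-1) `^ (- b) * (y + T^-1) `^ (- b))))).
  by rewrite ler_wpM2l// !mulr_ge0 ?powR_ge0 ?exprn_ge0 ?ltW.
have eA : A `^ (- de) / A = (4 * L) `^ (1 + de) * (T * (y - x)) `^ (-1 - de).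
  have -> : A `^ (- de) / A = A `^ (-1 - de).
    by rewrite -(powR_pred _ A0); congr (_ `^ _); ring.
  have TY : 0 < T * (y - x) by rewrite mulr_gt0.
  rewrite /A powRM ?(ltW TY) ?invr_ge0 ?(ltW L40)// mulrC; congr (_ * _).
  by rewrite -(powR_inv1 (ltW L40)) -powRrM; congr (_ `^ _); ring.
rewrite (_ : K ^+ 2 * C * A `^ (- de) * _ = K ^+ 2 * C * D * T * (A `^ (- de) / A) *
   ((x + T^-1) `^ (- b) * (y + T^-1) `^ (- b))); last by ring.
by rewrite eA /C' le_eqVlt; apply/orP; left; apply/eqP; ring.
Qed.

(** The triangle inequality suffices near the diagonal: this is [zero_sum] with A = 1, whose lower
    bound on T/A is the first zero. *)
Lemma kernel_near : exists2 C : R, 0 < C & forall T x y n, s 0%N <= T -> 0 <= x -> 0 <= y ->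
  `|\sum_(j < n) msym (s j / T) * (ev j x * ev j y)| <=
    C * T * ((x + T^-1) `^ (- b) * (y + T^-1) `^ (- b)).
Proof.
pose N := 2 + 2 * `|b|.
have [D D0 hD] := zero_sum (s_gt0 hs 0) (lexx N).
have [E E0 hE] := ev_bound nu1 hs.
exists (E ^+ 2 * 2 `^ N * D); first by rewrite !mulr_gt0 ?powR_gt0 ?exprn_gt0.
move=> T x y n T0 x0 y0; have Tp : 0 < T := lt_le_trans (s_gt0 hs 0) T0.
have N0 : 0 <= N by rewrite addr_ge0// mulr_ge0.
apply: (le_trans (ler_norm_sum _ _ _)).
have := hD T 1 x y n Tp (lexx 1); rewrite divr1 => /(_ T0 x0 y0) hz.
apply: (@le_trans _ _ (E ^+ 2 * 2 `^ N * (\sum_(j < n) (1 + 1 * `|1 - s j / T|) `^ (- N) *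
   ((x + (s j)^-1) `^ (- b) * (y + (s j)^-1) `^ (- b))))).
  rewrite mulr_sumr; apply: ler_sum => j _; rewrite mul1r.
  rewrite normrM (ger0_norm (msym_ge0 _ _)) normrM.
  have ta0 : 0 <= s j / T by rewrite divr_ge0 ?(ltW (s_gt0 hs j)) ?ltW.
  have hm : msym (s j / T) <= 2 `^ N * (1 + `|1 - s j / T|) `^ (- N).
    have [t1|t1] := leP 1 (s j / T).
      by rewrite msym_out; [rewrite mulr_ge0 ?powR_ge0|exact: de0|rewrite (ger0_norm ta0)].
    apply: (le_trans (msym_le1 _ _)) => //.
    rewrite powRN ler_pdivlMr ?powR_gt0 ?mul1r ?ltr_pwDl//.
    apply: ge0_ler_powR; rewrite ?nnegrE ?addr_ge0//.
    by rewrite ger0_norm; lra.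
  apply: (@le_trans _ _ ((2 `^ N * (1 + `|1 - s j / T|) `^ (- N)) *
     ((E * (x + (s j)^-1) `^ (- b)) * (E * (y + (s j)^-1) `^ (- b))))).
    apply: ler_pM => //; first exact: msym_ge0.
    by apply: ler_pM => //; exact: hE.
  by rewrite le_eqVlt; apply/orP; left; apply/eqP; ring.
have E20 : 0 <= E ^+ 2 * 2 `^ N by rewrite mulr_ge0 ?powR_ge0// exprn_ge0// ltW.
apply: (le_trans (ler_wpM2l E20 hz)).
by rewrite le_eqVlt; apply/orP; left; apply/eqP; ring.
Qed.

Lemma kernel_bound : exists2 C : R, 0 < C & forall T x y n, 0 < T -> T <= s n ->
  0 < x < 1 -> 0 < y < 1 ->
  `|\sum_(j < n) msym (s j / T) * (ev j x * ev j y)| <=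
    C * T * (1 + T * `|x - y|) `^ (-1 - de) * ((x + T^-1) `^ (- b) * (y + T^-1) `^ (- b)).
Proof.
have [C1 [L [C10 L0 far]]] := kernel_far.
have [C2 C20 near] := kernel_near.
pose D1 := (1 + L^-1) `^ (1 + de); pose D2 := (1 + L) `^ (1 + de).
have Li : 0 < L^-1 by rewrite invr_gt0.
have D10 : 0 < D1 by rewrite powR_gt0 ?addr_gt0.
have D20 : 0 < D2 by rewrite powR_gt0 ?addr_gt0.
exists (C1 * D1 + C2 * D2); first by rewrite addr_gt0 ?mulr_gt0.
move=> T x y n T0 Tn x01 y01.
set X := (x + T^-1) `^ (- b); set Y := (y + T^-1) `^ (- b).
have X0 : 0 <= X by exact: powR_ge0.
have Y0 : 0 <= Y by exact: powR_ge0.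
set d := `|x - y|; have d0 : 0 <= d by exact: normr_ge0.
have Td : 0 <= T * d by rewrite mulr_ge0// ltW.
have Td1 : 0 < 1 + T * d by rewrite ltr_pwDl.
have e1 : -1 - de = - (1 + de) by ring.
have q0 : 0 <= 1 + de by rewrite addr_ge0// ltW.
set P := (1 + T * d) `^ (-1 - de); have P0 : 0 <= P by exact: powR_ge0.
have fin C D : 0 <= C -> 0 <= D -> `|\sum_(j < n) msym (s j / T) * (ev j x * ev j y)| <= C * T * (D * P) * (X * Y) ->
   C * D <= C1 * D1 + C2 * D2 ->
   `|\sum_(j < n) msym (s j / T) * (ev j x * ev j y)| <= (C1 * D1 + C2 * D2) * T * P * (X * Y).
  move=> CC DD h hc; apply: (le_trans h).
  rewrite (_ : C * T * (D * P) * (X * Y) = C * D * (T * P * (X * Y))); last by ring.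
  rewrite [leRHS](_ : _ = (C1 * D1 + C2 * D2) * (T * P * (X * Y))); last by ring.
  by rewrite ler_wpM2r// !mulr_ge0// ltW.
have [LT|TL] := leP L (T * d).
  apply: (fin C1 D1); [exact: ltW|exact: ltW| |by rewrite lerDl mulr_ge0 ?ltW].
  have k : (T * d) `^ (-1 - de) <= D1 * P.
    rewrite /D1 /P e1 !powRN.
    have Tdp : 0 < T * d by exact: lt_le_trans LT.
    rewrite ler_pdivlMr ?powR_gt0// mulrC ler_pdivrMr ?powR_gt0// -powRM ?addr_ge0 ?(ltW Li)//.
    apply: ge0_ler_powR; [exact: q0|exact: ltW|by rewrite nnegrE mulr_ge0// addr_ge0// ltW|].
    by rewrite mulrDl mul1r addrC lerD2l ler_pdivlMl// mulr1.
  apply: (@le_trans _ _ (C1 * T * (T * d) `^ (-1 - de) * (X * Y))); last first.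
    by rewrite ler_wpM2r ?mulr_ge0// ler_wpM2l// mulr_ge0 ?ltW.
  have [xy|yx|xy] := ltgtP x y.
  - have dE : d = y - x by rewrite /d distrC ger0_norm// subr_ge0 ltW.
    by rewrite dE in LT *; exact: far.
  - have dE : d = x - y by rewrite /d ger0_norm// subr_ge0 ltW.
    rewrite dE in LT *; rewrite (mulrC X).
    under eq_bigr do rewrite (mulrC (ev _ x)).
    exact: far.
  - by exfalso; move: LT; rewrite /d xy subrr normr0 mulr0 leNgt L0.
have [x0 x1] := andP x01; have [y0 y1] := andP y01.
apply: (fin C2 D2); [exact: ltW|exact: ltW| |by rewrite lerDr mulr_ge0 ?ltW].
have k : 1 <= D2 * P.
  rewrite /D2 /P e1 powRN ler_pdivlMr ?powR_gt0// mul1r.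
  by apply: ge0_ler_powR; [exact: q0|rewrite nnegrE addr_ge0|rewrite nnegrE addr_ge0// ltW|rewrite lerD2l ltW].
have [sT|Ts] := leP (s 0%N) T.
  apply: (le_trans (near T x y n sT (ltW x0) (ltW y0))).
  by rewrite -/X -/Y ler_wpM2r ?mulr_ge0// ler_peMr// mulr_ge0 ?(ltW C20) ?(ltW T0).
rewrite big1 ?normr0; first by rewrite !mulr_ge0// ltW.
move=> j _; rewrite msym_out ?mul0r// ger0_norm ?divr_ge0 ?(ltW (s_gt0 hs j)) ?(ltW T0)//.
by rewrite ler_pdivlMr// mul1r (le_trans (ltW Ts))// (s_le hs).
Qed.

End Bound.

End Kernel.

(** * Maximal functions and Schur's test *)

Section RealAnalysis.
Variable R : realType.
Notation mu := (@lebesgue_measure R).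
Implicit Types (f g h : R -> R) (x y t p q r : R).
Local Open Scope ereal_scope.

(* No measurability is required: the integral of a nonnegative function is a supremum over simple functions. *)
Lemma integral_mono (D : set R) (f1 f2 : R -> \bar R) : (forall x, D x -> 0 <= f1 x) ->
  (forall x, D x -> f1 x <= f2 x) -> \int[mu]_(x in D) f1 x <= \int[mu]_(x in D) f2 x.
Proof.
move=> f0 f12; rewrite !ge0_integralE//; last by move=> x Dx; exact: le_trans (f0 x Dx) (f12 x Dx).
apply: le_ereal_sup => _ [s hs <-]; exists s => // x; apply: (le_trans (hs x)).
by rewrite !patchE; case: ifPn => // /set_mem; exact: f12.
Qed.

Lemma le_poweR (a c : \bar R) p : (0 <= p)%R -> 0 <= a -> a <= c -> a `^ p <= c `^ p.
Proof.
move=> p0 a0 ac; apply: gt0_ler_poweR => //; rewrite in_itv/= leey andbT//.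
exact: le_trans ac.
Qed.

Lemma measurable_fun_powRc d (T : measurableType d) (D : set T) (f : T -> R) r :
  measurable_fun D f -> measurable_fun D (fun x : T => f x `^ r)%R.
Proof. by move=> mf; apply: (measurableT_comp (measurable_powR r)). Qed.

Lemma integral_powR_oo q r : (0 < q)%R -> (0 <= r)%R ->
  \int[mu]_(t in `]0%R, r[) (t `^ (q - 1))%:E = (r `^ q / q)%:E.
Proof.
move=> q0; rewrite le_eqVlt => /predU1P[<-|r0].
  by rewrite set_itvoo0 integral_set0 powR0 ?gt_eqF// mul0r.
apply: (etrans (@ge0_FTC_oo R (fun x => x `^ (q - 1))%R (fun x => q^-1 * x `^ q)%R 0%R r _ _ _ _ _ _)) => //.
- move=> x /andP[x0 _]; apply: dE (dZ q^-1 (dpowR q x0)) _.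
  by rewrite mulrA mulVf ?gt_eqF// mul1r.
- by move=> x; rewrite in_itv/= => /andP[x0 _]; exact: continuous_powR_pos.
- by apply: cvgMr; exact: powR_cvg_right0.
- by apply: cvgMr; apply: cvg_at_left_filter; exact: continuous_powR_pos.
- by move=> x _; exact: powR_ge0.
- by rewrite powR0 ?gt_eqF// mulr0 subr0 mulrC.
Qed.

(** Marcinkiewicz interpolation with L^oo: u^p is written as an integral over levels, the weak bound
    is applied to g truncated at t/2, and Tonelli turns the level integral into (2 g)^(p-1)/(p -
    1). *)
Lemma weak_to_strong (u : R -> \bar R) g p (C : R) : (1 < p)%R -> (0 <= C)%R ->
  measurable_fun setT u -> (forall x, 0 <= u x) ->
  measurable_fun setT g -> (forall x, 0 <= g x)%R ->
  (forall t, (0 < t)%R -> mu [set x | t%:E < u x] <=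
      (C / t)%:E * \int[mu]_x (if (t / 2 < g x)%R then g x else 0%R)%:E) ->
  \int[mu]_x (u x `^ p) <= (C * p / (p - 1) * 2 `^ (p - 1))%:E * \int[mu]_x (g x `^ p)%:E.
Proof.
move=> p1 C0 mu_ u0 mg g0 weak; have p0 : (0 < p)%R by lra.
have q0 : (0 < p - 1)%R by rewrite subr_gt0.
pose F (z : R * R) : \bar R := if ((0 < z.2)%R && (z.2%:E < u z.1)) then (p * z.2 `^ (p - 1))%:E else 0.
pose G (z : R * R) : \bar R := if ((0 < z.2)%R && (z.2 / 2 < g z.1)%R) then (C * p * (z.2 `^ (p - 1 - 1) * g z.1))%:E else 0.
have F0 z : 0 <= F z by rewrite /F; case: ifP => // _; rewrite lee_fin mulr_ge0 ?powR_ge0// ltW.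
have G0 z : 0 <= G z.
  by rewrite /G; case: ifP => // _; rewrite lee_fin !mulr_ge0 ?powR_ge0// ltW.
have mF : measurable_fun setT F.
  apply: measurable_fun_ifT.
  - apply: measurable_and; first exact: measurable_fun_ltr.
    apply: measurable_fun_lte; first by apply/measurable_EFinP; exact: measurable_snd.
    by apply: measurableT_comp => //; exact: measurable_fst.
  - apply/measurable_EFinP; apply: measurable_funM => //.
    by apply: measurable_fun_powRc; exact: measurable_snd.
  - exact: measurable_cst.
have mG : measurable_fun setT G.
  have mg1 : measurable_fun setT (fun z : R * R => g z.1).
    by apply: measurableT_comp => //; exact: measurable_fst.
  apply: measurable_fun_ifT.
  - apply: measurable_and; first exact: measurable_fun_ltr.
    apply: measurable_fun_ltr => //; apply: measurable_funM => //; exact: measurable_snd.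
  - apply/measurable_EFinP; apply: measurable_funM => //; apply: measurable_funM => //.
    by apply: measurable_fun_powRc; exact: measurable_snd.
  - exact: measurable_cst.
have layer x : u x `^ p <= \int[mu]_t F (x, t).
  (* u may be infinite, so the level formula is tested on all finite r below u x. *)
  have low r : (0 <= r)%R -> r%:E <= u x -> (r `^ p)%:E <= \int[mu]_t F (x, t).
    move=> r0 ru.
    have <- : \int[mu]_(t in `]0%R, r[) (p * t `^ (p - 1))%:E = (r `^ p)%:E.
      under eq_integral do rewrite EFinM.
      rewrite ge0_integralZl//.
      - by rewrite integral_powR_oo// -EFinM mulrCA divff ?gt_eqF// mulr1.
      - by apply/measurable_EFinP; apply: measurable_funTS; exact: measurable_powR.
      - by move=> t _; rewrite lee_fin powR_ge0.
      - by rewrite lee_fin ltW.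
    rewrite [leLHS]integral_mkcond; apply: integral_mono => t _.
      by rewrite patchE; case: ifP => // _; rewrite lee_fin mulr_ge0 ?powR_ge0// ltW.
    rewrite patchE; case: ifPn => [|_]; last exact: F0.
    rewrite inE/= in_itv/= => /andP[t0 tr]; rewrite /F/= t0 ifT//.
    by apply: lt_le_trans ru; rewrite lte_fin.
  move: (u0 x) low; case: (u x) => [r| |] // r0 low; first by rewrite poweR_EFin low// -lee_fin.
  rewrite poweRyr ?gt_eqF// leye_eq; apply/eqP/eqyP => A A0.
  apply: le_trans (low (A `^ p^-1)%R (powR_ge0 _ _) (leey _)).
  by rewrite -powRrM mulVf ?gt_eqF// powRr1// ltW.
apply: (@le_trans _ _ (\int[mu]_x \int[mu]_t F (x, t))).
  by apply: integral_mono => x _; rewrite ?poweR_ge0.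
rewrite (@fubini_tonelli _ _ _ _ _ mu mu F)//.
apply: (@le_trans _ _ (\int[mu]_t \int[mu]_x G (x, t))).
  apply: integral_mono => t _; first exact: integral_ge0.
  have [t0|t0] := leP t 0%R.
    rewrite (_ : (fun x => F (x, t)) = cst 0); first by rewrite integral0 integral_ge0.
    by apply/funext => x; rewrite /F/= ltNge t0.
  have mt : measurable [set x | t%:E < u x].
    by rewrite -[X in measurable X]setTI; exact: emeasurable_fun_o_infty.
  have -> : \int[mu]_x F (x, t) = (p * t `^ (p - 1))%:E * mu [set x | t%:E < u x].
    rewrite -[mu _]mul1e -integral_cst// -ge0_integralZl//=; last first.
      by rewrite lee_fin mulr_ge0 ?powR_ge0// ltW.
    rewrite [RHS]integral_mkcond; apply: eq_integral => x _; rewrite patchE /F/= t0/=.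
    case: ifPn => xu; first by rewrite mem_set// mule1.
    by rewrite memNset//; exact/negP.
  apply: (@le_trans _ _ ((p * t `^ (p - 1))%:E * ((C / t)%:E * \int[mu]_x (if (t / 2 < g x)%R then g x else 0%R)%:E))).
    by rewrite lee_pmul2l ?weak// ?lte_fin ?mulr_gt0 ?powR_gt0//.
  rewrite muleA -EFinM -ge0_integralZl//.
  - apply: integral_mono => x _.
      rewrite -EFinM lee_fin mulr_ge0//; first by rewrite !mulr_ge0 ?powR_ge0 ?invr_ge0 ?(ltW p0) ?(ltW t0).
      by case: ifP.
    rewrite /G/= t0/=; case: ifP => _; last by rewrite mule0.
    rewrite -EFinM lee_fin (powR_pred (p - 1) t0) le_eqVlt; apply/orP; left; apply/eqP.
    by field; rewrite gt_eqF.
  - apply/measurable_EFinP; apply: measurable_fun_ifT => //; exact: measurable_fun_ltr.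
  - by move=> x _; case: ifP => //; rewrite lee_fin.
  - by rewrite lee_fin !mulr_ge0 ?powR_ge0 ?invr_ge0 ?(ltW p0) ?(ltW t0).
rewrite -(@fubini_tonelli _ _ _ _ _ mu mu G)//.
rewrite -ge0_integralZl//; last 3 first.
- by apply/measurable_EFinP; exact: measurable_fun_powRc.
- by move=> x _; rewrite lee_fin powR_ge0.
- by rewrite lee_fin !mulr_ge0 ?powR_ge0 ?invr_ge0 ?(ltW p0) ?(ltW q0).
apply: integral_mono => x _; first exact: integral_ge0.
have := g0 x; rewrite le_eqVlt => /predU1P[gx|gx].
  rewrite (_ : (fun t => G (x, t)) = cst 0).
    by rewrite integral0 mule_ge0// lee_fin ?powR_ge0// !mulr_ge0 ?powR_ge0 ?invr_ge0 ?(ltW p0) ?(ltW q0).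
  apply/funext => t; rewrite /G/= -gx; case: ifP => // /andP[t0].
  by rewrite ltNge divr_ge0// ltW.
have -> : \int[mu]_t G (x, t) = \int[mu]_(t in `]0%R, (2 * g x)%R[) ((C * p * g x)%:E * (t `^ (p - 1 - 1))%:E).
  rewrite [RHS]integral_mkcond; apply: eq_integral => t _; rewrite patchE /G/=.
  have e : ((0 < t)%R && (t / 2 < g x)%R) = (t \in `]0%R, (2 * g x)%R[).
    by rewrite in_itv/= ltr_pdivrMr// mulrC.
  rewrite e; case: ifPn => ht; last by rewrite memNset//; exact/negP.
  by rewrite mem_set// -EFinM; congr EFin; ring.
rewrite ge0_integralZl//.
- rewrite integral_powR_oo//; last by rewrite mulr_ge0.
  rewrite -!EFinM lee_fin powRM//.
  have gp : (g x `^ p = g x * g x `^ (p - 1))%R.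
    by rewrite (powR_pred _ gx) mulrCA divff ?gt_eqF// mulr1.
  rewrite gp le_eqVlt; apply/orP; left; apply/eqP.
  by field; rewrite gt_eqF.
- by apply/measurable_EFinP; apply: measurable_funTS; exact: measurable_powR.
- by move=> t _; rewrite lee_fin powR_ge0.
- by rewrite lee_fin !mulr_ge0// ltW.
Qed.

Lemma locally_integrable_powR g p : (1 < p)%R -> measurable_fun setT g -> (forall x, 0 <= g x)%R ->
  \int[mu]_x (g x `^ p)%:E < +oo -> locally_integrable setT g.
Proof.
move=> p1 mg g0 gp.
split => //; first exact: openT.
move=> K _ cK; have mK := compact_measurable cK.
apply: (@le_lt_trans _ _ (\int[mu]_(x in K) (1 + (g x `^ p)%:E))).
  apply: ge0_le_integral => //.
  - by apply/measurable_EFinP; apply: measurableT_comp => //; exact: measurable_funTS.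
  - apply: emeasurable_funD => //; apply/measurable_EFinP; apply: measurable_funTS; exact: measurable_fun_powRc.
  move=> x _; rewrite ger0_norm// -EFinD lee_fin.
  have [g1|/ltW g1] := leP (g x) 1%R; first by rewrite (le_trans g1)// lerDl powR_ge0.
  by rewrite -[leLHS](powRr1 (g0 x)) (le_trans (ler_powR g1 (ltW p1)))// lerDr.
rewrite ge0_integralD//; last 2 first.
- by move=> x _; rewrite lee_fin powR_ge0.
- by apply/measurable_EFinP; apply: measurable_funTS; exact: measurable_fun_powRc.
rewrite lte_add_pinfty//; first by rewrite integral_cst// mul1e; exact: compact_finite_measure.
apply: le_lt_trans gp; apply: ge0_subset_integral => //.
- by apply/measurable_EFinP; exact: measurable_fun_powRc.
- by move=> x _; rewrite lee_fin powR_ge0.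
Qed.

(** Where g is at most t/2 it contributes at most t/2 to any average, so a maximal function above t
    forces that of the truncated g above t/2; the covering constant 3 thus becomes 6. *)
Lemma HL_strong g p : (1 < p)%R -> measurable_fun setT g -> (forall x, 0 <= g x)%R ->
  \int[mu]_x (g x `^ p)%:E < +oo ->
  \int[mu]_x (HL_maximal g x `^ p) <= (6 * p / (p - 1) * 2 `^ (p - 1))%:E * \int[mu]_x (g x `^ p)%:E.
Proof.
move=> p1 mg g0 gp.
have igp : mu.-integrable setT (EFin \o (fun x => g x `^ p)%R).
  apply/integrableP; split; first by apply/measurable_EFinP; exact: measurable_fun_powRc.
  by under eq_integral do rewrite /= ger0_norm ?powR_ge0//.
have lg := locally_integrable_powR p1 mg g0 gp.
apply: weak_to_strong => //.
- exact: measurable_HL_maximal.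
- by move=> x; exact: HL_maximalT_ge0.
move=> t t0; have t20 : (0 < t / 2)%R by rewrite divr_gt0.
pose gt x : R := if (t / 2 < g x)%R then g x else 0%R.
have gt0 x : (0 <= gt x)%R by rewrite /gt; case: ifP.
have mgt : measurable_fun setT gt by apply: measurable_fun_ifT => //; exact: measurable_fun_ltr.
have lgt : locally_integrable setT gt.
  apply: open_integrable_locally; first exact: openT.
  apply: (@le_integrable _ _ _ mu _ measurableT _ (EFin \o (fun x => (t / 2) `^ (1 - p) * g x `^ p)%R)).
  - by apply/measurable_EFinP.
  - move=> x _ /=; rewrite lee_fin !ger0_norm ?mulr_ge0 ?powR_ge0//.
    rewrite /gt; case: ifPn => [tg|_]; last by rewrite mulr_ge0 ?powR_ge0.
    have gx : (0 < g x)%R by exact: lt_trans tg.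
    have -> : (1 - p = - (p - 1))%R by rewrite opprB.
    rewrite powRN ler_pdivlMl ?powR_gt0//.
    have gpE : (g x `^ p = g x * g x `^ (p - 1))%R.
      by rewrite (powR_pred _ gx) mulrCA divff ?gt_eqF// mulr1.
    rewrite gpE mulrC ler_pM2l//.
    by apply: ge0_ler_powR; rewrite ?nnegrE ?(ltW t20) ?(ltW gx) ?(ltW tg)// subr_ge0 ltW.
  - exact: integrableRZ.
have sub : [set x | t%:E < HL_maximal g x] `<=` [set x | (t / 2)%:E < HL_maximal gt x].
  move=> x /= tx; rewrite ltNge; apply/negP => le; move: tx; rewrite ltNge => /negP; apply.
  apply: ge_ereal_sup => _ /= [r r0 <-]; move: r0; rewrite in_itv/= andbT => r0.
  have mb : measurable (ball x r) by exact: measurable_ball.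
  have b0 : mu (ball x r) = (r *+ 2)%:E by rewrite lebesgue_measure_ball// ltW.
  have r2 : (0 < r *+ 2)%R by rewrite mulrn_wgt0.
  have h1 : iavg gt (ball x r) <= (t / 2)%:E.
    by apply: le_trans le; apply: ereal_sup_ubound; exists r => //=; rewrite in_itv/= andbT.
  move: h1; rewrite /iavg b0 inver gt_eqF// => h1.
  have h2 : \int[mu]_(y in ball x r) `|(g y)%:E| <= \int[mu]_(y in ball x r) `|(gt y)%:E| + (t / 2 * (r *+ 2))%:E.
    rewrite (_ : (t / 2 * (r *+ 2))%:E = \int[mu]_(y in ball x r) (t / 2)%:E); last first.
      by rewrite integral_cst// EFinM; congr (_ * _); exact: esym b0.
    rewrite -ge0_integralD//=; last 2 first.
    - by apply/measurable_EFinP; apply: measurableT_comp => //; exact: measurable_funTS.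
    - by move=> y _; rewrite lee_fin ltW.
    apply: integral_mono => y _; first by rewrite lee_fin.
    rewrite -EFinD lee_fin !ger0_norm//.
    by rewrite /gt; case: ltP => h; [rewrite lerDl ltW|rewrite add0r].
  apply: (@le_trans _ _ ((r *+ 2)^-1%:E * (\int[mu]_(y in ball x r) `|(gt y)%:E| + (t / 2 * (r *+ 2))%:E))).
    by rewrite lee_pmul2l ?lte_fin ?invr_gt0.
  have tr0 : (0 <= t / 2 * (r *+ 2))%R by apply: mulr_ge0; apply: ltW.
  rewrite ge0_muleDr ?integral_ge0 ?lee_fin//.
  rewrite -EFinM (_ : ((r *+ 2)^-1 * (t / 2 * (r *+ 2)) = t / 2)%R); last by field; rewrite gt_eqF.
  by apply: (le_trans (leeD h1 (lexx _))); rewrite -EFinD lee_fin; lra.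
have m1 : measurable [set x | t%:E < HL_maximal g x].
  by rewrite -[X in measurable X]setTI; apply: emeasurable_fun_o_infty => //; exact: measurable_HL_maximal.
have m2 : measurable [set x | (t / 2)%:E < HL_maximal gt x].
  by rewrite -[X in measurable X]setTI; apply: emeasurable_fun_o_infty => //; exact: measurable_HL_maximal.
apply: (@le_trans _ _ (mu [set x | (t / 2)%:E < HL_maximal gt x])).
  apply: le_measure; [exact: mem_set m1|exact: mem_set m2|exact: sub].
apply: (le_trans (maximal_inequality lgt t20)).
rewrite (_ : (3 / (t / 2) = 6 / t)%R); last by field; rewrite gt_eqF.
rewrite lee_pmul2l ?lte_fin ?divr_gt0//.
by apply: integral_mono => x _; rewrite ?lee_fin// ger0_norm// gt0.
Qed.

(** Hoelder's inequality for the splitting k g = (k^(1/q) h)(k^(1/p) g/h), then Tonelli. The kernel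
    has to vanish where h does, since g/h is 0 there by convention. *)
Lemma schur_test (k : R * R -> R) h g p q (A B : R) : (1 < p)%R -> (0 < q)%R -> (p^-1 + q^-1 = 1)%R ->
  (0 <= A)%R -> (0 <= B)%R ->
  measurable_fun setT k -> (forall z, 0 <= k z)%R ->
  measurable_fun setT h -> (forall x, 0 <= h x)%R -> (forall x y, h y = 0%R -> k (x, y) = 0%R) ->
  measurable_fun setT g -> (forall x, 0 <= g x)%R ->
  (forall x, \int[mu]_y (k (x, y) * h y `^ q)%:E <= (A * h x `^ q)%:E) ->
  (forall y, \int[mu]_x (k (x, y) * h x `^ p)%:E <= (B * h y `^ p)%:E) ->
  \int[mu]_x ((\int[mu]_y (k (x, y) * g y)%:E) `^ p) <= (A `^ (p / q) * B)%:E * \int[mu]_y (g y `^ p)%:E.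
Proof.
move=> p1 q0 pq A0 B0 mk k0 mh h0 hk mg g0 hA hB; have p0 : (0 < p)%R by lra.
have mkx x : measurable_fun setT (fun y => k (x, y)).
  by apply: measurableT_comp => //; exact: measurable_pair1.
have mhv : measurable_fun setT (fun y => (h y)^-1)%R.
  rewrite (_ : (fun y => _) = (fun y => h y `^ (-1))%R); first exact: measurable_fun_powRc.
  by apply/funext => y; rewrite powR_inv1.
pose w y : R := ((g y / h y) `^ p)%R.
have mw : measurable_fun setT w.
  by apply: measurable_fun_powRc; exact: measurable_funM.
pose G (z : R * R) : \bar R := (h z.1 `^ p * (k z * w z.2))%:E.
have mG : measurable_fun setT G.
  apply/measurable_EFinP; apply: measurable_funM.
    apply: measurable_fun_powRc.
    by apply: measurableT_comp => //; exact: measurable_fst.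
  by apply: measurable_funM => //; apply: measurableT_comp => //; exact: measurable_snd.
have G0 z : 0 <= G z by rewrite lee_fin !mulr_ge0 ?powR_ge0.
have point x : (\int[mu]_y (k (x, y) * g y)%:E) `^ p <= (A `^ (p / q))%:E * \int[mu]_y G (x, y).
  pose f1 y := (k (x, y) `^ q^-1 * h y)%R.
  pose f2 y := (k (x, y) `^ p^-1 * (g y / h y))%R.
  have mf1 : measurable_fun setT f1.
    by apply: measurable_funM => //; apply: measurable_fun_powRc; exact: mkx.
  have mf2 : measurable_fun setT f2.
    apply: measurable_funM; first by apply: measurable_fun_powRc; exact: mkx.
    exact: measurable_funM.
  have := hoelder mu mf1 mf2 q0 p0; rewrite addrC => /(_ pq).
  rewrite Lnorm1 => H.
  have e1 : \int[mu]_y (k (x, y) * g y)%:E = \int[mu]_y `|((f1 \* f2)%R y)%:E|.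
    apply: eq_integral => y _ /=; congr EFin.
    have [hy|hy] := eqVneq (h y) 0%R; first by rewrite hk// mul0r /f1 hy mulr0 mul0r normr0.
    rewrite ger0_norm; last by rewrite /f1 /f2 !mulr_ge0 ?powR_ge0 ?invr_ge0.
    rewrite /f1 /f2 mulrACA -powRD; last by rewrite addrC pq oner_eq0.
    have -> : (q^-1 + p^-1 = 1)%R by rewrite addrC pq.
    have -> : (h y * (g y / h y) = g y)%R by field.
    by rewrite powRr1.
  rewrite e1; apply: (@le_trans _ _ (('N[mu]_q%:E[EFin \o f1] * 'N[mu]_p%:E[EFin \o f2]) `^ p)).
    by apply: le_poweR => //; [exact: ltW|exact: integral_ge0].
  rewrite poweRM ?Lnorm_ge0// powR_Lnorm ?gt_eqF//.
  have -> : 'N[mu]_q%:E[EFin \o f1] `^ p = ('N[mu]_q%:E[EFin \o f1] `^ q) `^ (p / q).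
    by rewrite -poweRrM mulrCA divff ?mulr1// gt_eqF.
  rewrite powR_Lnorm ?gt_eqF//.
  have b1 : (\int[mu]_y (`|(EFin \o f1) y| `^ q)) `^ (p / q) <= (A `^ (p / q) * h x `^ p)%:E.
    have -> : (A `^ (p / q) * h x `^ p)%:E = (A * h x `^ q)%:E `^ (p / q).
      rewrite poweR_EFin powRM ?powR_ge0//; congr ((_ * _)%:E).
      by rewrite -powRrM mulrCA divff ?mulr1// gt_eqF.
    apply: le_poweR; [by rewrite divr_ge0// ltW|by apply: integral_ge0 => y _; rewrite poweR_ge0|].
    apply: le_trans (hA x); apply: integral_mono => y _; first by rewrite poweR_ge0.
    have -> : `|(EFin \o f1) y| = (`|f1 y|)%:E by [].
    rewrite poweR_EFin lee_fin ger0_norm ?mulr_ge0 ?powR_ge0// powRM ?powR_ge0//.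
    by rewrite -powRrM mulVf ?gt_eqF// powRr1.
  have b2 : \int[mu]_y (`|(EFin \o f2) y| `^ p) <= \int[mu]_y (k (x, y) * w y)%:E.
    apply: integral_mono => y _; first by rewrite poweR_ge0.
    have gh : (0 <= g y / h y)%R by rewrite mulr_ge0// invr_ge0.
    have -> : `|(EFin \o f2) y| = (`|f2 y|)%:E by [].
    have f20 : (0 <= f2 y)%R by rewrite mulr_ge0// powR_ge0.
    rewrite poweR_EFin lee_fin (ger0_norm f20) /f2 powRM ?powR_ge0//.
    by rewrite -powRrM mulVf ?gt_eqF// powRr1.
  apply: (le_trans (lee_pmul _ _ b1 b2)); rewrite ?poweR_ge0 ?integral_ge0//.
    by move=> y _; rewrite poweR_ge0.
  rewrite EFinM -muleA; apply: lee_wpmul2l; first by rewrite lee_fin powR_ge0.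
  rewrite -ge0_integralZl//.
  - by apply/measurable_EFinP; apply: measurable_funM => //; exact: mkx.
  - by move=> y _; rewrite lee_fin mulr_ge0// powR_ge0.
  - by rewrite lee_fin powR_ge0.
apply: (@le_trans _ _ (\int[mu]_x ((A `^ (p / q))%:E * \int[mu]_y G (x, y)))).
  by apply: integral_mono => x _; rewrite ?poweR_ge0.
rewrite ge0_integralZl//; last 3 first.
- exact: measurable_fun_fubini_tonelli_F.
- by move=> x _; exact: integral_ge0.
- by rewrite lee_fin powR_ge0.
rewrite EFinM -muleA; apply: lee_wpmul2l; first by rewrite lee_fin powR_ge0.
rewrite (@fubini_tonelli _ _ _ _ _ mu mu G)// -ge0_integralZl//; last 2 first.
- by apply/measurable_EFinP; exact: measurable_fun_powRc.
- by move=> y _; rewrite lee_fin powR_ge0.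
apply: integral_mono => y _; first exact: integral_ge0.
have w0 : (0 <= w y)%R by exact: powR_ge0.
have -> : \int[mu]_x G (x, y) = (w y)%:E * \int[mu]_x (k (x, y) * h x `^ p)%:E.
  transitivity (\int[mu]_x ((w y)%:E * (k (x, y) * h x `^ p)%:E)).
    by apply: eq_integral => x _; rewrite /G/= -EFinM; congr EFin; ring.
  rewrite ge0_integralZl//.
  - apply/measurable_EFinP; apply: measurable_funM; last exact: measurable_fun_powRc.
    by apply: measurableT_comp => //; exact: measurable_pair2.
  - by move=> x _; rewrite lee_fin mulr_ge0// powR_ge0.
apply: (@le_trans _ _ ((w y)%:E * (B * h y `^ p)%:E)).
  by apply: lee_wpmul2l; rewrite ?lee_fin.
rewrite -!EFinM lee_fin /w.
have [hy|hy] := eqVneq (h y) 0%R.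
  by rewrite hy powR0 ?gt_eqF// !mulr0 mulr_ge0 ?powR_ge0.
rewrite mulrCA ler_wpM2l// -powRM ?mulr_ge0 ?invr_ge0//.
by rewrite divfK.
Qed.

End RealAnalysis.

(** * Radial majorants and the maximal function *)

Section Dyadic.
Variable R : realType.
Notation mu := (@lebesgue_measure R).
Implicit Types (g : R -> R) (x y t T v de : R).
Local Open Scope ereal_scope.

Lemma ball_integral_le g x r : (0 < r)%R -> (forall y, 0 <= g y)%R ->
  \int[mu]_(y in ball x r) (g y)%:E <= (2 * r)%:E * HL_maximal g x.
Proof.
move=> r0 g0.
have b0 : mu (ball x r) = (r *+ 2)%:E by rewrite lebesgue_measure_ball// ltW.
have r2 : (0 < r *+ 2)%R by rewrite mulrn_wgt0.
apply: (@le_trans _ _ ((2 * r)%:E * iavg g (ball x r))).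
  have -> : (2 * r = r *+ 2)%R by rewrite mulr_natl.
  rewrite /iavg b0 inver (gt_eqF r2) muleA -EFinM (mulfV (lt0r_neq0 r2)) mul1e.
  by apply: integral_mono => y _; rewrite lee_fin// ger0_norm.
apply: lee_wpmul2l; first by rewrite lee_fin mulr_ge0// ltW.
by apply: ereal_sup_ubound; exists r => //=; rewrite in_itv/= andbT.
Qed.

(** For v >= 1 the least k with v < 2^k satisfies 2^(k-1) <= v, and the factor 2^(1+de) pays for
    this gap. The bound N makes the sum finite. *)
Lemma dyadic_term v de (z := (2 `^ (- de))%R) N : (0 < de)%R -> (0 <= v)%R -> (v < 2 ^+ N)%R ->
  ((1 + v) `^ (-1 - de) <= \sum_(k < N.+1) (2 `^ (1 + de) * (z / 2) ^+ k) * (if v < 2 ^+ k then 1 else 0))%R.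
Proof.
move=> d0 v0 vN.
have ex : exists k, (v < 2 ^+ k)%R by exists N.
case: (ex_minnP ex) => k vk kmin; have kN : (k < N.+1)%N by rewrite ltnS kmin.
have c0 j : (0 <= 2 `^ (1 + de) * (z / 2) ^+ j)%R by rewrite mulr_ge0 ?powR_ge0// exprn_ge0// divr_ge0// powR_ge0.
rewrite (bigD1 (Ordinal kN))//= vk mulr1 ler_wpDr//.
  by apply: sumr_ge0 => j _; rewrite mulr_ge0//; case: ifP.
have q0 : (0 <= 1 + de)%R by lra.
have e1 : (-1 - de = - (1 + de))%R by ring.
have v1 : (0 < 1 + v)%R by lra.
case: k vk kmin kN => [|k] vk kmin kN.
  rewrite expr0 mulr1 e1 powRN; apply: (@le_trans _ _ 1%R).
    by rewrite invf_le1 ?powR_gt0// -[leLHS](powRr0 (1 + v)); apply: ler_powR; lra.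
  by rewrite -[leLHS](powRr0 2); apply: ler_powR => //; lra.
have kv : (2 ^+ k <= v)%R by rewrite leNgt; apply/negP => /kmin; rewrite ltnn.
have zE : (z / 2 = 2 `^ (-1 - de))%R.
  have t0 : (0 < 2 :> R)%R by [].
  have -> : (-1 - de = - de - 1)%R by ring.
  exact: esym (powR_pred (- de)%R t0).
have -> : (2 `^ (1 + de) * (z / 2) ^+ k.+1 = (2 ^+ k) `^ (-1 - de))%R.
  rewrite zE exprS mulrA -powRD ?pnatr_eq0 ?implybT// addrC (_ : -1 - de + (1 + de) = 0)%R; last by ring.
  rewrite powRr0 mul1r -(powR_mulrn k (powR_ge0 2 _)) -(powR_mulrn k (ler0n _ 2)) -!powRrM.
  by congr (_ `^ _)%R; exact: mulrC.
rewrite e1 !powRN lef_pV2 ?posrE ?powR_gt0 ?exprn_gt0//.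
by apply: ge0_ler_powR; rewrite ?nnegrE ?exprn_ge0 ?(ltW v1)//; lra.
Qed.

Lemma dyadic_maximal de : (0 < de)%R -> exists2 C, (0 < C)%R & forall g x T,
  measurable_fun setT g -> (forall y, 0 <= g y)%R -> (0 < x < 1)%R -> (0 < T)%R ->
  \int[mu]_(y in `]0%R, 1%R[) (T * (1 + T * `|x - y|) `^ (-1 - de) * g y)%:E <= C%:E * HL_maximal g x.
Proof.
move=> d0; pose z : R := (2 `^ (- de))%R.
have z0 : (0 < z)%R by rewrite powR_gt0.
have z1 : (z < 1)%R.
  rewrite /z powRN invf_lt1 ?powR_gt0//.
  have := @gt0_ltr_powR R de d0 1%R 2%R; rewrite !nnegrE powR1; apply => //.
  by rewrite ltr1n.
have z1' : (0 < 1 - z)%R by rewrite subr_gt0.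
pose D : R := (2 `^ (1 + de) * 4)%R.
have D0 : (0 < D)%R by rewrite mulr_gt0 ?powR_gt0.
exists (D / (1 - z))%R; first by rewrite divr_gt0.
move=> g x T mg g0 /andP[x0 x1] T0.
pose N := (Num.truncn T).+1.
have TN : (T <= 2 ^+ N)%R.
  apply: (@le_trans _ _ N%:R); first by rewrite ltW// truncnS_gt.
  by rewrite -natrX ler_nat ltnW// ltn_expl.
pose c k : R := (2 `^ (1 + de) * (z / 2) ^+ k)%R.
have c0 k : (0 <= c k)%R by rewrite mulr_ge0 ?powR_ge0// exprn_ge0// divr_ge0// ltW.
pose I k (y : R) : R := if (T * `|x - y| < 2 ^+ k)%R then 1%R else 0%R.
have I0 k y : (0 <= I k y)%R by rewrite /I; case: ifP.
have Tc0 k : (0 <= T * c k)%R by apply: mulr_ge0; [exact: ltW|exact: c0].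
have f0 k y : (0 <= T * c k * (I k y * g y))%R.
  by apply: mulr_ge0; [exact: Tc0|apply: mulr_ge0; [exact: I0|exact: g0]].
have h0 k y : 0 <= (T * c k)%:E * (g y)%:E.
  by rewrite -EFinM lee_fin; apply: mulr_ge0; [exact: Tc0|exact: g0].
have mI k : measurable_fun setT (I k).
  apply: measurable_fun_ifT => //; apply: measurable_fun_ltr => //.
  by apply: measurable_funM => //; apply: measurableT_comp => //; exact: measurable_funB.
have HL0 : 0 <= HL_maximal g x.
  apply: le_trans (_ : iavg g (ball x 1) <= _); first exact: iavg_ge0.
  by apply: ereal_sup_ubound; exists 1%R => //=; rewrite in_itv/= andbT.
apply: (@le_trans _ _ (\int[mu]_(y in `]0%R, 1%R[) \sum_(k < N.+1) (T * c k * (I k y * g y))%:E)).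
  apply: integral_mono => y /=.
    by rewrite lee_fin !mulr_ge0 ?powR_ge0// ltW.
  rewrite in_itv/= => /andP[y0 y1]; rewrite sumEFin lee_fin.
  have v0 : (0 <= T * `|x - y|)%R by rewrite mulr_ge0// ltW.
  have vN : (T * `|x - y| < 2 ^+ N)%R.
    apply: lt_le_trans TN; rewrite -[ltRHS]mulr1 ltr_pM2l// ltr_norml.
    by apply/andP; split; lra.
  have := dyadic_term d0 v0 vN; rewrite -/z => h.
  rewrite (_ : \sum_(k < N.+1) _ = T * (\sum_(k < N.+1) c k * I k y) * g y)%R; last first.
    by rewrite mulr_sumr mulr_suml; apply: eq_bigr => k _; rewrite !mulrA.
  by rewrite ler_wpM2r// ler_pM2l.
rewrite ge0_integral_sum//; last 2 first.
- move=> k; apply/measurable_EFinP; apply: measurable_funM => //.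
  by apply: measurable_funM => //; apply: measurable_funTS; [exact: mI|exact: mg].
- move=> k y _; rewrite lee_fin; exact: f0.
apply: (@le_trans _ _ (\sum_(k < N.+1) (D * z ^+ k)%:E * HL_maximal g x)).
  apply: lee_sum => k _.
  have rk : (0 < 2 ^+ k / T)%R by rewrite divr_gt0// exprn_gt0.
  apply: (@le_trans _ _ (\int[mu]_(y in ball x (2 ^+ k / T)%R) ((T * c k)%:E * (g y)%:E))).
    rewrite [leLHS]integral_mkcond [leRHS]integral_mkcond; apply: integral_mono => y _.
      by rewrite patchE; case: ifP => // _; rewrite lee_fin; exact: f0.
    rewrite !patchE; case: ifPn => // _; last first.
      by case: ifPn => // _; exact: h0.
    rewrite /I; case: ltP => h.
      by rewrite mem_set ?mul1r -?EFinM// /ball/= ltr_pdivlMr// mulrC.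
    by rewrite mul0r mulr0; case: ifPn => // _; exact: h0.
  rewrite ge0_integralZl//; last 4 first.
  - exact: measurable_ball.
  - by apply/measurable_EFinP; exact: measurable_funTS.
  - by move=> y _; rewrite lee_fin.
  - by rewrite lee_fin; exact: Tc0.
  apply: (@le_trans _ _ ((T * c k)%:E * ((2 * (2 ^+ k / T))%:E * HL_maximal g x))).
    by apply: lee_wpmul2l; [rewrite lee_fin; exact: Tc0|exact: ball_integral_le].
  rewrite muleA -EFinM (_ : (T * c k * (2 * (2 ^+ k / T)) = (2 `^ (1 + de) * 2) * z ^+ k)%R).
    apply: lee_wpmul2r => //; rewrite lee_fin ler_wpM2r ?exprn_ge0 ?(ltW z0)//.
    by rewrite /D ler_wpM2l ?powR_ge0// ler_nat.
  by rewrite /c exprMn exprVn; field; rewrite gt_eqF// expf_neq0.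
rewrite -ge0_sume_distrl//; last by move=> k _; rewrite lee_fin mulr_ge0 ?exprn_ge0 ?ltW.
apply: lee_wpmul2r => //; rewrite sumEFin lee_fin -mulr_sumr ler_wpM2l ?(ltW D0)//.
rewrite -[leRHS]mul1r ler_pdivlMr// mulrC.
have := subrX1 z N.+1; move=> e.
have -> : ((1 - z) * \sum_(k < N.+1) z ^+ k = 1 - z ^+ N.+1)%R.
  by rewrite -[RHS]opprB e -mulNr opprB.
by rewrite gerBl exprn_ge0// ltW.
Qed.

Lemma integral_powRN_oo a r : (0 < a)%R -> (0 < r)%R ->
  \int[mu]_(t in `]r, 1%R[) (t `^ (- a - 1))%:E <= (r `^ (- a) / a)%:E.
Proof.
move=> a0 r0; have [r1|r1] := ltP r 1%R; last first.
  by rewrite set_itv_ge ?bnd_simp -?leNgt// integral_set0 lee_fin divr_ge0 ?powR_ge0// ltW.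
have -> : \int[mu]_(t in `]r, 1%R[) (t `^ (- a - 1))%:E = (- a^-1 * 1 `^ (- a) - (- a^-1 * r `^ (- a)))%:E.
  apply: (etrans (@ge0_FTC_oo R (fun x => x `^ (- a - 1))%R (fun x => - a^-1 * x `^ (- a))%R r 1%R _ _ _ _ _ _)) => //.
  - move=> x /andP[x0 _]; apply: dE (dZ (- a^-1) (dpowR (- a) (lt_trans r0 x0))) _.
    by rewrite mulrA mulrNN mulVf ?gt_eqF// mul1r.
  - move=> x; rewrite in_itv/= => /andP[x0 _]; apply: continuous_powR_pos; exact: lt_trans x0.
  - by apply: cvgMr; apply: cvg_at_right_filter; exact: continuous_powR_pos.
  - by apply: cvgMr; apply: cvg_at_left_filter; exact: continuous_powR_pos.
  - by move=> x _; exact: powR_ge0.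
have ai : (0 <= a^-1)%R by rewrite invr_ge0 ltW.
by rewrite lee_fin powR1 mulr1 mulNr opprK [(_ / a)%R]mulrC gerDr oppr_le0.
Qed.

End Dyadic.

(** * The kernel bound near and far from the diagonal, uniformly in T *)

Section KernelRegions.
Variables (R : realType) (b de : R).
Hypotheses (b1 : -(1 / 2) < b) (de0 : 0 < de).
Implicit Types (x y z w T : R).

Definition Qk T x y : R := T * (1 + T * `|x - y|) `^ (-1 - de) *
  ((x + T^-1) `^ (- b) * (y + T^-1) `^ (- b)).

Notation dd := (Num.min de b).

Lemma powR_invT z T : 0 < z -> 0 < T -> (z + T^-1) `^ (- b) = T `^ b * (1 + T * z) `^ (- b).
Proof.
move=> z0 T0; have -> : z + T^-1 = (1 + T * z) * T^-1 by field; rewrite gt_eqF.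
rewrite powRM ?invr_ge0 ?addr_ge0 ?mulr_ge0 ?(ltW T0) ?(ltW z0)// mulrC; congr (_ * _).
by rewrite -(powR_inv1 (ltW T0)) -powRrM mulN1r opprK.
Qed.

(** Removes T by a bound for the supremum over T, of degree -1 - 2 b in (z, w). The left side is
    largest near T = 1/w when b < de and near T = 1/z when de < b, which is the origin of the
    minimum of the two. *)
Lemma Qk_far T z w : 0 < T -> 0 < z -> z <= w / 2 ->
  T * (1 + T * `|z - w|) `^ (-1 - de) * ((z + T^-1) `^ (- b) * (w + T^-1) `^ (- b)) <=
  2 `^ (1 + de) * (w `^ (-1 - dd - b) * z `^ (dd - b)).
Proof.
move=> T0 z0 zw; have hb := b1; have hd := de0.
have w0 : 0 < w by lra.
pose u := T * z; pose v := T * w.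
have u0 : 0 < u by rewrite mulr_gt0.
have v0 : 0 < v by rewrite mulr_gt0.
have uv : u <= v by rewrite ler_pM2l//; lra.
have u1 : 0 < 1 + u by lra.
have v1 : 0 < 1 + v by lra.
have ddb : dd <= b by rewrite ge_min lexx orbT.
have ddd : dd <= de by rewrite ge_min lexx.
have dq : 0 < 1 + dd + b by rewrite minElt; case: ifP => _; lra.
rewrite !powR_invT// -/u -/v.
have h1 : (1 + T * `|z - w|) `^ (-1 - de) <= 2 `^ (1 + de) * (1 + v) `^ (-1 - de).
  have e1 : -1 - de = - (1 + de) by ring.
  have q0 : 0 <= 1 + de by lra.
  rewrite e1 !powRN ler_pdivlMr ?powR_gt0// ler_pdivrMl; last first.
    by rewrite powR_gt0// ltr_pwDl// mulr_ge0// ltW.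
  rewrite -powRM; [|by rewrite addr_ge0// mulr_ge0// ltW|by []].
  apply: ge0_ler_powR; rewrite ?nnegrE ?(ltW v1)//.
    by rewrite mulr_ge0// addr_ge0// mulr_ge0// ltW.
  have : w / 2 <= `|z - w| by rewrite distrC ger0_norm; lra.
  move=> h; have : T * (w / 2) <= T * `|z - w| by rewrite ler_pM2l.
  by rewrite /v; lra.
have wE : w `^ (-1 - dd - b) = T `^ (1 + dd + b) * v `^ (-1 - dd - b).
  rewrite /v powRM ?(ltW T0) ?(ltW w0)// mulrA -powRD ?(gt_eqF T0) ?implybT//.
  by rewrite (_ : 1 + dd + b + (-1 - dd - b) = 0) ?powRr0 ?mul1r//; ring.
have zE : z `^ (dd - b) = T `^ (b - dd) * u `^ (dd - b).
  rewrite /u powRM ?(ltW T0) ?(ltW z0)// mulrA -powRD ?(gt_eqF T0) ?implybT//.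
  by rewrite (_ : b - dd + (dd - b) = 0) ?powRr0 ?mul1r//; ring.
have TE : T * (T `^ b * T `^ b) = T `^ (1 + dd + b) * T `^ (b - dd).
  rewrite -{1}(powRr1 (ltW T0)) -!powRD ?(gt_eqF T0) ?implybT//.
  by congr (_ `^ _); ring.
have key : (1 + v) `^ (-1 - de) * ((1 + u) `^ (- b) * (1 + v) `^ (- b)) <= v `^ (-1 - dd - b) * u `^ (dd - b).
  apply: (@le_trans _ _ ((1 + v) `^ (-1 - dd - b) * (1 + u) `^ (dd - b))); last first.
    apply: ler_pM; rewrite ?powR_ge0//.
      rewrite (_ : -1 - dd - b = - (1 + dd + b)); last by ring.
      rewrite !powRN lef_pV2 ?posrE ?powR_gt0//.
      by apply: ge0_ler_powR; rewrite ?nnegrE ?(ltW dq) ?(ltW v0) ?(ltW v1)//; lra.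
    rewrite -[dd - b]opprB !powRN lef_pV2 ?posrE ?powR_gt0//.
    by apply: ge0_ler_powR; rewrite ?nnegrE ?(ltW u0) ?(ltW u1) ?subr_ge0//; lra.
  have -> : (1 + v) `^ (-1 - de) * ((1 + u) `^ (- b) * (1 + v) `^ (- b)) =
      ((1 + v) `^ (-1 - dd - b) * (1 + u) `^ (- b)) * (1 + v) `^ (dd - de).
    rewrite mulrCA mulrC -powRD ?(gt_eqF v1) ?implybT//.
    rewrite mulrAC -powRD ?(gt_eqF v1) ?implybT//; congr (_ `^ _ * _); ring.
  have -> : (1 + v) `^ (-1 - dd - b) * (1 + u) `^ (dd - b) =
      ((1 + v) `^ (-1 - dd - b) * (1 + u) `^ (- b)) * (1 + u) `^ dd.
    by rewrite -mulrA -powRD ?(gt_eqF u1) ?implybT//; congr (_ * _ `^ _); ring.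
  rewrite ler_wpM2l ?mulr_ge0 ?powR_ge0//.
  have [d0|d0] := leP 0 dd.
    apply: (@le_trans _ _ 1).
      by rewrite -[leRHS](powRr0 (1 + v)); apply: ler_powR; clear -v0 ddd; lra.
    by rewrite -[leLHS](powRr0 (1 + u)); apply: ler_powR; clear -u0 d0; lra.
  have -> : dd = b by move: d0; clear -hd; rewrite minElt; case: ifP => _; lra.
  have bn : b < 0 by move: d0; clear -hd; rewrite minElt; case: ifP => _; lra.
  apply: (@le_trans _ _ ((1 + v) `^ b)); first by apply: ler_powR; lra.
  have -> : b = - `|b| by rewrite ltr0_norm// opprK.
  rewrite (powRN (1 + v)) (powRN (1 + u)) lef_pV2 ?posrE ?powR_gt0//.
  by apply: ge0_ler_powR; rewrite ?nnegrE ?(ltW u1) ?(ltW v1)//; clear -bn uv; lra.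
rewrite wE zE.
apply: (@le_trans _ _ (2 `^ (1 + de) * (T * (T `^ b * T `^ b)) * ((1 + v) `^ (-1 - de) * ((1 + u) `^ (- b) * (1 + v) `^ (- b))))).
  rewrite [leRHS](_ : _ = T * (2 `^ (1 + de) * (1 + v) `^ (-1 - de)) * (T `^ b * (1 + u) `^ (- b) * (T `^ b * (1 + v) `^ (- b)))); last by ring.
  by rewrite ler_wpM2r ?mulr_ge0 ?powR_ge0// ler_pM2l.
rewrite TE [leRHS](_ : _ = 2 `^ (1 + de) * (T `^ (1 + dd + b) * T `^ (b - dd)) * (v `^ (-1 - dd - b) * u `^ (dd - b))); last by ring.
by rewrite ler_wpM2l ?mulr_ge0 ?powR_ge0.
Qed.

(** The bound of [Qk_far] times the density y^(2b), for either order of x and y. The two regions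
    overlap where x and y are comparable, so that K0 also dominates 1/x there. *)
Definition K0 x y : R := (if y <= 2 * x then x `^ (-1 - dd - b) * y `^ (dd + b) else 0) +
  (if x <= 2 * y then x `^ (dd - b) * y `^ (-1 - dd + b) else 0).

Definition loc x y : R := if (x <= 2 * y) && (y <= 2 * x) then 1 else 0.

Lemma K0_ge0 x y : 0 <= K0 x y.
Proof. by rewrite addr_ge0//; case: ifP => // _; rewrite mulr_ge0 ?powR_ge0. Qed.

(** For b >= 0 dropping 1/T bounds the weights. For b < 0 they are larger than x^(-b) y^(-b) when T
    y < 1; the excess (T y)^(2b), with -2b < 1 from nu > -1, is paid by the term 1/x. *)
Lemma Qk_near T x y : 0 < T -> 0 < x -> 0 < y -> x <= 2 * y -> y <= 2 * x ->
  Qk T x y * y `^ (2 * b) <= 32 * 2 `^ `|b| * (T * (1 + T * `|x - y|) `^ (-1 - de) + x^-1).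
Proof.
move=> T0 x0 y0 xy yx; have hb := b1; have hd := de0.
set P := (1 + T * _) `^ _.
have P0 : 0 <= P by exact: powR_ge0.
have P1 : P <= 1.
  rewrite -[leRHS](powRr0 (1 + T * `|x - y|)); apply: ler_powR; last by lra.
  by rewrite lerDl mulr_ge0// ltW.
have xi : 0 < x^-1 by rewrite invr_gt0.
have TP : 0 <= T * P by rewrite mulr_ge0// ltW.
have Ti : 0 < T^-1 by rewrite invr_gt0.
have y2 : y `^ (2 * b) = y `^ b * y `^ b by rewrite -powRD ?(gt_eqF y0) ?implybT//; congr (_ `^ _); ring.
have D1 : 1 <= 2 `^ `|b| by rewrite -[leLHS](powRr0 2); apply: ler_powR => //; rewrite ler1n.
have [bp|bn] := leP 0 b.
  apply: (@le_trans _ _ (T * P * 2 `^ `|b|)); last first.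
    rewrite mulrC -mulrA; apply: (@le_trans _ _ (32 * (2 `^ `|b| * (T * P)))).
      by rewrite ler_peMl ?mulr_ge0 ?powR_ge0 ?ler1n// ltW.
    by rewrite ler_pM2l// ler_pM2l ?powR_gt0// lerDl ltW.
  rewrite /Qk -/P -mulrA ler_wpM2l// y2.
  have h z : 0 < z -> (z + T^-1) `^ (- b) <= z `^ (- b).
    move=> z0; rewrite !powRN lef_pV2 ?posrE ?powR_gt0 ?addr_gt0//.
    by apply: ge0_ler_powR; rewrite ?nnegrE ?(ltW z0) ?(ltW (addr_gt0 z0 Ti)) ?lerDl ?(ltW Ti).
  apply: (@le_trans _ _ (x `^ (- b) * y `^ (- b) * (y `^ b * y `^ b))).
    by rewrite ler_wpM2r ?mulr_ge0 ?powR_ge0//; apply: ler_pM; rewrite ?powR_ge0 ?h.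
  rewrite (_ : _ * _ = (y `^ (- b) * y `^ b) * (y `^ b * x `^ (- b))); last by ring.
  rewrite -powRD ?(gt_eqF y0) ?implybT// addNr powRr0 mul1r powRN ler_pdivrMr ?powR_gt0//.
  by apply: powR_ratio => //; rewrite ler1n.
have bb : `|b| = - b by rewrite ltr0_norm.
have bn' : 0 < - b by rewrite oppr_gt0.
have h : (x + T^-1) `^ (- b) * (y + T^-1) `^ (- b) * y `^ (2 * b) <= 2 `^ `|b| * (1 + (T * y)^-1) `^ (- (2 * b)).
  have e : (1 + (T * y)^-1) `^ (- (2 * b)) = (1 + (T * y)^-1) `^ (- b) * (1 + (T * y)^-1) `^ (- b).
    rewrite -powRD; first by congr (_ `^ _); ring.
    by rewrite gt_eqF ?implybT// addr_gt0// invr_gt0 mulr_gt0.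
  have yi : y `^ b = y^-1 `^ (- b) by rewrite -(powR_inv1 (ltW y0)) -powRrM mulN1r opprK.
  rewrite y2 mulrACA e [leRHS]mulrA.
  have Ty : 0 < (T * y)^-1 by rewrite invr_gt0 mulr_gt0.
  have Ty1 : 0 < 1 + (T * y)^-1 by rewrite addr_gt0.
  have z1 z : 0 < z -> (z + T^-1) `^ (- b) * y `^ b = ((z + T^-1) / y) `^ (- b).
    by move=> z0; rewrite yi -powRM// ?invr_ge0 ?addr_ge0// ltW.
  have zy z : 0 < z -> 0 <= (z + T^-1) / y by move=> z0; rewrite ltW// divr_gt0// addr_gt0.
  rewrite !z1// bb; apply: ler_pM; rewrite ?powR_ge0//.
    rewrite -powRM ?(ltW Ty1)//; apply: ge0_ler_powR; rewrite ?nnegrE ?(ltW bn') ?zy ?mulr_ge0 ?(ltW Ty1)//.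
    rewrite ler_pdivrMr//.
    have -> : 2 * (1 + (T * y)^-1) * y = 2 * y + 2 * T^-1 by field; rewrite !gt_eqF.
    lra.
  apply: ge0_ler_powR; rewrite ?nnegrE ?(ltW bn') ?zy ?(ltW Ty1)//.
  by rewrite le_eqVlt; apply/orP; left; apply/eqP; field; rewrite !gt_eqF.
have th : 0 < - (2 * b) by lra.
have th1 : - (2 * b) < 1 by lra.
have k : T * P * (1 + (T * y)^-1) `^ (- (2 * b)) <= 4 * (T * P + x^-1).
  have [Ty1|Ty1] := leP 1 (T * y).
    apply: (@le_trans _ _ (T * P * 2)); last by lra.
    rewrite ler_wpM2l//; apply: (@le_trans _ _ (2 `^ (- (2 * b)))).
      apply: ge0_ler_powR; rewrite ?nnegrE ?(ltW th)//.
        by rewrite addr_ge0// invr_ge0 mulr_ge0 ?ltW.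
      have : (T * y)^-1 <= 1 by rewrite invf_le1// mulr_gt0.
      lra.
    by rewrite -[leRHS](powRr1 (ler0n _ 2)); apply: ler_powR; [rewrite ler1n|exact: ltW].
  have Tyi : 1 <= (T * y)^-1 by rewrite invf_ge1 ?mulr_gt0// ltW.
  apply: (@le_trans _ _ (T * (2 * (T * y)^-1))).
    rewrite -mulrA ler_pM2l// -[leRHS]mul1r; apply: ler_pM; rewrite ?powR_ge0//.
    apply: (@le_trans _ _ ((2 * (T * y)^-1) `^ (- (2 * b)))).
      apply: ge0_ler_powR; rewrite ?nnegrE ?(ltW th)//; clear -Tyi th; lra.
    rewrite -[leRHS](powRr1 (_ : 0 <= 2 * (T * y)^-1)); last by lra.
    by apply: ler_powR; [lra|exact: ltW].
  have -> : T * (2 * (T * y)^-1) = 2 * y^-1 by field; rewrite !gt_eqF.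
  have : y^-1 <= 2 * x^-1 by rewrite -[leLHS]mul1r ler_pdivrMr// mulrAC ler_pdivlMr//; lra.
  lra.
have -> : Qk T x y * y `^ (2 * b) = T * P * ((x + T^-1) `^ (- b) * (y + T^-1) `^ (- b) * y `^ (2 * b)).
  by rewrite /Qk -/P; ring.
apply: (le_trans (ler_wpM2l TP h)).
rewrite mulrCA; apply: (@le_trans _ _ (2 `^ `|b| * (4 * (T * P + x^-1)))).
  by rewrite ler_wpM2l ?powR_ge0.
rewrite mulrA [2 `^ _ * 4]mulrC -!mulrA; apply: ler_pM => //; rewrite ?ler_nat//.
by rewrite mulr_ge0 ?powR_ge0// addr_ge0// ltW.
Qed.

Lemma Qk_regions : exists2 C : R, 0 < C & forall T x y, 0 < T -> 0 < x -> 0 < y ->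
  Qk T x y * y `^ (2 * b) <= C * (T * (1 + T * `|x - y|) `^ (-1 - de) * loc x y + K0 x y).
Proof.
have hb := b1; have hd := de0.
have ddb : dd <= b by rewrite ge_min lexx orbT.
have dq : 0 < 1 + dd + b by rewrite minElt; case: ifP => _; lra.
pose M := 2 `^ `|dd + b|.
have M0 : 0 < M by rewrite powR_gt0.
pose C1 := 32 * 2 `^ `|b| * (1 + M).
have C10 : 0 < C1 by rewrite !mulr_gt0 ?powR_gt0// addr_gt0.
pose C2 := 2 `^ (1 + de).
have C20 : 0 < C2 by rewrite powR_gt0.
exists (C1 + C2); first by rewrite addr_gt0.
move=> T x y T0 x0 y0; have K00 := K0_ge0 x y.
have L0 : 0 <= T * (1 + T * `|x - y|) `^ (-1 - de) by rewrite mulr_ge0 ?powR_ge0// ltW.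
have y2 : y `^ (2 * b) = y `^ b * y `^ b by rewrite -powRD ?(gt_eqF y0) ?implybT//; congr (_ `^ _); ring.
have far X : X <= C2 * K0 x y -> X <= (C1 + C2) * (T * (1 + T * `|x - y|) `^ (-1 - de) * loc x y + K0 x y).
  move=> h; apply: (le_trans h); apply: ler_pM => //; [exact: ltW|by rewrite lerDr ltW|].
  by rewrite lerDr mulr_ge0// /loc; case: ifP.
have [xy|yx] := leP x (2 * y); last first.
  apply: far; rewrite /K0 (leNgt x) yx/= addr0 ifT; last by lra.
  have yx2 : y <= x / 2 by rewrite ler_pdivlMr// mulrC ltW.
  have := Qk_far T0 y0 yx2; rewrite distrC [(y + _) `^ _ * _]mulrC => h.
  apply: (le_trans (ler_wpM2r (powR_ge0 y (2 * b)) h)).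
  rewrite le_eqVlt; apply/orP; left; apply/eqP; rewrite -/C2 -!mulrA; congr (_ * (_ * _)).
  by rewrite -powRD ?(gt_eqF y0) ?implybT//; congr (_ `^ _); ring.
have [yx|xy'] := leP y (2 * x); last first.
  apply: far; rewrite /K0 (leNgt y) xy'/= add0r xy.
  have xy2 : x <= y / 2 by rewrite ler_pdivlMr// mulrC ltW.
  apply: (le_trans (ler_wpM2r (powR_ge0 y (2 * b)) (Qk_far T0 x0 xy2))).
  rewrite le_eqVlt; apply/orP; left; apply/eqP; rewrite -/C2.
  rewrite (_ : C2 * _ * _ = C2 * (x `^ (dd - b) * (y `^ (-1 - dd - b) * y `^ (2 * b)))); last by ring.
  by congr (_ * (_ * _)); rewrite -powRD ?(gt_eqF y0) ?implybT//; congr (_ `^ _); ring.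
apply: (le_trans (Qk_near T0 x0 y0 xy yx)).
have lx : loc x y = 1 by rewrite /loc xy yx.
have xK : x^-1 <= M * K0 x y.
  apply: (@le_trans _ _ (M * (x `^ (-1 - dd - b) * y `^ (dd + b)))); last first.
    rewrite ler_pM2l// /K0 yx lerDl; case: ifP => // _; by rewrite mulr_ge0 ?powR_ge0.
  have -> : x^-1 = x `^ (-1 - dd - b) * x `^ (dd + b).
    rewrite -powRD ?(gt_eqF x0) ?implybT// (_ : -1 - dd - b + (dd + b) = -1); last by ring.
    by rewrite powR_inv1// ltW.
  rewrite mulrCA ler_wpM2l ?powR_ge0//; apply: powR_ratio => //; rewrite ler1n//.
rewrite lx mulr1; set L := T * _ in L0 *.
set E := 32 * _; have E0 : 0 < E by rewrite mulr_gt0 ?powR_gt0.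
apply: (@le_trans _ _ (E * (1 + M) * (L + K0 x y))).
  rewrite -mulrA ler_pM2l//; have : 0 <= M * L by rewrite mulr_ge0// ltW.
  lra.
by apply: ler_wpM2r; [exact: addr_ge0|apply: (@le_trans _ _ C1) => //; rewrite lerDl ltW].
Qed.

End KernelRegions.

(** * Hardy kernels on the unit interval *)

Section Hardy.
Variable R : realType.
Notation mu := (@lebesgue_measure R).
Implicit Types (g : R -> R) (x y t a : R).

(** The kernel, homogeneous of degree -1, of the Hardy operator that averages g against y^t up to 2
    x. *)
Definition lowk t x y : R := if y <= 2 * x then x `^ (-1 - t) * y `^ t else 0.

Lemma lowk_ge0 t x y : 0 <= lowk t x y.
Proof. by rewrite /lowk; case: ifP => // _; rewrite mulr_ge0 ?powR_ge0. Qed.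

Lemma measurable_lowk t : measurable_fun setT (fun z : R * R => lowk t z.1 z.2).
Proof.
apply: measurable_fun_ifT => //.
  by apply: measurable_fun_ler; [exact: measurable_snd|apply: measurable_funM => //; exact: measurable_fst].
by apply: measurable_funM; apply: measurable_fun_powRc; [exact: measurable_fst|exact: measurable_snd].
Qed.

Lemma lowk_intr t a x : 0 < t + 1 - a -> 0 < x ->
  (\int[mu]_(y in `]0%R, 1%R[) (lowk t x y * y `^ (- a))%:E <=
   (3 `^ (t + 1 - a) / (t + 1 - a) * x `^ (- a))%:E)%E.
Proof.
move=> e0 x0.
(* The factor 3 puts the closed condition y <= 2 x inside an open interval. *)
apply: (@le_trans _ _ (\int[mu]_(y in `]0%R, (3 * x)%R[) ((x `^ (-1 - t))%:E * (y `^ (t + 1 - a - 1))%:E))%E).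
  rewrite [leLHS]integral_mkcond [leRHS]integral_mkcond; apply: integral_mono => y _.
    by rewrite patchE; case: ifP => // _; rewrite lee_fin mulr_ge0 ?powR_ge0 ?lowk_ge0.
  have rhs0 : (0 <= (x `^ (-1 - t))%:E * (y `^ (t + 1 - a - 1))%:E)%E.
    by rewrite -EFinM lee_fin mulr_ge0 ?powR_ge0.
  rewrite !patchE; case: ifPn => [|_]; last by case: ifPn.
  rewrite inE/= in_itv/= => /andP[y0 y1].
  rewrite /lowk; case: ifPn => [yx|_]; last by rewrite mul0r; case: ifPn.
  rewrite mem_set; last by rewrite /= in_itv/= y0/=; lra.
  rewrite -EFinM lee_fin -mulrA -powRD ?(gt_eqF y0) ?implybT//.
  by rewrite le_eqVlt; apply/orP; left; apply/eqP; congr (_ * _ `^ _); ring.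
rewrite ge0_integralZl//; last 3 first.
- by apply/measurable_EFinP; apply: measurable_funTS; exact: measurable_powR.
- by move=> y _; rewrite lee_fin powR_ge0.
- by rewrite lee_fin powR_ge0.
rewrite integral_powR_oo//; last by rewrite mulr_ge0// ltW.
rewrite -EFinM lee_fin powRM// ?(ltW x0)//.
have -> : x `^ (- a) = x `^ (-1 - t) * x `^ (t + 1 - a).
  by rewrite -powRD ?(gt_eqF x0) ?implybT//; congr (_ `^ _); ring.
by rewrite le_eqVlt; apply/orP; left; apply/eqP; ring.
Qed.

Lemma lowk_intl t a y : 0 < t + a -> 0 < y ->
  (\int[mu]_(x in `]0%R, 1%R[) (lowk t x y * x `^ (- a))%:E <=
   (3 `^ (t + a) / (t + a) * y `^ (- a))%:E)%E.
Proof.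
move=> e0 y0; have y3 : 0 < y / 3 by rewrite divr_gt0.
apply: (@le_trans _ _ (\int[mu]_(x in `](y / 3)%R, 1%R[) ((y `^ t)%:E * (x `^ (- (t + a) - 1))%:E))%E).
  rewrite [leLHS]integral_mkcond [leRHS]integral_mkcond; apply: integral_mono => x _.
    by rewrite patchE; case: ifP => // _; rewrite lee_fin mulr_ge0 ?powR_ge0 ?lowk_ge0.
  have rhs0 : (0 <= (y `^ t)%:E * (x `^ (- (t + a) - 1))%:E)%E.
    by rewrite -EFinM lee_fin mulr_ge0 ?powR_ge0.
  rewrite !patchE; case: ifPn => [|_]; last by case: ifPn.
  rewrite inE/= in_itv/= => /andP[x0 x1].
  rewrite /lowk; case: ifPn => [yx|_]; last by rewrite mul0r; case: ifPn.
  rewrite mem_set; last by rewrite /= in_itv/= x1 andbT; lra.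
  rewrite -EFinM lee_fin mulrC mulrA -powRD ?(gt_eqF x0) ?implybT// mulrC.
  by rewrite le_eqVlt; apply/orP; left; apply/eqP; congr (_ * _ `^ _); ring.
rewrite ge0_integralZl//; last 3 first.
- by apply/measurable_EFinP; apply: measurable_funTS; exact: measurable_powR.
- by move=> x _; rewrite lee_fin powR_ge0.
- by rewrite lee_fin powR_ge0.
apply: (@le_trans _ _ ((y `^ t)%:E * ((y / 3) `^ (- (t + a)) / (t + a))%:E)%E).
  by apply: lee_wpmul2l; [rewrite lee_fin powR_ge0|exact: integral_powRN_oo].
rewrite -EFinM lee_fin powRM ?(ltW y0)// ?invr_ge0//.
have -> : (3^-1 : R) `^ (- (t + a)) = 3 `^ (t + a).
  by rewrite -(powR_inv1 (ler0n _ 3)) -powRrM mulN1r opprK.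
have -> : y `^ (- a) = y `^ t * y `^ (- (t + a)).
  by rewrite -powRD ?(gt_eqF y0) ?implybT//; congr (_ `^ _); ring.
by rewrite le_eqVlt; apply/orP; left; apply/eqP; ring.
Qed.

Definition hardyk ka la (z : R * R) : R :=
  \1_(`]0, 1[%classic) z.1 * \1_(`]0, 1[%classic) z.2 * (lowk ka z.1 z.2 + lowk la z.2 z.1).

Lemma hardyk_ge0 ka la z : 0 <= hardyk ka la z.
Proof. by rewrite !mulr_ge0 ?indicE// addr_ge0 ?lowk_ge0. Qed.

Lemma measurable_hardyk ka la : measurable_fun setT (hardyk ka la).
Proof.
apply: measurable_funM.
  apply: measurable_funM; (apply: measurableT_comp; first exact: measurable_indic).
    exact: measurable_fst.
  exact: measurable_snd.
apply: measurable_funD; first exact: measurable_lowk.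
apply: (@measurableT_comp _ _ _ _ _ _ (fun z : R * R => lowk la z.1 z.2) _ (fun z : R * R => (z.2, z.1))).
  exact: measurable_lowk.
by apply/measurable_fun_pairP; split; [exact: measurable_snd|exact: measurable_fst].
Qed.

Lemma indic01 x : \1_(`]0, 1[%classic) x = (if 0 < x < 1 then 1 else 0) :> R.
Proof. by rewrite indicE mem_setE in_itv/=; case: ifP. Qed.

(** Schur's test with h = x^(-1/(pq)), for which h^q = x^(-1/p) and h^p = x^(-1/q). Convergence at 0
    and at infinity then gives four conditions, which coincide in pairs: ka > -1/q and la > -1/p. *)
Lemma hardy_schur ka la p : 1 < p -> p^-1 - 1 < ka -> - p^-1 < la ->
  exists2 C, 0 < C & forall g, measurable_fun setT g -> (forall x, 0 <= g x) ->
  (\int[mu]_x ((\int[mu]_y (hardyk ka la (x, y) * g y)%:E) `^ p) <= C%:E * \int[mu]_y (g y `^ p)%:E)%E.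
Proof.
move=> p1 hka hla; have p0 : 0 < p by lra.
have pi1 : p^-1 < 1 by rewrite invf_lt1.
have pi0 : 0 < p^-1 by rewrite invr_gt0.
pose q := (1 - p^-1)^-1.
have q0 : 0 < q by rewrite invr_gt0 subr_gt0.
have qi : q^-1 = 1 - p^-1 by rewrite invrK.
have pq : p^-1 + q^-1 = 1 by rewrite qi; ring.
pose e := p^-1 * q^-1.
have eq_ : - e * q = - p^-1 by rewrite /e mulNr -mulrA mulVf ?gt_eqF// mulr1.
have ep : - e * p = - q^-1 by rewrite /e mulNr mulrAC mulVf ?gt_eqF// mul1r.
pose h x : R := \1_(`]0, 1[%classic) x * x `^ (- e).
have a1 : 0 < ka + 1 - p^-1 by lra.
have a2 : 0 < la + p^-1 by lra.
have a3 : 0 < la + 1 - q^-1 by rewrite qi; lra.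
have a4 : 0 < ka + q^-1 by rewrite qi; lra.
pose A := 3 `^ (ka + 1 - p^-1) / (ka + 1 - p^-1) + 3 `^ (la + p^-1) / (la + p^-1).
pose B := 3 `^ (ka + q^-1) / (ka + q^-1) + 3 `^ (la + 1 - q^-1) / (la + 1 - q^-1).
have A0 : 0 < A by rewrite addr_gt0// divr_gt0 ?powR_gt0.
have B0 : 0 < B by rewrite addr_gt0// divr_gt0 ?powR_gt0.
have hp r c x : 0 < c -> - e * c = - r -> 0 < x < 1 -> h x `^ c = x `^ (- r).
  by move=> c0 ec x01; rewrite /h indic01 x01 mul1r -powRrM ec.
have h0 c x : 0 < c -> (0 < x < 1) = false -> h x `^ c = 0.
  by move=> c0 x01; rewrite /h indic01 x01 mul0r powR0// gt_eqF.
have mlowl t y r : measurable_fun (`]0, 1[ : set R) (fun x => lowk t x y * x `^ r).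
  apply: measurable_funTS; apply: measurable_funM; last exact: measurable_powR.
  exact: (measurableT_comp (measurable_lowk t) (measurable_pair2 y)).
have mlowr t x r : measurable_fun (`]0, 1[ : set R) (fun y => lowk t x y * y `^ r).
  apply: measurable_funTS; apply: measurable_funM; last exact: measurable_powR.
  exact: (measurableT_comp (measurable_lowk t) (measurable_pair1 x)).
have lp t x y z r : 0 <= lowk t x y * z `^ r by rewrite mulr_ge0 ?lowk_ge0 ?powR_ge0.
exists (A `^ (p / q) * B); first by rewrite mulr_gt0// powR_gt0.
move=> g mg g0; apply: (@schur_test R (hardyk ka la) h g p q A B p1 q0 pq (ltW A0) (ltW B0)
  (measurable_hardyk ka la) (@hardyk_ge0 ka la) _ _ _ mg g0) => [||x y hy|x|y].
- apply: measurable_funM; first exact: measurable_indic.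
  exact: measurable_powR.
- by move=> x; rewrite /h mulr_ge0 ?powR_ge0// indicE.
- move: hy; rewrite /h /hardyk/= (indic01 y); case: ifP => [/andP[y0 _]|_]; last by rewrite mulr0 mul0r.
  by rewrite mul1r => /eqP; rewrite gt_eqF// powR_gt0.
- have [x01|x01] := boolP (0 < x < 1); last first.
    rewrite (_ : (fun y => _) = cst 0%E); last first.
      by apply/funext => y; rewrite /hardyk/= indic01 (negbTE x01) !mul0r.
    by rewrite integral0 lee_fin mulr_ge0 ?powR_ge0// ltW.
  have /andP[x0 x1] := x01; rewrite (hp _ _ _ q0 eq_ x01).
  rewrite (_ : (\int[mu]_y _)%E = (\int[mu]_(y in `]0%R, 1%R[)
     ((lowk ka x y * y `^ (- p^-1))%:E + (lowk la y x * y `^ (- p^-1))%:E))%E); last first.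
    rewrite [RHS]integral_mkcond; apply: eq_integral => y _; rewrite patchE /hardyk/=.
    rewrite (indic01 x) (indic01 y) x01 mul1r mem_setE in_itv/=; case: ifPn => y01; last by rewrite !mul0r.
    by rewrite mul1r (hp _ _ _ q0 eq_ y01) -EFinD mulrDl.
  rewrite ge0_integralD//; last 4 first.
  - by move=> y _; rewrite lee_fin.
  - apply/measurable_EFinP; exact: mlowr.
  - by move=> y _; rewrite lee_fin.
  - apply/measurable_EFinP; exact: mlowl.
  by rewrite /A mulrDl EFinD; apply: leeD; [exact: lowk_intr|exact: lowk_intl].
- have [y01|y01] := boolP (0 < y < 1); last first.
    rewrite (_ : (fun x => _) = cst 0%E); last first.
      by apply/funext => x; rewrite /hardyk/= (indic01 y) (negbTE y01) mulr0 !mul0r.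
    by rewrite integral0 lee_fin mulr_ge0 ?powR_ge0// ltW.
  have /andP[y0 y1] := y01; rewrite (hp _ _ _ p0 ep y01).
  rewrite (_ : (\int[mu]_x _)%E = (\int[mu]_(x in `]0%R, 1%R[)
     ((lowk ka x y * x `^ (- q^-1))%:E + (lowk la y x * x `^ (- q^-1))%:E))%E); last first.
    rewrite [RHS]integral_mkcond; apply: eq_integral => x _; rewrite patchE /hardyk/=.
    rewrite (indic01 x) (indic01 y) y01 mulr1 mem_setE in_itv/=; case: ifPn => x01; last by rewrite !mul0r.
    by rewrite mul1r (hp _ _ _ p0 ep x01) -EFinD mulrDl.
  rewrite ge0_integralD//; last 4 first.
  - by move=> x _; rewrite lee_fin.
  - apply/measurable_EFinP; exact: mlowl.
  - by move=> x _; rewrite lee_fin.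
  - apply/measurable_EFinP; exact: mlowr.
  by rewrite /B mulrDl EFinD; apply: leeD; [exact: lowk_intl|exact: lowk_intr].
Qed.

End Hardy.

(** * Sufficiency *)

Section Pointwise.
Variables (R : realType) (nu de : R) (s : nat -> R).
Hypotheses (nu1 : -1 < nu) (hs : bessel_zeros nu s) (de0 : 0 < de).
Notation b := (nu + 1 / 2).
Notation mu := (@lebesgue_measure R).
Notation ev := (ev nu s).
Implicit Types (f : R -> R) (x y T : R).

Lemma BR_sum f T x n : 0 < T -> T <= s n -> 0 < x ->
  BR nu de s f T x = \sum_(j < n) msym de (s j / T) * fb_coef nu s f j * ev j x.
Proof.
move=> T0 Tn x0; rewrite /BR.
pose u j := msym de (s j / T) * fb_coef nu s f j * ev j x.
have e : series (fun j => Num.max 0 (1 - s j ^+ 2 / T ^+ 2) `^ de * fb_coef nu s f j * psi nu s j x) = series u.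
  apply/funext => N; apply: eq_bigr => j _; rewrite /u /msym expr_div_n (psi_ev nu1 hs)//.
rewrite e; apply: cvg_lim => //.
apply: cvg_near_cst; near=> N.
have nN : (n <= N)%N by near: N; exact: nbhs_infty_ge.
rewrite /series/= (big_cat_nat (n := n))//= [X in _ + X]big1_seq ?addr0 ?big_mkord//.
move=> j /andP[_]; rewrite mem_index_iota => /andP[nj _]; rewrite /u.
rewrite msym_out ?mul0r//; have sj : T <= s j by apply: (le_trans Tn); exact: s_le hs _ _ nj.
have sT : 0 <= s j / T by rewrite divr_ge0 ?(ltW T0) ?(ltW (s_gt0 hs j)).
by rewrite (ger0_norm sT) ler_pdivlMr// mul1r.
Unshelve. all: by end_near.
Qed.

Lemma BR_le : exists2 C, 0 < C & forall f T x,
  mu.-integrable `]0%R, 1%R[ (EFin \o (fun y => f y * y `^ (2 * nu + 1))) -> 0 < T -> 0 < x < 1 ->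
  ((`|BR nu de s f T x|)%:E <=
   \int[mu]_(y in `]0%R, 1%R[) (C * (Qk b de T x y * y `^ (2 * b) * `|f y|))%:E)%E.
Proof.
have [C C0 hC] := kernel_bound nu1 hs de0; exists C => // f T x fi T0 x01.
have /andP[x0 x1] := x01.
have [n hn] := s_cvg_pinfty nu1 hs T; have Tn := hn _ (leqnn n).
rewrite (BR_sum _ T0 Tn x0).
have b2 : 2 * b = 2 * nu + 1 by field.
pose K y := \sum_(j < n) msym de (s j / T) * (ev j x * ev j y).
have mI : measurable (`]0, 1[ : set R) by exact: measurable_itv.
have evi j : mu.-integrable `]0%R, 1%R[ (EFin \o (fun y => f y * ev j y * y `^ (2 * nu + 1))).
  have ce : continuous (ev j) by exact: (@continuous_ev R nu s nu1 j).
  have [M [_ hM]] := continuous_bounded_itv 0 1 ce.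
  apply: (@le_integrable _ _ _ mu _ mI _ (EFin \o (fun y => M * (f y * y `^ (2 * nu + 1))))).
  - rewrite (_ : _ \o _ = (fun y => (f y * y `^ (2 * nu + 1))%:E * (ev j y)%:E)%E); last first.
      by apply/funext => y /=; rewrite -EFinM; congr EFin; ring.
    apply: emeasurable_funM; first exact: measurable_int fi.
    by apply/measurable_EFinP; exact: continuous_measurable_itv.
  - move=> y; rewrite /= in_itv/= => /andP[/ltW y0 /ltW y1].
    have h := hM y; rewrite y0 y1 in h.
    rewrite lee_fin mulrAC [leLHS]normrM [leRHS]normrM mulrC ler_wpM2r//.
    exact: (le_trans (h isT) (ler_norm M)).
  - exact: integrableRZ.
have ti (j : 'I_n) : mu.-integrable `]0%R, 1%R[
    (EFin \o (fun y => msym de (s j / T) * ev j x * (f y * ev j y * y `^ (2 * nu + 1)))).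
  exact: integrableRZ.
have -> : \sum_(j < n) msym de (s j / T) * fb_coef nu s f j * ev j x =
    Rintegral mu `]0, 1[ (fun y => \sum_(j < n) msym de (s j / T) * ev j x * (f y * ev j y * y `^ (2 * nu + 1))).
  rewrite Rintegral_sum//; apply: eq_bigr => j _.
  rewrite RintegralZl// mulrAC; congr (_ * _); rewrite /fb_coef.
  apply: eq_Rintegral => y; rewrite inE/= in_itv/= => /andP[y0 _].
  by rewrite (psi_ev nu1 hs).
have si := integrableRsum mI ti.
rewrite EFin_normr_Rintegral//.
apply: le_trans; first by apply: le_abse_integral => //; exact: measurable_int si.
apply: integral_mono => y; first by move=> _; exact: abse_ge0.
rewrite /= in_itv/= => y01; rewrite lee_fin.
have -> : \sum_(j < n) msym de (s j / T) * ev j x * (f y * ev j y * y `^ (2 * nu + 1)) =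
    K y * (f y * y `^ (2 * nu + 1)).
  by rewrite mulr_suml; apply: eq_bigr => j _; ring.
rewrite normrM normrM (ger0_norm (powR_ge0 _ _)) b2.
have h := hC T x y n T0 Tn x01 y01.
apply: (@le_trans _ _ (C * T * (1 + T * `|x - y|) `^ (-1 - de) * ((x + T^-1) `^ (- b) * (y + T^-1) `^ (- b)) * (`|f y| * y `^ (2 * nu + 1)))).
  by rewrite ler_wpM2r// mulr_ge0// powR_ge0.
by rewrite /Qk le_eqVlt; apply/orP; left; apply/eqP; ring.
Qed.

End Pointwise.

Section PoweR.
Variable R : realType.
Local Open Scope ereal_scope.
Implicit Types (a c : \bar R) (p : R).

Lemma poweR_add_le a c p : (0 <= p)%R -> 0 <= a -> 0 <= c ->
  (a + c) `^ p <= (2 `^ p)%:E * (a `^ p + c `^ p).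
Proof.
move=> p0; wlog ac : a c / a <= c => [h a0 c0|a0 c0].
  have [ac|/ltW ca] := leP a c; first exact: h.
  by rewrite addeC [X in _ * X]addeC; exact: h.
apply: (@le_trans _ _ (((2 : R)%:E * c) `^ p)).
  apply: le_poweR => //; first exact: adde_ge0.
  by rewrite mule_natl mule2n leeD.
by rewrite poweRM// poweR_EFin lee_wpmul2l ?lee_fin ?powR_ge0// leeDr// poweR_ge0.
Qed.

End PoweR.

(** * Bounds for finite p *)

Section WeightedBound.
Variables (R : realType) (nu de : R) (s : nat -> R).
Hypotheses (nu1 : -1 < nu) (hs : bessel_zeros nu s) (de0 : 0 < de).
Notation b := (nu + 1 / 2).
Notation dd := (Num.min de b).
Notation mu := (@lebesgue_measure R).
Implicit Types (f : R -> R) (x y T : R).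

Lemma lowk_weight t r x y : 0 < x -> 0 < y -> lowk t x y * y `^ (- r) = x `^ (- r) * lowk (t - r) x y.
Proof.
move=> x0 y0; rewrite /lowk; case: ifP => _; last by rewrite mul0r mulr0.
rewrite -mulrA -powRD ?(gt_eqF y0) ?implybT// mulrA -powRD ?(gt_eqF x0) ?implybT//.
by congr (_ `^ _ * _ `^ _); ring.
Qed.

Lemma lowk_weight' t r x y : 0 < x -> 0 < y -> lowk t y x * y `^ (- r) = x `^ (- r) * lowk (t + r) y x.
Proof.
move=> x0 y0; rewrite /lowk; case: ifP => _; last by rewrite mul0r mulr0.
rewrite mulrAC -powRD ?(gt_eqF y0) ?implybT// mulrCA -powRD ?(gt_eqF x0) ?implybT//.
by congr (_ `^ _ * _ `^ _); ring.
Qed.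

Lemma K0_lowk x y : K0 b de x y = lowk (dd + b) x y + lowk (dd - b) y x.
Proof.
rewrite /K0 /lowk; congr (_ + _); case: ifP => // _.
  by congr (_ `^ _ * _); ring.
by rewrite mulrC; congr (_ `^ _ * _); ring.
Qed.

Lemma weighted_bound r : exists2 C, 0 < C & forall f x,
  measurable_fun (`]0, 1[ : set R) f ->
  mu.-integrable `]0%R, 1%R[ (EFin \o (fun y => f y * y `^ (2 * nu + 1))) -> 0 < x < 1 ->
  ((x `^ r)%:E * Bmax nu de s f x <= C%:E * (HL_maximal (fun y => \1_(`]0%R, 1%R[%classic) y * (`|f y| * y `^ r))%R x +
    \int[mu]_y (hardyk (dd + b - r) (dd - b + r) (x, y) *
        (\1_(`]0%R, 1%R[%classic) y * (`|f y| * y `^ r)))%R%:E))%E.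
Proof.
have b1 : - (1 / 2) < b by move: nu1 => h; lra.
have [C1 C10 hC1] := BR_le nu1 hs de0.
have [C2 C20 hC2] := Qk_regions b1 de0.
have [C3 C30 hC3] := dyadic_maximal de0.
pose M := 2 `^ `|r|.
have M1 : 1 <= M by rewrite -[leLHS](powRr0 2); apply: ler_powR => //; rewrite ler1n.
have M0 : 0 < M by exact: lt_le_trans M1.
pose C := C1 * C2 * M * (C3 + 1).
have C123 : 0 < C1 * C2 * M by rewrite !mulr_gt0.
have C0 : 0 < C by rewrite mulr_gt0// addr_gt0.
exists C => // f x mf fi x01; have /andP[x0 x1] := x01.
set ka := dd + b - r; set la := dd - b + r.
pose g y := \1_(`]0, 1[%classic) y * (`|f y| * y `^ r).
rewrite -/g.
have g0 y : 0 <= g y by rewrite /g indicE mulr_ge0// mulr_ge0// powR_ge0.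
have mg : measurable_fun setT g.
  have -> : g = (fun y => `|f y| * y `^ r) \_ `]0, 1[.
    apply/funext => y; rewrite /g patchE mem_setE in_itv/= indic01; case: ifP; by rewrite ?mul1r ?mul0r.
  apply/(measurable_restrictT _ _).1; first exact: measurable_itv.
  apply: measurable_funM; first exact: measurableT_comp.
  by apply: measurable_funTS; exact: measurable_powR.
have mk : measurable_fun setT (fun y => hardyk ka la (x, y) * g y).
  by apply: measurable_funM => //; apply: measurableT_comp; [exact: measurable_hardyk|exact: measurable_pair1].
have HL0 : (0 <= HL_maximal g x)%E.
  apply: le_trans (_ : iavg g (ball x 1) <= _)%E; first exact: iavg_ge0.
  by apply: ereal_sup_ubound; exists 1 => //=; rewrite in_itv/= andbT.
have H0 : (0 <= \int[mu]_y (hardyk ka la (x, y) * g y)%:E)%E.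
  by apply: integral_ge0 => y _; rewrite lee_fin mulr_ge0// hardyk_ge0.
have xr : 0 < x `^ r by rewrite powR_gt0.
rewrite -lee_pdivlMl//; apply: ge_ereal_sup => _ [T + <-].
rewrite /= in_itv/= andbT => T0.
apply: (le_trans (hC1 f T x fi T0 x01)).
have pt y : 0 < y < 1 -> C1 * (Qk b de T x y * y `^ (2 * b) * `|f y|) <=
    C1 * C2 * M * (x `^ r)^-1 * (T * (1 + T * `|x - y|) `^ (-1 - de) * g y + hardyk ka la (x, y) * g y).
  move=> y01; have /andP[y0 y1] := y01.
  have -> : g y = `|f y| * y `^ r by rewrite /g indic01 y01 mul1r.
  have -> : hardyk ka la (x, y) = lowk ka x y + lowk la y x.
    by rewrite /hardyk/= !indic01 x01 y01 !mul1r.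
  have := hC2 T x y T0 x0 y0; rewrite K0_lowk.
  set L := T * _ `^ _; set Q := Qk _ _ _ _ _ * _ => hQ.
  have L0 : 0 <= L by rewrite mulr_ge0 ?powR_ge0// ltW.
  have yr : 0 < y `^ r by rewrite powR_gt0.
  have fE : `|f y| = `|f y| * y `^ r * y `^ (- r) by rewrite powRN mulfK// gt_eqF.
  have nf : 0 <= `|f y| * y `^ r by rewrite mulr_ge0// ltW.
  set F := `|f y| * y `^ r in nf fE *; rewrite [X in C1 * (_ * X)]fE.
  apply: (@le_trans _ _ (C1 * ((C2 * (L * loc x y + (lowk (dd + b) x y + lowk (dd - b) y x))) * (F * y `^ (- r))))).
    by rewrite ler_pM2l// ler_wpM2r// mulr_ge0// powR_ge0.
  have -> : C1 * ((C2 * (L * loc x y + (lowk (dd + b) x y + lowk (dd - b) y x))) * (F * y `^ (- r))) =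
     C1 * C2 * F * (L * (loc x y * y `^ (- r)) + (lowk (dd + b) x y * y `^ (- r) + lowk (dd - b) y x * y `^ (- r))) by ring.
  rewrite lowk_weight// lowk_weight'// -/ka -/la powRN.
  have -> : C1 * C2 * M * (x `^ r)^-1 * (L * F + (lowk ka x y + lowk la y x) * F) =
    C1 * C2 * F * (L * (M * (x `^ r)^-1) + M * ((x `^ r)^-1 * lowk ka x y + (x `^ r)^-1 * lowk la y x)) by ring.
  apply: ler_wpM2l; first by rewrite !mulr_ge0// ltW.
  have lw := lowk_ge0 ka x y; have lw' := lowk_ge0 la y x.
  have xri : 0 <= (x `^ r)^-1 by rewrite invr_ge0 ltW.
  apply: lerD; last first.
    by rewrite -powRN ler_peMl// addr_ge0// mulr_ge0// powR_ge0.
  apply: ler_wpM2l => //; rewrite /loc; case: ifPn => [/andP[xy yx]|_]; last by rewrite mul0r mulr_ge0// ltW.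
  rewrite ler_pdivrMr// mulrAC ler_pdivlMr// mul1r.
  by apply: powR_ratio; rewrite ?ler1n.
apply: (@le_trans _ _ (\int[mu]_(y in `]0%R, 1%R[) ((C1 * C2 * M * (x `^ r)^-1)%:E *
   ((T * (1 + T * `|x - y|) `^ (-1 - de) * g y)%:E + (hardyk ka la (x, y) * g y)%:E)))%E).
  apply: integral_mono => y.
    by move=> _; rewrite lee_fin !mulr_ge0 ?powR_ge0 ?(ltW C10) ?(ltW T0).
  by rewrite /= in_itv/= => y01; rewrite -EFinD -EFinM lee_fin; exact: pt.
have cx : 0 <= C1 * C2 * M * (x `^ r)^-1 by rewrite mulr_ge0 ?invr_ge0 ?(ltW C123) ?(ltW xr).
have L0 y : 0 <= T * (1 + T * `|x - y|) `^ (-1 - de) * g y.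
  by rewrite mulr_ge0// mulr_ge0 ?powR_ge0// ltW.
have mL : measurable_fun (`]0, 1[ : set R) (fun y => T * (1 + T * `|x - y|) `^ (-1 - de) * g y).
  apply: measurable_funTS; apply: measurable_funM => //; apply: measurable_funM => //.
  apply: measurable_fun_powRc; apply: measurable_funD => //; apply: measurable_funM => //.
  by apply: measurableT_comp => //; exact: measurable_funB.
have h0 y : 0 <= hardyk ka la (x, y) * g y by rewrite mulr_ge0// hardyk_ge0.
have mk' : measurable_fun (`]0, 1[ : set R) (fun y => hardyk ka la (x, y) * g y) by exact: measurable_funTS.
rewrite ge0_integralZl//; last 2 first.
- by apply: emeasurable_funD; apply/measurable_EFinP.
- by move=> y _; rewrite adde_ge0// lee_fin.
rewrite ge0_integralD//; last 4 first.
- by move=> y _; rewrite lee_fin.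
- by apply/measurable_EFinP.
- by move=> y _; rewrite lee_fin.
- by apply/measurable_EFinP.
rewrite mulrC EFinM -muleA; apply: lee_wpmul2l; first by rewrite lee_fin invr_ge0 ltW.
have -> : C%:E = ((C1 * C2 * M)%:E * (C3 + 1)%:E)%E by rewrite -EFinM.
rewrite -[leRHS]muleA; apply: lee_wpmul2l; first by rewrite lee_fin ltW.
rewrite EFinD ge0_muleDl ?lee_fin ?(ltW C30)// ge0_muleDr//.
rewrite mul1e; apply: (@le_trans _ _ (C3%:E * HL_maximal g x + \int[mu]_y (hardyk ka la (x, y) * g y)%:E)%E).
  apply: leeD; first exact: hC3.
  by apply: ge0_subset_integral => //; [exact/measurable_EFinP|move=> y _; rewrite lee_fin].
apply: leeD.
  by rewrite leeDl// mule_ge0// lee_fin ltW.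
by rewrite leeDr.
Qed.

Lemma integrable_Lp f p : 1 < p -> measurable_fun (`]0, 1[ : set R) f ->
  (\int[mu]_(x in `]0%R, 1%R[) (`|f x| `^ p * x `^ (2 * nu + 1))%:E < +oo)%E ->
  mu.-integrable `]0%R, 1%R[ (EFin \o (fun y => f y * y `^ (2 * nu + 1))).
Proof.
move=> p1 mf fp; have q0 : 0 < 2 * nu + 2 by move: nu1 => h; lra.
have mI : measurable (`]0, 1[ : set R) by exact: measurable_itv.
have mw : measurable_fun (`]0, 1[ : set R) (fun y => y `^ (2 * nu + 1)).
  by apply: measurable_funTS; exact: measurable_powR.
have ip : mu.-integrable `]0%R, 1%R[ (EFin \o (fun y => `|f y| `^ p * y `^ (2 * nu + 1))).
  apply/integrableP; split.
    apply/measurable_EFinP; apply: measurable_funM => //; apply: measurable_fun_powRc.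
    exact: measurableT_comp.
  by under eq_integral do rewrite /= (ger0_norm (mulr_ge0 (powR_ge0 _ _) (powR_ge0 _ _))).
have i1 : mu.-integrable `]0%R, 1%R[ (EFin \o (fun y => y `^ (2 * nu + 1))).
  have := integrable_powR01 q0; apply: eq_integrable => // x _ /=.
  by congr (_ `^ _)%:E; ring.
apply: (@le_integrable _ _ _ mu _ mI _ _ _ _ (integrableRD mI ip i1)).
  by apply/measurable_EFinP; exact: measurable_funM.
move=> y _ /=; rewrite lee_fin normrM (ger0_norm (powR_ge0 _ _)).
rewrite -[X in `|_ + X|]mul1r -mulrDl (ger0_norm (mulr_ge0 (addr_ge0 (powR_ge0 _ _) ler01) (powR_ge0 _ _))).
rewrite ler_wpM2r ?powR_ge0//.
have [f1|/ltW f1] := leP `|f y| 1; first by rewrite (le_trans f1)// lerDr powR_ge0.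
rewrite (@le_trans _ _ (`|f y| `^ p))//; last by rewrite lerDl.
by rewrite -[leLHS](powRr1 (normr_ge0 (f y))); apply: ler_powR => //; exact: ltW.
Qed.

(** With r = 2 b/p the measure is absorbed, and the two hypotheses are those of [hardy_schur]
    multiplied by p. *)
Lemma Lpnorm_bound p : 1 < p -> 2 * b + 1 < p * (b + 1 + dd) -> p * (b - dd) < 2 * b + 1 ->
  exists C : R, forall f,
      measurable_fun (`]0%R, 1%R[ : set R) f -> (Lpnorm nu p%:E (EFin \o f) < +oo)%E ->
      (Lpnorm nu p%:E (Bmax nu de s f) <= C%:E * Lpnorm nu p%:E (EFin \o f))%E.
Proof.
move=> p1 c1 c2; have p0 : 0 < p by lra.
have pi0 : 0 < p^-1 by rewrite invr_gt0.
pose r := 2 * b / p.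
have rp : r * p = 2 * nu + 1 by rewrite /r divfK ?gt_eqF//; field.
have hka : p^-1 - 1 < dd + b - r.
  rewrite /r -(ltr_pM2r p0) !mulrBl mulVf ?gt_eqF// divfK ?gt_eqF//; lra.
have hla : - p^-1 < dd - b + r.
  rewrite /r -(ltr_pM2r p0) mulrDl mulNr mulVf ?gt_eqF// divfK ?gt_eqF//; lra.
have [C1 C10 h1] := weighted_bound r.
have [C2 C20 h2] := hardy_schur p1 hka hla.
pose D := (6 * p / (p - 1) * 2 `^ (p - 1)).
have D0 : 0 <= D by rewrite mulr_ge0 ?powR_ge0// divr_ge0//; lra.
pose E := C1 `^ p * (2 `^ p * (D + C2)).
have E0 : 0 <= E by rewrite !mulr_ge0 ?powR_ge0// addr_ge0// ltW.
exists (E `^ p^-1) => f mf fp.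
pose g y := \1_(`]0, 1[%classic) y * (`|f y| * y `^ r).
have g0 y : 0 <= g y by rewrite /g indicE mulr_ge0// mulr_ge0// powR_ge0.
have mg : measurable_fun setT g.
  have -> : g = (fun y => `|f y| * y `^ r) \_ `]0, 1[.
    apply/funext => y; rewrite /g patchE mem_setE in_itv/= indic01; case: ifP; by rewrite ?mul1r ?mul0r.
  apply/(measurable_restrictT _ _).1; first exact: measurable_itv.
  apply: measurable_funM; first exact: measurableT_comp.
  by apply: measurable_funTS; exact: measurable_powR.
have gE : (\int[mu]_(x in `]0%R, 1%R[) (`|f x| `^ p * x `^ (2 * nu + 1))%:E = \int[mu]_x (g x `^ p)%:E)%E.
  rewrite [LHS]integral_mkcond; apply: eq_integral => x _; rewrite patchE /g mem_setE in_itv/= indic01.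
  case: ifP => [/andP[x0 x1]|_]; last by rewrite mul0r powR0// gt_eqF.
  by rewrite mul1r powRM ?powR_ge0// -powRrM rp.
have NfE : Lpnorm nu p%:E (EFin \o f) = ((\int[mu]_x (g x `^ p)%:E) `^ p^-1)%E.
  by rewrite /Lpnorm -gE.
have gfin : (\int[mu]_x (g x `^ p)%:E < +oo)%E.
  have I0 : (0 <= \int[mu]_x (g x `^ p)%:E)%E by apply: integral_ge0 => x _; rewrite lee_fin powR_ge0.
  move: fp; rewrite NfE; move: (\int[mu]_x (g x `^ p)%:E)%E I0 => [v _ _|_|//].
    by rewrite ltry.
  by rewrite poweRyr ?gt_eqF.
have fi : mu.-integrable `]0%R, 1%R[ (EFin \o (fun y => f y * y `^ (2 * nu + 1))).
  by apply: (@integrable_Lp f p) => //; rewrite gE.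
have lg := locally_integrable_powR p1 mg g0 gfin.
have HL0 := HL_maximalT_ge0 lg.
pose H x := (\int[mu]_y (hardyk (dd + b - r) (dd - b + r) (x, y) * g y)%:E)%E.
have H0 x : (0 <= H x)%E by apply: integral_ge0 => y _; rewrite lee_fin mulr_ge0// hardyk_ge0.
have mH : measurable_fun setT H.
  apply: (@measurable_fun_fubini_tonelli_F _ _ _ _ _ mu (fun z : R * R => (hardyk (dd + b - r) (dd - b + r) z * g z.2)%:E)).
    apply/measurable_EFinP; apply: measurable_funM; first exact: measurable_hardyk.
    by apply: measurableT_comp => //; exact: measurable_snd.
  by move=> z; rewrite lee_fin mulr_ge0// hardyk_ge0.
rewrite NfE /Lpnorm -poweR_EFin -poweRM ?lee_fin//; last by apply: integral_ge0 => x _; rewrite lee_fin powR_ge0.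
have B0 x : (0 <= Bmax nu de s f x)%E.
  apply: (@le_trans _ _ (`|BR nu de s f 1 x|)%:E); first by rewrite lee_fin.
  by apply: ereal_sup_ubound; exists 1 => //=; rewrite in_itv/= andbT.
apply: le_poweR; first exact: ltW.
  by apply: integral_ge0 => x _; rewrite mule_ge0 ?poweR_ge0// lee_fin powR_ge0.
apply: (@le_trans _ _ (\int[mu]_x ((C1 `^ p * 2 `^ p)%:E * (HL_maximal g x `^ p + H x `^ p)))%E).
  rewrite [leLHS]integral_mkcond; apply: integral_mono => x _.
    by rewrite patchE; case: ifP => // _; rewrite mule_ge0 ?poweR_ge0// lee_fin powR_ge0.
  have rhs0 : (0 <= (C1 `^ p * 2 `^ p)%:E * (HL_maximal g x `^ p + H x `^ p))%E.
    by rewrite mule_ge0 ?adde_ge0 ?poweR_ge0// lee_fin mulr_ge0 ?powR_ge0.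
  rewrite patchE; case: ifPn => // ; rewrite inE/= in_itv/= => x01.
  have xr : (x `^ (2 * nu + 1))%:E = ((x `^ r)%:E `^ p)%E by rewrite poweR_EFin -powRrM rp.
  rewrite gee0_abs// xr -poweRM ?lee_fin ?powR_ge0// muleC.
  apply: (@le_trans _ _ ((C1%:E * (HL_maximal g x + H x)) `^ p)%E).
    apply: le_poweR; first exact: ltW.
      by rewrite mule_ge0// lee_fin powR_ge0.
    exact: h1.
  have C1e : (0 <= C1%:E)%E by rewrite lee_fin ltW.
  rewrite (poweRM p C1e (adde_ge0 (HL0 x) (H0 x))) poweR_EFin EFinM -muleA.
  apply: lee_wpmul2l; first by rewrite lee_fin powR_ge0.
  exact: poweR_add_le (ltW p0) (HL0 x) (H0 x).
have mHLp : measurable_fun setT (fun x => HL_maximal g x `^ p)%E.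
  exact: measurableT_comp (measurable_poweR p) (measurable_HL_maximal lg).
have mHp : measurable_fun setT (fun x => H x `^ p)%E.
  exact: measurableT_comp (measurable_poweR p) mH.
rewrite ge0_integralZl//; last 3 first.
- exact: emeasurable_funD.
- by move=> x _; rewrite adde_ge0 ?poweR_ge0.
- by rewrite lee_fin mulr_ge0 ?powR_ge0.
rewrite ge0_integralD//; last 2 first.
- by move=> x _; exact: poweR_ge0.
- by move=> x _; exact: poweR_ge0.
have -> : E%:E = ((C1 `^ p * 2 `^ p)%:E * (D + C2)%:E)%E by rewrite -EFinM /E mulrA.
rewrite -muleA; apply: lee_wpmul2l; first by rewrite lee_fin mulr_ge0 ?powR_ge0.
rewrite EFinD ge0_muleDl ?lee_fin ?(ltW C20)//.
by apply: leeD; [exact: HL_strong|exact: h2].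
Qed.

End WeightedBound.

(** * The end point p = oo: integrability of the kernel uniformly in T *)

Section KernelL1.
Variables (R : realType) (b de : R).
Hypotheses (b1 : -(1 / 2) < b) (de0 : 0 < de) (bde : b < de).
Notation mu := (@lebesgue_measure R).
Implicit Types (x y T : R).
Notation c := (de - Num.max b 0).

(** When b < de the T-free kernel of [K0] is 1/y for y >= 2 x, and its integral grows like log(1/x).
    This majorant keeps T and has an integral bounded independently of T: it rises like y^(2b) up to
    1/T and decays beyond with the positive rate de - max(b, 0). *)
Definition farmaj T y : R := if T * y <= 1 then T `^ (1 + 2 * b) * y `^ (2 * b) else T `^ (- c) * y `^ (- c - 1).

Lemma farmaj_ge0 T y : 0 <= farmaj T y.
Proof. by rewrite /farmaj; case: ifP => _; rewrite mulr_ge0 ?powR_ge0. Qed.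

Lemma decay_gt0 : 0 < c.
Proof. by rewrite subr_gt0 gt_max bde. Qed.

Lemma Qk_farmaj T x y : 0 < T -> 0 < x -> 2 * x <= y ->
  Qk b de T x y * y `^ (2 * b) <= 2 `^ (1 + de) * 2 `^ `|b| * farmaj T y.
Proof.
move=> T0 x0 xy; have hb := b1; have hd := de0; have hbd := bde.
have y0 : 0 < y by lra.
pose u := T * x; pose v := T * y.
have u0 : 0 < u by rewrite mulr_gt0.
have v0 : 0 < v by rewrite mulr_gt0.
have uv : u <= v by rewrite ler_pM2l//; lra.
have u1 : 0 < 1 + u by lra.
have v1 : 0 < 1 + v by lra.
have q0 : 0 < 1 + de by lra.
have q1 : 0 < 1 + de + b by lra.
have h1 : (1 + T * `|x - y|) `^ (-1 - de) <= 2 `^ (1 + de) * (1 + v) `^ (-1 - de).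
  have e1 : -1 - de = - (1 + de) by ring.
  rewrite e1 !powRN ler_pdivlMr ?powR_gt0// ler_pdivrMl; last first.
    by rewrite powR_gt0// ltr_pwDl// mulr_ge0// ltW.
  rewrite -powRM; [|by rewrite addr_ge0// mulr_ge0// ltW|by []].
  apply: ge0_ler_powR; rewrite ?nnegrE ?(ltW v1) ?(ltW q0)//.
    by rewrite mulr_ge0// addr_ge0// mulr_ge0// ltW.
  have h2 : y / 2 <= `|x - y| by rewrite distrC ger0_norm; lra.
  have : T * (y / 2) <= T * `|x - y| by rewrite ler_pM2l.
  by rewrite /v; lra.
have T2 : T `^ (1 + 2 * b) = T * (T `^ b * T `^ b).
  rewrite -{2}(powRr1 (ltW T0)) -!powRD ?(gt_eqF T0) ?implybT//.
  by congr (_ `^ _); ring.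
have y2v : y `^ (2 * b) * (T `^ b * T `^ b) = v `^ (2 * b).
  rewrite /v powRM ?(ltW T0) ?(ltW y0)// mulrC; congr (_ * _).
  by rewrite -powRD ?(gt_eqF T0) ?implybT//; congr (_ `^ _); ring.
have key : (1 + v) `^ (-1 - de) * ((1 + u) `^ (- b) * (1 + v) `^ (- b)) * v `^ (2 * b) <=
    2 `^ `|b| * (if v <= 1 then v `^ (2 * b) else v `^ (- c - 1)).
  have -> : (1 + v) `^ (-1 - de) * ((1 + u) `^ (- b) * (1 + v) `^ (- b)) =
      (1 + u) `^ (- b) * (1 + v) `^ (- (1 + de + b)).
    by rewrite mulrCA -powRD ?(gt_eqF v1) ?implybT//; congr (_ * _ `^ _); ring.
  have B1 : 1 <= 2 `^ `|b| by rewrite -[leLHS](powRr0 2); apply: ler_powR => //; rewrite ler1n.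
  have vq : (1 + v) `^ (- (1 + de + b)) <= 1.
    by rewrite -[leRHS](powRr0 (1 + v)); apply: ler_powR; clear -v0 q1; lra.
  have uA A : u <= A -> 1 <= A -> (1 + u) `^ (- b) <= 2 `^ `|b| * A `^ Num.max (- b) 0.
    move=> uA A1; have A0 : 0 <= A by apply: le_trans A1.
    have [bp|bn] := leP 0 b.
      have mx : Num.max (- b) 0 = 0 by apply/max_idPr; rewrite oppr_le0.
      rewrite mx powRr0 mulr1; apply: le_trans B1.
      by rewrite -[leRHS](powRr0 (1 + u)); apply: ler_powR; clear -u0 bp; lra.
    have mx : Num.max (- b) 0 = - b by apply/max_idPl; rewrite oppr_ge0 ltW.
    rewrite mx (ltr0_norm bn) -powRM//; apply: ge0_ler_powR; rewrite ?nnegrE ?(ltW u1) ?mulr_ge0 ?oppr_ge0 ?(ltW bn)//.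
    lra.
  case: ifPn => [vs|]; last rewrite -ltNge => vl.
    rewrite ler_wpM2r ?powR_ge0//; have := uA 1 (le_trans uv vs) (lexx 1).
    rewrite powR1 mulr1 => h; rewrite -[leRHS]mulr1.
    by apply: ler_pM; rewrite ?powR_ge0.
  have h := uA v uv (ltW vl).
  have -> : - c - 1 = Num.max (- b) 0 + (- (1 + de + b) + 2 * b).
    by have [bp|bn] := leP 0 b; [rewrite (max_idPr _) ?oppr_le0//|
       rewrite (max_idPl _) ?oppr_ge0 ?(ltW bn)//]; ring.
  rewrite powRD ?(gt_eqF v0) ?implybT// mulrA powRD ?(gt_eqF v0) ?implybT// [leRHS]mulrA.
  rewrite ler_wpM2r ?powR_ge0//; apply: ler_pM; rewrite ?powR_ge0//.
  rewrite !powRN lef_pV2 ?posrE ?powR_gt0//.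
  by apply: ge0_ler_powR; rewrite ?nnegrE ?(ltW v0) ?(ltW v1) ?(ltW q1)//; clear -v0 q1; lra.
have -> : farmaj T y = T * (if v <= 1 then v `^ (2 * b) else v `^ (- c - 1)).
  rewrite /farmaj -/v; case: ifP => _; first by rewrite T2 -mulrA [_ * y `^ _]mulrC y2v.
  rewrite /v powRM ?(ltW T0) ?(ltW y0)// mulrA; congr (_ * _).
  rewrite -{2}(powRr1 (ltW T0)) -powRD ?(gt_eqF T0) ?implybT//.
  by congr (_ `^ _); ring.
rewrite /Qk !powR_invT// -/u -/v.
apply: (@le_trans _ _ (2 `^ (1 + de) * T * ((1 + v) `^ (-1 - de) * ((1 + u) `^ (- b) * (1 + v) `^ (- b)) * v `^ (2 * b)))).
  rewrite -y2v [leRHS](_ : _ = T * (2 `^ (1 + de) * (1 + v) `^ (-1 - de)) * (T `^ b * (1 + u) `^ (- b) * (T `^ b * (1 + v) `^ (- b))) * y `^ (2 * b)); last by ring.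
  by rewrite ler_wpM2r ?powR_ge0// ler_wpM2r ?mulr_ge0 ?powR_ge0// ler_pM2l.
rewrite [leRHS](_ : _ = 2 `^ (1 + de) * T * (2 `^ `|b| * (if v <= 1 then v `^ (2 * b) else v `^ (- c - 1)))); last by ring.
by rewrite ler_wpM2l// mulr_ge0 ?powR_ge0// ltW.
Qed.

Local Open Scope ereal_scope.

Lemma measurable_farmaj T : measurable_fun setT (farmaj T).
Proof.
apply: measurable_fun_ifT.
- by apply: measurable_fun_ler => //; exact: measurable_funM.
- by apply: measurable_funM => //; exact: measurable_powR.
- by apply: measurable_funM => //; exact: measurable_powR.
Qed.

Lemma integral_farmaj T : (0 < T)%R ->
  \int[mu]_(y in `]0%R, 1%R[) (farmaj T y)%:E <= (2 `^ (2 * b + 1) / (2 * b + 1) + 2 `^ c / c)%:E.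
Proof.
move=> T0; have c0 := decay_gt0; have hb := b1; have q0 : (0 < 2 * b + 1)%R by lra.
have Ti : (0 < T^-1)%R by rewrite invr_gt0.
pose F1 (y : R) := (T `^ (1 + 2 * b))%:E * (y `^ (2 * b + 1 - 1))%:E.
pose F2 (y : R) := (T `^ (- c))%:E * (y `^ (- c - 1))%:E.
have F10 y : 0 <= F1 y by rewrite /F1 -EFinM lee_fin mulr_ge0 ?powR_ge0.
have F20 y : 0 <= F2 y by rewrite /F2 -EFinM lee_fin mulr_ge0 ?powR_ge0.
have mp r : measurable_fun setT (fun y : R => (y `^ r)%:E).
  by apply/measurable_EFinP; exact: measurable_powR.
have mF1 : measurable_fun setT F1 by apply: emeasurable_funM => //; exact: mp.
have mF2 : measurable_fun setT F2 by apply: emeasurable_funM => //; exact: mp.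
apply: (@le_trans _ _ (\int[mu]_y ((F1 \_ `]0%R, (2 / T)%R[) y + (F2 \_ `](T^-1 / 2)%R, 1%R[) y))).
  rewrite [leLHS]integral_mkcond; apply: integral_mono => y _.
    by rewrite patchE; case: ifP => // _; rewrite lee_fin farmaj_ge0.
  have P1 : 0 <= (F1 \_ `]0%R, (2 / T)%R[) y by rewrite patchE; case: ifP.
  have P2 : 0 <= (F2 \_ `](T^-1 / 2)%R, 1%R[) y by rewrite patchE; case: ifP.
  rewrite patchE; case: ifPn => [|_]; last exact: adde_ge0.
  rewrite inE/= in_itv/= => /andP[y0 y1]; rewrite /farmaj; case: ifPn => [Ty|].
    apply: (@le_trans _ _ ((F1 \_ `]0%R, (2 / T)%R[) y)); last by rewrite leeDl.
    rewrite patchE mem_set; last first.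
      by rewrite /= in_itv/= y0/= ltr_pdivlMr// mulrC; apply: le_lt_trans Ty _; rewrite ltr1n.
    by rewrite /F1 -EFinM lee_fin addrK.
  rewrite -ltNge => Ty.
  apply: (@le_trans _ _ ((F2 \_ `](T^-1 / 2)%R, 1%R[) y)); last by rewrite leeDr.
  rewrite patchE mem_set//= in_itv/= y1 andbT ltr_pdivrMr// -(ltr_pM2l T0) divff ?gt_eqF// mulrA.
  by apply: lt_le_trans Ty _; rewrite ler_peMr ?ler1n// mulr_ge0// ltW.
rewrite ge0_integralD//; last 4 first.
- by move=> y _; rewrite patchE; case: ifP.
- by apply/(measurable_restrictT _ _).1 => //; exact: measurable_funTS.
- by move=> y _; rewrite patchE; case: ifP.
- by apply/(measurable_restrictT _ _).1 => //; exact: measurable_funTS.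
rewrite -!integral_mkcond EFinD; apply: leeD.
  rewrite ge0_integralZl//; last 3 first.
  - by apply: measurable_funTS; exact: mp.
  - by move=> y _; rewrite lee_fin powR_ge0.
  - by rewrite lee_fin powR_ge0.
  rewrite integral_powR_oo//; last by rewrite divr_ge0// ltW.
  rewrite -EFinM lee_fin powRM ?invr_ge0 ?(ltW T0)//.
  rewrite -(powR_inv1 (ltW T0)) -powRrM mulN1r.
  rewrite (_ : forall u v w z : R, u * (v * w / z) = u * w * (v / z))%R; last by move=> *; ring.
  by rewrite -powRD ?(gt_eqF T0) ?implybT// (_ : 1 + 2 * b + - (2 * b + 1) = 0)%R ?powRr0 ?mul1r//; ring.
rewrite ge0_integralZl//; last 3 first.
- by apply: measurable_funTS; exact: mp.
- by move=> y _; rewrite lee_fin powR_ge0.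
- by rewrite lee_fin powR_ge0.
apply: (@le_trans _ _ ((T `^ (- c))%:E * ((T^-1 / 2) `^ (- c) / c)%:E)).
  by apply: lee_wpmul2l; [rewrite lee_fin powR_ge0|apply: integral_powRN_oo => //; rewrite divr_gt0].
rewrite -EFinM lee_fin powRM ?invr_ge0 ?(ltW T0)//.
have -> : ((2^-1 : R) `^ (- c) = 2 `^ c)%R.
  by rewrite -(powR_inv1 (ler0n _ 2)) -powRrM mulN1r opprK.
rewrite -(powR_inv1 (ltW T0)) -powRrM mulrNN mul1r mulrA mulrA.
by rewrite -powRD ?(gt_eqF T0) ?implybT// addNr powRr0 mul1r.
Qed.

Lemma HL_maximal_cst1 x : HL_maximal (fun _ : R => 1%R) x <= 1.
Proof.
apply: ge_ereal_sup => _ [r + <-]; rewrite /= in_itv/= andbT => r0.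
have b0 : mu (ball x r) = (r *+ 2)%:E by rewrite lebesgue_measure_ball// ltW.
have r2 : (0 < r *+ 2)%R by rewrite mulrn_wgt0.
rewrite /iavg b0 inver (gt_eqF r2).
rewrite (eq_integral (cst 1)); last by move=> y _; rewrite /= ?abse1 ?normr1.
have mb : measurable (ball x r) by exact: measurable_ball.
have -> : \int[mu]_(y in ball x r) cst 1 y = (r *+ 2)%:E.
  by apply: (etrans (integral_cst mu mb 1)); rewrite mul1e.
by rewrite -EFinM mulVf ?gt_eqF.
Qed.

(** For y >= 2 x the majorant [farmaj] is used; for y < 2 x the local part is controlled by the
    maximal function of the constant 1, and the rest by [lowk] with exponents 2 b and 0, both
    integrable at 0. *)
Lemma Qk_integral : exists2 C, (0 < C)%R & forall T x, (0 < T)%R -> (0 < x < 1)%R ->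
  \int[mu]_(y in `]0%R, 1%R[) (Qk b de T x y * y `^ (2 * b))%:E <= C%:E.
Proof.
have hb := b1; have hd := de0; have hbd := bde; have c0 := decay_gt0.
have q0 : (0 < 2 * b + 1)%R by lra.
have ddb : Num.min de b = b by apply/min_idPr; exact: ltW.
have [C1 C10 h1] := Qk_regions b1 de0.
have [C2 C20 h2] := @dyadic_maximal R de de0.
pose C3 := (2 `^ (1 + de) * 2 `^ `|b|)%R; have C30 : (0 < C3)%R by rewrite mulr_gt0 ?powR_gt0.
pose C4 := (2 `^ (2 * b + 1) / (2 * b + 1) + 2 `^ c / c)%R.
have C40 : (0 < C4)%R by rewrite addr_gt0// divr_gt0 ?powR_gt0.
pose C5 := (3 `^ (2 * b + 1 - 0) / (2 * b + 1 - 0) + 2 * (3 `^ (0 + 1 - 0) / (0 + 1 - 0)))%R.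
have C50 : (0 < C5)%R.
  by rewrite /C5 !subr0 add0r; apply: addr_gt0; [|apply: mulr_gt0 => //]; apply: divr_gt0; rewrite ?powR_gt0.
exists (C1 * (C2 + C5) + C3 * C4)%R; first by rewrite addr_gt0// mulr_gt0// addr_gt0.
move=> T x T0 x01; have /andP[x0 x1] := x01.
pose L y : R := (T * (1 + T * `|x - y|) `^ (-1 - de) * 1)%R.
pose K y : R := (lowk (2 * b) x y * y `^ (- 0) + 2 * (lowk 0 x y * y `^ (- 0)))%R.
have L0 y : (0 <= L y)%R by rewrite /L mulr1 mulr_ge0 ?powR_ge0// ltW.
have lk t y : (0 <= lowk t x y * y `^ (- 0))%R by rewrite mulr_ge0 ?lowk_ge0 ?powR_ge0.
have K0' y : (0 <= K y)%R by rewrite addr_ge0// mulr_ge0.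
have mlk t : measurable_fun (`]0%R, 1%R[ : set R) (fun y => lowk t x y * y `^ (- 0))%R.
  apply: measurable_funTS; apply: measurable_funM; last exact: measurable_powR.
  exact: (measurableT_comp (measurable_lowk t) (measurable_pair1 x)).
have mL : measurable_fun (`]0%R, 1%R[ : set R) L.
  apply: measurable_funTS; apply: measurable_funM => //; apply: measurable_funM => //.
  apply: measurable_fun_powRc; apply: measurable_funD => //; apply: measurable_funM => //.
  by apply: measurableT_comp => //; exact: measurable_funB.
have mK : measurable_fun (`]0%R, 1%R[ : set R) K.
  by apply: measurable_funD; [exact: mlk|apply: measurable_funM => //; exact: mlk].
have mF : measurable_fun (`]0%R, 1%R[ : set R) (farmaj T) by apply: measurable_funTS; exact: measurable_farmaj.
have fm0 := farmaj_ge0 T.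
apply: (@le_trans _ _ (\int[mu]_(y in `]0%R, 1%R[) (C1%:E * ((L y)%:E + (K y)%:E) + C3%:E * (farmaj T y)%:E))).
  apply: integral_mono => y; rewrite /= in_itv/= => /andP[y0 y1].
    by rewrite lee_fin !mulr_ge0 ?powR_ge0// ltW.
  rewrite [leRHS](_ : _ = (C1 * (L y + K y) + C3 * farmaj T y)%:E)// lee_fin.
  have [xy|yx] := leP (2 * x)%R y.
    apply: (le_trans (Qk_farmaj T0 x0 xy)); rewrite lerDr mulr_ge0 ?(ltW C10)//.
    by rewrite addr_ge0.
  apply: (@le_trans _ _ (C1 * (L y + K y))%R); last by rewrite lerDl mulr_ge0// ltW.
  apply: (le_trans (h1 T x y T0 x0 y0)); rewrite ler_pM2l//; apply: lerD.
    rewrite /L mulr1 ler_piMr//; first by rewrite mulr_ge0 ?powR_ge0// ltW.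
    by rewrite /loc; case: ifP.
  rewrite /K0 ddb /K oppr0 !powRr0 !mulr1 /lowk (ltW yx); apply: lerD.
    by rewrite le_eqVlt; apply/orP; left; apply/eqP; congr (_ `^ _ * _ `^ _)%R; ring.
  rewrite subrr !powRr0 mulr1 mul1r subr0 (powR_inv1 (ltW x0)) (_ : -1 - b + b = -1)%R; last by ring.
  case: ifPn => xy; last by rewrite mulr_ge0// invr_ge0 ltW.
  by rewrite powR_inv1 ?(ltW y0)// -[leLHS]mul1r ler_pdivrMr// mulrAC ler_pdivlMr// mul1r.
rewrite ge0_integralD//; last 4 first.
- by move=> y _; rewrite mule_ge0 ?adde_ge0 ?lee_fin// ltW.
- apply: emeasurable_funM => //; apply: emeasurable_funD; by apply/measurable_EFinP.
- by move=> y _; rewrite mule_ge0 ?lee_fin// ltW.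
- by apply: emeasurable_funM => //; apply/measurable_EFinP.
rewrite ge0_integralZl//; last 3 first.
- by apply: emeasurable_funD; apply/measurable_EFinP.
- by move=> y _; rewrite adde_ge0 ?lee_fin.
- by rewrite lee_fin ltW.
rewrite ge0_integralZl//; last 3 first.
- by apply/measurable_EFinP.
- by move=> y _; rewrite lee_fin.
- by rewrite lee_fin ltW.
rewrite EFinD !EFinM; apply: leeD; last first.
  by apply: lee_wpmul2l; [rewrite lee_fin ltW|exact: integral_farmaj].
apply: lee_wpmul2l; first by rewrite lee_fin ltW.
rewrite ge0_integralD//; last 4 first.
- by move=> y _; rewrite lee_fin.
- by apply/measurable_EFinP.
- by move=> y _; rewrite lee_fin.
- by apply/measurable_EFinP.
rewrite EFinD; apply: leeD.
  apply: le_trans (h2 (fun _ : R => 1%R) x T _ _ x01 T0) _ => //.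
  by rewrite -[leRHS]mule1; apply: lee_wpmul2l; [rewrite lee_fin ltW|exact: HL_maximal_cst1].
have -> : (fun y => (K y)%:E) =
    (fun y => (lowk (2 * b) x y * y `^ (- 0))%R%:E + 2%:E * (lowk 0 x y * y `^ (- 0))%R%:E) by [].
rewrite ge0_integralD//; last 4 first.
- by move=> y _; rewrite lee_fin.
- by apply/measurable_EFinP; exact: mlk.
- by move=> y _; rewrite mule_ge0// lee_fin.
- by apply: emeasurable_funM => //; apply/measurable_EFinP; exact: mlk.
rewrite ge0_integralZl//; last 2 first.
- by apply/measurable_EFinP; exact: mlk.
- by move=> y _; rewrite lee_fin.
have hh t : (0 < t + 1 - 0)%R -> \int[mu]_(y in `]0%R, 1%R[) (lowk t x y * y `^ (- 0))%:E <=
    (3 `^ (t + 1 - 0) / (t + 1 - 0))%:E.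
  by move=> t0; apply: (le_trans (lowk_intr t0 x0)); rewrite oppr0 powRr0 mulr1.
have -> : C5%:E = (3 `^ (2 * b + 1 - 0) / (2 * b + 1 - 0))%:E + 2%:E * (3 `^ (0 + 1 - 0) / (0 + 1 - 0))%:E by [].
apply: leeD; first by apply: hh; rewrite subr0.
by apply: lee_wpmul2l; [rewrite lee_fin|apply: hh; rewrite subr0 add0r].
Qed.

End KernelL1.

Section LinftyBound.
Variables (R : realType) (nu de : R) (s : nat -> R).
Hypotheses (nu1 : -1 < nu) (hs : bessel_zeros nu s) (de0 : 0 < de).
Notation b := (nu + 1 / 2).
Notation mu := (@lebesgue_measure R).
Implicit Types (f : R -> R) (A : set R) (x y T : R).

Lemma mu_nu_null A : measurable (A `&` `]0, 1[) -> mu_nu nu A = 0%E -> mu (A `&` `]0, 1[) = 0%E.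
Proof.
move=> mA h; have mw : measurable_fun (A `&` `]0, 1[) (fun y : R => (y `^ (2 * nu + 1))%:E).
  by apply/measurable_EFinP; apply: measurable_funTS; exact: measurable_powR.
have [+ _] := ae_eq_integral_abs mu mA mw.
move=> /(_ _)[|N [mN N0 sN]].
  rewrite -[RHS]h /mu_nu; apply: eq_integral => y _; by rewrite gee0_abs// lee_fin powR_ge0.
apply: (subset_measure0 (mu := mu) mA mN _ N0) => // y [Ay y01]; apply: sN => /= /(_ (conj Ay y01)).
move: y01; rewrite /= in_itv/= => /andP[y0 _] [] /eqP.
by rewrite gt_eqF// powR_gt0.
Qed.

Lemma measurable_superlevel f (M : \bar R) : measurable_fun (`]0, 1[ : set R) f ->
  measurable ([set x | (M < `|(EFin \o f) x|)%E] `&` `]0, 1[).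
Proof.
move=> mf; rewrite setIC; apply: emeasurable_fun_o_infty; first exact: measurable_itv.
by apply: measurableT_comp => //; exact/measurable_EFinP.
Qed.

Lemma Bmax_le_bound : b < de -> exists2 C, 0 < C & forall f M x,
  measurable_fun (`]0, 1[ : set R) f -> 0 <= M ->
  mu ([set x | (M%:E < `|(EFin \o f) x|)%E] `&` `]0, 1[) = 0%E -> 0 < x < 1 ->
  (Bmax nu de s f x <= (C * M)%:E)%E.
Proof.
move=> bde; have b1 : - (1 / 2) < b by move: nu1 => h; lra.
have [C1 C10 h1] := BR_le nu1 hs de0.
have [C2 C20 h2] := Qk_integral b1 de0 bde.
exists (C1 * C2); first exact: mulr_gt0.
move=> f M x mf M0 null x01.
have mI : measurable (`]0, 1[ : set R) by exact: measurable_itv.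
have ae : {ae mu, forall y, (`]0, 1[%classic : set R) y -> `|f y| <= M}.
  exists ([set x | (M%:E < `|(EFin \o f) x|)%E] `&` `]0, 1[); split => //.
    exact: measurable_superlevel.
  move=> y /= /not_implyP[y01 /negP]; rewrite -ltNge => h; split => //=.
have mw : measurable_fun (`]0, 1[ : set R) (fun y => y `^ (2 * nu + 1)).
  by apply: measurable_funTS; exact: measurable_powR.
have mnf : measurable_fun (`]0, 1[ : set R) (fun y => `|f y|) by exact: measurableT_comp.
have q0 : 0 < 2 * nu + 2 by move: nu1 => h; lra.
have i1 : mu.-integrable `]0%R, 1%R[ (EFin \o (fun y => M * y `^ (2 * nu + 1))).
  apply: integrableRZ; first exact: mI.
  have := integrable_powR01 q0; apply: eq_integrable => // z _ /=.
  by congr (_ `^ _)%:E; ring.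
have fi : mu.-integrable `]0%R, 1%R[ (EFin \o (fun y => f y * y `^ (2 * nu + 1))).
  apply/integrableP; split; first by apply/measurable_EFinP; exact: measurable_funM.
  apply: (@le_lt_trans _ _ (\int[mu]_(y in `]0%R, 1%R[) (M * y `^ (2 * nu + 1))%:E)%E).
    apply: ae_ge0_le_integral => //.
    - apply/measurable_EFinP; apply: measurableT_comp => //; exact: measurable_funM.
    - by move=> y _; rewrite lee_fin mulr_ge0 ?powR_ge0.
    - by apply/measurable_EFinP; exact: measurable_funM.
    have [N [mN N0 sN]] := ae; exists N; split => // y ny; apply: sN => h; apply: ny => y01; rewrite /= lee_fin normrM (ger0_norm (powR_ge0 _ _)).
    by rewrite ler_wpM2r ?powR_ge0// h.
  have /integrableP[_] := i1; apply: le_lt_trans; apply: integral_mono => y _ /=.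
    by rewrite lee_fin mulr_ge0 ?powR_ge0.
  by rewrite lee_fin ler_norm.
apply: ge_ereal_sup => _ [T + <-]; rewrite /= in_itv/= andbT => T0.
apply: (le_trans (h1 f T x fi T0 x01)).
have Q0 y : 0 <= Qk b de T x y * y `^ (2 * b) by rewrite !mulr_ge0 ?powR_ge0// ltW.
have mQ : measurable_fun (`]0, 1[ : set R) (fun y => Qk b de T x y * y `^ (2 * b)).
  apply: measurable_funTS; apply: measurable_funM; last exact: measurable_powR.
  apply: measurable_funM; first apply: measurable_funM => //.
    apply: measurable_fun_powRc; apply: measurable_funD => //; apply: measurable_funM => //.
    by apply: measurableT_comp => //; exact: measurable_funB.
  by apply: measurable_funM => //; apply: measurable_fun_powRc; exact: measurable_funD.
apply: (@le_trans _ _ (\int[mu]_(y in `]0%R, 1%R[) ((C1 * M)%:E * (Qk b de T x y * y `^ (2 * b))%:E))%E).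
  apply: ae_ge0_le_integral => //.
  - move=> y _; rewrite lee_fin; apply: mulr_ge0; [exact: ltW|exact: mulr_ge0].
  - by apply/measurable_EFinP; apply: measurable_funM => //; exact: measurable_funM.
  - move=> y _; rewrite -EFinM lee_fin; apply: mulr_ge0 => //; apply: mulr_ge0 => //; exact: ltW.
  - by apply: emeasurable_funM => //; exact/measurable_EFinP.
  have [N [mN N0 sN]] := ae; exists N; split => // y ny; apply: sN => h; apply: ny => y01; rewrite -EFinM lee_fin -[leRHS]mulrA ler_pM2l// [leRHS]mulrC.
  by apply: ler_wpM2l => //; exact: h.
rewrite ge0_integralZl//; last 3 first.
- exact/measurable_EFinP.
- by move=> y _; rewrite lee_fin.
- by rewrite lee_fin mulr_ge0// ltW.
have -> : (C1 * C2 * M)%:E = ((C1 * M)%:E * C2%:E)%E by rewrite -EFinM mulrAC.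
apply: lee_wpmul2l; last exact: h2.
by rewrite lee_fin mulr_ge0// ltW.
Qed.

(** For every level M admissible for f, the set where the maximal function exceeds C M is empty
    inside ]0, 1[, not merely null, because [Bmax_le_bound] is pointwise. *)
Lemma Linfty_bound : b < de -> exists C : R, forall f,
      measurable_fun (`]0%R, 1%R[ : set R) f -> (Lpnorm nu +oo (EFin \o f) < +oo)%E ->
      (Lpnorm nu +oo (Bmax nu de s f) <= C%:E * Lpnorm nu +oo (EFin \o f))%E.
Proof.
move=> bde; have [C C0 hC] := Bmax_le_bound bde; exists C => f mf _.
rewrite -lee_pdivrMl//; apply: le_ereal_inf_tmp => M /= hM.
have mS := measurable_superlevel M mf.
have null := mu_nu_null mS hM.
have M0 : (0 <= M)%E.
  rewrite leNgt; apply/negP => M0; move: null.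
  rewrite (_ : _ `&` _ = `]0, 1[%classic); last first.
    apply/seteqP; split => [y []//|y y01]; split => //=.
    by apply: lt_le_trans M0 _; rewrite lee_fin.
  by rewrite lebesgue_measure_itv/= lte01 sube0 => /eqP; rewrite onee_eq0.
case: M hM mS null M0 => [M||] hM mS null M0 //; last by rewrite leey.
rewrite lee_pdivrMl//; apply: ereal_inf_lbound => /=.
rewrite -EFinM /mu_nu (_ : _ `&` _ = set0) ?integral_set0//.
apply/seteqP; split => // x [] /= + x01; rewrite in_itv/= in x01.
rewrite gee0_abs; first by rewrite ltNge hC.
apply: (@le_trans _ _ (`|BR nu de s f 1 x|)%:E); first by rewrite lee_fin.
by apply: ereal_sup_ubound; exists 1 => //=; rewrite in_itv/= andbT.
Qed.

Lemma sufficiency (p : \bar R) : (1 < p)%E ->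
  (nu <= - (1 / 2) \/ nu + 1 / 2 < de) \/
    (de <= nu + 1 / 2 /\ - (1 / 2) < nu /\ ((p0 nu de)%:E < p)%E /\ (p < p1 nu de)%E) ->
  exists C : R, forall f : R -> R,
      measurable_fun (`]0%R, 1%R[ : set R) f -> (Lpnorm nu p (EFin \o f) < +oo)%E ->
      (Lpnorm nu p (Bmax nu de s f) <= C%:E * Lpnorm nu p (EFin \o f))%E.
Proof.
have hnu := nu1; have hd := de0.
move=> p1 [h|[dn [n2 [hp0 hp1]]]].
  (* The alternative nu <= -1/2 reads b <= 0 < de. *)
  have bde : b < de by case: h => h; lra.
  have ddE : Num.min de b = b by apply/min_idPr; exact: ltW.
  case: p p1 => [p||] // p1; last exact: Linfty_bound.
  rewrite lte_fin in p1; apply: Lpnorm_bound => //; rewrite ddE.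
    have q : 0 < 2 * nu + 2 by lra.
    have : 0 < (p - 1) * (2 * nu + 2) by rewrite mulr_gt0// subr_gt0.
    lra.
  by rewrite subrr mulr0; lra.
have ddE : Num.min de b = de by apply/min_idPl.
case: p p1 hp0 hp1 => [p||] // p1 hp0 hp1; last first.
  (* The value +oo cannot lie strictly below [p1], even when de = b makes [p1] infinite. *)
  by move: hp1; rewrite /Defs.p1; case: ifP.
rewrite lte_fin in p1; rewrite lte_fin in hp0; apply: Lpnorm_bound => //; rewrite ddE.
  by move: hp0; rewrite /Defs.p0 ltr_pdivrMr; lra.
move: hp1; rewrite /Defs.p1; case: ifPn => [/eqP e _|e].
  by rewrite (_ : b - de = 0) ?mulr0; lra.
have e0 : 0 < 2 * nu + 1 - 2 * de by rewrite lt_neqAle eq_sym e/=; lra.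
by rewrite lte_fin ltr_pdivlMr//; lra.
Qed.

End LinftyBound.

(** * Asymptotics of the zeros and Sonine's integral *)

Section ZeroAsymptotics.
Variables (R : realType) (nu : R) (s : nat -> R).
Hypothesis nu1 : -1 < nu.
Hypothesis hs : bessel_zeros nu s.
Notation b := (nu + 1 / 2).
Implicit Types (x t u : R).

(* Near a zero [t] the amplitude solves a small perturbation of w'' = - w, so it stays close to
   the sinusoid with the same initial data. *)
Lemma amp_sin_close : exists2 K : R, 0 < K & forall j u, s j <= u <= s j + 4 ->
  `|amp nu u / damp nu (s j) - sin (u - s j)| <= K / s j.
Proof.
have [t0 [m [M [t00 m0 M0 p0 eM]]]] := energy_bounds nu1.
pose k : R := `|b ^+ 2 - b|.
have k0 : 0 <= k by exact: normr_ge0.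
have rM : Num.sqrt M ^+ 2 = M by rewrite sqr_sqrtr// ltW.
set r := Num.sqrt M in rM.
have r0 : 0 < r by rewrite sqrtr_gt0.
pose K2 : R := 16 * (k + 1) * M / m.
have K20 : 0 < K2 by rewrite divr_gt0// !mulr_gt0// ltr_wpDl.
exists (Num.sqrt K2); first by rewrite sqrtr_gt0.
move=> j u /andP[ju uj]; have sj := s_gt0 hs j.
have st0 : t0 <= s j.
  by rewrite leNgt; apply/negP => /ltW h; have := p0 (s j); rewrite (ltW sj) h (phi_s nu1 hs) => /(_ isT); lra.
pose A := damp nu (s j).
have A2 : m <= A ^+ 2.
  by have /andP[+ _] := eM _ st0; rewrite /energy /amp (phi_s nu1 hs) mulr0 expr0n addr0.
have sqle x : x ^+ 2 <= M -> `|x| <= r.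
  by move=> h; apply: sqr_le_le => //; rewrite real_normK ?num_real// rM.
have ampM v : s j <= v -> `|amp nu v| <= r /\ `|damp nu v| <= r.
  move=> jv; have /andP[_ h] := eM v (le_trans st0 jv); rewrite /energy in h.
  have h1 := sqr_ge0 (amp nu v); have h2 := sqr_ge0 (damp nu v).
  by split; apply: sqle; lra.
have Ar : `|A| <= r by have [] := ampM _ (lexx (s j)).
pose D v := amp nu v - A * sin (v - s j).
pose D' v := damp nu v - A * cos (v - s j).
have dsin v : is_derive v (1 : R) (fun v => sin (v - s j)) (cos (v - s j)).
  by apply: dE (dcomp (dB (did v) (dcst (s j) v)) (is_derive_sin _)) _; rewrite subr0 mulr1.
have dcos v : is_derive v (1 : R) (fun v => cos (v - s j)) (- sin (v - s j)).
  by apply: dE (dcomp (dB (did v) (dcst (s j) v)) (is_derive_cos _)) _; rewrite subr0 mulr1.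
have dDf v : s j <= v -> is_derive v (1 : R) D (D' v).
  by move=> jv; apply: dB (is_derive_amp nu1 (lt_le_trans sj jv)) (dZ A (dsin v)).
have dD' v : s j <= v -> is_derive v (1 : R) D' (- D v + (b ^+ 2 - b) / v ^+ 2 * amp nu v).
  move=> jv; apply: dE (dB (is_derive_damp nu1 (lt_le_trans sj jv)) (dZ A (dcos v))) _.
  by rewrite /D; ring.
(* The energy D^2 + D'^2 of the difference grows at rate at most c, hence stays below 4 c on the
   window of length 4. This window is chosen longer than pi. *)
pose c : R := 4 * k * M / s j ^+ 2.
have dG v : s j <= v <= u -> is_derive v (1 : R) (fun v => c * v - (D v ^+ 2 + D' v ^+ 2))
   (c * 1 - (2%:R * D v ^+ 1 * D' v + 2%:R * D' v ^+ 1 * (- D v + (b ^+ 2 - b) / v ^+ 2 * amp nu v))).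
  by move=> /andP[jv _]; apply: dB (dZ c (did v)) (dD (dX 2 (dDf v jv)) (dX 2 (dD' v jv))).
have key : c * s j - (D (s j) ^+ 2 + D' (s j) ^+ 2) <= c * u - (D u ^+ 2 + D' u ^+ 2).
  apply: (derive_ge0_le ju dG) => v /andP[jv vu].
  have [hw hw'] := ampM v jv.
  rewrite subr_ge0 mulr1 !expr1.
  have -> : 2%:R * D v * D' v + 2%:R * D' v * (- D v + (b ^+ 2 - b) / v ^+ 2 * amp nu v) =
     2 * ((b ^+ 2 - b) / v ^+ 2 * (D' v * amp nu v)) by ring.
  have v0 : 0 < v by exact: lt_le_trans jv.
  have D'r : `|D' v| <= 2 * r.
    apply: (le_trans (ler_normB _ _)); rewrite mulr2n mulrDl !mul1r lerD// normrM.
    rewrite -[leRHS]mulr1; apply: ler_pM => //.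
    by rewrite ler_norml cos_geN1 cos_le1.
  move: (amp nu v) hw => a ha; apply: (le_trans (ler_norm _)); rewrite !normrM (ger0_norm (ler0n _ 2)) -/k.
  have vi : `|(v ^+ 2)^-1| <= (s j ^+ 2)^-1.
    rewrite ger0_norm ?invr_ge0 ?sqr_ge0// lef_pV2 ?posrE ?exprn_gt0//.
    by rewrite ler_pXn2r ?nnegrE ?(ltW sj) ?(ltW v0).
  apply: (@le_trans _ _ (2 * (k * (s j ^+ 2)^-1 * (2 * r * r)))).
    rewrite ler_pM2l//; apply: ler_pM; rewrite ?mulr_ge0//.
      by rewrite ler_wpM2l.
    exact: ler_pM.
  by rewrite le_eqVlt; apply/orP; left; apply/eqP; rewrite /c -rM; ring.
have Dj : D (s j) = 0 by rewrite /D /amp (phi_s nu1 hs) mulr0 subrr sin0 mulr0 subr0.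
have D'j : D' (s j) = 0 by rewrite /D' subrr cos0 mulr1 subrr.
rewrite Dj D'j expr0n/= addr0 subr0 in key.
have c0 : 0 <= c by rewrite divr_ge0 ?sqr_ge0// !mulr_ge0// ltW.
have Du : D u ^+ 2 <= 4 * c.
  have := sqr_ge0 (D' u); have : c * (u - s j) <= c * 4 by apply: ler_wpM2l => //; lra.
  by move: key; lra.
have A0 : A != 0 by rewrite -sqrf_eq0 gt_eqF//; exact: lt_le_trans A2.
have -> : amp nu u / A - sin (u - s j) = D u / A by rewrite /D; field.
apply: sqr_le_le; first by rewrite divr_gt0// sqrtr_gt0.
rewrite real_normK ?num_real// !expr_div_n (sqr_sqrtr (ltW K20)).
have A20 : 0 < A ^+ 2 by exact: lt_le_trans A2.
rewrite ler_pdivrMr//; apply: (le_trans Du).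
rewrite mulrAC ler_pdivlMr ?exprn_gt0//.
have -> : 4 * c * s j ^+ 2 = 16 * k * M by rewrite /c; field; rewrite gt_eqF.
have -> : K2 * A ^+ 2 = (16 * (k + 1) * M) * (A ^+ 2 / m) by rewrite /K2; field; rewrite gt_eqF.
apply: (@le_trans _ _ (16 * (k + 1) * M * 1)).
  by rewrite mulr1 ler_pM2r// ler_pM2l// lerDl.
rewrite ler_wpM2l ?ler_pdivlMr ?mul1r// !mulr_ge0 ?(ltW M0)//; lra.
Qed.

Lemma sin_ge_mid e : 0 < e -> e <= 1 -> exists2 c : R, 0 < c & forall x, e <= x <= pi - e -> c <= sin x.
Proof.
move=> e0 e1; have hpi := pi_ge2 R.
have epi : e <= pi - e by lra.
have cs : {within `[e, pi - e], continuous (@sin R)}.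
  by apply: continuous_subspaceT; exact: continuous_sin.
have [c cin hc] := EVT_min epi cs; exists (sin c).
  by apply: sin_gt0_pi; move: cin; rewrite !in_itv/= => /andP[? ?]; apply/andP; split; lra.
by move=> x xe; apply: hc; rewrite in_itv.
Qed.

(** By [amp_sin_close] the amplitude changes sign between s_j + pi - e and s_j + pi + e, which gives
    a zero there. None lies earlier: the sine is at least c between e and pi - e, and distances
    below e are excluded by the separation, as e <= h. *)
Lemma gap_cvg : (s j.+1 - s j) @[j --> \oo] --> pi.
Proof.
have [K K0 hK] := amp_sin_close.
have [h h0 [_ hsep]] := s_sep nu1 hs.
have hpi := pi_ge2 R; have hpi4 : pi < 4 :> R by have := pihalf_lt2 R; lra.
apply/cvgrPdist_le => e0 e00.
pose e := Num.min (Num.min e0 h) (Num.min 1 (4 - pi)).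
have e_e0 : e <= e0 by rewrite !ge_min lexx.
have e_h : e <= h by rewrite !ge_min lexx orbT.
have e1 : e <= 1 by rewrite !ge_min lexx !orbT.
have e4 : e <= 4 - pi by rewrite !ge_min lexx !orbT.
have e0' : 0 < e by rewrite !lt_min e00 h0 ltr01 subr_gt0.
have [c c0 hc] := sin_ge_mid e0' e1.
have [N hN] := s_cvg_pinfty nu1 hs (2 * K / c).
near=> j; have jN : (N <= j)%N by near: j; exact: nbhs_infty_ge.
have sj := s_gt0 hs j; have {}hN := hN _ jN.
have Kc : K / s j < c.
  rewrite ltr_pdivrMr// -ltr_pdivrMl// mulrC; apply: lt_le_trans hN.
  by rewrite -mulrA ltr_pMl ?divr_gt0// ltr1n.
pose A := damp nu (s j).
have z1 : s j + (pi - e) <= s j + 4 by lra.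
pose g u := amp nu u / A.
have close u : s j <= u <= s j + 4 -> `|g u - sin (u - s j)| <= K / s j by exact: hK.
have close' d : 0 <= d <= 4 -> `|g (s j + d) - sin d| <= K / s j.
  move=> /andP[d0 d4]; rewrite -{2}(_ : s j + d - s j = d); last by ring.
  by apply: close; apply/andP; split; lra.
have gp : 0 < g (s j + (pi - e)).
  have : c <= sin (pi - e) by apply: hc; apply/andP; split; clear -e1 hpi; lra.
  have : `|g (s j + (pi - e)) - sin (pi - e)| <= K / s j by apply: close'; apply/andP; split; lra.
  by rewrite ler_norml => /andP[+ _]; lra.
have gn : g (s j + (pi + e)) < 0.
  have : c <= sin e by apply: hc; apply/andP; split; clear -e1 hpi; lra.
  have : `|g (s j + (pi + e)) - sin (pi + e)| <= K / s j by apply: close'; apply/andP; split; lra.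
  by rewrite [X in sin X]addrC sinDpi ler_norml => /andP[_ +]; lra.
have cg : {within `[s j + (pi - e), s j + (pi + e)], continuous g}.
  apply: derivable_within_continuous => v; rewrite in_itv/= => /andP[v1 v2].
  have v0 : 0 < v by lra.
  by have [] := dM (is_derive_amp nu1 v0) (dcst A^-1 v).
have le1 : s j + (pi - e) <= s j + (pi + e) by lra.
have gm : Num.min (g (s j + (pi - e))) (g (s j + (pi + e))) <= 0 <=
    Num.max (g (s j + (pi - e))) (g (s j + (pi + e))).
  by rewrite ge_min le_max (ltW gp) (ltW gn) orbT.
have [v + gv] := IVT le1 cg gm; rewrite in_itv/= => /andP[v1 v2].
have v0 : 0 < v by lra.
have A0 : A != 0.
  by apply/negP => /eqP A0; move: gp; rewrite /g A0 invr0 mulr0 ltxx.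
have pv : phi nu v = 0.
  move/eqP: gv; rewrite /g mulf_eq0 invr_eq0 (negbTE A0) orbF /amp mulf_eq0 gt_eqF ?powR_gt0//=.
  by move/eqP.
have [k kv] := s_exhaust nu1 hs v0 pv.
have jk : (j < k)%N.
  by rewrite ltnNge; apply/negP => /(s_le hs); rewrite kv; clear -v1 e1 hpi; lra.
have s1 : s j.+1 <= s j + (pi + e) by apply: (le_trans (s_le hs jk)); rewrite kv.
have s2 : h <= s j.+1 - s j by have := hsep j j.+1 (leqnSn j); rewrite subSnn mulr1.
have s3 : pi - e <= s j.+1 - s j.
  rewrite leNgt; apply/negP => s3.
  have := close (s j.+1); rewrite /g /amp (phi_s nu1 hs) mulr0 mul0r sub0r normrN => /(_ _) h1.
  have h2 : c <= sin (s j.+1 - s j) by apply: hc; apply/andP; split; clear -s2 s3 e_h; lra.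
  have : `|sin (s j.+1 - s j)| <= K / s j by apply: h1; apply/andP; split; clear -s1 s2 h0 hpi4 e4; lra.
  by rewrite ler_norml => /andP[_]; clear -h2 Kc; lra.
rewrite ler_norml; clear -s1 s3 e_e0; apply/andP; split; lra.
Unshelve. all: by end_near.
Qed.

(** At a zero the energy is s_j^(2 nu + 1) phi'^2, so this ratio is 2 divided by the energy, which
    converges. *)
Lemma ncoef_cvg : exists2 A : R, 0 < A & (ncoef nu (s j) ^+ 2 / s j `^ (2 * nu + 1)) @[j --> \oo] --> A.
Proof.
have [E E0 hE] := energy_cvg nu1; exists (2 / E); first by rewrite divr_gt0.
have e j : ncoef nu (s j) ^+ 2 / s j `^ (2 * nu + 1) = 2 / energy nu (s j).
  have sj := s_gt0 hs j.
  rewrite /ncoef expr_div_n sqr_sqrtr// real_normK ?num_real//.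
  rewrite /energy /amp (phi_s nu1 hs) mulr0 expr0n addr0 /damp (phi_s nu1 hs) mulr0 addr0.
  have -> : s j `^ (2 * nu + 1) = (s j `^ b) ^+ 2.
    by rewrite expr2 -powRD ?(gt_eqF sj) ?implybT//; congr (_ `^ _); field.
  have d0 := Dphi_s_neq0 nu1 hs j.
  by field; rewrite d0 gt_eqF// powR_gt0.
rewrite (_ : (fun j => _) = (fun j => 2 / energy nu (s j))); last by apply/funext => j; rewrite e.
apply: cvgMr; apply: cvgV; first by rewrite gt_eqF.
have sinf : s j @[j --> \oo] --> +oo.
  apply/cvgryPge => a; have [N hN] := s_cvg_pinfty nu1 hs a; exists N => // k /= Nk; exact: hN.
exact: (cvg_comp s (energy nu) sinf hE).
Qed.

End ZeroAsymptotics.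

Section Heine.
Variable R : realType.

(** Only x has to lie in the segment: in the Riemann sums the right end of a cell may leave it. *)
Lemma heine_segment (F : R -> R) a c e : continuous F -> 0 < e ->
  exists2 d : R, 0 < d & forall x y, a <= x <= c -> `|x - y| <= d -> `|F x - F y| <= e.
Proof.
move=> cF e0; have /compact_near_coveringP nc := @segment_compact R a c.
have e2 : 0 < e / 2 by rewrite divr_gt0.
have := nc R (0 : R)^'+ (fun d y => forall z, `|y - z| <= d -> `|F y - F z| <= e) _ _.
move=> /(_ _)[|d0 /=].
  move=> x _; have /cvgrPdist_le/(_ _ e2) := cF x.
  case=> r /= r0 hr; have r2 : 0 < r / 2 by rewrite divr_gt0.
  exists (ball x (r / 2), [set d | d < r / 2]).
    by split; [exact: nbhsx_ballx|exact: nbhs_right_lt].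
  move=> [y d] /= [xy dr] z yz.
  have h1 : `|F x - F y| <= e / 2.
    by apply: hr => /=; apply: lt_trans xy _; lra.
  have h2 : `|F x - F z| <= e / 2.
    apply: hr => /=; apply: (le_lt_trans (ler_distD y _ _)); rewrite /ball/= in xy.
    lra.
  by rewrite (le_trans (ler_distD (F x) _ _))// distrC; lra.
move=> d00 hd; exists (d0 / 2); first by rewrite divr_gt0.
move=> x y xa xy; apply: (hd (d0 / 2)) => //=.
- by rewrite sub0r normrN ger0_norm ?divr_ge0 ?(ltW d00)//; lra.
- by rewrite divr_gt0.
Qed.

End Heine.

(** * Riemann sums over the zeros *)

Section RiemannSums.
Variables (R : realType) (nu : R) (s : nat -> R).
Hypothesis nu2 : - (1 / 2) < nu.
Hypothesis hs : bessel_zeros nu s.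
Notation q := (2 * nu + 2).
Implicit Types (x t T : R) (F Phi : R -> R).

Let nu1 : -1 < nu. Proof. by move: nu2 => h; lra. Qed.
Let q0 : 0 < q. Proof. by move: nu2 => h; lra. Qed.

(** The measure x^(2 nu + 1) dx of the interval between two consecutive zeros. *)
Definition cell j : R := (s j.+1 `^ q - s j `^ q) / q.

Lemma powR_mono x t : 0 <= x -> x <= t -> x `^ q <= t `^ q.
Proof. by move=> x0 xt; apply: ge0_ler_powR; rewrite ?nnegrE ?(ltW q0)// (le_trans x0). Qed.

Lemma cell_gt0 j : 0 < cell j.
Proof.
rewrite divr_gt0// subr_gt0; apply: gt0_ltr_powR => //; rewrite ?nnegrE ?(ltW (s_gt0 hs _))//.
exact: (s_lt hs (ltnSn j)).
Qed.

(** The mean value theorem writes the cell as the gap times x^(2 nu + 1) at an intermediate x. As 2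
    nu + 1 > 0 this power is squeezed between its values at both ends, whose ratio tends to 1. *)
Lemma cell_cvg : (cell j / s j `^ (2 * nu + 1)) @[j --> \oo] --> pi.
Proof.
have hq := q0; have hn := nu2; have h1 : 0 <= 2 * nu + 1 by lra.
have sinf : s j @[j --> \oo] --> +oo.
  apply/cvgryPge => a; have [N hN] := s_cvg_pinfty nu1 hs a; exists N => // k /= Nk; exact: hN.
have gc := gap_cvg nu1 hs.
have rc : ((1 + (s j.+1 - s j) / s j) `^ (2 * nu + 1)) @[j --> \oo] --> (1 : R).
  have c1 : (1 + (s j.+1 - s j) / s j) @[j --> \oo] --> 1 + pi * (0 : R).
    apply: cvgD; first exact: cvg_cst.
    apply: cvgM => //; apply/gtr0_cvgV0; last exact: sinf.
    by near=> j; exact: s_gt0 hs j.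
  have p1 : 0 < 1 + pi * (0 : R) by rewrite mulr0 addr0.
  have := cvg_comp _ _ c1 (@continuous_powR_pos R (2 * nu + 1) _ p1).
  by rewrite mulr0 addr0 powR1.
apply: (squeeze_cvgr (f := fun j => s j.+1 - s j)
  (h := fun j => (s j.+1 - s j) * (1 + (s j.+1 - s j) / s j) `^ (2 * nu + 1))).
- near=> j; have sj := s_gt0 hs j; have sjj := s_lt hs (leqnn j.+1).
  have d x : s j <= x <= s j.+1 -> is_derive x (1 : R) (fun x => q^-1 * x `^ q) (x `^ (2 * nu + 1)).
    move=> /andP[sx _]; apply: dE (dZ q^-1 (dpowR q (lt_le_trans sj sx))) _.
    by rewrite mulrA mulVf ?gt_eqF// mul1r; congr (_ `^ _); ring.
  have [x /andP[x1 x2] e] := MVT_le (ltW sjj) d.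
  have -> : cell j / s j `^ (2 * nu + 1) = (s j.+1 - s j) * (x `^ (2 * nu + 1) / s j `^ (2 * nu + 1)).
    have -> : cell j = x `^ (2 * nu + 1) * (s j.+1 - s j) by rewrite -e /cell; ring.
    by ring.
  have x0 : 0 < x by exact: lt_le_trans x1.
  have sp : 0 < s j `^ (2 * nu + 1) by rewrite powR_gt0.
  have g0 : 0 < s j.+1 - s j by rewrite subr_gt0.
  rewrite ler_pMr// ler_pdivlMr// mul1r ler_pM2l// ler_pdivrMr// -powRM ?(ltW sj)//; last first.
    by rewrite addr_ge0// divr_ge0 ?(ltW sj) ?(ltW g0).
  apply/andP; split; apply: ge0_ler_powR; rewrite ?nnegrE ?(ltW sj) ?(ltW x0)//.
    by rewrite mulr_ge0 ?(ltW sj)// addr_ge0// divr_ge0 ?(ltW sj) ?(ltW g0).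
  by rewrite mulrDl mul1r divfK ?gt_eqF// addrC subrK.
- exact: gc.
- by rewrite -[X in _ --> X]mulr1; apply: cvgM.
Unshelve. all: by end_near.
Qed.

Lemma ncoef_cell_cvg : exists2 K : R, 0 < K & (ncoef nu (s j) ^+ 2 / cell j) @[j --> \oo] --> K.
Proof.
have [A A0 hA] := ncoef_cvg nu1 hs; exists (A / pi); first by rewrite divr_gt0// pi_gt0.
rewrite (_ : (fun j => _) = (fun j => (ncoef nu (s j) ^+ 2 / s j `^ (2 * nu + 1)) / (cell j / s j `^ (2 * nu + 1)))).
  by apply: cvgM => //; apply: cvgV; [rewrite gt_eqF// pi_gt0|exact: cell_cvg].
apply/funext => j; have sj := s_gt0 hs j; have c0 := cell_gt0 j.
by field; rewrite !gt_eqF// powR_gt0.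
Qed.

Lemma cell_sum n T : 0 < T -> \sum_(j < n) cell j / T `^ q = ((s n / T) `^ q - (s 0 / T) `^ q) / q.
Proof.
move=> T0; have e j : cell j / T `^ q = ((s j.+1 / T) `^ q - (s j / T) `^ q) / q.
  rewrite /cell !powRM ?invr_ge0 ?(ltW (s_gt0 hs _)) ?(ltW T0)//.
  have -> : T^-1 `^ q = (T `^ q)^-1 by rewrite -(powR_inv1 (ltW T0)) -powRrM mulN1r powRN.
  by ring.
under eq_bigr do rewrite e.
rewrite -mulr_suml; congr (_ / _).
rewrite -(big_mkord xpredT (fun j => (s j.+1 / T) `^ q - (s j / T) `^ q)).
by rewrite telescope_sumr.
Qed.

Lemma small_pow (S c e : R) : 0 < S -> 0 <= c -> 0 < e ->
  exists T1, forall T, 0 < T -> T1 <= T -> c * (S / T) `^ q <= e.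
Proof.
move=> S0 c0 e0; have c1 : 0 < c + 1 by rewrite ltr_wpDl.
pose t := (e / (c + 1)) `^ q^-1; have t0 : 0 < t by rewrite powR_gt0 ?divr_gt0.
exists (S / t) => T T0 h; have st : S / T <= t by rewrite ler_pdivrMr// mulrC -ler_pdivrMr.
apply: (@le_trans _ _ (c * t `^ q)).
  by rewrite ler_wpM2l//; apply: powR_mono => //; rewrite divr_ge0 ?ltW.
rewrite /t -powRrM mulVf ?gt_eqF// powRr1 ?divr_ge0 ?(ltW e0) ?(ltW c1)//.
by rewrite mulrA ler_pdivrMr// mulrC ler_pM2l// lerDl.
Qed.

(** The squared normalising constants are asymptotically K times the cells, so the sum is a Riemann
    sum of F against x^(2 nu + 1) dx on ]0, 1[. The integral is represented by an antiderivative Phi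
    with |Phi x| = O(x^q), which fixes Phi(0+) = 0. *)
Lemma riemann_sum : exists2 K : R, 0 < K & forall F Phi B, continuous F -> (forall x, `|F x| <= B) ->
  (forall x, 1 <= x -> F x = 0) ->
  (forall x, 0 < x -> is_derive x 1 Phi (F x * x `^ (2 * nu + 1))) ->
  (forall x, 0 < x -> `|Phi x| <= B * x `^ q / q) ->
  forall e, 0 < e -> exists T0, forall T n, T0 <= T -> 0 < T -> T <= s n ->
    `|(\sum_(j < n) ncoef nu (s j) ^+ 2 * F (s j / T)) / T `^ q - K * Phi 1| <= e.
Proof.
have [K K0 hK] := ncoef_cell_cvg; exists K => // F Phi B cF FB F1 dPhi Phi0 e e0.
have hq := q0.
have B0 : 0 <= B by exact: le_trans (normr_ge0 _) (FB 0).
pose ka j := ncoef nu (s j) ^+ 2 / cell j.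
have [M [M0 hM]] : exists M, 0 < M /\ forall j, `|ka j - K| <= M.
  have c : cvgn (fun j => ka j - K).
    by apply/cvg_ex; exists (K - K); apply: cvgB => //; exact: cvg_cst.
  have /pinfty_ex_gt0[M M0 h] := cvg_seq_bounded c.
  by exists M; split => // j; exact: h.
have [G [G0 hG]] : exists G, 0 < G /\ forall j, s j.+1 - s j <= G.
  have c : cvgn (fun j => s j.+1 - s j) by apply/cvg_ex; exists pi; exact: gap_cvg nu1 hs.
  have /pinfty_ex_gt0[G G0 h] := cvg_seq_bounded c.
  by exists G; split => // j; apply: (le_trans (ler_norm _)); exact: h.
pose Q := 2 `^ q / q; have Q0 : 0 < Q by rewrite divr_gt0// powR_gt0.
pose e1 := e / 4; have e10 : 0 < e1 by rewrite divr_gt0.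
have [J hJ] : exists J, forall j, (J <= j)%N -> B * `|ka j - K| <= e1 / Q.
  have c0 : 0 < (B + 1) * Q by rewrite mulr_gt0// ltr_wpDl.
  have := hK => /cvgrPdist_le/(_ (e1 / ((B + 1) * Q))) []; first by rewrite divr_gt0.
  move=> J _ h; exists J => j Jj; have {}h := h j Jj.
  apply: (@le_trans _ _ ((B + 1) * (e1 / ((B + 1) * Q)))).
    by apply: ler_pM; rewrite ?lerDl// distrC.
  by rewrite le_eqVlt; apply/orP; left; apply/eqP; field; rewrite !gt_eqF// ltr_wpDl.
have [d d0 hd] := @heine_segment R F 0 2 (e1 / (K * Q)) cF (divr_gt0 e10 (mulr_gt0 K0 Q0)).
have [T1 hT1] := small_pow (s_gt0 hs J) (divr_ge0 (mulr_ge0 B0 (ltW M0)) (ltW q0)) e10.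
have [T2 hT2] := small_pow (s_gt0 hs 0) (divr_ge0 (mulr_ge0 (ltW K0) B0) (ltW q0)) e10.
exists (Num.max (Num.max T1 T2) (Num.max (s 0 + G) (G / d))) => T n.
rewrite !ge_max => /andP[/andP[TT1 TT2] /andP[TG TGd]] T0 Tn.
have hA := hT1 T T0 TT1; have hC := hT2 T T0 TT2.
have ex : exists m, T <= s m by exists n.
(* The least m with T <= s_m: beyond it F vanishes, and the last node s_m/T lies between 1 and 2. *)
case: (ex_minnP ex) => m Tm mmin.
have mn : (m <= n)%N by exact: mmin.
have Tq : 0 < T `^ q by rewrite powR_gt0.
have -> : \sum_(j < n) ncoef nu (s j) ^+ 2 * F (s j / T) = \sum_(j < m) ncoef nu (s j) ^+ 2 * F (s j / T).
  rewrite -!(big_mkord xpredT (fun j => ncoef nu (s j) ^+ 2 * F (s j / T))) (big_cat_nat (n := m))//=.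
  rewrite [X in _ + X]big1_seq ?addr0// => j /andP[_]; rewrite mem_index_iota => /andP[mj _].
  by rewrite F1 ?mulr0// ler_pdivlMr// mul1r; apply: le_trans Tm (s_le hs mj).
pose v j := cell j / T `^ q; pose x j := s j / T.
have v0 j : 0 < v j by rewrite divr_gt0// cell_gt0.
have x0 j : 0 < x j by rewrite divr_gt0// (s_gt0 hs).
have sm2 : s m <= 2 * T.
  have s0 := s_gt0 hs 0; case: m Tm mmin {mn} => [|m] Tm mmin; first by lra.
  have smT : s m < T by rewrite ltNge; apply/negP => /mmin; rewrite ltnn.
  by have := hG m; clear -smT G0 TG s0; lra.
have xm2 : x m <= 2 by rewrite /x ler_pdivrMr.
have vsum k : \sum_(j < k) v j <= x k `^ q / q.
  by rewrite /v cell_sum// ler_wpM2r ?invr_ge0 ?(ltW q0)// gerBl powR_ge0.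
have vQ : \sum_(j < m) v j <= Q.
  apply: (le_trans (vsum m)); rewrite /Q ler_wpM2r ?invr_ge0 ?(ltW q0)//.
  by apply: powR_mono => //; exact: ltW.
have -> : (\sum_(j < m) ncoef nu (s j) ^+ 2 * F (s j / T)) / T `^ q = \sum_(j < m) ka j * v j * F (x j).
  rewrite mulr_suml; apply: eq_bigr => j _; rewrite /ka /v /x; have c0 := cell_gt0 j.
  by field; rewrite !gt_eqF.
have Pm : Phi (x m) = Phi 1.
  have xm1 : 1 <= x m by rewrite /x ler_pdivlMr// mul1r.
  have dP y : 1 <= y <= x m -> is_derive y (1 : R) Phi (F y * y `^ (2 * nu + 1)).
    by move=> /andP[y1 _]; apply: dPhi; exact: lt_le_trans y1.
  have [y /andP[y1 _] h] := MVT_le xm1 dP.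
  by apply/eqP; rewrite -subr_eq0 h F1// !mul0r.
(* Three errors: the weights differ from K times the cells, F is not constant on a cell, and the
   cells start at s_0/T instead of 0. *)
have -> : \sum_(j < m) ka j * v j * F (x j) - K * Phi 1 =
    \sum_(j < m) (ka j - K) * F (x j) * v j +
    K * \sum_(j < m) (v j * F (x j) - (Phi (x j.+1) - Phi (x j))) - K * Phi (x 0).
  rewrite sumrB -(big_mkord xpredT (fun j => Phi (x j.+1) - Phi (x j))) telescope_sumr// Pm.
  have -> : \sum_(j < m) (ka j - K) * F (x j) * v j =
      \sum_(j < m) ka j * v j * F (x j) - K * \sum_(j < m) v j * F (x j).
    by rewrite mulr_sumr -sumrB; apply: eq_bigr => j _; ring.
  by ring.
have t1 : `|\sum_(j < m) (ka j - K) * F (x j) * v j| <= e1 + e1.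
  apply: (le_trans (ler_norm_sum _ _ _)).
  (* For j >= J the weights are close to K; the finitely many other cells have total measure at most
     of order (s_J/T)^q, small for large T. *)
  apply: (@le_trans _ _ (e1 / Q * (\sum_(j < m) v j) + B * M * \sum_(j < m | (j < J)%N) v j)).
    rewrite [X in _ + B * M * X]big_mkcond !mulr_sumr -big_split/=; apply: ler_sum => j _.
    rewrite normrM (normrM (ka j - K)) (ger0_norm (ltW (v0 j))).
    have h : `|ka j - K| * `|F (x j)| <= B * `|ka j - K| by rewrite mulrC ler_wpM2r.
    case: ltnP => [jJ|Jj].
      rewrite -mulrDl ler_pM2r//; apply: (le_trans h); apply: (@le_trans _ _ (B * M)).
        by rewrite ler_wpM2l.
      by rewrite lerDr divr_ge0// ltW.
    by rewrite mulr0 addr0 ler_pM2r//; apply: (le_trans h); exact: hJ.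
  apply: lerD; first by rewrite -[leRHS](divfK (lt0r_neq0 Q0)) ler_pM2l// divr_gt0.
  apply: le_trans hA; rewrite (_ : B * M / q * (s J / T) `^ q = B * M * (x J `^ q / q)); last by rewrite /x; ring.
  rewrite ler_wpM2l// ?mulr_ge0 ?(ltW M0)//; apply: le_trans (vsum J).
  have [mJ|/ltnW Jm] := leqP m J; last by rewrite -(big_ord_widen _ _ Jm).
  apply: (@le_trans _ _ (\sum_(j < m) v j)).
    by rewrite big_mkcond; apply: ler_sum => j _; case: ifP => // _; exact: ltW.
  rewrite -!(big_mkord xpredT v) (big_cat_nat (n := m) (p := J))//= lerDl.
  by apply: sumr_ge0 => j _; exact: ltW.
have t2 : `|K * \sum_(j < m) (v j * F (x j) - (Phi (x j.+1) - Phi (x j)))| <= e1.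
  rewrite normrM (ger0_norm (ltW K0)).
  apply: (@le_trans _ _ (K * \sum_(j < m) e1 / (K * Q) * v j)); last first.
    rewrite -mulr_sumr (_ : K * (e1 / (K * Q) * \sum_(j < m) v j) = e1 * (\sum_(j < m) v j) / Q).
      by rewrite ler_pdivrMr// ler_pM2l.
    by field; rewrite !gt_eqF.
  rewrite ler_pM2l//; apply: (le_trans (ler_norm_sum _ _ _)); apply: ler_sum => j _.
  have xj : x j <= x j.+1 by rewrite /x ler_pM2r ?invr_gt0// (s_le hs (leqnSn j)).
  have xj2 : x j <= 2 by apply: le_trans xm2; rewrite /x ler_pM2r ?invr_gt0// (s_le hs (ltnW (ltn_ord j))).
  have osc y : x j <= y <= x j.+1 -> `|F (x j) - F y| <= e1 / (K * Q).
    move=> /andP[y1 y2]; apply: hd; first by rewrite (ltW (x0 j)).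
    rewrite distrC ger0_norm ?subr_ge0//; apply: (@le_trans _ _ (x j.+1 - x j)); first by rewrite lerB.
    rewrite /x -mulrBl ler_pdivrMr//; apply: (le_trans (hG j)).
    by rewrite mulrC -ler_pdivrMr.
  have vE : v j = q^-1 * x j.+1 `^ q - q^-1 * x j `^ q.
    rewrite /v /cell /x !powRM ?invr_ge0 ?(ltW (s_gt0 hs _)) ?(ltW T0)//.
    have -> : T^-1 `^ q = (T `^ q)^-1 by rewrite -(powR_inv1 (ltW T0)) -powRrM mulN1r powRN.
    by ring.
  have dq y : x j <= y <= x j.+1 -> is_derive y (1 : R) (fun y => q^-1 * y `^ q) (y `^ (2 * nu + 1)).
    move=> /andP[xy _]; apply: dE (dZ q^-1 (dpowR q (lt_le_trans (x0 j) xy))) _.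
    by rewrite mulrA mulVf ?gt_eqF// mul1r; congr (_ `^ _); ring.
  have dPy y : x j <= y <= x j.+1 -> is_derive y (1 : R) Phi (F y * y `^ (2 * nu + 1)).
    by move=> /andP[xy _]; apply: dPhi; exact: lt_le_trans xy.
  pose o := e1 / (K * Q).
  have up := derive_ge0_le xj (fun y h => dB (dZ (o + F (x j)) (dq y h)) (dPy y h)) _.
  have lo := derive_ge0_le xj (fun y h => dB (dPy y h) (dZ (F (x j) - o) (dq y h))) _.
  have {}up : (o + F (x j)) * (q^-1 * x j `^ q) - Phi (x j) <= (o + F (x j)) * (q^-1 * x j.+1 `^ q) - Phi (x j.+1).
    apply: up => y h; rewrite -mulrBl mulr_ge0 ?powR_ge0//.
    by have := osc y h; rewrite ler_norml -/o => /andP[h1 h2]; clear -h1 h2; lra.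
  have {}lo : Phi (x j) - (F (x j) - o) * (q^-1 * x j `^ q) <= Phi (x j.+1) - (F (x j) - o) * (q^-1 * x j.+1 `^ q).
    apply: lo => y h; rewrite -mulrBl mulr_ge0 ?powR_ge0//.
    by have := osc y h; rewrite ler_norml -/o => /andP[h1 h2]; clear -h1 h2; lra.
  rewrite -/o vE ler_norml; clear -up lo; apply/andP; split; lra.
have t3 : `|K * Phi (x 0)| <= e1.
  rewrite normrM (ger0_norm (ltW K0)); apply: le_trans hC.
  rewrite (_ : K * B / q * (s 0 / T) `^ q = K * (B * x 0 `^ q / q)); last by rewrite /x; ring.
  by rewrite ler_pM2l// Phi0.
apply: (le_trans (ler_normB _ _)); apply: (@le_trans _ _ (((e1 + e1) + e1) + e1)).
  by apply: lerD t3; apply: (le_trans (ler_normD _ _)); exact: lerD.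
by rewrite /e1; lra.
Qed.

End RiemannSums.

(** * Sonine's integral through moments of the symbol *)

Section Sonine.
Variables (R : realType) (nu : R).
Hypothesis nu1 : -1 < nu.
Notation wint := (wint nu).
Implicit Types (x z a : R) (k K : nat).

Definition bpart K x : R := \sum_(k < K) bcoef nu k * (x ^+ 2) ^+ k.

Lemma bpart_error (Z e : R) : 0 < Z -> 0 < e -> exists K0, forall K x, (K0 <= K)%N -> x ^+ 2 <= Z ->
  `|phi nu x - bpart K x| <= e.
Proof.
move=> Z0 e0; pose M : R := (Num.min 1 (nu + 1))^-1.
have M0 : 0 < M by rewrite invr_gt0 lt_min ltr01/=; move: nu1 => h; lra.
pose E := limn (series (exp_coeff Z)).
have cE : series (exp_coeff Z) @ \oo --> E := is_cvg_series_exp_coeff Z.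
have Ege n : series (exp_coeff Z) n <= E.
  apply: nondecreasing_cvgn_le; last exact: is_cvg_series_exp_coeff.
  by apply/nondecreasing_seqP => k; rewrite /series/= big_nat_recr//= lerDl exp_coeff_ge0// ltW.
have [K0 _ hK0] : \forall n \near \oo, `|E - series (exp_coeff Z) n| <= e / M.
  by move/cvgrPdist_le : cE; apply; rewrite divr_gt0.
exists K0 => K x KK xZ; have x20 : 0 <= x ^+ 2 by exact: sqr_ge0.
have step L : (K <= L)%N -> `|pseries (bcoef nu) (x ^+ 2) L - bpart K x| <= e.
  move=> KL; rewrite /bpart /pseries /series/= (big_cat_nat (n := K))//= big_mkord addrAC subrr add0r.
  apply: (le_trans (ler_norm_sum _ _ _)).
  apply: (@le_trans _ _ (\sum_(K <= i < L) M * exp_coeff Z i)).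
    apply: ler_sum => i _; apply: (le_trans (norm_bcoef_le _ _ nu1)).
    rewrite (ger0_norm x20) ler_pM2l// /exp_coeff/= ler_wpM2r ?invr_ge0//.
    by rewrite lerXn2r// ?nnegrE ?(ltW Z0).
  rewrite -mulr_sumr -ler_pdivlMl// mulrC.
  apply: (@le_trans _ _ (E - series (exp_coeff Z) K)).
    have := Ege L; rewrite /series/= (big_cat_nat (n := K))//= => h; lra.
  by apply: le_trans (hK0 K KK); exact: ler_norm.
have c : `|pseries (bcoef nu) (x ^+ 2) L - bpart K x| @[L --> \oo] --> `|phi nu x - bpart K x|.
  by apply: cvg_norm; apply: cvgB; [exact: is_cvg_bseries|exact: cvg_cst].
apply: (cvgr_to_le c); exists K => // L /=; exact: step.
Qed.

Section Moments.
Variable a : R.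
Hypothesis a0 : 0 < a.

Definition moment k : R := wint (fun s => msym a s * (s ^+ 2) ^+ k).

Lemma continuous_moment k : continuous (fun s : R => msym a s * (s ^+ 2) ^+ k).
Proof. by apply: cM; [exact: continuous_msym|apply: cX; apply: cX; exact: cid]. Qed.

Lemma moment_gt0 k : 0 < moment k.
Proof.
apply: (wint_gt0 nu1 (x0 := 1 / 2)); first exact: continuous_moment.
- by move=> x; rewrite mulr_ge0 ?msym_ge0// exprn_ge0// sqr_ge0.
- by apply/andP; split; lra.
have h : 0 < 1 - (1 / 2) ^+ 2 :> R by rewrite expr2; lra.
have h2 : 0 < ((1 / 2) ^+ 2) ^+ k :> R by rewrite exprn_gt0// exprn_gt0// divr_gt0.
rewrite (pmulr_lgt0 _ h2).
by rewrite msym_in ?powR_gt0// ger0_norm; lra.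
Qed.

Lemma msymS c x : 0 < x < 1 -> msym (c + 1) x = msym c x * (1 - x ^+ 2).
Proof.
move=> /andP[x0 x1]; have h : 0 < 1 - x ^+ 2 by rewrite subr_gt0 exprn_ilt1// ltW.
have xn : `|x| <= 1 by rewrite ger0_norm ltW.
by rewrite !msym_in// powRD ?(gt_eqF h) ?implybT// powRr1// ltW.
Qed.

(** The derivative of (1 - x^2)^(a+1) x^(2k + 2nu + 2) integrates to 0 over ]0, 1[. This recursion
    takes the place of Beta integrals. *)
Lemma moment_rec k : (k%:R + nu + 1) * moment k = (k%:R + nu + a + 2) * moment k.+1.
Proof.
have hn := nu1; have ha := a0.
have k0 : 0 <= k%:R :> R by [].
pose r : R := 2 * k%:R + 2 * nu + 2; have r0 : 0 < r by rewrite /r; lra.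
have a1 : 0 < a + 1 by lra.
pose F (x : R) : R := msym (a + 1) x * x `^ r.
pose g (x : R) : R := r * (msym a x * (x ^+ 2) ^+ k) - (r + 2 * a + 2) * (msym a x * (x ^+ 2) ^+ k.+1).
have cg : continuous g.
  by apply: cB; apply: cM; first [exact: ccst|exact: continuous_moment].
have wg : wint g = r * moment k - (r + 2 * a + 2) * moment k.+1.
  have c1 := @continuous_moment k; have c2 := @continuous_moment k.+1.
  rewrite /g wintB ?wintZ//; by apply: cM; first exact: ccst.
have pw x : 0 < x -> x `^ r = (x ^+ 2) ^+ k * x * x `^ (2 * nu + 1).
  move=> x0; rewrite -exprM -[x in _ * x * _](powRr1 (ltW x0)) -powR_mulrn ?(ltW x0)//.
  rewrite -!powRD ?(gt_eqF x0) ?implybT//; congr (_ `^ _); rewrite /r natrM; ring.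
have g0 : wint g = 0.
  have -> : wint g = F 1 - F 0; last first.
    by rewrite /F msym_out ?normr1// powR0 ?gt_eqF// mul0r mulr0 subrr.
  have cF1 : continuous (@msym R (a + 1)) by exact: continuous_msym.
  apply: (@FTC_oo R (fun x => g x * x `^ (2 * nu + 1)) F 0 1) => //.
  - move=> x /andP[x0 x1]; have h : 0 < 1 - x ^+ 2 by rewrite subr_gt0 exprn_ilt1// ltW.
    have d1 : is_derive x (1 : R) (fun y => (1 - y ^+ 2) `^ (a + 1)) ((a + 1) * (1 - x ^+ 2) `^ (a + 1 - 1) * (0 - 2%:R * x ^+ 1 * 1)).
      by apply: (dcomp (dB (dcst 1 x) (dX 2 (did x))) (dpowR (a + 1) h)).
    have d2 : is_derive x (1 : R) (@msym R (a + 1)) ((a + 1) * (1 - x ^+ 2) `^ (a + 1 - 1) * (0 - 2%:R * x ^+ 1 * 1)).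
      apply: (near_eq_is_derive _ d1); near=> y.
      have y0 : 0 < y by near: y; exact: lt_nbhsr.
      have y1 : y < 1 by near: y; exact: lt_nbhsl.
      by rewrite msym_in// ger0_norm ltW.
    apply: dE (dM d2 (dpowR r x0)) _.
    have x01 : 0 < x < 1 by rewrite x0.
    rewrite msymS// addrK /g [(x ^+ 2) ^+ k.+1]exprS.
    have -> : (1 - x ^+ 2) `^ a = msym a x by rewrite msym_in// ger0_norm ltW.
    have -> : x `^ (r - 1) = (x ^+ 2) ^+ k * x `^ (2 * nu + 1).
      by rewrite powR_pred// pw//; field; rewrite gt_eqF.
    by rewrite pw//; ring.
  - move=> x; rewrite in_itv/= => /andP[x0 _]; apply: cvgM; [exact: cg|exact: continuous_powR_pos].
  - by apply: cvgM; [apply: cvg_at_right_filter; exact: cF1|exact: powR_cvg_right0].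
  - by apply: cvg_at_left_filter; apply: cvgM; [exact: cF1|exact: continuous_powR_pos].
  - exact: integrable_wgt_continuous.
move: g0; rewrite wg /r => h; lra.
Unshelve. all: by end_near.
Qed.

Lemma momentE k : moment k * poch (nu + a + 2) k = moment 0 * poch (nu + 1) k.
Proof.
have hn := nu1; have ha := a0.
elim: k => [|k IHk]; first by rewrite /poch !big_ord0.
rewrite !pochSr mulrA [RHS]mulrA -IHk.
have := moment_rec k; set p := poch _ k => h.
have -> : moment k.+1 * p * (nu + a + 2 + k%:R) = p * ((k%:R + nu + a + 2) * moment k.+1) by ring.
by rewrite -h; ring.
Qed.

(** By [momentE] the k-th moment replaces the Pochhammer factor of order nu by that of order nu + a
    + 1, so termwise integration turns one Bessel series into the other; [bpart_error] justifies the
    exchange. *)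
Lemma sonine Y : wint (fun s => msym a s * phi nu (s * Y)) = moment 0 * phi (nu + a + 1) Y.
Proof.
have hn := nu1; have ha := a0.
have n1 : -1 < nu + a + 1 by lra.
have cm : continuous (@msym R a) by exact: continuous_msym.
have cY : continuous (fun s : R => s * Y) by apply: cM; [exact: cid|exact: ccst].
have cp : continuous (fun s : R => phi nu (s * Y)) by exact: (ccomp (continuous_phi nu1) cY).
have cb K : continuous (fun s : R => bpart K (s * Y)).
  by apply: csum => k; apply: cM; [exact: ccst|apply: cX; apply: cX; exact: cY].
have part K : wint (fun s : R => msym a s * bpart K (s * Y)) = moment 0 * pseries (bcoef (nu + a + 1)) (Y ^+ 2) K.
  have -> : (fun s : R => msym a s * bpart K (s * Y)) =
     (fun s => \sum_(k < K) (bcoef nu k * (Y ^+ 2) ^+ k) * (msym a s * (s ^+ 2) ^+ k)).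
    apply/funext => s; rewrite /bpart mulr_sumr; apply: eq_bigr => k _.
    by rewrite !exprMn; ring.
  rewrite wint_sum//; last by move=> k; apply: cM; [exact: ccst|exact: continuous_moment].
  rewrite /pseries /series/= big_mkord mulr_sumr; apply: eq_bigr => k _.
  rewrite wintZ//; last exact: continuous_moment.
  rewrite -/(moment k).
  have p1 : 0 < poch (nu + 1) k by apply: poch_gt0; lra.
  have p2 : 0 < poch (nu + a + 2) k by apply: poch_gt0; lra.
  have -> : moment k = moment 0 * poch (nu + 1) k / poch (nu + a + 2) k by rewrite -momentE mulfK// gt_eqF.
  rewrite /bcoef (_ : nu + a + 1 + 1 = nu + a + 2); last by ring.
  have f0 : k`!%:R != 0 :> R by rewrite pnatr_eq0 -lt0n fact_gt0.
  by field; rewrite f0 !gt_eqF.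
have c1 : moment 0 * pseries (bcoef (nu + a + 1)) (Y ^+ 2) K @[K --> \oo] --> moment 0 * phi (nu + a + 1) Y.
  by apply: cvgMr; exact: is_cvg_bseries.
apply: (cvg_unique _ _ c1) => //.
have -> : (fun K => moment 0 * pseries (bcoef (nu + a + 1)) (Y ^+ 2) K) =
    (fun K => wint (fun s : R => msym a s * bpart K (s * Y))) by apply/funext => K; rewrite part.
apply/cvgrPdist_le => e e0.
have m00 := moment_gt0 0.
have Z0 : 0 < Y ^+ 2 + 1 by rewrite ltr_wpDl ?sqr_ge0.
have [K0 hK] := bpart_error Z0 (divr_gt0 e0 m00).
exists K0 => // K /= KK.
have cA : continuous (fun s : R => msym a s * phi nu (s * Y)) by exact: cM.
have cB' : continuous (fun s : R => msym a s * bpart K (s * Y)) by exact: cM.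
rewrite -(wintB nu1 cA cB').
have -> : e = wint (fun s => e / moment 0 * (msym a s * (s ^+ 2) ^+ 0)).
  by rewrite wintZ//; [rewrite -/(moment 0) divfK// gt_eqF|exact: continuous_moment].
apply: norm_wint_le.
- exact: nu1.
- exact: cB.
- by apply: cM; [exact: ccst|exact: continuous_moment].
move=> x /andP[x0 x1]; rewrite -mulrBr normrM (ger0_norm (msym_ge0 _ _)) expr0 mulr1 mulrC.
rewrite ler_wpM2r ?msym_ge0//; apply: hK => //.
rewrite exprMn; apply: (@le_trans _ _ (Y ^+ 2)); last by rewrite lerDl.
by rewrite ler_piMl ?sqr_ge0// exprn_ile1// ltW.
Qed.

End Moments.

(** 1 - x^2/4 = 3/4 + (1 - x^2)/4, so the binomial formula expands the product symbol in (1 -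
    x^2)^(de + k), to each of which [sonine] applies. The coefficient for k = 0 is singled out
    because its Bessel function decays most slowly. *)
Lemma sonine_poly (de : R) N : 0 < de -> (0 < N)%N -> exists al : 'I_N.+1 -> R, 0 < al ord0 /\
  forall Y, wint (fun s => msym de s * msym N%:R (s / 2) * phi nu (s * Y)) =
    \sum_(k < N.+1) al k * phi (nu + de + 1 + k%:R) Y.
Proof.
move=> de0 N0.
exists (fun k => ((3 / 4) ^+ (N - k) * (1 / 4) ^+ k) *+ 'C(N, k) * moment (de + k%:R) 0); split.
  apply: mulr_gt0; last by apply: moment_gt0; rewrite addr0.
  by rewrite pmulrn_lgt0 ?bin_gt0// mulr_gt0 ?exprn_gt0// divr_gt0.
move=> Y.
have dk k : 0 < de + k%:R by rewrite ltr_wpDr.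
have cY : continuous (fun s : R => s * Y) by apply: cM; [exact: cid|exact: ccst].
have cp : continuous (fun s : R => phi nu (s * Y)) by exact: (ccomp (continuous_phi nu1) cY).
have -> : wint (fun s => msym de s * msym N%:R (s / 2) * phi nu (s * Y)) =
  wint (fun s => \sum_(k < N.+1) ((3 / 4) ^+ (N - k) * (1 / 4) ^+ k) *+ 'C(N, k) * (msym (de + k%:R) s * phi nu (s * Y))).
  apply: eq_wint => x x01; have /andP[x0 x1] := x01.
  have x2 : 0 <= x ^+ 2 <= 1 by rewrite sqr_ge0 exprn_ile1// ltW.
  rewrite (@msym_in _ N%:R) ?powR_mulrn; last 2 first.
  - rewrite expr_div_n subr_ge0 ler_pdivrMr//; have /andP[_ h] := x2; rewrite expr2; lra.
  - by rewrite ger0_norm; lra.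
  have -> : 1 - (x / 2) ^+ 2 = 3 / 4 + (1 / 4) * (1 - x ^+ 2) by field.
  rewrite exprDn mulr_sumr mulr_suml; apply: eq_bigr => k _.
  have mk : msym (de + k%:R) x = msym de x * (1 - x ^+ 2) ^+ k.
    elim: {k}(nat_of_ord k) => [|k IHk]; first by rewrite addr0 expr0 mulr1.
    by rewrite -natr1 addrA msymS// IHk [(1 - x ^+ 2) ^+ k.+1]exprSr mulrA.
  rewrite mk [(1 / 4 * _) ^+ k]exprMn.
  move: ((3 / 4) ^+ (N - k)) ((1 / 4) ^+ k) ((1 - x ^+ 2) ^+ k) ('C(N, k)) (msym de x) (phi nu (x * Y)).
  by move=> A B C D E F; rewrite -(mulr_natr (A * (B * C)) D) -(mulr_natr (A * B) D); ring.
rewrite wint_sum//; last first.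
  by move=> k; apply: cM; [exact: ccst|apply: cM => //; exact: continuous_msym].
apply: eq_bigr => k _; rewrite wintZ//; last by apply: cM => //; exact: continuous_msym.
rewrite sonine// mulrA; congr (_ * phi _ _); ring.
Qed.

End Sonine.

(** * Logarithmic divergence of the limit kernel *)

Section Divergence.
Variable R : realType.
Notation mu := (@lebesgue_measure R).
Implicit Types (x t Y : R).

(** Reduces a q-th power to an affine function, so that a lower bound for the logarithmic mean of
    the first power is enough for every q >= 1. *)
Lemma pow_linear_le (e q z : R) : 0 < e -> 1 <= q -> 0 <= z -> e `^ (q - 1) * (z - e) <= z `^ q.
Proof.
move=> e0 q1 z0; have [ez|ze] := leP e z; last first.
  by apply: le_trans (powR_ge0 _ _); rewrite mulr_ge0_le0 ?powR_ge0// subr_le0 ltW.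
have zp : 0 < z by exact: lt_le_trans ez.
have -> : z `^ q = z `^ (q - 1) * z by rewrite powR_pred// divfK// gt_eqF.
apply: ler_pM; rewrite ?powR_ge0 ?subr_ge0//.
  by apply: ge0_ler_powR; rewrite ?nnegrE ?(ltW e0) ?subr_ge0.
by rewrite gerBl ltW.
Qed.

(* Since w = amp m satisfies w'' = - w + O(1/Y^2), the mean of w^2 is half of the energy; the
   boundary term of that average is the function [w * w' / Y] below. *)
Lemma amp_log_lower (m : R) : -1 < m -> exists M c C Y0 : R, [/\ 0 < M, 0 < c, 0 < C, 1 <= Y0 &
  (forall Y, Y0 <= Y -> `|amp m Y| <= M) /\
  exists P P' : R -> R, (forall Y, Y0 <= Y -> [/\ is_derive Y (1 : R) P (P' Y), `|P Y| <= C &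
     {for Y, continuous P'}]) /\
     forall Y, Y0 <= Y -> c / Y - P' Y - C / Y ^+ 2 <= `|amp m Y| / Y].
Proof.
move=> m1.
have [t0 [e [E [t00 e0 E0 _ eE]]]] := energy_bounds m1.
pose b := m + 1 / 2; pose k : R := `|b ^+ 2 - b|.
have k0 : 0 <= k by exact: normr_ge0.
have rE : Num.sqrt E ^+ 2 = E by rewrite sqr_sqrtr// ltW.
set r := Num.sqrt E in rE.
have r0 : 0 < r by rewrite sqrtr_gt0.
pose Y0 := Num.max 1 t0.
have Y01 : 1 <= Y0 by rewrite le_max lexx.
have Yt x : Y0 <= x -> t0 <= x by apply: le_trans; rewrite le_max lexx orbT.
have sqle x : x ^+ 2 <= E -> `|x| <= r.
  by move=> h; apply: sqr_le_le => //; rewrite real_normK ?num_real// rE.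
have bnd v : Y0 <= v -> `|amp m v| <= r /\ `|damp m v| <= r.
  move=> jv; have /andP[_ h] := eE v (Yt _ jv); rewrite /energy in h.
  have h1 := sqr_ge0 (amp m v); have h2 := sqr_ge0 (damp m v).
  by split; apply: sqle; lra.
pose P v := (2 * r)^-1 * (amp m v * damp m v * v^-1).
pose P' v := (2 * r)^-1 * ((damp m v * damp m v + amp m v * (- amp m v + (b ^+ 2 - b) / v ^+ 2 * amp m v)) * v^-1 +
   (amp m v * damp m v) * (- 1 / v ^+ 2)).
pose C := r + (k + 1) * r.
have kr : 0 <= k * r by rewrite mulr_ge0// ltW.
have C0 : 0 < C by rewrite /C; lra.
exists r, (e / (2 * r)), C, Y0; split => //; first by rewrite divr_gt0// mulr_gt0.
split; first by move=> Y /bnd[].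
exists P, P'; split => Y hY.
  have Yp : 0 < Y by apply: lt_le_trans hY; apply: lt_le_trans Y01.
  have [h1 h2] := bnd Y hY.
  have dY : is_derive Y (1 : R) P (P' Y).
    have dinv : is_derive Y (1 : R) (fun v => v^-1) (- 1 / Y ^+ 2) by apply: dV (did Y); rewrite gt_eqF.
    exact: dZ (dM (dM (is_derive_amp m1 Yp) (is_derive_damp m1 Yp)) dinv).
  split => //.
    rewrite /P; move: (amp m Y) (damp m Y) h1 h2 => u v hu hv.
    rewrite normrM (ger0_norm (_ : 0 <= (2 * r)^-1)); last by rewrite invr_ge0 mulr_ge0// ltW.
    rewrite ler_pdivrMl ?mulr_gt0// !normrM.
    have iY : `|Y^-1| <= 1 by rewrite ger0_norm ?invr_ge0 ?(ltW Yp)// invf_le1//; apply: le_trans hY.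
    apply: (@le_trans _ _ (r * r * 1)).
      by apply: ler_pM; rewrite ?mulr_ge0//; apply: ler_pM.
    have rr : 0 < r * r by rewrite mulr_gt0.
    have krr : 0 <= k * (r * r) by rewrite mulr_ge0// ltW.
    by rewrite /C; lra.
  have ca : {for Y, continuous (amp m)}.
    by have [h _] := is_derive_amp m1 Yp; apply: differentiable_continuous; exact/derivable1_diffP.
  have cd : {for Y, continuous (damp m)}.
    by have [h _] := is_derive_damp m1 Yp; apply: differentiable_continuous; exact/derivable1_diffP.
  have ci : {for Y, continuous (fun v : R => v^-1)} by apply: cvgV => //; rewrite gt_eqF.
  have c2 : {for Y, continuous (fun v : R => (v ^+ 2)^-1)}.
    by apply: cvgV; [rewrite gt_eqF// exprn_gt0|apply: (cX (n := 2)); exact: cid].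
  apply: cvgMr; apply: cvgD; apply: cvgM => //.
  - apply: cvgD; first exact: cvgM.
    apply: cvgM => //; apply: cvgD; first exact: cvgN.
    by apply: cvgM => //; apply: cvgM => //; exact: cvg_cst.
  - exact: cvgM.
  - by apply: cvgM => //; exact: cvg_cst.
have Yp : 0 < Y by apply: lt_le_trans hY; apply: lt_le_trans Y01.
have [h1 h2] := bnd Y hY.
have /andP[h3 _] := eE Y (Yt _ hY); rewrite /energy in h3.
have Y2 : 0 < Y ^+ 2 by rewrite exprn_gt0.
rewrite /P'; move: (amp m Y) (damp m Y) h1 h2 h3 => u v hu hv huv.
have Yge1 : 1 <= Y by apply: le_trans hY.
have u2 : u ^+ 2 <= `|u| * r.
  by rewrite -(real_normK (num_real u)) expr2 ler_wpM2l.
have uv : `|u * v| <= r * r by rewrite normrM; apply: ler_pM.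
have ku : `|(b ^+ 2 - b) * u ^+ 2| <= k * (r * r).
  by rewrite normrM -/k ler_wpM2l// normrX expr2; apply: ler_pM.
rewrite -(ler_pM2r (mulr_gt0 (mulr_gt0 (ltr0n _ 2) r0) Y2)).
have Yn0 : Y != 0 by rewrite gt_eqF.
have rn0 : r != 0 by rewrite gt_eqF.
have -> : (e / (2 * r) / Y - (2 * r)^-1 *
    ((v * v + u * (- u + (b ^+ 2 - b) / Y ^+ 2 * u)) / Y + u * v * (-1 / Y ^+ 2)) - C / Y ^+ 2) * (2 * r * Y ^+ 2) =
   (e - (v ^+ 2 + u ^+ 2)) * Y + 2 * u ^+ 2 * Y - (b ^+ 2 - b) * u ^+ 2 / Y + u * v - 2 * r * C.
  by field; rewrite Yn0 rn0.
have -> : `|u| / Y * (2 * r * Y ^+ 2) = 2 * (`|u| * r) * Y by field.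
have a1 : (e - (v ^+ 2 + u ^+ 2)) * Y <= 0 by rewrite mulr_le0_ge0 ?(ltW Yp)// subr_le0.
have a2 : 2 * u ^+ 2 * Y <= 2 * (`|u| * r) * Y by rewrite ler_pM2r// ler_pM2l.
have a3 : - ((b ^+ 2 - b) * u ^+ 2 / Y) <= k * (r * r).
  apply: (le_trans (ler_norm _)); rewrite normrN normrM -[leRHS]mulr1; apply: ler_pM => //.
  by rewrite ger0_norm ?invr_ge0 ?(ltW Yp)// invf_le1.
have a4 : u * v <= r * r by apply: le_trans uv; exact: ler_norm.
have a5 : 0 <= r * r by rewrite mulr_ge0// ltW.
have a6 : 0 <= k * (r * r) by rewrite mulr_ge0.
have -> : 2 * r * C = 2 * (r * r) + 2 * (k * (r * r) + r * r) by rewrite /C; ring.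
lra.
Qed.

End Divergence.

Section SonineTail.
Variables (R : realType) (m : R) (N : nat) (al : 'I_N.+1 -> R).
Hypotheses (m1 : -1 < m) (al0 : 0 < al ord0).
Notation mu := (@lebesgue_measure R).
Implicit Types (x t Y : R).

Definition stail Y : R := \sum_(k < N.+1) al k * phi (m + k%:R) Y.

Lemma continuous_stail : continuous stail.
Proof.
apply: csum => k; apply: cM; first exact: ccst.
apply: continuous_phi; apply: (lt_le_trans m1); by rewrite lerDl.
Qed.

(** The terms with k >= 1 decay faster by at least one power of Y and go into C/Y. *)
Lemma stail_lower : exists2 C : R, 0 < C & forall Y, 1 <= Y ->
  al ord0 * `|amp m Y| - C / Y <= `|stail Y| * Y `^ (m + 1 / 2).
Proof.
have hb (k : nat) : exists D : R, 0 < D /\ forall t, 1 <= t -> `|phi (m + k%:R) t| <= D * t `^ (- (m + k%:R + 1 / 2)).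
  have mk : -1 < m + k%:R by apply: (lt_le_trans m1); rewrite lerDl.
  have [C C0 hC] := phi_bound mk.
  exists (C * 2 `^ `|- (m + k%:R + 1 / 2)|); split; first by rewrite mulr_gt0 ?powR_gt0.
  move=> t t1; apply: (le_trans (hC t _)); first by lra.
  rewrite -mulrA ler_pM2l//; apply: powR_ratio; rewrite ?ler1n//; lra.
have [D hD] : exists D : nat -> R, forall k, 0 < D k /\ forall t, 1 <= t -> `|phi (m + k%:R) t| <= D k * t `^ (- (m + k%:R + 1 / 2)).
  by have /boolp.choice[D hD] := hb; exists D.
pose C := 1 + \sum_(k < N) `|al (lift ord0 k)| * D (lift ord0 k).
have S0 : 0 <= \sum_(k < N) `|al (lift ord0 k)| * D (lift ord0 k).
  by apply: sumr_ge0 => k _; rewrite mulr_ge0// ltW//; have [] := hD (lift ord0 k).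
exists C; first by rewrite /C; lra.
move=> Y Y1; have Y0 : 0 < Y by lra.
have bp : 0 < Y `^ (m + 1 / 2) by rewrite powR_gt0.
pose rest := \sum_(k < N) al (lift ord0 k) * phi (m + (lift ord0 k)%:R) Y.
have e : stail Y = al ord0 * phi m Y + rest by rewrite /stail big_ord_recl addr0.
have hr : `|rest| * Y `^ (m + 1 / 2) <= C / Y.
  apply: (@le_trans _ _ (\sum_(k < N) `|al (lift ord0 k)| * D (lift ord0 k) / Y)); last first.
    by rewrite -mulr_suml ler_pM2r ?invr_gt0// /C lerDr.
  apply: (@le_trans _ _ (\sum_(k < N) `|al (lift ord0 k) * phi (m + (lift ord0 k)%:R) Y| * Y `^ (m + 1 / 2))).
    by rewrite -mulr_suml ler_pM2r// ler_norm_sum.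
  apply: ler_sum => k _; rewrite normrM -!mulrA ler_wpM2l//.
  have [D0 h] := hD (lift ord0 k).
  apply: (@le_trans _ _ ((D (lift ord0 k) * Y `^ (- (m + (lift ord0 k)%:R + 1 / 2))) * Y `^ (m + 1 / 2))).
    by rewrite ler_pM2r// h.
  rewrite -mulrA ler_pM2l// -powRD ?(gt_eqF Y0) ?implybT// -(powR_inv1 (ltW Y0)).
  apply: ler_powR => //; have : 1 <= (lift ord0 k)%:R :> R by rewrite ler1n.
  lra.
rewrite e; have : al ord0 * `|amp m Y| = `|al ord0 * phi m Y| * Y `^ (m + 1 / 2).
  by rewrite /amp !normrM (ger0_norm (ltW bp)) (gtr0_norm al0); ring.
move=> ->; have := ler_normB (al ord0 * phi m Y + rest) rest; rewrite addrK => h.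
have := ler_wpM2r (ltW bp) h; rewrite mulrDl; lra.
Qed.

(** With z = |stail| Y^(m + 1/2) the exponent condition makes the integrand at least z^q/Y for Y >=
    1. Linearised, this exceeds the derivative of H, which grows like ln Y; the exponent condition
    allows equality, where the divergence is exactly logarithmic. *)
Lemma stail_diverges q r (B : R) : 1 <= q -> 0 <= r -> q * (m + 1 / 2) <= r + 1 ->
  exists Y1, 0 < Y1 /\ (B%:E < \int[mu]_(Y in `]0%R, Y1[) (`|stail Y| `^ q * Y `^ r)%:E)%E.
Proof.
move=> q1 r0 qr; have [C2 C20 low] := stail_lower.
have [M [c [C [Y0 [M0 c0 C0 Y01 [hM [P [P' [hP key]]]]]]]]] := amp_log_lower m1.
pose a0 := al ord0; have a00 : 0 < a0 by [].
(* Half of the mean of z supplied by [amp_log_lower]: subtracting e in [pow_linear_le] leaves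
   e/Y. *)
pose e := a0 * c / 2; have e0 : 0 < e by rewrite divr_gt0// mulr_gt0.
pose E := e `^ (q - 1); have E0 : 0 < E by rewrite powR_gt0.
pose H (Y : R) := E * ((e * ln Y - a0 * P Y) + (a0 * C + C2) * Y^-1).
pose H' (Y : R) := E * ((e * Y^-1 - a0 * P' Y) + (a0 * C + C2) * (- 1 / Y ^+ 2)).
have Yp Y : Y0 <= Y -> 0 < Y by move=> h; apply: lt_le_trans h; apply: lt_le_trans Y01.
have dH Y : Y0 <= Y -> is_derive Y (1 : R) H (H' Y).
  move=> hY; have [d _ _] := hP Y hY; have Y0' := Yp Y hY.
  have dinv : is_derive Y (1 : R) (fun v => v^-1) (- 1 / Y ^+ 2) by apply: dV (did Y); rewrite gt_eqF.
  exact: dZ (dD (dB (dZ e (is_derive1_ln Y0')) (dZ a0 d)) (dZ (a0 * C + C2) dinv)).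
have cH' Y : Y0 <= Y -> {for Y, continuous H'}.
  move=> hY; have [_ _ cP] := hP Y hY; have Y0' := Yp Y hY.
  have ci : {for Y, continuous (fun v : R => v^-1)} by apply: cvgV => //; rewrite gt_eqF.
  have c2 : {for Y, continuous (fun v : R => (v ^+ 2)^-1)}.
    by apply: cvgV; [rewrite gt_eqF// exprn_gt0|apply: (cX (n := 2)); exact: cid].
  apply: cvgMr; apply: cvgD; first by apply: cvgB; exact: cvgMr.
  by apply: cvgMr; apply: cvgM => //; exact: cvg_cst.
have pt Y : Y0 <= Y -> H' Y <= `|stail Y| `^ q * Y `^ r.
  move=> hY; have Y0' := Yp Y hY; have Y1' : 1 <= Y by exact: le_trans hY.
  pose z := `|stail Y| * Y `^ (m + 1 / 2).
  have z0 : 0 <= z by rewrite mulr_ge0 ?powR_ge0.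
  apply: (@le_trans _ _ (z `^ q / Y)); last first.
    rewrite /z powRM ?powR_ge0// -powRrM -mulrA ler_wpM2l ?powR_ge0//.
    rewrite -(powR_inv1 (ltW Y0')) -powRD ?(gt_eqF Y0') ?implybT//.
    by apply: ler_powR => //; lra.
  apply: (@le_trans _ _ (E * (z - e) / Y)); last first.
    by rewrite ler_pM2r ?invr_gt0//; exact: pow_linear_le.
  rewrite /H' -mulrA ler_pM2l//.
  have h1 := low Y Y1'; rewrite -/z -/a0 in h1.
  have h2 := key Y hY.
  have h3 : a0 * (c / Y - P' Y - C / Y ^+ 2) <= a0 * (`|amp m Y| / Y) by rewrite ler_pM2l.
  have h4 : (a0 * `|amp m Y| - C2 / Y) / Y <= z / Y by rewrite ler_pM2r ?invr_gt0.
  have -> : (z - e) / Y = z / Y - e / Y by rewrite mulrBl.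
  have i2 : C2 / Y / Y = C2 / Y ^+ 2 by field; rewrite gt_eqF.
  move: h4; rewrite mulrBl i2 -mulrA => h4.
  have -> : (a0 * C + C2) * (-1 / Y ^+ 2) = - (a0 * (C / Y ^+ 2)) - C2 / Y ^+ 2 by ring.
  move: h3; rewrite !mulrBr => h3.
  have ce : a0 * (c / Y) = 2 * (e / Y) by rewrite /e; field; rewrite gt_eqF.
  rewrite ce in h3; lra.
pose L := B / E + a0 * C + (e * ln Y0 - a0 * P Y0 + (a0 * C + C2) * Y0^-1) + 1.
pose Y1 := Num.max (Y0 + 1) (expR (L / e)).
have Y1Y : Y0 + 1 <= Y1 by rewrite le_max lexx.
have Y01' : Y0 < Y1 by lra.
have Y1p := Yp Y1 (ltW Y01').
exists Y1; split => //.
have HB : B < H Y1 - H Y0.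
  have [_ hp _] := hP Y1 (ltW Y01').
  have lY : L / e <= ln Y1.
    rewrite -[leLHS](expRK (L / e)) ler_ln ?posrE ?expR_gt0//; by rewrite le_max lexx orbT.
  have lY' : L <= e * ln Y1 by rewrite mulrC -ler_pdivrMr.
  have pY : a0 * P Y1 <= a0 * C.
    by rewrite ler_pM2l// (le_trans (ler_norm _)).
  have i0 : 0 <= (a0 * C + C2) * Y1^-1.
    by rewrite mulr_ge0 ?invr_ge0 ?(ltW Y1p)// addr_ge0 ?mulr_ge0 ?(ltW C20) ?(ltW C0) ?(ltW a00).
  rewrite /H -mulrBr -ltr_pdivrMl// mulrC; move: lY'; rewrite /L; lra.
have cw : {within `[Y0, Y1], continuous H'}.
  apply: continuous_in_subspaceT => Y; rewrite inE/= in_itv/= => /andP[hY _]; exact: cH'.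
have HE : (\int[mu]_(Y in `[Y0, Y1]) (H' Y)%:E = (H Y1 - H Y0)%:E)%E.
  have dH1 Y : Y0 <= Y <= Y1 -> is_derive Y (1 : R) H (H' Y) by move=> /andP[hY _]; exact: dH.
  exact: (FTC_cc (ltW Y01') dH1 cw).
pose f (Y : R) := `|stail Y| `^ q * Y `^ r.
have f0 Y : 0 <= f Y by rewrite mulr_ge0 ?powR_ge0.
have mf (D : set R) : measurable_fun D f.
  apply: measurable_funTS; apply: measurable_funM; last exact: measurable_powR.
  apply: measurable_fun_powRc; apply: measurableT_comp => //.
  exact: continuous_measurable_fun continuous_stail.
apply: (@lt_le_trans _ _ (\int[mu]_(Y in `[Y0, Y1]) (f Y)%:E)%E); last first.
  rewrite -integral_itv_obnd_cbnd; last by apply/measurable_EFinP; exact: mf.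
  rewrite -integral_itv_bndo_bndc; last by apply/measurable_EFinP; exact: mf.
  apply: ge0_subset_integral => //.
  - by apply/measurable_EFinP; exact: mf.
  - by move=> Y _; rewrite lee_fin.
  move=> Y /=; rewrite !in_itv/= => /andP[h1 ->]; rewrite andbT.
  by apply: lt_trans h1; apply: lt_le_trans Y01.
apply: (@lt_le_trans _ _ (H Y1 - H Y0)%:E); first by rewrite lte_fin.
rewrite -HE.
have [fin|] := ltP (\int[mu]_(Y in `[Y0, Y1]) (f Y)%:E)%E +oo%E; last by rewrite leye_eq => /eqP ->; rewrite leey.
apply: le_integral => //.
- exact: (continuous_compact_integrable (@segment_compact R Y0 Y1) cw).
- apply/integrableP; split; first by apply/measurable_EFinP; exact: mf.
  by under eq_integral do rewrite /= (ger0_norm (f0 _)).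
by move=> Y; rewrite inE/= in_itv/= => /andP[hY _]; rewrite lee_fin; exact: pt.
Qed.

End SonineTail.

(** * Necessity *)

Section NecessityCore.
Variables (R : realType) (nu de : R) (s : nat -> R).
Hypotheses (nu2 : - (1 / 2) < nu) (hs : bessel_zeros nu s) (de0 : 0 < de).
Notation b := (nu + 1 / 2).
Notation mu := (@lebesgue_measure R).
Notation ev := (ev nu s).
Notation lcomb := (lcomb nu s).
Implicit Types (x y T Y : R).

Let nu1 : -1 < nu. Proof. by move: nu2 => h; lra. Qed.

Lemma fb_coef_ip f j : fb_coef nu s f j = ip nu f (ev j).
Proof.
apply: eq_Rintegral => y; rewrite inE/= in_itv/= => /andP[y0 _].
by rewrite (psi_ev nu1 hs)// mulrA.
Qed.

Lemma fb_coef_lcomb n (al : 'I_n -> R) (j : 'I_n) : fb_coef nu s (lcomb al) j = al j.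
Proof.
have ce := @continuous_ev R nu s nu1.
rewrite fb_coef_ip ip_lcombl//.
under eq_bigr do rewrite (ip_ev nu1 hs).
rewrite (bigD1 j)//= eqxx mulr1 big1 ?addr0// => i ij.
by rewrite (_ : (i == j :> nat) = false) ?mulr0//; apply/negbTE.
Qed.

Lemma BR_lcomb n (al : 'I_n -> R) T x : 0 < T -> T <= s n -> 0 < x ->
  BR nu de s (lcomb al) T x = lcomb (fun j : 'I_n => msym de (s j / T) * al j) x.
Proof.
move=> T0 Tn x0; rewrite (BR_sum nu1 hs de0 _ T0 Tn x0); apply: eq_bigr => j _.
by rewrite fb_coef_lcomb.
Qed.

(** Since phi(0) = 1, [ncoef] is the value of the eigenfunction at 0, so these are the coefficients
    of a Riesz kernel of order N with pole at 0. Its frequency is 2 T, so that on s_j <= T the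
    symbol has no singularity of its own. *)
Definition dirac_coef N T n (j : 'I_n) : R := msym N%:R (s j / (2 * T)) * ncoef nu (s j).

Lemma ev0 j : ev j 0 = ncoef nu (s j).
Proof. by rewrite evE mulr0 phi0// mulr1. Qed.

(** [kernel_bound] of order N with the second point tending to 0 from the right. *)
Lemma dirac_bound N : (0 < N)%N -> exists2 C : R, 0 < C & forall T n x, 0 < T -> 2 * T <= s n -> 0 < x < 1 ->
  `|lcomb (@dirac_coef N T n) x| <= C * (2 * T) `^ (2 * b + 1) * (1 + 2 * T * x) `^ (- (1 + N%:R + b)).
Proof.
move=> N0; have hn := nu2; have Np : 0 < N%:R :> R by rewrite ltr0n.
have [C C0 hC] := kernel_bound nu1 hs Np.
exists (C * 2 `^ (1 + N%:R)); first by rewrite mulr_gt0// powR_gt0.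
move=> T n x T0 Tn x01; have /andP[x0 x1] := x01.
pose U := 2 * T; have U0 : 0 < U by rewrite mulr_gt0.
rewrite -/U; have Ui : 0 < U^-1 by rewrite invr_gt0.
have u1 : 0 < 1 + U * x by rewrite addr_gt0// mulr_gt0.
have cv : `|\sum_(j < n) msym N%:R (s j / U) * (ev j x * ev j y)| @[y --> 0^'+] --> `|lcomb (@dirac_coef N T n) x|.
  have -> : lcomb (@dirac_coef N T n) x = \sum_(j < n) msym N%:R (s j / U) * (ev j x * ev j 0).
    by apply: eq_bigr => j _; rewrite ev0 /dirac_coef -/U; ring.
  apply: cvg_norm; apply: cvg_at_right_filter.
  apply: (csum (F := fun j y => msym N%:R (s j / U) * (ev j x * ev j y))) => j.
  by apply: cM; [exact: ccst|apply: cM; [exact: ccst|exact: continuous_ev]].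
have UTn : U <= s n by [].
clearbody U; apply: (cvgr_to_le cv); near=> y.
have y0 : 0 < y by near: y; exact: nbhs_right_gt.
have y2 : y < x / 2 by near: y; apply: nbhs_right_lt; rewrite divr_gt0.
have y01 : 0 < y < 1 by apply/andP; split => //; lra.
apply: (le_trans (hC U x y n U0 UTn x01 y01)).
have h1 : (1 + U * `|x - y|) `^ (-1 - N%:R) <= 2 `^ (1 + N%:R) * (1 + U * x) `^ (- (1 + N%:R)).
  have e1 : -1 - N%:R = - (1 + N%:R) :> R by ring.
  rewrite e1 !powRN ler_pdivlMr ?powR_gt0// ler_pdivrMl; last first.
    by rewrite powR_gt0// ltr_pwDl// mulr_ge0// ltW.
  rewrite -powRM; [|by rewrite addr_ge0// mulr_ge0// ltW|by []].
  apply: ge0_ler_powR; rewrite ?nnegrE ?(ltW u1)//.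
    by rewrite mulr_ge0// addr_ge0// mulr_ge0// ltW.
  have h2 : x / 2 <= `|x - y| by rewrite ger0_norm; lra.
  have : U * (x / 2) <= U * `|x - y| by rewrite ler_pM2l.
  lra.
have hb : 0 < b by lra.
have h2 : (y + U^-1) `^ (- b) <= U `^ b.
  have -> : U `^ b = U^-1 `^ (- b) by rewrite -(powR_inv1 (ltW U0)) -powRrM mulN1r opprK.
  rewrite !powRN lef_pV2 ?posrE ?powR_gt0 ?addr_gt0//.
  by apply: ge0_ler_powR; rewrite ?nnegrE ?(ltW hb) ?(ltW Ui) ?lerDr ?(ltW y0)// addr_ge0// ltW.
rewrite (powR_invT _ x0 U0).
apply: (@le_trans _ _ (C * U * (2 `^ (1 + N%:R) * (1 + U * x) `^ (- (1 + N%:R))) * (U `^ b * (1 + U * x) `^ (- b) * U `^ b))).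
  apply: ler_pM; rewrite ?mulr_ge0 ?powR_ge0 ?(ltW C0) ?(ltW U0)//.
    by rewrite ler_wpM2l// mulr_ge0// ltW.
  by rewrite ler_wpM2l// mulr_ge0 ?powR_ge0.
have -> : U `^ (2 * b + 1) = U * (U `^ b * U `^ b).
  by rewrite -{2}(powRr1 (ltW U0)) -!powRD ?(gt_eqF U0) ?implybT//; congr (_ `^ _); ring.
have -> : (1 + U * x) `^ (- (1 + N%:R + b)) = (1 + U * x) `^ (- (1 + N%:R)) * (1 + U * x) `^ (- b).
  by rewrite -powRD ?(gt_eqF u1) ?implybT//; congr (_ `^ _); ring.
by rewrite le_eqVlt; apply/orP; left; apply/eqP; ring.
Unshelve. all: by end_near.
Qed.

(** The scaling of a unit mass spread over ]0, 1/T[, whose measure is of order T^(-2b-1). The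
    condition on N gives integrable decay beyond 1/T already for q = 1, and [farmaj] with b + 1 in
    place of de serves as majorant. *)
Lemma dirac_Lq q N : 1 <= q -> b + 1 <= N%:R -> exists2 C : R, 0 < C & forall T n, 0 < T -> 2 * T <= s n ->
  (\int[mu]_(x in `]0%R, 1%R[) (`|lcomb (@dirac_coef N T n) x| `^ q * x `^ (2 * nu + 1))%:E <=
   (C * T `^ ((2 * b + 1) * (q - 1)))%:E)%E.
Proof.
move=> q1 Nb; have hn := nu2; have q0 : 0 < q by lra.
have N0 : (0 < N)%N by rewrite -(ltr0n R); lra.
have [C C0 hC] := dirac_bound N0.
have b1 : - (1 / 2) < b by lra.
have bb : b < b + 1 by lra.
pose G : R := 2 `^ (2 * b + 1) / (2 * b + 1) + 2 `^ (b + 1 - Num.max b 0) / (b + 1 - Num.max b 0).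
have mx : Num.max b 0 = b by apply/max_idPl; lra.
have G0 : 0 < G.
  by rewrite /G mx; apply: addr_gt0; apply: divr_gt0; rewrite ?powR_gt0//; lra.
exists (C `^ q * 2 `^ ((2 * b + 1) * (q - 1)) * G); first by rewrite !mulr_gt0 ?powR_gt0.
move=> T n T0 Tn; pose U := 2 * T; have U0 : 0 < U by rewrite mulr_gt0.
have pt x : 0 < x < 1 -> `|lcomb (@dirac_coef N T n) x| `^ q * x `^ (2 * nu + 1) <=
    C `^ q * U `^ ((2 * b + 1) * (q - 1)) * farmaj b (b + 1) U x.
  move=> x01; have /andP[x0 x1] := x01.
  have v0 : 0 < U * x by rewrite mulr_gt0.
  have u1 : 0 < 1 + U * x by lra.
  have h := hC T n x T0 Tn x01; rewrite -/U in h.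
  apply: (@le_trans _ _ ((C * U `^ (2 * b + 1) * (1 + U * x) `^ (- (1 + N%:R + b))) `^ q * x `^ (2 * nu + 1))).
    rewrite ler_wpM2r ?powR_ge0//; apply: ge0_ler_powR; rewrite ?nnegrE ?(ltW q0)//.
    by rewrite !mulr_ge0 ?powR_ge0// ltW.
  rewrite (powRM _ (mulr_ge0 (ltW C0) (powR_ge0 _ _)) (powR_ge0 _ _)) (powRM _ (ltW C0) (powR_ge0 _ _)) -!powRrM.
  have -> : U `^ ((2 * b + 1) * q) = U `^ ((2 * b + 1) * (q - 1)) * U `^ (2 * b + 1).
    by rewrite -powRD ?(gt_eqF U0) ?implybT//; congr (_ `^ _); ring.
  have b2 : 2 * nu + 1 = 2 * b by field.
  have -> : C `^ q * (U `^ ((2 * b + 1) * (q - 1)) * U `^ (2 * b + 1)) * (1 + U * x) `^ (- (1 + N%:R + b) * q) * x `^ (2 * nu + 1) =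
    C `^ q * U `^ ((2 * b + 1) * (q - 1)) * (U `^ (2 * b + 1) * (1 + U * x) `^ (- (1 + N%:R + b) * q) * x `^ (2 * nu + 1)) by ring.
  rewrite ler_wpM2l ?mulr_ge0 ?powR_ge0// b2.
  have ex : - (1 + N%:R + b) * q <= - (2 * b + 2).
    rewrite mulNr lerN2; apply: (@le_trans _ _ (1 + N%:R + b)); first by lra.
    by rewrite ler_peMr//; lra.
  have u2 : (1 + U * x) `^ (- (1 + N%:R + b) * q) <= (1 + U * x) `^ (- (2 * b + 2)).
    by apply: ler_powR => //; lra.
  apply: (@le_trans _ _ (U `^ (2 * b + 1) * (1 + U * x) `^ (- (2 * b + 2)) * x `^ (2 * b))).
    by rewrite ler_wpM2r ?powR_ge0// ler_wpM2l ?powR_ge0.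
  rewrite /farmaj; case: ifPn => [_|]; last rewrite -ltNge => Ux1.
    rewrite [1 + 2 * b]addrC mulrAC ler_piMr ?mulr_ge0 ?powR_ge0//.
    by rewrite -[leRHS](powRr0 (1 + U * x)); apply: ler_powR; clear -v0 b1; lra.
  have -> : b + 1 - Num.max b 0 = 1 by rewrite mx; ring.
  apply: (@le_trans _ _ (U `^ (2 * b + 1) * (U * x) `^ (- (2 * b + 2)) * x `^ (2 * b))).
    rewrite ler_wpM2r ?powR_ge0// ler_wpM2l ?powR_ge0// !powRN lef_pV2 ?posrE ?powR_gt0//.
    by apply: ge0_ler_powR; rewrite ?nnegrE ?(ltW v0) ?(ltW u1)//; clear -v0 b1; lra.
  rewrite (@powRM _ U x _ (ltW U0) (ltW x0)) mulrA -powRD ?(gt_eqF U0) ?implybT// -mulrA -powRD ?(gt_eqF x0) ?implybT//.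
  by rewrite le_eqVlt; apply/orP; left; apply/eqP; congr (_ `^ _ * _ `^ _); ring.
have cf0 : 0 <= C `^ q * U `^ ((2 * b + 1) * (q - 1)) by rewrite mulr_ge0 ?powR_ge0.
apply: (@le_trans _ _ (\int[mu]_(x in `]0%R, 1%R[) ((C `^ q * U `^ ((2 * b + 1) * (q - 1)))%:E * (farmaj b (b + 1) U x)%:E))%E).
  apply: integral_mono => x; first by move=> _; rewrite lee_fin mulr_ge0 ?powR_ge0.
  by rewrite /= in_itv/= => x01; rewrite -EFinM lee_fin; exact: pt.
rewrite ge0_integralZl//; last 2 first.
- by apply/measurable_EFinP; apply: measurable_funTS; exact: measurable_farmaj.
- by move=> x _; rewrite lee_fin farmaj_ge0.
apply: (@le_trans _ _ ((C `^ q * U `^ ((2 * b + 1) * (q - 1)))%:E * G%:E)%E).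
  by apply: lee_wpmul2l; [rewrite lee_fin|apply: integral_farmaj => //; lra].
rewrite -EFinM lee_fin /U powRM ?(ltW T0)//.
by rewrite le_eqVlt; apply/orP; left; apply/eqP; ring.
Qed.

End NecessityCore.

Section RieszKernelLimit.
Variable R : realType.
Notation mu := (@lebesgue_measure R).
Implicit Types (x y Y : R) (F : R -> R).

Lemma cvg_powR_ge0 (u : nat -> R) (l q : R) : 0 < q -> (forall k, 0 <= u k) -> u k @[k --> \oo] --> l ->
  u k `^ q @[k --> \oo] --> l `^ q.
Proof.
move=> q0 u0 ul; have l0 : 0 <= l by apply: (cvgr_to_ge ul); exists 0%N.
have := cvg_comp _ _ ul (@continuous_pospowR R q q0 l); rewrite (max_idPr l0).
have -> // : ((fun y => Num.max 0 y `^ q) \o u) = (fun k => u k `^ q).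
by apply/funext => k /=; rewrite (max_idPr (u0 k)).
Qed.

Lemma limn_einf_le (u : (\bar R)^nat) (B : \bar R) : (forall n, (u n <= B)%E) -> (limn_einf u <= B)%E.
Proof.
move=> uB; rewrite limn_einf_lim; apply: lime_le; first exact: is_cvg_einfs.
apply: nearW => n; apply: le_trans (uB n).
by apply: ereal_inf_lbound; exists n => /=.
Qed.

Lemma weighted_antiderivative F (B r : R) : 0 < r -> continuous F -> (forall x, `|F x| <= B) ->
  exists Phi : R -> R, [/\ forall x, 0 < x -> is_derive x (1 : R) Phi (F x * x `^ r),
    forall x, 0 < x -> `|Phi x| <= B * x `^ (r + 1) / (r + 1) &
    Phi 1 = \int[mu]_(x in `]0, 1[) (F x * x `^ r)].
Proof.
move=> r0 cF FB; have r1 : 0 < r + 1 by lra.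
have B0 : 0 <= B by exact: le_trans (normr_ge0 _) (FB 0).
(* Truncation makes the weight continuous on the whole line, and it agrees with x^r where it is
   integrated. *)
pose f x := F x * Num.max 0 x `^ r.
have cf : continuous f by apply: cM => //; exact: continuous_pospowR.
have fint (a c : R) : mu.-integrable `[a, c] (EFin \o f).
  apply: (continuous_compact_integrable (@segment_compact R a c)).
  exact: continuous_subspaceT.
exists (fun x => \int[mu]_(t in `[0, x]) f t); split.
- move=> x x0; have [d1 d2] := continuous_FTC1_closed (ltr_pwDr ltr01 (lexx x)) (fint 0 (x + 1)) x0 (cf x).
  have fx : f x = F x * x `^ r by rewrite /f (max_idPr (ltW x0)).
  by rewrite -fx -d2 derive1E; exact: (DeriveDef d1 erefl).
- move=> x x0; have mI : measurable (`[0, x]%classic : set R) by exact: measurable_itv.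
  rewrite -lee_fin EFin_normr_Rintegral; [|exact: mI|exact: fint].
  apply: le_trans; first by apply: le_abse_integral => //; exact: measurable_int (fint 0 x).
  have mf (D : set R) : measurable_fun D (fun t => (`|f t|)%:E).
    by apply/measurable_EFinP; apply: measurable_funTS; apply: measurableT_comp => //; exact: continuous_measurable_fun.
  rewrite /= -integral_itv_obnd_cbnd// -integral_itv_bndo_bndc//.
  apply: (@le_trans _ _ (\int[mu]_(t in `]0%R, x[) (B%:E * (t `^ (r + 1 - 1))%:E))%E).
    apply: integral_mono => t; first by move=> _; rewrite lee_fin.
    rewrite /= in_itv/= => /andP[t0 _]; rewrite -EFinM lee_fin /f (max_idPr (ltW t0)) addrK.
    by rewrite normrM (ger0_norm (powR_ge0 _ _)) ler_wpM2r ?powR_ge0.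
  rewrite ge0_integralZl//; last 2 first.
  - by apply/measurable_EFinP; apply: measurable_funTS; exact: measurable_powR.
  - by move=> t _; rewrite lee_fin powR_ge0.
  by rewrite integral_powR_oo ?(ltW x0)// -EFinM mulrA.
have fint1 : mu.-integrable (`]0, 1] : set R) (EFin \o f).
  by apply: (@integrableS _ _ _ mu `[0, 1]) => //; exact: subset_itv_oc_cc.
have fint2 : mu.-integrable (`]0, 1[ : set R) (EFin \o f).
  by apply: (@integrableS _ _ _ mu `[0, 1]) => //; exact: subset_itv_oo_cc.
rewrite -Rintegral_itv_obnd_cbnd; last exact: fint1.
rewrite -Rintegral_itv_bndo_bndc; last exact: fint2.
by apply: eq_Rintegral => t; rewrite inE/= in_itv/= => /andP[t0 _]; rewrite /f (max_idPr (ltW t0)).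
Qed.

End RieszKernelLimit.

Section NecessityCore2.
Variables (R : realType) (nu de : R) (s : nat -> R).
Hypotheses (nu2 : - (1 / 2) < nu) (hs : bessel_zeros nu s) (de0 : 0 < de).
Notation b := (nu + 1 / 2).
Notation mu := (@lebesgue_measure R).
Notation ev := (ev nu s).
Notation lcomb := (lcomb nu s).
Implicit Types (x y T Y : R).

Let nu1 : -1 < nu. Proof. by move: nu2 => h; lra. Qed.

(** Uniform boundedness of the single means on finite combinations of eigenfunctions. This weaker
    property, unlike a bound for the maximal operator, passes to the conjugate exponent by
    self-adjointness. *)
Definition span_bounded q (C : R) := forall T n (al : 'I_n -> R), 0 < T -> T <= s n ->
  (\int[mu]_(x in `]0%R, 1%R[) (`|BR nu de s (lcomb al) T x| `^ q * x `^ (2 * nu + 1))%:E <=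
   C%:E * \int[mu]_(x in `]0%R, 1%R[) (`|lcomb al x| `^ q * x `^ (2 * nu + 1))%:E)%E.

(** At the point Y/T the mean of the approximate mass is a Riemann sum of msym_de(x) msym_N(x/2)
    phi(x Y), whose integral is [sonine_poly]. T runs through the positive integers to give
    sequences for Fatou's lemma. *)
Lemma riesz_dirac_cvg N (nT : nat -> nat) : (0 < N)%N ->
  (forall k : nat, 2 * k.+1%:R <= s (nT k)) -> exists2 K : R, 0 < K & exists al : 'I_N.+1 -> R, 0 < al ord0 /\
  forall Y, 0 < Y ->
  lcomb (fun j : 'I_(nT k) => msym de (s j / k.+1%:R) * dirac_coef nu s N k.+1%:R j) (Y / k.+1%:R) /
     k.+1%:R `^ (2 * nu + 2) @[k --> \oo] --> K * stail (nu + de + 1) al Y.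
Proof.
move=> N0 hn; have hnu := nu2; have [K K0 hK] := riemann_sum nu2 hs.
have [al [al0 hal]] := sonine_poly nu1 de0 N0; exists K => //; exists al; split => // Y Y0.
pose F x := msym de x * msym N%:R (x / 2) * phi nu (x * Y).
have Np : 0 < N%:R :> R by rewrite ltr0n.
have cF : continuous F.
  apply: cM; first apply: cM; first exact: continuous_msym.
    by apply: (ccomp (continuous_msym Np)); apply: cM; [exact: cid|exact: ccst].
  by apply: (ccomp (continuous_phi nu1)); apply: cM; [exact: cid|exact: ccst].
have F1 x : 1 <= x -> F x = 0.
  by move=> x1; rewrite /F msym_out ?mul0r// ger0_norm//; apply: le_trans x1.
have [B FB] : exists B, forall x, `|F x| <= B.
  have [B [B0 hB]] := continuous_bounded_itv (-1) 1 cF; exists B => x.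
  have [x1|x1] := leP 1 `|x|; first by rewrite /F msym_out// !mul0r normr0 ltW.
  by apply: hB; rewrite -ler_norml ltW.
have r0 : 0 < 2 * nu + 1 by lra.
have [Phi [dPhi Phi0 Phi1]] := weighted_antiderivative r0 cF FB.
have rq : 2 * nu + 1 + 1 = 2 * nu + 2 by ring.
rewrite rq in Phi0.
have P1 : Phi 1 = stail (nu + de + 1) al Y by rewrite Phi1 /stail -hal.
have lim := hK F Phi B cF FB F1 dPhi Phi0.
apply/cvgrPdist_le => e e0; have [T0 hT] := lim e e0.
near=> k.
have T0k : T0 <= k.+1%:R.
  apply: (@le_trans _ _ k%:R); last by rewrite ler_nat.
  by near: k; exact: nbhs_infty_ger.
have kp : 0 < k.+1%:R :> R by rewrite ltr0n.
have ks : k.+1%:R <= s (nT k) by apply: le_trans (hn k); lra.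
have := hT k.+1%:R (nT k) T0k kp ks; rewrite distrC P1.
rewrite (_ : \sum_(j < nT k) ncoef nu (s j) ^+ 2 * F (s j / k.+1%:R) =
  lcomb (fun j : 'I_(nT k) => msym de (s j / k.+1%:R) * dirac_coef nu s N k.+1%:R j) (Y / k.+1%:R))//.
apply: eq_bigr => j _; rewrite /F /dirac_coef evE.
have -> : s j / (2 * k.+1%:R) = s j / k.+1%:R / 2 by field; rewrite gt_eqF.
have -> : s j * (Y / k.+1%:R) = s j / k.+1%:R * Y by ring.
by ring.
Unshelve. all: by end_near.
Qed.

(** In the variable Y = T x both sides of the assumed bound scale alike, so the rescaled means have
    integrals bounded by C C3 for all T. Fatou's lemma transfers this to the limit on every ]0, Y1[,
    against [stail_diverges] with m = nu + de + 1. *)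
Lemma span_unbounded q C : 1 <= q -> 0 <= C -> q * (b + 1 + de) <= 2 * b + 1 -> ~ span_bounded q C.
Proof.
move=> q1 C0 qb hC; have hn := nu2; have hd := de0; have q0 : 0 < q by lra.
pose N := (Num.truncn (b + 1)).+1.
have Nb : b + 1 <= N%:R by rewrite ltW// truncnS_gt.
have N0 : (0 < N)%N by [].
pose p := 2 * nu + 2; have p0 : 0 < p by rewrite /p; lra.
have [C3 C30 hC3] := dirac_Lq nu2 hs q1 Nb.
have exn (k : nat) : exists n, 2 * k.+1%:R <= s n.
  by have [n hn'] := s_cvg_pinfty nu1 hs (2 * k.+1%:R); exists n; exact: hn'.
have [nT hT] : exists nT : nat -> nat, forall k : nat, 2 * k.+1%:R <= s (nT k).
  by have /boolp.choice[nT h] := exn; exists nT.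
have [K K0 [al [al0 lim]]] := riesz_dirac_cvg N0 hT.
pose G k := lcomb (fun j : 'I_(nT k) => msym de (s j / k.+1%:R) * dirac_coef nu s N k.+1%:R j).
have cG k : continuous (G k) by exact: continuous_lcomb.
have r0 : 0 < 2 * nu + 1 by lra.
(* msym 1 is a continuous cutoff to ]0, 1[; after rescaling it is evaluated at Y/T and tends to
   1. *)
pose g k x := (`|G k x| / k.+1%:R `^ p) `^ q * Num.max 0 x `^ (2 * nu + 1) * msym 1 x.
have Gp k x : 0 <= `|G k x| / k.+1%:R `^ p by rewrite divr_ge0 ?powR_ge0.
have g0 k x : 0 <= g k x by rewrite !mulr_ge0 ?powR_ge0.
have cg k : continuous (g k).
  apply: cM; first apply: cM.
  - have -> : (fun x => (`|G k x| / k.+1%:R `^ p) `^ q) = (fun x => Num.max 0 (`|G k x| / k.+1%:R `^ p) `^ q).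
      by apply/funext => x; rewrite (max_idPr (Gp k x)).
    apply: (ccomp (continuous_pospowR q0)); apply: cM; last exact: ccst.
    by move=> x; apply: cvg_norm; exact: cG.
  - exact: continuous_pospowR.
  - exact: continuous_msym.
have gint k : (\int[mu]_x (g k x)%:E <= (C * C3 * k.+1%:R `^ (- p))%:E)%E.
  have T0 : 0 < k.+1%:R :> R by rewrite ltr0n.
  have Tp : 0 < k.+1%:R `^ p :> R by rewrite powR_gt0.
  have Tn : k.+1%:R <= s (nT k) by apply: le_trans (hT k); lra.
  apply: (@le_trans _ _ (\int[mu]_(x in `]0%R, 1%R[) ((k.+1%:R `^ (- p * q))%:E *
      (`|BR nu de s (lcomb (@dirac_coef R nu s N k.+1%:R (nT k))) k.+1%:R x| `^ q * x `^ (2 * nu + 1))%:E))%E).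
    rewrite [leRHS]integral_mkcond; apply: integral_mono => x _; first by rewrite lee_fin.
    rewrite patchE mem_setE in_itv/=; case: ifPn => [/andP[x0 x1]|].
      rewrite -EFinM lee_fin (BR_lcomb nu2 hs de0 _ T0 Tn x0) -/(G k) /g (max_idPr (ltW x0)).
      rewrite powRM ?invr_ge0 ?powR_ge0//.
      have -> : (k.+1%:R `^ p)^-1 `^ q = k.+1%:R `^ (- p * q) :> R by rewrite -powRN -powRrM.
      rewrite [leRHS](_ : _ = `|G k x| `^ q * k.+1%:R `^ (- p * q) * x `^ (2 * nu + 1) * 1); last by ring.
      by rewrite ler_wpM2l ?mulr_ge0 ?powR_ge0// msym_le1.
    rewrite negb_and -!leNgt /g => /orP[x0|x1].
      by rewrite (max_idPl x0) powR0 ?gt_eqF// mulr0 mul0r.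
    by rewrite msym_out ?mulr0// ger0_norm//; apply: le_trans x1.
  have mB : measurable_fun (`]0, 1[ : set R) (fun x => `|BR nu de s (lcomb (@dirac_coef R nu s N k.+1%:R (nT k))) k.+1%:R x| `^ q * x `^ (2 * nu + 1)).
    apply: (eq_measurable_fun (fun x => `|G k x| `^ q * x `^ (2 * nu + 1))).
      move=> x; rewrite inE/= in_itv/= => /andP[x0 x1].
      by rewrite (BR_lcomb nu2 hs de0 _ T0 Tn x0).
    apply: measurable_funTS; apply: measurable_funM; last exact: measurable_powR.
    apply: measurable_fun_powRc; apply: measurableT_comp => //; exact: continuous_measurable_fun.
  rewrite ge0_integralZl//; last 2 first.
  - exact/measurable_EFinP.
  - by move=> x _; rewrite lee_fin mulr_ge0 ?powR_ge0.
  have step := hC k.+1%:R (nT k) (@dirac_coef R nu s N k.+1%:R (nT k)) T0 Tn.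
  have step2 := hC3 k.+1%:R (nT k) T0 (hT k).
  apply: (@le_trans _ _ ((k.+1%:R `^ (- p * q))%:E * (C%:E * (C3 * k.+1%:R `^ ((2 * b + 1) * (q - 1)))%:E))%E).
    apply: lee_wpmul2l; first by rewrite lee_fin powR_ge0.
    by apply: (le_trans step); apply: lee_wpmul2l; rewrite ?lee_fin.
  rewrite -!EFinM lee_fin.
  have -> : k.+1%:R `^ (- p) = k.+1%:R `^ (- p * q) * k.+1%:R `^ ((2 * b + 1) * (q - 1)) :> R.
    by rewrite -powRD ?(gt_eqF T0) ?implybT//; congr (_ `^ _); rewrite /p; field.
  by rewrite le_eqVlt; apply/orP; left; apply/eqP; ring.
(* The change of variables x = Y/T; the factor T^p undoes the decay in [gint]. *)
pose h k Y := k.+1%:R `^ p * (g k (k.+1%:R^-1 * (Y - 0)) * k.+1%:R^-1).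
have hint k : (\int[mu]_Y (h k Y)%:E <= (C * C3)%:E)%E.
  have T0 : 0 < k.+1%:R :> R by rewrite ltr0n.
  have Ti : 0 < k.+1%:R^-1 :> R by rewrite invr_gt0.
  have Tp : 0 < k.+1%:R `^ p :> R by rewrite powR_gt0.
  have -> : (\int[mu]_Y (h k Y)%:E = (k.+1%:R `^ p)%:E * \int[mu]_x (g k x)%:E)%E.
    rewrite (integral_shift_scale 0 Ti (cg k) (g0 k)) -ge0_integralZl//.
    - apply/measurable_EFinP; apply: continuous_measurable_fun.
      apply: cM; last exact: ccst.
      by apply: (ccomp (cg k)); apply: cM; [exact: ccst|apply: cB; [exact: cid|exact: ccst]].
    - by move=> x _; rewrite lee_fin mulr_ge0// ltW.
  apply: (@le_trans _ _ ((k.+1%:R `^ p)%:E * (C * C3 * k.+1%:R `^ (- p))%:E)%E).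
    by apply: lee_wpmul2l; [rewrite lee_fin ltW|exact: gint].
  by rewrite -EFinM lee_fin powRN mulrCA divff ?gt_eqF// mulr1.
have h0 k Y : 0 <= h k Y by rewrite !mulr_ge0 ?powR_ge0 ?invr_ge0.
have mh k : measurable_fun setT (EFin \o h k).
  apply/measurable_EFinP; apply: continuous_measurable_fun.
  apply: cM; first exact: ccst.
  apply: cM; last exact: ccst.
  by apply: (ccomp (cg k)); apply: cM; [exact: ccst|apply: cB; [exact: cid|exact: ccst]].
have hlim Y : 0 < Y -> h k Y @[k --> \oo] --> (K * `|stail (nu + de + 1) al Y|) `^ q * Y `^ (2 * nu + 1).
  move=> Y0.
  have e k : h k Y = (`|G k (Y / k.+1%:R)| / k.+1%:R `^ p) `^ q * Y `^ (2 * nu + 1) * msym 1 (Y / k.+1%:R).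
    have T0 : 0 < k.+1%:R :> R by rewrite ltr0n.
    rewrite /h subr0 [_^-1 * Y]mulrC /g (max_idPr (_ : 0 <= Y / k.+1%:R)) ?divr_ge0 ?(ltW Y0)//.
    rewrite powRM ?invr_ge0 ?(ltW Y0) ?(ltW T0)//.
    have -> : k.+1%:R `^ p = k.+1%:R * k.+1%:R `^ (2 * nu + 1) :> R.
      by rewrite -{2}(powRr1 (ltW T0)) -powRD ?(gt_eqF T0) ?implybT//; congr (_ `^ _); rewrite /p; ring.
    have -> : k.+1%:R^-1 `^ (2 * nu + 1) = (k.+1%:R `^ (2 * nu + 1))^-1 :> R.
      by rewrite -(powR_inv1 (ltW T0)) -powRrM mulN1r powRN.
    have Tr : 0 < k.+1%:R `^ (2 * nu + 1) :> R by rewrite powR_gt0.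
    by field; rewrite !gt_eqF.
  rewrite (_ : (fun k => h k Y) = (fun k => (`|G k (Y / k.+1%:R)| / k.+1%:R `^ p) `^ q * Y `^ (2 * nu + 1) * msym 1 (Y / k.+1%:R))); last first.
    by apply/funext => k; rewrite e.
  rewrite -[X in _ --> X]mulr1; apply: cvgM.
    apply: cvgM; last exact: cvg_cst.
    apply: cvg_powR_ge0 => //.
    rewrite -[K]gtr0_norm// -normrM.
    rewrite (_ : (fun k => _) = (fun k => `|G k (Y / k.+1%:R) / k.+1%:R `^ p|)).
      by apply: cvg_norm; exact: lim.
    by apply/funext => k; rewrite normrM [X in _ = _ * X]ger0_norm// invr_ge0 powR_ge0.
  have m1 : msym 1 (0 : R) = 1 by rewrite msym_in ?normr0// expr0n subr0 powR1.
  have c0 : (Y / k.+1%:R) @[k --> \oo] --> (0 : R).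
    rewrite (_ : (0 : R) = Y * 0); last by rewrite mulr0.
    by apply: cvgM; [exact: cvg_cst|exact: cvg_harmonic].
  have := cvg_comp _ _ c0 (@continuous_msym R 1 ltr01 0).
  by rewrite m1.
have m1 : -1 < nu + de + 1 by lra.
have Kq : 0 < K `^ q by rewrite powR_gt0.
have qm : q * (nu + de + 1 + 1 / 2) <= 2 * nu + 1 + 1.
  have -> : nu + de + 1 + 1 / 2 = b + 1 + de by ring.
  by apply: (le_trans qb); lra.
have [Y1 [Y10 big]] := stail_diverges m1 al0 (C * C3 / K `^ q) q1 (ltW r0) qm.
have mD : measurable (`]0, Y1[%classic : set R) by exact: measurable_itv.
have := fatou mu mD (fun k => measurable_funTS (mh k)) (fun k x _ => h0 k x).
apply/negP; rewrite -ltNge.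
apply: (@le_lt_trans _ _ (C * C3)%:E).
  apply: limn_einf_le => k; apply: le_trans (hint k).
  apply: ge0_subset_integral => //; [exact: mh|by move=> x _; exact: h0].
apply: (@lt_le_trans _ _ ((K `^ q)%:E * \int[mu]_(Y in `]0%R, Y1[) (`|stail (nu + de + 1) al Y| `^ q * Y `^ (2 * nu + 1))%:E)%E).
  by rewrite -lte_pdivrMl// -EFinM mulrC.
have ms : measurable_fun (`]0, Y1[ : set R) (fun Y => `|stail (nu + de + 1) al Y| `^ q * Y `^ (2 * nu + 1)).
  apply: measurable_funTS; apply: measurable_funM; last exact: measurable_powR.
  apply: measurable_fun_powRc; apply: measurableT_comp => //.
  by apply: continuous_measurable_fun; exact: continuous_stail.
rewrite -ge0_integralZl//; last 3 first.
- exact/measurable_EFinP.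
- by move=> Y _; rewrite lee_fin mulr_ge0 ?powR_ge0.
- by rewrite lee_fin ltW.
apply: integral_mono => Y; first by move=> _; rewrite -EFinM lee_fin !mulr_ge0 ?powR_ge0.
rewrite /= in_itv/= => /andP[Y0 _].
have c : ((h k Y)%:E @[k --> \oo] --> ((K * `|stail (nu + de + 1) al Y|) `^ q * Y `^ (2 * nu + 1))%:E)%E.
  by apply: cvg_EFin; [exact: nearW|exact: hlim].
have [-> _] := cvg_limn_einf_sup c.
by rewrite -EFinM lee_fin powRM ?(ltW K0)// mulrA.
Qed.

End NecessityCore2.

(** * Boundedness at the conjugate exponent *)

Section Duality.
Variables (R : realType) (nu de : R) (s : nat -> R).
Hypotheses (nu2 : - (1 / 2) < nu) (hs : bessel_zeros nu s) (de0 : 0 < de).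
Notation b := (nu + 1 / 2).
Notation mu := (@lebesgue_measure R).
Notation ev := (ev nu s).
Notation lcomb := (lcomb nu s).
Implicit Types (x y T Y : R) (f : R -> R).

Let nu1 : -1 < nu. Proof. by move: nu2 => h; lra. Qed.

Definition Lp_bounded (p : \bar R) (C : R) := forall f : R -> R,
  measurable_fun (`]0%R, 1%R[ : set R) f -> (Lpnorm nu p (EFin \o f) < +oo)%E ->
  (Lpnorm nu p (Bmax nu de s f) <= C%:E * Lpnorm nu p (EFin \o f))%E.

Lemma BR_le_Bmax f T x : 0 < T -> ((`|BR nu de s f T x|)%:E <= Bmax nu de s f x)%E.
Proof. by move=> T0; apply: ereal_sup_ubound; exists T => //=; rewrite in_itv/= T0. Qed.

Lemma Bmax_ge0 f x : (0 <= Bmax nu de s f x)%E.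
Proof. by apply: le_trans (BR_le_Bmax f x ltr01); rewrite lee_fin. Qed.

Definition pint (p : R) f : \bar R := (\int[mu]_(x in `]0%R, 1%R[) (`|f x| `^ p * x `^ (2 * nu + 1))%:E)%E.

Lemma pint_ge0 p f : (0 <= pint p f)%E.
Proof. by apply: integral_ge0 => x _; rewrite lee_fin mulr_ge0 ?powR_ge0. Qed.

Lemma LpnormE p f : Lpnorm nu p%:E (EFin \o f) = ((pint p f) `^ p^-1)%E.
Proof. by []. Qed.

Lemma Lp_bounded_pint (p C : R) f T : 1 < p -> Lp_bounded p%:E C -> 0 < T ->
  measurable_fun (`]0%R, 1%R[ : set R) f -> (pint p f < +oo)%E ->
  (pint p (BR nu de s f T) <= (`|C| `^ p)%:E * pint p f)%E.
Proof.
move=> p1 hC T0 mf fin; have p0 : 0 < p by lra.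
have pi0 : 0 < p^-1 by rewrite invr_gt0.
have I0 := pint_ge0 p f.
have Nfin : (Lpnorm nu p%:E (EFin \o f) < +oo)%E.
  rewrite LpnormE; move: fin I0; case: (pint p f) => // v _ _; by rewrite poweR_EFin ltry.
have h := hC f mf Nfin.
have h1 : (pint p (BR nu de s f T) `^ p^-1 <= `|C|%:E * pint p f `^ p^-1)%E.
  apply: (@le_trans _ _ (Lpnorm nu p%:E (Bmax nu de s f))).
    rewrite -LpnormE; apply: le_poweR; [exact: ltW|exact: pint_ge0|].
    apply: integral_mono => x _; first by rewrite mule_ge0 ?poweR_ge0// lee_fin powR_ge0.
    rewrite lee_wpmul2r ?lee_fin ?powR_ge0//; apply: le_poweR; [exact: ltW|exact: abse_ge0|].
    by rewrite (gee0_abs (Bmax_ge0 f x)); exact: BR_le_Bmax.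
  apply: (le_trans h); rewrite LpnormE; apply: lee_wpmul2r; first exact: poweR_ge0.
  by rewrite lee_fin ler_norm.
have := le_poweR (ltW p0) (poweR_ge0 _ _) h1.
have Ce : (0 <= `|C|%:E)%E by rewrite lee_fin.
have pK (x : \bar R) : (0 <= x)%E -> ((x `^ p^-1) `^ p = x)%E.
  by move=> x0; rewrite -poweRrM mulVf ?lt0r_neq0// poweRe1.
rewrite (pK _ (pint_ge0 _ _)) => /le_trans; apply.
apply: (@le_trans _ _ ((`|C|%:E `^ p) * ((pint p f `^ p^-1) `^ p))%E); first by rewrite (poweRM p Ce (poweR_ge0 _ _)).
by rewrite (pK _ I0) poweR_EFin.
Qed.

Lemma pint_bounded p f M : 0 <= p -> (forall x, 0 < x < 1 -> `|f x| <= M) -> (pint p f < +oo)%E.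
Proof.
move=> p0 fM; have h := nu1; have r0 : 0 < 2 * nu + 2 by lra.
have M0 : 0 <= M by apply: le_trans (normr_ge0 _) (fM (1 / 2) _); apply/andP; split; lra.
apply: (@le_lt_trans _ _ (\int[mu]_(x in `]0%R, 1%R[) ((M `^ p)%:E * (x `^ (2 * nu + 2 - 1))%:E))%E).
  apply: integral_mono => x; first by move=> _; rewrite lee_fin mulr_ge0 ?powR_ge0.
  rewrite /= in_itv/= => x01; rewrite -EFinM lee_fin.
  have -> : 2 * nu + 2 - 1 = 2 * nu + 1 by ring.
  rewrite ler_wpM2r ?powR_ge0//; apply: ge0_ler_powR; rewrite ?nnegrE//; exact: fM.
rewrite ge0_integralZl//; last 3 first.
- by apply/measurable_EFinP; apply: measurable_funTS; exact: measurable_powR.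
- by move=> x _; rewrite lee_fin powR_ge0.
- by rewrite lee_fin powR_ge0.
by rewrite integral_powR_oo// -EFinM ltry.
Qed.

Lemma continuous_bounded01 f : continuous f -> exists M, forall x, 0 < x < 1 -> `|f x| <= M.
Proof.
move=> cf; have [M [_ hM]] := continuous_bounded_itv 0 1 cf; exists M => x /andP[x0 x1].
by apply: hM; rewrite !ltW.
Qed.

Lemma continuous_norm_powR q f : 0 < q -> continuous f -> continuous (fun x => `|f x| `^ q).
Proof.
move=> q0 cf; have -> : (fun x => `|f x| `^ q) = (fun x => Num.max 0 `|f x| `^ q).
  by apply/funext => x; rewrite (max_idPr (normr_ge0 _)).
by apply: (ccomp (continuous_pospowR q0)) => x; apply: cvg_norm; exact: cf.
Qed.

Lemma pint_continuous q f : 0 < q -> continuous f -> pint q f = (wint nu (fun x => `|f x| `^ q))%:E.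
Proof.
move=> q0 cf; have cq := continuous_norm_powR q0 cf.
have i := integrable_wgt_continuous nu1 cq.
rewrite /wint /Rintegral fineK//; apply: integrable_fin_num; [exact: measurable_itv|exact: i].
Qed.

Lemma span_bounded_direct p C : 1 < p -> Lp_bounded p%:E C -> span_bounded nu de s p (`|C| `^ p).
Proof.
move=> p1 hC T n al T0 Tn; have cl : continuous (lcomb al) by exact: continuous_lcomb.
apply: Lp_bounded_pint => //.
  by apply: measurable_funTS; exact: continuous_measurable_fun.
have [M hM] := continuous_bounded01 cl; apply: pint_bounded hM; lra.
Qed.

(** The extremal function sign(f) |f|^(q-1), with sign 1 at the zeros of f; for q = 1 it has modulus
    1 everywhere. *)
Definition dualf q f x : R := if 0 <= f x then `|f x| `^ (q - 1) else - `|f x| `^ (q - 1).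

Lemma norm_dualf q f x : `|dualf q f x| = `|f x| `^ (q - 1).
Proof. by rewrite /dualf; case: ifP => _; rewrite ?normrN ger0_norm// powR_ge0. Qed.

Lemma mul_dualf q f x : 1 <= q -> f x * dualf q f x = `|f x| `^ q.
Proof.
move=> q1; have q0 : 0 < q by lra.
rewrite -(mulr_powRB1 (normr_ge0 (f x)) q0) /dualf; case: (leP 0 (f x)) => h.
  by rewrite (ger0_norm h).
by rewrite (ltr0_norm h) mulrN mulNr.
Qed.

Lemma measurable_dualf q f : continuous f -> measurable_fun setT (dualf q f).
Proof.
move=> cf; have mf := continuous_measurable_fun cf.
have mp : measurable_fun setT (fun x => `|f x| `^ (q - 1)).
  by apply: measurable_fun_powRc; exact: measurableT_comp.
by apply: measurable_fun_ifT; [exact: measurable_fun_ler|exact: mp|exact: measurableT_comp].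
Qed.

Section Adjoint.
Variables (q T : R) (n : nat) (al : 'I_n -> R).
Hypotheses (q1 : 1 <= q) (T0 : 0 < T) (Tn : T <= s n).

Definition riesz_sum : R -> R := lcomb (fun j : 'I_n => msym de (s j / T) * al j).
Definition riesz_dual : R -> R :=
  lcomb (fun j : 'I_n => msym de (s j / T) * fb_coef nu s (dualf q riesz_sum) j).

Lemma continuous_riesz_sum : continuous riesz_sum.
Proof. exact: continuous_lcomb. Qed.

Lemma continuous_riesz_dual : continuous riesz_dual.
Proof. exact: continuous_lcomb. Qed.

Lemma pint_riesz_sum r : pint r (BR nu de s (lcomb al) T) = pint r riesz_sum.
Proof.
by apply: eq_integral => x; rewrite inE/= in_itv/= => /andP[x0 _]; rewrite (BR_lcomb nu2 hs de0 _ T0 Tn x0).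
Qed.

Lemma BR_dualf x : 0 < x -> BR nu de s (dualf q riesz_sum) T x = riesz_dual x.
Proof. by move=> x0; rewrite (BR_sum nu1 hs de0 _ T0 Tn x0). Qed.

Lemma dualf_bounded : exists M, forall x, 0 < x < 1 -> `|dualf q riesz_sum x| <= M.
Proof.
have hq := q1; have [M hM] := continuous_bounded01 continuous_riesz_sum.
have M0 : 0 <= M by apply: le_trans (normr_ge0 _) (hM (1 / 2) _); apply/andP; split; lra.
exists (M `^ (q - 1)) => x x01; rewrite norm_dualf; apply: ge0_ler_powR; rewrite ?nnegrE ?subr_ge0//.
exact: hM.
Qed.

(* Self-adjointness of B_T, tested on the function extremal in Hoelder's inequality. *)
Lemma riesz_adjoint : wint nu (fun x => `|riesz_sum x| `^ q) = ip nu (lcomb al) riesz_dual.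
Proof.
have hq := q1; have mI : measurable (`]0, 1[ : set R) by exact: measurable_itv.
rewrite (ip_lcomb2 nu1 hs).
have [M hM] := dualf_bounded.
have ih (j : 'I_n) : mu.-integrable `]0%R, 1%R[ (EFin \o (fun x => dualf q riesz_sum x * ev j x * wgt nu x)).
  have ce : continuous (ev j) by exact: (@continuous_ev R nu s nu1 j).
  have [E hE] := continuous_bounded01 ce.
  apply: (integrable_wgt_bounded nu1).
    apply: measurable_funM; apply: measurable_funTS; [exact: measurable_dualf continuous_riesz_sum|exact: continuous_measurable_fun].
  exists (M * E) => x x01; rewrite normrM; apply: ler_pM => //; [exact: hM|exact: hE].
transitivity (Rintegral mu `]0, 1[ (fun x => \sum_(j < n) msym de (s j / T) * al j * (dualf q riesz_sum x * ev j x * wgt nu x))).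
  apply: eq_Rintegral => x _; rewrite -mul_dualf// /riesz_sum {1}lcombE !mulr_suml.
  by apply: eq_bigr => j _; ring.
rewrite Rintegral_sum//; last by move=> j; exact: integrableRZ.
apply: eq_bigr => j _; rewrite RintegralZl// [msym _ _ * al j]mulrC -mulrA; congr (_ * (_ * _)).
apply: eq_Rintegral => x; rewrite inE/= in_itv/= => /andP[x0 _].
by rewrite (psi_ev nu1 hs).
Qed.

End Adjoint.

(** By [riesz_adjoint] the q-th power integral G of the mean is a pairing of f with the mean of the
    extremal function, whose p-th power integral is at most |C|^p G. Young's inequality with a
    parameter l replaces Hoelder's: the second term is absorbed into G, which is finite because all
    functions are continuous. *)
Lemma span_bounded_dual p C : 1 < p -> Lp_bounded p%:E C ->
  exists2 C' : R, 0 <= C' & span_bounded nu de s (1 - p^-1)^-1 C'.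
Proof.
move=> p1 hC; have p0 : 0 < p by lra.
have pi1 : p^-1 < 1 by rewrite invf_lt1.
have pi0 : 0 < p^-1 by rewrite invr_gt0.
set q := (1 - p^-1)^-1.
have q1 : 1 < q by rewrite /q invf_gt1; lra.
have q0 : 0 < q by lra.
have pq : q^-1 + p^-1 = 1 by rewrite /q invrK; ring.
have qp : (q - 1) * p = q.
  have e : p - 1 != 0 by rewrite subr_eq0 gt_eqF.
  by rewrite /q; field; rewrite gt_eqF// e.
(* Makes |C|^p l^(-p) at most 1/2; the summand 1 keeps l positive when C = 0. *)
pose l := (2 * `|C| `^ p + 1) `^ p^-1.
have Cp0 : 0 <= `|C| `^ p by exact: powR_ge0.
have l0 : 0 < l by rewrite powR_gt0//; lra.
have lp : l `^ p = 2 * `|C| `^ p + 1 by rewrite /l -powRrM mulVf ?gt_eqF// powRr1//; lra.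
have lp0 : 0 < l `^ p by rewrite powR_gt0.
exists (2 * (l `^ q / q)); first by rewrite mulr_ge0// divr_ge0 ?powR_ge0// ltW.
move=> T n al T0 Tn; have q1' := ltW q1.
have cf : continuous (lcomb al) by exact: continuous_lcomb.
have cg := @continuous_riesz_sum T n al.
have ck := @continuous_riesz_dual q T n al.
have -> : (\int[mu]_(x in `]0%R, 1%R[) (`|BR nu de s (lcomb al) T x| `^ q * x `^ (2 * nu + 1))%:E)%E = pint q (riesz_sum T al).
  exact: pint_riesz_sum.
rewrite -/(pint q (lcomb al)) !pint_continuous// -EFinM lee_fin.
set G := wint _ _; set F := wint _ _.
have mh : measurable_fun (`]0, 1[ : set R) (dualf q (riesz_sum T al)).
  by apply: measurable_funTS; exact: measurable_dualf.
have hp : pint p (dualf q (riesz_sum T al)) = G%:E.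
  rewrite /G -(pint_continuous q0 cg); apply: eq_integral => x _.
  by rewrite norm_dualf -powRrM qp.
have hfin : (pint p (dualf q (riesz_sum T al)) < +oo)%E by rewrite hp ltry.
have := Lp_bounded_pint p1 hC T0 mh hfin.
have -> : pint p (BR nu de s (dualf q (riesz_sum T al)) T) = pint p (riesz_dual q T al).
  by apply: eq_integral => x; rewrite inE/= in_itv/= => /andP[x0 _]; rewrite BR_dualf.
rewrite hp (pint_continuous p0 ck) -EFinM lee_fin; set Kp := wint _ _ => hK.
have cfq := continuous_norm_powR q0 cf; have ckp := continuous_norm_powR p0 ck.
have young : G <= l `^ q / q * F + (l `^ p)^-1 / p * Kp.
  rewrite /G riesz_adjoint// /F /Kp -!wintZ// -wintD//; last 2 first.
  - by apply: cM => //; exact: ccst.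
  - by apply: cM => //; exact: ccst.
  apply: le_wint => //; first by apply: cM.
    by apply: cD; apply: cM => //; exact: ccst.
  move=> x _; apply: (le_trans (ler_norm _)); rewrite normrM.
  set u := `|lcomb al x|; set v := `|riesz_dual _ _ _ x|.
  have u0 : 0 <= u by exact: normr_ge0.
  have v0 : 0 <= v by exact: normr_ge0.
  have := conjugate_powR (mulr_ge0 (ltW l0) u0) (divr_ge0 v0 (ltW l0)) q0 p0 pq.
  have -> : l * u * (v / l) = u * v by field; rewrite gt_eqF.
  move/le_trans; apply; rewrite !powRM ?invr_ge0 ?(ltW l0)//.
  have -> : l^-1 `^ p = (l `^ p)^-1 by rewrite -(powR_inv1 (ltW l0)) -powRrM mulN1r powRN.
  by rewrite le_eqVlt; apply/orP; left; apply/eqP; ring.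
have G0 : 0 <= G by apply: wint_ge0 => x _; exact: powR_ge0.
have small : (l `^ p)^-1 / p * Kp <= G / 2.
  apply: (@le_trans _ _ ((l `^ p)^-1 * (`|C| `^ p * G))).
    have Kp0 : 0 <= Kp by apply: wint_ge0 => x _; exact: powR_ge0.
    rewrite mulrAC -mulrA; apply: ler_pM => //; rewrite ?invr_ge0 ?(ltW lp0) ?divr_ge0 ?(ltW p0)//.
    by apply: le_trans hK; rewrite ler_pdivrMr// ler_peMr// ltW.
  rewrite ler_pdivrMl// lp mulrDl mul1r.
  have : 0 <= `|C| `^ p * G by rewrite mulr_ge0.
  lra.
rewrite -/F; lra.
Qed.

Lemma Linfty_ge0 (g : R -> \bar R) : (0 <= Lpnorm nu +oo g)%E.
Proof.
apply: le_ereal_inf_tmp => M /= hM; rewrite leNgt; apply/negP => M0.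
have e : [set x | (M < `|g x|)%E] `&` `]0, 1[ = setT `&` `]0, 1[.
  by apply/seteqP; split => [x []//|x [_ x01]]; split => //=; exact: lt_le_trans M0 (abse_ge0 _).
have : mu_nu nu setT = 0%E by rewrite -hM /mu_nu e.
have mT : measurable ((setT : set R) `&` `]0, 1[) by rewrite setTI; exact: measurable_itv.
move=> /(mu_nu_null mT); rewrite setTI.
by rewrite lebesgue_measure_itv/= lte01 sube0 => /eqP; rewrite onee_eq0.
Qed.

(** For q = 1 the extremal function has norm at most 1, so its mean is bounded almost everywhere and
    the pairing with f is controlled by the integral of |f|. *)
Lemma span_bounded_dual_oo C : Lp_bounded +oo C -> span_bounded nu de s 1 (`|C| + 1).
Proof.
move=> hC T n al T0 Tn; have q1 := lexx (1 : R).
have cf : continuous (lcomb al) by exact: continuous_lcomb.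
have cg := @continuous_riesz_sum T n al.
have ck := @continuous_riesz_dual 1 T n al.
pose h := dualf 1 (riesz_sum T al).
have mh : measurable_fun (`]0, 1[ : set R) h by apply: measurable_funTS; exact: measurable_dualf.
have h1 : (Lpnorm nu +oo (EFin \o h) <= 1%:E)%E.
  apply: ereal_inf_lbound => /=; rewrite /mu_nu (_ : _ `&` _ = set0) ?integral_set0//.
  by apply/seteqP; split => // x [] /=; rewrite lte_fin norm_dualf subrr powRr0 ltxx.
have h2 : (Lpnorm nu +oo (EFin \o h) < +oo)%E by apply: le_lt_trans h1 _; rewrite ltry.
(* The norm is an infimum of levels; the extra 1 leaves room for an admissible level M below
   [|C| + 1]. *)
have h3 : (Lpnorm nu +oo (Bmax nu de s h) < (`|C| + 1)%:E)%E.
  apply: (@le_lt_trans _ _ (`|C|%:E)); last by rewrite lte_fin ltrDl.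
  apply: (le_trans (hC h mh h2)); apply: (@le_trans _ _ (`|C|%:E * Lpnorm nu +oo (EFin \o h))%E).
    by apply: lee_wpmul2r; [exact: Linfty_ge0|rewrite lee_fin ler_norm].
  by rewrite -[leRHS]mule1; apply: lee_wpmul2l => //; rewrite lee_fin.
have [M hM MC] := ereal_inf_lt h3.
pose A := [set x | ((`|C| + 1)%:E < `|(EFin \o riesz_dual 1 T al) x|)%E].
have mA : measurable (A `&` `]0, 1[).
  by apply: measurable_superlevel; apply: measurable_funTS; exact: continuous_measurable_fun.
have A0 : mu_nu nu A = 0%E.
  apply/eqP; rewrite eq_le; apply/andP; split; last by apply: integral_ge0 => x _; rewrite lee_fin powR_ge0.
  rewrite -hM /mu_nu integral_mkcond [leRHS]integral_mkcond; apply: integral_mono => x _.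
    by rewrite patchE; case: ifP => // _; rewrite lee_fin powR_ge0.
  rewrite !patchE; case: ifPn => [|_]; last by case: ifPn => // _; rewrite lee_fin powR_ge0.
  rewrite inE => -[/= Ax x01]; rewrite mem_set//; split => //=.
  move: x01; rewrite /= in_itv/= => /andP[x0 _].
  rewrite (gee0_abs (Bmax_ge0 h x)); apply: (lt_le_trans (lt_trans MC Ax)).
  have -> : (EFin \o riesz_dual 1 T al) x = (BR nu de s h T x)%:E by rewrite /= -(BR_dualf 1 al T0 Tn x0).
  exact: BR_le_Bmax.
have null := mu_nu_null mA A0.
have -> : (\int[mu]_(x in `]0%R, 1%R[) (`|BR nu de s (lcomb al) T x| `^ 1 * x `^ (2 * nu + 1))%:E)%E = pint 1 (riesz_sum T al).
  exact: pint_riesz_sum.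
rewrite (pint_continuous ltr01 cg) riesz_adjoint//.
have cfk : continuous (fun x => lcomb al x * riesz_dual 1 T al x) by exact: cM.
have i := integrable_wgt_continuous nu1 cfk.
have mI : measurable (`]0, 1[ : set R) by exact: measurable_itv.
have c0 : 0 <= `|C| + 1 by rewrite addr_ge0.
apply: (@le_trans _ _ (`|ip nu (lcomb al) (riesz_dual 1 T al)|)%:E); first by rewrite lee_fin ler_norm.
rewrite /ip /wint EFin_normr_Rintegral//.
apply: le_trans; first by apply: le_abse_integral => //; exact: measurable_int i.
have mw : measurable_fun (`]0, 1[ : set R) (fun x => `|lcomb al x| `^ 1 * x `^ (2 * nu + 1)).
  apply: measurable_funTS; apply: measurable_funM; last exact: measurable_powR.
  by apply: measurable_fun_powRc; apply: measurableT_comp => //; exact: continuous_measurable_fun.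
rewrite -ge0_integralZl//; last 2 first.
- exact/measurable_EFinP.
- by move=> x _; rewrite lee_fin mulr_ge0 ?powR_ge0.
apply: ae_ge0_le_integral => //.
- by apply: measurableT_comp => //; exact: measurable_int i.
- by move=> x _; rewrite -EFinM lee_fin mulr_ge0// mulr_ge0 ?powR_ge0.
- by apply: emeasurable_funM => //; exact/measurable_EFinP.
exists (A `&` `]0, 1[); split => // x nx; move: nx => /= /not_implyP[x01 nx]; split => //=.
rewrite /A /= lte_fin ltNge; apply/negP => kC; apply: nx.
rewrite -EFinM lee_fin !normrM (ger0_norm (powR_ge0 _ _)) powRr1// mulrA ler_wpM2r ?powR_ge0//.
by rewrite mulrC ler_wpM2r.
Qed.

End Duality.

(** 1/p0 + 1/p1 = 1, so p >= p1 says that the conjugate exponent q is at most p0, that is q (b + 1 +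
    de) <= 2 b + 1; both ends are thus excluded by [span_unbounded]. *)
Lemma necessity (R : realType) (nu de : R) (p : \bar R) (s : nat -> R) :
  -1 < nu -> 0 < de -> (1 < p)%E -> bessel_zeros nu s -> (exists C, Lp_bounded nu de s p C) ->
  (nu <= - (1 / 2) \/ nu + 1 / 2 < de) \/
    (de <= nu + 1 / 2 /\ - (1 / 2) < nu /\ ((p0 nu de)%:E < p)%E /\ (p < p1 nu de)%E).
Proof.
move=> nu1 de0 p1 hs [C hC].
have [h|nu2] := leP nu (- (1 / 2)); first by left; left.
have [h|db] := ltP (nu + 1 / 2) de; first by left; right.
right; split => //; split => //.
have b0 : 0 < nu + 1 / 2 by exact: lt_le_trans db.
split.
  case: p p1 hC => [p||]// p1 hC; last by rewrite ltry.
  rewrite lte_fin in p1; rewrite lte_fin ltNge; apply/negP => pp.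
  have [C' C'0 h] : exists2 C', 0 <= C' & span_bounded nu de s p C'.
    by exists (`|C| `^ p); [exact: powR_ge0|exact: span_bounded_direct].
  apply: (span_unbounded nu2 hs de0 (ltW p1) C'0 _ h).
  move: pp; rewrite /p0 ler_pdivlMr; lra.
rewrite /Defs.p1; case: ifPn => [/eqP e|ne].
  case: p p1 hC => [p||]// p1 hC; first by rewrite ltry.
  (* Here de = b and [p1] is +oo, so p = +oo is the end point itself; its conjugate exponent 1
     equals p0. *)
  exfalso; apply: (span_unbounded nu2 hs de0 (lexx 1) _ _ (span_bounded_dual_oo nu2 hs de0 hC)); first by rewrite addr_ge0.
  by lra.
have e0 : 0 < 2 * nu + 1 - 2 * de by rewrite lt_neqAle eq_sym ne/=; lra.
case: p p1 hC => [p||]// p1 hC; last first.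
  exfalso; apply: (span_unbounded nu2 hs de0 (lexx 1) _ _ (span_bounded_dual_oo nu2 hs de0 hC)); first by rewrite addr_ge0.
  by lra.
rewrite lte_fin in p1; rewrite lte_fin ltNge; apply/negP => pp.
have [C' C'0 h] := span_bounded_dual nu2 hs de0 p1 hC.
have p0 : 0 < p by lra.
have pi1 : p^-1 < 1 by rewrite invf_lt1.
have pi0 : 0 < p^-1 by rewrite invr_gt0.
have q1 : 1 <= (1 - p^-1)^-1 by rewrite invf_ge1; lra.
apply: (span_unbounded nu2 hs de0 q1 C'0 _ h).
rewrite mulrC ler_pdivrMr; last by lra.
move: pp; rewrite ler_pdivrMr// => pp.
have : p^-1 * (4 * (nu + 1)) <= p^-1 * (p * (2 * nu + 1 - 2 * de)) by rewrite ler_pM2l.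
rewrite [X in _ <= X]mulrA mulVf ?gt_eqF// mul1r => pp'.
nra.
Qed.

Theorem theorem2 (R : realType) (nu delta : R) (p : \bar R) (s : nat -> R) :
  -1 < nu -> 0 < delta -> (1 < p)%E -> bessel_zeros nu s ->
  ((exists C : R, forall f : R -> R,
      measurable_fun (`]0%R, 1%R[ : set R) f -> (Lpnorm nu p (EFin \o f) < +oo)%E ->
      (Lpnorm nu p (Bmax nu delta s f) <= C%:E * Lpnorm nu p (EFin \o f))%E)
   <->
   ((nu <= - (1 / 2) \/ nu + 1 / 2 < delta) \/
    (delta <= nu + 1 / 2 /\ - (1 / 2) < nu /\
     ((p0 nu delta)%:E < p)%E /\ (p < p1 nu delta)%E))).
Proof.
move=> nu1 de0 p1 hs; split; last exact: sufficiency.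
exact: necessity.
Qed.
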